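(* Let $0<\beta\le\alpha$, $f_0\in C^\beta([0,1]^d)_1$, $\tau,s>0$, and let $\hat Z^{\tau,s}$ be the Vecchia approximation of the rescaled Matérn process with smoothness parameter $\alpha$, built on $\mathcal{X}_n\subset[0,1]^d$ with a DAG satisfying the Layered condition and the Norming condition with $l=\underline{\alpha}$. Then there is an absolute constant $c>0$ such that, with $\tilde\vartheta_n=\vartheta_n\exp(c\,\vartheta_n)$, for $\epsilon\in(0,1)$, $$\inf_{f\in\mathbb{H}_n^{\tau,s}:\,\|f-f_0\|_{\infty,n}\le\tilde\vartheta_n\epsilon}\|f\|_{\mathbb{H}_n^{\tau,s}}^2\lesssim s^{-2}\Big[\tau^d\epsilon^{-d/\alpha}+\tau^{-2\alpha}\epsilon^{-\frac{2(\alpha-\beta)+d}{\beta}}\Big][\ln(1/\epsilon)]^{\mathbf{1}_{\{\alpha\in\mathbb{N}\}}}.$$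
   Context: For $\alpha>0$, $\underline{\alpha}$ is the largest integer strictly smaller than $\alpha$. $C^\beta([0,1]^d)_1$ is the unit ball of the Hölder-$\beta$ norm. The Matérn kernel with regularity $\alpha$ on $\mathbb{R}^d$ is $K(x_1,x_2)=\frac{2^{1-\alpha}}{\Gamma(\alpha)}\|x_1-x_2\|_2^{\alpha}\,\mathcal{K}_\alpha(\|x_1-x_2\|_2)$ (equal to $1$ when $x_1=x_2$), with $\mathcal{K}_\alpha$ the modified Bessel function of the second kind. $Z$ is the centered Gaussian process on $\mathbb{R}^d$ with covariance $K$, and $Z^{\tau,s}_x=sZ_{\tau x}$. For finite sets $A,B$, $K_{A,B}=(K(a,b))_{a\in A,b\in B}$; $\bm{f}(A)=(f(x))_{x\in A}$; $\tau A=\{\tau x:x\in A\}$; $\|f\|_{\infty,n}=\sup_{x\in\mathcal{X}_n}|f(x)|$. DAG conditions. $\mathcal{X}_n=\{X_1,\dots,X_n\}\subset[0,1]^d$ is the vertex set of a directed acyclic graph; $\mathrm{pa}(X)$ is the set of parents of $X$. For compact $\Omega\subset\mathbb{R}^d$, $\mathscr{P}_l(\Omega)$ is the space of polynomials of degree at most $l$ on $\Omega$; a finite $A\subset\Omega$ is a norming set for $\mathscr{P}_l(\Omega)$ with norming constant $c_N>0$ if $\sup_{x\in\Omega}|P(x)|\le c_N\sup_{x'\in A}|P(x')|$ for all $P\in\mathscr{P}_l(\Omega)$. Layered condition: $\mathcal{X}_n=\cup_{j=0}^J\mathcal{N}_j$ is a partition with $\mathrm{pa}(X_i)\subset\cup_{j'=0}^{j-1}\mathcal{N}_{j'}$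 for all $X_i\in\mathcal{N}_j$, and there exist $\gamma>1$, $c_d>0$ with $\|X_{i_1}-X_{i_2}\|_\infty\ge c_d\gamma^{-j}$ for all distinct $X_{i_1},X_{i_2}\in\cup_{j'=0}^j\mathcal{N}_{j'}$. Points are indexed so that the layer index is nondecreasing in $i$. Norming condition (order $l$): the Layered condition holds with parameter $\gamma>1$; with $m=\binom{l+d}{l}$, there is $i_0\in\mathbb{N}$ with $|\mathrm{pa}(X_i)|=m$ for all $i\ge i_0$; and there exist $c_L,c_N>0$ such that for all $X_i\in\mathcal{N}_j$, $0\le j\le J$, $i\ge i_0$, there is a $d$-dimensional cube $\mathcal{C}\supset\mathrm{pa}(X_i)\cup\{X_i\}$ of side length at most $c_L\gamma^{-j}$ for which $\mathrm{pa}(X_i)$ is a norming set for $\mathscr{P}_l(\mathcal{C})$ with norming constant $c_N$. The constants $\gamma,i_0,c_d,c_L,c_N$ do not depend on $n$. Vecchia process and its RKHS. $\hat Z^{\tau,s}$ is the centered Gaussian process whose restriction to $\mathcal{X}_n$ has density $\prod_{i=1}^np(\hat Z^{\tau,s}_{X_i}\mid\hat Z^{\tau,s}_{\mathrm{pa}(X_i)})$, where the conditional law of $\hat Z^{\tau,s}_X$ given $\hat Z^{\tau,s}_{\mathrm{pa}(X)}=z$ is the same as that of $Z^{\tau,s}_X$ given $Z^{\tau,s}_{\mathrm{pa}(X)}=z$, i.e. $N\big(K_{\tau X,\tau\mathrm{pa}(X)}K_{\tau\mathrm{pa}(X),\tau\mathrm{pa}(X)}^{-1}z,\ s^2[K_{\tau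 X,\tau X}-K_{\tau X,\tau\mathrm{pa}(X)}K^{-1}_{\tau\mathrm{pa}(X),\tau\mathrm{pa}(X)}K_{\tau\mathrm{pa}(X),\tau X}]\big)$ (the law of $Z^{\tau,s}_X$ if $\mathrm{pa}(X)=\emptyset$). Let $\hat K^{\tau,s}$ be the covariance kernel of $\hat Z^{\tau,s}$. Then $\mathbb{H}_n^{\tau,s}=\{\sum_{i=1}^na_i\hat K^{\tau,s}(X_i,\cdot):a_i\in\mathbb{R}\}$, viewed as functions on $\mathcal{X}_n$, with $\|f\|^2_{\mathbb{H}_n^{\tau,s}}=\bm{f}(\mathcal{X}_n)^T(\hat K^{\tau,s}_{\mathcal{X}_n,\mathcal{X}_n})^{-1}\bm{f}(\mathcal{X}_n)$. Interpolation constant. Order multi-indices of $\mathbb{N}^d$ by total degree and then, within equal degree, by the first differing coordinate (smaller first); $k_{(i)}$ is the $i$th one. For $A=\{w_1,\dots,w_p\}$ let $v_x=(x^{k_{(1)}},\dots,x^{k_{(p)}})^T$ and $V_A=[v_{w_1}\cdots v_{w_p}]$. For $f:\cup_{j'\le j}\mathcal{N}_{j'}\to\mathbb{R}$, $P_j(f):\cup_{j'\le j+1}\mathcal{N}_{j'}\to\mathbb{R}$ is given by $P_j(f)(X)=f(X)$ for $X\in\cup_{j'\le j}\mathcal{N}_{j'}$ and $P_j(f)(X)=v_X^TV_{\mathrm{pa}(X)}^{-T}\bm{f}(\mathrm{pa}(X))$ for $X\in\mathcal{N}_{j+1}$ (presupposing the Vandermonde matrices are invertible, which is automatic for $i\ge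 i_0$). With $\|g\|_{\infty,j}=\max_{X\in\cup_{j'\le j}\mathcal{N}_{j'}}|g(X)|$, $$\vartheta_n=\sup\Big\{\frac{\|P_{j_2}P_{j_2-1}\cdots P_{j_1}(f)\|_{\infty,j_2+1}}{\|f\|_{\infty,j_1}}:\ 0\le j_1\le j_2\le J-1,\ f:\cup_{j'\le j_1}\mathcal{N}_{j'}\to\mathbb{R},\ f\ne0\Big\}.$$ $a\lesssim b$ means $a\le Cb$ for a constant $C>0$ not depending on $n$ or $\epsilon$. *)

(* Defs.v *)
From HB Require Import structures.
From mathcomp Require Import all_boot all_order all_algebra.
From mathcomp Require Import all_classical all_reals all_analysis.
(* The notations of mpoly clash with those of mathcomp-analysis. *)
From mathcomp Require Import -(notations) mpoly.

Set Implicit Arguments.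
Unset Strict Implicit.
Unset Printing Implicit Defensive.

Import Order.TTheory GRing.Theory Num.Theory.
Import numFieldNormedType.Exports.

Local Open Scope classical_set_scope.
Local Open Scope ring_scope.

(* Largest integer strictly smaller than a; only meaningful for a > 0, where
   the integer Num.ceil a - 1 is nonnegative. *)
Definition strict_floor (R : realType) (a : R) : nat := `|Num.ceil a - 1|%N.

Definition norm2 (R : realType) d (x : 'rV[R]_d) : R :=
  Num.sqrt (\sum_(k < d) x ord0 k ^+ 2).

Definition unit_cube (R : realType) d : set 'rV[R]_d :=
  [set x | forall k, 0 <= x ord0 k <= 1].

(* A partial derivative is named by the list of its successive directions, the
   last direction of the list being differentiated first. The order does not
   matter for the functions of [holder_ball], so these are the derivatives
   D^k f with |k| = size s. *)
Definition pderiv (R : realType) d (s : seq 'I_d) (f : 'rV[R]_d -> R) :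
    'rV[R]_d -> R :=
  foldr (fun (i : 'I_d) (g : 'rV[R]_d -> R) => 'D_(delta_mx ord0 i) g) f s.

(*   max_{|k| <= l} sup_x |D^k f(x)|
     + max_{|k| = l} sup_{x <> y} |D^k f(x) - D^k f(y)| / |x - y|_2^(b - l),
   l being the largest integer strictly smaller than b; the suprema are over
   the interior of the cube, where the derivatives make sense. *)
Definition holder_norm (R : realType) d (b : R) (f : 'rV[R]_d -> R) : \bar R :=
  (ereal_sup [set r : \bar R | exists s (x : 'rV[R]_d),
     [/\ (size s <= strict_floor b)%N, (@unit_cube R d)° x &
         r = (`|pderiv s f x|)%:E]] +
   ereal_sup [set r : \bar R | exists s (x y : 'rV[R]_d),
     [/\ size s = strict_floor b, (@unit_cube R d)° x, (@unit_cube R d)° y,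
         x != y &
         r = (`|pderiv s f x - pderiv s f y| /
              norm2 (x - y) `^ (b - (strict_floor b)%:R))%:E]])%E.

(* Unit ball of C^b([0,1]^d); only the values of f on [0,1]^d matter. *)
Definition holder_ball (R : realType) d (b : R) (f : 'rV[R]_d -> R) : Prop :=
  [/\ {within @unit_cube R d, continuous f},
      forall (s : seq 'I_d) (i : 'I_d) (x : 'rV[R]_d),
        (size s < strict_floor b)%N -> (@unit_cube R d)° x ->
        derivable (pderiv s f) x (delta_mx ord0 i) &
      (holder_norm b f <= 1)%E].

Definition gamma_fun (R : realType) (a : R) : R :=
  \int[@lebesgue_measure R]_(t in `]0, +oo[) (t `^ (a - 1) * expR (- t)).

(* K_nu(r) = int_0^oo exp(- r cosh t) cosh(nu t) dt, for r > 0. *)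
Definition besselK (R : realType) (nu r : R) : R :=
  let cosh u := (expR u + expR (- u)) / 2 in
  \int[@lebesgue_measure R]_(t in `[0, +oo[)
    (expR (- (r * cosh t)) * cosh (nu * t)).

Definition matern (R : realType) d (alpha : R) (x y : 'rV[R]_d) : R :=
  if x == y then 1 else
  2 `^ (1 - alpha) / gamma_fun alpha *
  norm2 (x - y) `^ alpha * besselK alpha (norm2 (x - y)).

(* The matrix K_{A,B}, for A and B given as indexed families of points. *)
Definition matern_mx (R : realType) d (alpha : R) p q
    (A : 'I_p -> 'rV[R]_d) (B : 'I_q -> 'rV[R]_d) : 'M[R]_(p, q) :=
  \matrix_(a, b) matern alpha (A a) (B b).

(* The vertices X_1, ..., X_n are X i for i : 'I_n (indices are shifted by one)
   and vertex i has the set pa i of parents. *)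
Definition acyclic n (pa : 'I_n -> {set 'I_n}) : Prop :=
  forall c : seq 'I_n, cycle (fun i k => k \in pa i) c -> c = [::].

Definition parent_pts (R : realType) d n (X : 'I_n -> 'rV[R]_d)
    (pa : 'I_n -> {set 'I_n}) (i : 'I_n) : 'I_#|pa i| -> 'rV[R]_d :=
  fun k => X (enum_val k).
Arguments parent_pts {R d n} X pa i _.

Definition parent_vals (R : realType) n (pa : 'I_n -> {set 'I_n})
    (f : 'I_n -> R) (i : 'I_n) : 'cV[R]_#|pa i| :=
  \col_k f (enum_val k).

(* The layer of vertex i is lay i. Layers need not all be inhabited. The norm
   of 'rV[R]_d is the supremum norm. *)
Definition layered (R : realType) d n J (X : 'I_n -> 'rV[R]_d)
    (pa : 'I_n -> {set 'I_n}) (lay : 'I_n -> 'I_J.+1) (gamma cd : R) : Prop :=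
  [/\ forall i k : 'I_n, k \in pa i -> (lay k < lay i)%N,
      forall (j : 'I_J.+1) (i1 i2 : 'I_n), i1 != i2 ->
        (lay i1 <= j)%N -> (lay i2 <= j)%N ->
        cd * gamma ^- j <= `|X i1 - X i2| &
      forall i1 i2 : 'I_n, (i1 <= i2)%N -> (lay i1 <= lay i2)%N].

Definition norming_set (R : realType) d (l : nat) (Omega A : set 'rV[R]_d)
    (cN : R) : Prop :=
  A `<=` Omega /\
  forall P : mpoly d R, (msize P <= l.+1)%N ->
    sup [set `|meval (x ord0) P| | x in Omega] <=
    cN * sup [set `|meval (x ord0) P| | x in A].

Definition cube (R : realType) d (a : 'rV[R]_d) (h : R) : set 'rV[R]_d :=
  [set x | forall k, a ord0 k <= x ord0 k <= a ord0 k + h].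

(* [i0 <= i.+1] because i : 'I_n stands for the vertex X_{i+1}. *)
Definition norming (R : realType) d n J (X : 'I_n -> 'rV[R]_d)
    (pa : 'I_n -> {set 'I_n}) (lay : 'I_n -> 'I_J.+1)
    (l i0 : nat) (gamma cL cN : R) : Prop :=
  forall i : 'I_n, (i0 <= i.+1)%N ->
    #|pa i| = 'C(l + d, l)%N /\
    exists (a : 'rV[R]_d) (h : R),
      [/\ 0 < h <= cL * gamma ^- lay i,
          cube a h (X i),
          forall k, k \in pa i -> cube a h (X k) &
          norming_set l (cube a h) [set X k | k in [set` pa i]] cN].

Section Vecchia.
Variables (R : realType) (d n : nat) (alpha tau s : R).
Variables (X : 'I_n -> 'rV[R]_d) (pa : 'I_n -> {set 'I_n}).

Definition scaled_vertex (i : 'I_n) : 'I_1 -> 'rV[R]_d := fun=> tau *: X i.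

Definition scaled_parents (i : 'I_n) : 'I_#|pa i| -> 'rV[R]_d :=
  fun k => tau *: parent_pts X pa i k.
Arguments scaled_parents i _ : clear implicits.

Definition kriging (i : 'I_n) : 'rV[R]_#|pa i| :=
  matern_mx alpha (scaled_vertex i) (scaled_parents i) *m
  invmx (matern_mx alpha (scaled_parents i) (scaled_parents i)).

(* cond_mean i z and cond_var i are the mean and the variance of the conditional
   law of s Z_{tau X_i} given s Z_{tau pa(X_i)} = z, where Z is the centered
   Gaussian process with covariance [matern alpha]; a vertex without parents
   gets mean 0 and variance s^2, the matrices being empty. *)
Definition cond_mean (i : 'I_n) (z : 'I_n -> R) : R :=
  (kriging i *m parent_vals pa z i) ord0 ord0.

Definition cond_var (i : 'I_n) : R :=
  s ^+ 2 *
  (matern_mx alpha (scaled_vertex i) (scaled_vertex i) -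
   kriging i *m matern_mx alpha (scaled_parents i) (scaled_vertex i))
  ord0 ord0.

Definition vecchia_pdf (z : 'I_n -> R) : R :=
  \prod_(i < n) normal_pdf (cond_mean i z) (Num.sqrt (cond_var i)) (z i).

End Vecchia.

(* Lebesgue integral over R^n, as an iterated integral. *)
Fixpoint integral_tuple (R : realType) (n : nat) :
    (n.-tuple R -> \bar R) -> \bar R :=
  match n with
  | 0 => fun f => f [tuple]
  | n'.+1 => fun f => (\int[@lebesgue_measure R]_x
                integral_tuple (fun z : n'.-tuple R => f [tuple of x :: z]))%E
  end.

Definition vecchia_expect (R : realType) d n (alpha tau s : R)
    (X : 'I_n -> 'rV[R]_d) (pa : 'I_n -> {set 'I_n})
    (g : ('I_n -> R) -> R) : R :=
  fine (integral_tuple (fun z : n.-tuple R =>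
          (g (tnth z) * vecchia_pdf alpha tau s X pa (tnth z))%:E)).

(* Covariance matrix of a random vector with density [vecchia_pdf]. *)
Definition vecchia_cov (R : realType) d n (alpha tau s : R)
    (X : 'I_n -> 'rV[R]_d) (pa : 'I_n -> {set 'I_n}) : 'M[R]_n :=
  let E := vecchia_expect alpha tau s X pa in
  \matrix_(i, k) E (fun z => (z i - E (fun z' => z' i)) *
                             (z k - E (fun z' => z' k))).

Definition vecchia_rkhs (R : realType) d n (alpha tau s : R)
    (X : 'I_n -> 'rV[R]_d) (pa : 'I_n -> {set 'I_n}) : set ('I_n -> R) :=
  [set f | exists a : 'I_n -> R,
     f = fun k => \sum_(i < n) a i * vecchia_cov alpha tau s X pa i k].

Definition rkhs_sqnorm (R : realType) d n (alpha tau s : R)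
    (X : 'I_n -> 'rV[R]_d) (pa : 'I_n -> {set 'I_n}) (f : 'I_n -> R) : R :=
  let fX : 'cV[R]_n := \col_i f i in
  (fX^T *m invmx (vecchia_cov alpha tau s X pa) *m fX) ord0 ord0.

(* The multi-index k_(i+1). The order of mpoly on multi-indices compares the
   total degrees and then the first differing coordinates. For d > 0 there are
   more than i multi-indices of degree at most i. *)
Definition mindex d (i : nat) : multinom d :=
  nth mnm0 (sort <=%O [seq bmnm m | m : bmultinom d i.+1]) i.

Definition monomial (R : realType) d (m : multinom d) (x : 'rV[R]_d) : R :=
  \prod_(k < d) x ord0 k ^+ m k.

Definition monomials (R : realType) d p (x : 'rV[R]_d) : 'cV[R]_p :=
  \col_(r < p) monomial (mindex d r) x.

Definition vandermonde (R : realType) d p (w : 'I_p -> 'rV[R]_d) : 'M[R]_p :=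
  \matrix_(r, c) monomials p (w c) r ord0.

Section Interpolation.
Variables (R : realType) (d n J : nat) (X : 'I_n -> 'rV[R]_d).
Variables (pa : 'I_n -> {set 'I_n}) (lay : 'I_n -> 'I_J.+1).

Definition interp (f : 'I_n -> R) (i : 'I_n) : R :=
  ((monomials #|pa i| (X i))^T *m
   (invmx (vandermonde (parent_pts X pa i)))^T *m
   parent_vals pa f i) ord0 ord0.

(* A function on the layers 0, ..., j is represented by a function on all the
   vertices whose values on the other layers are ignored. *)
Definition extend_layer (j : nat) (f : 'I_n -> R) : 'I_n -> R :=
  fun i => if (lay i <= j)%N then f i
           else if lay i == j.+1 :> nat then interp f i else 0.

(* P_{j2} ... P_{j1} f, for j1 <= j2 *)
Definition extend_layers (j1 j2 : nat) (f : 'I_n -> R) : 'I_n -> R :=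
  foldl (fun g j => extend_layer j g) f (iota j1 (j2 - j1).+1).

Definition norm_layers (j : nat) (f : 'I_n -> R) : R :=
  \big[Num.max/0]_(i < n | (lay i <= j)%N) `|f i|.

(* For J = 0 the supremum is over the empty set, and is 0 by convention. *)
Definition interp_const : R :=
  sup [set r | exists (j1 j2 : nat) (f : 'I_n -> R),
    [/\ (j1 <= j2)%N, (j2 < J)%N,
        exists2 i, (lay i <= j1)%N & f i != 0 &
        r = norm_layers j2.+1 (extend_layers j1 j2 f) / norm_layers j1 f]].

End Interpolation.

(* Main.v *)
(** The Matern kernel is a Gamma mixture of Gaussian kernels, and the norm of its
    reproducing kernel Hilbert space is handled by duality, [hle k N g] saying
    that the norm of [g] is at most [N]. Polynomials times Gaussians have
    explicit norms for the Gaussian kernels, hence for the Matern kernel. This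
    gives a lower bound of the conditional variances by separation of the
    points, and, with the norming sets, shows that at small scales [t] the kriging
    weights differ from those of polynomial interpolation by [O(t^(alpha - l))],
    so that kriging reproduces Hoelder functions up to [O(t^alpha)].
    The inverse covariance of the Vecchia process factorizes along the graph:
    the squared norm of [f] is the sum over the vertices of the squared kriging
    residual of [f] divided by the conditional variance. One takes [f] close to
    [f0] on the layers up to the resolution dictated by [eps], and continues it
    by kriging to the finer layers, where it has no cost; a Gronwall
    argument with the interpolation constant controls the error there. *)
Require Import Defs.
From HB Require Import structures.
From mathcomp Require Import all_boot all_order all_algebra.
From mathcomp Require Import all_classical all_reals all_analysis.
From mathcomp Require Import -(notations) mpoly.
From mathcomp Require Import measurable_realfun ring lra zify.

Set Implicit Arguments.
Unset Strict Implicit.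
Unset Printing Implicit Defensive.

Import Order.TTheory GRing.Theory Num.Theory.
Import numFieldNormedType.Exports.

Local Open Scope classical_set_scope.
Local Open Scope ring_scope.

(** From index [i0] on, a vertex lives at the single scale [r = ga ^- lay i], where separation and a
    norming cube are available. The earlier vertices shape the proof: their parents are arbitrary
    and, since layers may be empty, their distances have no lower bound uniform in [n], so residual
    and conditional variance cannot be estimated separately. Their values are therefore chosen with
    a controlled Matern norm [N]: the residual is a functional whose norm is the conditional
    standard deviation divided by [s], so the variance cancels and each such vertex costs at most
    [N ^+ 2 / s ^+ 2]. The strict inequality [l < a] acts twice: the Gaussian bounds, of order
    [t ^ (- (a + l) / 2)] for small [t], are integrable against the Gamma weight, and the
    discrepancies [(tau * r) ^ (a - l)] are summable over the layers, which keeps the Gronwall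
    exponent of order theta. The difference of kriging and interpolation weights is controlled
    through a bound [M] of its moments: its Matern form [q] satisfies [M ^+ 2 <= C * q] and
    [q <= C * h ^ a * M], whence [M <= C ^+ 2 * h ^ a]. *)

(** * Exponential series, words and monomials *)

Section ExpSeries.
Variable R : realType.

Lemma cvgn_sumr (I : Type) (r : seq I) (f : I -> nat -> R) (l : I -> R) :
  (forall i, f i @ \oo --> l i) ->
  (fun N => \sum_(i <- r) f i N) @ \oo --> \sum_(i <- r) l i.
Proof.
move=> h; elim: r => [|i r IH].
  rewrite big_nil (_ : (fun N => _) = cst 0); first exact: cvg_cst.
  by apply/funext => N; rewrite big_nil.
rewrite big_cons (_ : (fun N => _) = f i \+ (fun N => \sum_(i <- r) f i N)).
  by apply: cvgD; first exact: h.
by apply/funext => N; rewrite big_cons.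
Qed.

(** The hypothesis makes every Taylor term of [\sum_i a i * expR (b i)] nonnegative, so each single
    term is a lower bound of the whole. Applied to pairs of points in [gk_schur], it gives both the
    positivity of Gaussian forms and the norms of monomials. *)
Lemma exp_sum_ge (I : finType) (a b : I -> R) :
  (forall n, 0 <= \sum_i a i * b i ^+ n) ->
  forall n, \sum_i a i * (b i ^+ n / n`!%:R) <= \sum_i a i * expR (b i).
Proof.
move=> h n.
have cv : (fun N => \sum_i a i * series (exp_coeff (b i)) N) @ \oo -->
   \sum_i a i * expR (b i).
  by apply: cvgn_sumr => i; apply: cvgMr; exact: is_cvg_series_exp_coeff.
rewrite -(cvg_lim _ cv)//.
apply: limr_ge; first by apply/cvg_ex; eexists; exact: cv.
near=> N.
have nN : (n < N)%N by near: N; exact: nbhs_infty_gt.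
rewrite [leRHS](_ : _ = \sum_(0 <= k < N) \sum_i a i * (b i ^+ k / k`!%:R)); last first.
  rewrite exchange_big/=; apply: eq_bigr => i _.
  by rewrite -mulr_sumr.
rewrite big_mkord (bigD1 (Ordinal nN))//= lerDl; apply: sumr_ge0 => k _.
under eq_bigr do rewrite mulrA.
by rewrite -mulr_suml divr_ge0.
Unshelve. all: end_near. Qed.

End ExpSeries.

Section Words.
Variables (R : realType) (d : nat).
Implicit Types (x y z : 'rV[R]_d) (w : seq 'I_d).

(** Words replace multi-indices: a monomial is listed once for each ordering of its letters, so the
    powers of [dot] and [sqn] expand with all coefficients equal to 1 and no multinomial coefficient
    appears. *)
Fixpoint words (N : nat) : seq (seq 'I_d) :=
  if N is N'.+1 then [seq c :: w | c <- enum 'I_d, w <- words N'] else [:: [::]].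

Lemma size_words N w : (w \in words N) = (size w == N).
Proof.
elim: N w => [|N IH] [|c w] //=.
- by apply/negbTE/allpairsP => -[[c w] /= [_ _]].
- apply/allpairsP/idP => [[[c' w'] /= [_ +] [_ ->]]|sw].
    by rewrite IH eqSS.
  by exists (c, w); rewrite mem_enum IH.
Qed.

Definition mon w y : R := \prod_(c <- w) y ord0 c.

Lemma mon_cons c w y : mon (c :: w) y = y ord0 c * mon w y.
Proof. by rewrite /mon big_cons. Qed.

Lemma mon_nil y : mon [::] y = 1.
Proof. by rewrite /mon big_nil. Qed.

Lemma mon_cat w1 w2 y : mon (w1 ++ w2) y = mon w1 y * mon w2 y.
Proof. by rewrite /mon big_cat. Qed.

Lemma monZ w (a : R) y : mon w (a *: y) = a ^+ size w * mon w y.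
Proof.
elim: w => [|c w IH]; first by rewrite !mon_nil mulr1.
by rewrite !mon_cons IH mxE/= exprS; ring.
Qed.

Lemma mon_le w y (h : R) : (forall c, `|y ord0 c| <= h) -> `|mon w y| <= h ^+ size w.
Proof.
move=> hy; elim: w => [|c w IH]; first by rewrite mon_nil normr1.
by rewrite mon_cons normrM/= exprS ler_pM.
Qed.

Definition dot x y : R := \sum_(c < d) x ord0 c * y ord0 c.
Definition sqn x : R := \sum_(c < d) x ord0 c ^+ 2.

Lemma sqn_ge0 x : 0 <= sqn x.
Proof. by apply: sumr_ge0 => c _; exact: sqr_ge0. Qed.

Lemma sqnB x y : sqn (x - y) = sqn x + sqn y - 2 * dot x y.
Proof.
rewrite /sqn /dot mulr_sumr -big_split -sumrB/=; apply: eq_bigr => c _.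
by rewrite !mxE; ring.
Qed.

Lemma sqnZ (a : R) x : sqn (a *: x) = a ^+ 2 * sqn x.
Proof. by rewrite /sqn mulr_sumr; apply: eq_bigr => c _; rewrite mxE exprMn. Qed.

Lemma sqnN x : sqn (- x) = sqn x.
Proof. by apply: eq_bigr => c _; rewrite mxE sqrrN. Qed.

Lemma sqn_le x (h : R) : (forall c, `|x ord0 c| <= h) -> sqn x <= d%:R * h ^+ 2.
Proof.
move=> hx; rewrite /sqn; apply: (@le_trans _ _ (\sum_(c < d) h ^+ 2)).
  apply: ler_sum => c _; rewrite -real_normK ?num_real// lerXn2r// ?nnegrE//.
  exact: le_trans (hx c).
by rewrite sumr_const card_ord mulr_natl.
Qed.

Lemma dot_exp (N : nat) x y :
  dot x y ^+ N = \sum_(w <- words N) mon w x * mon w y.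
Proof.
elim: N => [|N IH]; first by rewrite /= big_seq1 !mon_nil mulr1.
rewrite exprS IH /dot big_distrl/= big_allpairs_dep big_enum/=.
apply: eq_bigr => c _; rewrite big_distrr/=; apply: eq_bigr => w _.
by rewrite !mon_cons; ring.
Qed.

Lemma sqn_exp (N : nat) x : sqn x ^+ N = \sum_(w <- words N) mon (w ++ w) x.
Proof.
rewrite (_ : sqn x = dot x x).
  by rewrite dot_exp; apply: eq_bigr => w _; rewrite mon_cat.
by apply: eq_bigr => c _; rewrite expr2.
Qed.

End Words.

Section FactBound.

Lemma fact_add_le (m k : nat) : ((m + k)`! <= 2 ^ (m + k) * (m`! * k`!))%N.
Proof.
rewrite -(bin_fact (leq_addl m k)) addnK mulnC (mulnC k`!) mulnC leq_mul2r; apply/orP; right.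
have := Pascal 1 1 (m + k).
rewrite addn1 => ->; rewrite (bigD1 (Ordinal (leq_addl m k : k < (m + k).+1)%N))//=.
by rewrite !exp1n !muln1 leq_addr.
Qed.

End FactBound.

(** * Norms by duality and Gaussian kernels *)

Section Hle.
Variables (R : realType) (d : nat).
Implicit Types (x y : 'rV[R]_d) (g : 'rV[R]_d -> R) (k : 'rV[R]_d -> 'rV[R]_d -> R).

Definition qf k (I : finType) (u : I -> R) (x : I -> 'rV[R]_d) : R :=
  \sum_i \sum_j u i * u j * k (x i) (x j).

(* [g] lies in the reproducing kernel Hilbert space of [k], with norm at most
   [N]; this formulation by duality avoids constructing that space. *)
Definition hle k (N : R) g : Prop :=
  0 <= N /\ forall (I : finType) (u : I -> R) (x : I -> 'rV[R]_d),
    `|\sum_i u i * g (x i)| <= N * Num.sqrt (qf k u x).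

Lemma hle_eq k N g1 g2 : g1 =1 g2 -> hle k N g1 -> hle k N g2.
Proof.
move=> e [N0 h]; split => // I u x; apply: le_trans (h I u x).
by under eq_bigr do rewrite -e.
Qed.

Lemma hleW k N M g : N <= M -> hle k N g -> hle k M g.
Proof.
move=> NM [N0 h]; split; first exact: le_trans NM.
by move=> I u x; apply: le_trans (h I u x) _; rewrite ler_wpM2r// sqrtr_ge0.
Qed.

Lemma hle0 k : hle k 0 (fun=> 0).
Proof.
split => // I u x; rewrite big1 ?normr0 ?mul0r// => i _.
by rewrite mulr0.
Qed.

Lemma hleD k N1 N2 g1 g2 : hle k N1 g1 -> hle k N2 g2 ->
  hle k (N1 + N2) (fun y => g1 y + g2 y).
Proof.
move=> [N10 h1] [N20 h2]; split; first exact: addr_ge0.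
move=> I u x; under eq_bigr do rewrite mulrDr.
by rewrite big_split/= (le_trans (ler_normD _ _))// mulrDl lerD.
Qed.

Lemma hleZ k N g (a : R) : hle k N g -> hle k (`|a| * N) (fun y => a * g y).
Proof.
move=> [N0 h]; split; first exact: mulr_ge0.
move=> I u x; rewrite (_ : \sum_i _ = a * \sum_i u i * g (x i)).
  by rewrite normrM -mulrA ler_wpM2l.
by rewrite mulr_sumr; apply: eq_bigr => i _; ring.
Qed.

Lemma hleB k N1 N2 g1 g2 : hle k N1 g1 -> hle k N2 g2 ->
  hle k (N1 + N2) (fun y => g1 y - g2 y).
Proof.
move=> h1 /(hleZ (-1)); rewrite normrN1 mul1r => h2.
by apply: hle_eq (hleD h1 h2) => y /=; rewrite mulN1r.
Qed.

Lemma hle_sum k (T : Type) (r : seq T) (P : pred T) (N : T -> R)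
    (g : T -> 'rV[R]_d -> R) :
  (forall t, P t -> hle k (N t) (g t)) ->
  hle k (\sum_(t <- r | P t) N t) (fun y => \sum_(t <- r | P t) g t y).
Proof.
move=> h; elim: r => [|t r IH].
  rewrite big_nil; apply: hle_eq (hle0 k) => y.
  by rewrite big_nil.
rewrite big_cons; case: ifP => Pt.
  by apply: hle_eq (hleD (h _ Pt) IH) => y; rewrite big_cons Pt.
by apply: hle_eq IH => y; rewrite big_cons Pt.
Qed.

Lemma hle_lim k N (g : nat -> 'rV[R]_d -> R) g0 :
  (forall n, hle k N (g n)) -> (forall y, g ^~ y @ \oo --> g0 y) -> hle k N g0.
Proof.
move=> h cv; split; first by have [] := h 0.
move=> I u x.
have cv1 : (fun n => `|\sum_i u i * g n (x i)|) @ \oo --> `|\sum_i u i * g0 (x i)|.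
  by apply: cvg_norm; apply: cvgn_sumr => i; apply: cvgMr.
rewrite -(cvg_lim _ cv1)//; apply: limr_le; first by apply/cvg_ex; eexists; exact: cv1.
by near=> n; have [_] := h n; apply.
Unshelve. all: end_near. Qed.

(** The normalization [4 * t] is the one for which the Gamma mixture of [gk t] over [t] is the
    Matern kernel; see [matern_mix]. *)
Definition gk (t : R) x y : R := expR (- (sqn (x - y) / (4 * t))).
Definition ge (t : R) x : R := expR (- (sqn x / (4 * t))).

Lemma gkE t x y : t != 0 -> gk t x y = ge t x * ge t y * expR (dot x y / (2 * t)).
Proof.
move=> t0; rewrite /gk /ge -!expRD sqnB; congr expR; field.
by rewrite t0.
Qed.

Lemma gk_ge0 t x y : 0 <= gk t x y. Proof. exact: expR_ge0. Qed.

Lemma ge_le1 t x : 0 <= t -> ge t x <= 1.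
Proof.
by move=> t0; rewrite /ge expR_le1 oppr_le0 divr_ge0 ?sqn_ge0 ?mulr_ge0.
Qed.

Lemma gk_le1 t x y : 0 <= t -> gk t x y <= 1.
Proof. by move=> t0; exact: ge_le1. Qed.

Lemma gkxx t x : gk t x x = 1.
Proof. by rewrite /gk subrr /sqn big1 ?mul0r ?oppr0 ?expR0// => i _; rewrite mxE expr0n. Qed.

Lemma gk_shift t x y c : gk t (x - c) (y - c) = gk t x y.
Proof. by rewrite /gk opprB addrA subrK. Qed.

(** By [gkE] the form is [\sum_p a p * expR (b p)] over pairs of points, and by [dot_exp] its
    moments are sums over words of forms of [M], hence nonnegative: [exp_sum_ge] applies. This is
    the Schur product theorem with a quantitative lower bound. [M = 1] gives positivity and the
    norms of monomials; [M = N ^+ 2 * k - g * g] gives products. *)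
Lemma gk_schur t (I : finType) (u : I -> R) (x : I -> 'rV[R]_d) (M : I -> I -> R) :
  0 < t -> (forall v : I -> R, 0 <= \sum_i \sum_j v i * v j * M i j) ->
  forall n, 0 <= (n`!%:R * (2 * t) ^+ n)^-1 * \sum_(w <- words d n)
    \sum_i \sum_j (u i * ge t (x i) * mon w (x i)) *
                  (u j * ge t (x j) * mon w (x j)) * M i j <=
  \sum_i \sum_j u i * u j * (M i j * gk t (x i) (x j)).
Proof.
move=> t0 hM n.
pose a (p : I * I) := u p.1 * ge t (x p.1) * (u p.2 * ge t (x p.2)) * M p.1 p.2.
pose b (p : I * I) := dot (x p.1) (x p.2) / (2 * t).
have E m : \sum_p a p * b p ^+ m = (2 * t) ^- m * \sum_(w <- words d m)
    \sum_i \sum_j (u i * ge t (x i) * mon w (x i)) *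
                  (u j * ge t (x j) * mon w (x j)) * M i j.
  rewrite -(pair_bigA _ (fun i j => a (i, j) * b (i, j) ^+ m))/=.
  rewrite [X in _ = _ * X]exchange_big/= mulr_sumr; apply: eq_bigr => i _.
  rewrite [X in _ = _ * X]exchange_big/= mulr_sumr; apply: eq_bigr => j _.
  rewrite /a /b/= expr_div_n dot_exp -mulrA mulr_suml !mulr_sumr.
  by apply: eq_bigr => w _; ring.
have P (w : seq 'I_d) : 0 <= \sum_i \sum_j (u i * ge t (x i) * mon w (x i)) *
                  (u j * ge t (x j) * mon w (x j)) * M i j.
  exact: (hM (fun i => u i * ge t (x i) * mon w (x i))).
have h m : 0 <= \sum_p a p * b p ^+ m.
  rewrite E mulr_ge0 ?invr_ge0 ?exprn_ge0 ?mulr_ge0 ?(ltW t0)//.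
  by apply: sumr_ge0 => w _; exact: P.
have F : \sum_i \sum_j u i * u j * (M i j * gk t (x i) (x j)) =
    \sum_p a p * expR (b p).
  rewrite -(pair_bigA _ (fun i j => a (i, j) * expR (b (i, j))))/=.
  apply: eq_bigr => i _; apply: eq_bigr => j _.
  by rewrite gkE ?gt_eqF// /a/=; ring.
have G : (n`!%:R * (2 * t) ^+ n)^-1 * (\sum_(w <- words d n)
    \sum_i \sum_j (u i * ge t (x i) * mon w (x i)) *
                  (u j * ge t (x j) * mon w (x j)) * M i j) =
    \sum_p a p * (b p ^+ n / n`!%:R).
  under [RHS]eq_bigr do rewrite mulrA.
  by rewrite -mulr_suml E invfM; ring.
rewrite G F exp_sum_ge ?andbT//.
under eq_bigr do rewrite mulrA.
by rewrite -mulr_suml divr_ge0.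
Qed.

Lemma qf_gk_ge0 t (I : finType) (u : I -> R) (x : I -> 'rV[R]_d) :
  0 < t -> 0 <= qf (gk t) u x.
Proof.
move=> t0; have M1 (v : I -> R) : 0 <= \sum_i \sum_j v i * v j * 1.
  rewrite (_ : \sum_i _ = (\sum_i v i) ^+ 2) ?sqr_ge0// expr2 big_distrl/=.
  by apply: eq_bigr => i _; rewrite big_distrr/=; apply: eq_bigr => j _; rewrite mulr1.
have /andP[h0 h] := gk_schur u x t0 M1 0%N.
apply: le_trans (le_trans h0 h) _.
rewrite /qf le_eqVlt; apply/orP; left; apply/eqP.
by apply: eq_bigr => i _; apply: eq_bigr => j _; rewrite mul1r.
Qed.

Lemma hle_mon t (w : seq 'I_d) : 0 < t ->
  hle (gk t) (Num.sqrt ((size w)`!%:R * (2 * t) ^+ size w)) (fun y => ge t y * mon w y).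
Proof.
move=> t0; split; first exact: sqrtr_ge0.
move=> I u x.
have K0 : 0 < (size w)`!%:R * (2 * t) ^+ size w :> R.
  by rewrite mulr_gt0 ?exprn_gt0 ?mulr_gt0// ltr0n fact_gt0.
rewrite -sqrtrM ?(ltW K0)// -sqrtr_sqr ler_wsqrtr//.
have sq (v : I -> R) : \sum_i \sum_j v i * v j * 1 = (\sum_i v i) ^+ 2.
  rewrite expr2 big_distrl/=.
  by apply: eq_bigr => i _; rewrite big_distrr/=; apply: eq_bigr => j _; rewrite mulr1.
have M1 (v : I -> R) : 0 <= \sum_i \sum_j v i * v j * 1 by rewrite sq sqr_ge0.
have /andP[_ h] := gk_schur u x t0 M1 (size w).
rewrite mulrC -ler_pdivrMr// mulrC.
rewrite (_ : qf _ _ _ = \sum_i \sum_j u i * u j * (1 * gk t (x i) (x j))); last first.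
  by apply: eq_bigr => i _; apply: eq_bigr => j _; rewrite mul1r.
apply: le_trans h; rewrite ler_wpM2l ?invr_ge0 ?(ltW K0)//.
(* For [M = 1] the form of each word is a square: only that of [w] is kept. *)
rewrite (big_rem w) ?size_words//= sq.
rewrite (_ : \sum_i u i * _ = \sum_i u i * ge t (x i) * mon w (x i)); last first.
  by apply: eq_bigr => i _; rewrite mulrA.
by rewrite lerDl sumr_ge0// => w' _; rewrite sq sqr_ge0.
Qed.

Lemma hle_shift t N g c : hle (gk t) N g -> hle (gk t) N (fun y => g (y - c)).
Proof.
move=> [N0 h]; split => // I u x; apply: le_trans (h I u (fun i => x i - c)) _.
rewrite ler_wpM2l// (_ : qf _ _ _ = qf (gk t) u x)//.
by apply: eq_bigr => i _; apply: eq_bigr => j _; rewrite gk_shift.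
Qed.

Lemma hle_sqr k N g : hle k N g ->
  forall (I : finType) (u : I -> R) (x : I -> 'rV[R]_d), 0 <= qf k u x ->
  (\sum_i u i * g (x i)) ^+ 2 <= N ^+ 2 * qf k u x.
Proof.
move=> [N0 h] I u x q0; rewrite -real_normK ?num_real//.
rewrite -[X in _ <= _ * X](sqr_sqrtr q0) -exprMn lerXn2r ?nnegrE ?mulr_ge0 ?sqrtr_ge0//.
Qed.

Lemma gk_mul t1 t2 x y : 0 < t1 -> 0 < t2 ->
  gk (t1 * t2 / (t1 + t2)) x y = gk t1 x y * gk t2 x y.
Proof.
move=> h1 h2; rewrite /gk -expRD; congr expR; field.
by rewrite !gt_eqF// addr_gt0.
Qed.

(** A norm at most [N] means that the kernel [N ^+ 2 * k - g * g] is positive semidefinite. The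
    kernel for the product is [N2 ^+ 2 * (N1 ^+ 2 * k1 - g1 * g1) * k2 + g1 * g1 * (N2 ^+ 2 * k2 -
    g2 * g2)], where the first term is a Schur product with a Gaussian kernel and the second a
    rescaling of the test vector. The inverses of the parameters add up by [gk_mul]. *)
Lemma hle_mul t1 t2 N1 N2 g1 g2 : 0 < t1 -> 0 < t2 ->
  hle (gk t1) N1 g1 -> hle (gk t2) N2 g2 ->
  hle (gk (t1 * t2 / (t1 + t2))) (N1 * N2) (fun y => g1 y * g2 y).
Proof.
move=> t10 t20 h1 h2; have N10 := h1.1; have N20 := h2.1.
split; first exact: mulr_ge0.
move=> I u x.
have PSD (N t : R) g : 0 < t -> hle (gk t) N g -> forall v : I -> R,
    0 <= \sum_i \sum_j v i * v j * (N ^+ 2 * gk t (x i) (x j) - g (x i) * g (x j)).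
  move=> t0 h v; have := hle_sqr h (qf_gk_ge0 v x t0); rewrite -subr_ge0.
  rewrite (_ : _ - _ = \sum_i \sum_j v i * v j *
    (N ^+ 2 * gk t (x i) (x j) - g (x i) * g (x j)))// /qf mulr_sumr (expr2 (\sum_i _)) big_distrl/=.
  rewrite -sumrB; apply: eq_bigr => i _; rewrite mulr_sumr big_distrr/= -sumrB.
  by apply: eq_bigr => j _; ring.
have /andP[p1 p1'] := gk_schur u x t20 (PSD _ _ _ t10 h1) 0%N.
have {p1 p1'}A := le_trans p1 p1'.
have B := PSD _ _ _ t20 h2 (fun i => u i * g1 (x i)).
rewrite -mulrA -[leLHS]sqrtr_sqr.
have -> : N1 * (N2 * Num.sqrt (qf (gk (t1 * t2 / (t1 + t2))) u x)) =
    Num.sqrt ((N1 * N2) ^+ 2 * qf (gk (t1 * t2 / (t1 + t2))) u x).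
  by rewrite sqrtrM ?sqr_ge0// sqrtr_sqr ger0_norm ?mulr_ge0// mulrA.
apply: ler_wsqrtr; rewrite -subr_ge0.
have := addr_ge0 (mulr_ge0 (sqr_ge0 N2) A) B.
congr (0 <= _); rewrite /qf !mulr_sumr (expr2 (\sum_i _)) big_distrl/= -big_split -sumrB/=.
apply: eq_bigr => i _; rewrite !mulr_sumr -big_split -sumrB/=.
by apply: eq_bigr => j _; rewrite gk_mul//; ring.
Qed.

End Hle.

(** * Change of width of a Gaussian factor *)

Section GaussianBandwidth.
Variables (R : realType) (d : nat).

Lemma size_words_pow n : size (words d n) = (d ^ n)%N.
Proof.
elim: n => [|n IH] //=.
by rewrite size_allpairs IH -[size (enum _)]cardE card_ord expnS.
Qed.

Lemma sum_half_le n : \sum_(r < n) (2^-1 : R) ^+ r <= 2.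
Proof.
suff -> : \sum_(r < n) (2^-1 : R) ^+ r = 2 - 2 * 2^-1 ^+ n.
  by rewrite gerBl mulr_ge0// exprn_ge0// invr_ge0.
elim: n => [|n IH]; first by rewrite big_ord0 expr0; ring.
by rewrite big_ord_recr/= IH exprS; field.
Qed.

(** To have a Matern norm, one function must lie in the spaces of [gk t] for a whole window of [t],
    while its Gaussian factor has a fixed width [s]. Writing [ge s] as [ge t] times
    [expR (lam * sqn y)] and expanding the second factor leaves monomials of even extra degree,
    whose norms are known. *)
Lemma hle_ge_mon (t s : R) (w : seq 'I_d) : (0 < d)%N -> 0 < t -> t <= s ->
  4 * d%:R * (s - t) <= s ->
  hle (gk t) (2 * Num.sqrt ((size w)`!%:R * (4 * t) ^+ size w))
    (fun y => ge s y * mon w y).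
Proof.
move=> d0 t0 ts hts; have s0 : 0 < s by exact: lt_le_trans ts.
pose lam := (s - t) / (4 * t * s).
have lam0 : 0 <= lam by rewrite divr_ge0 ?subr_ge0// !mulr_ge0 ?ltW.
pose S := Num.sqrt ((size w)`!%:R * (4 * t) ^+ size w).
pose g (n : nat) (y : 'rV[R]_d) := \sum_(r < n) lam ^+ r / r`!%:R *
   \sum_(w' <- words d r) ge t y * mon (w ++ (w' ++ w')) y.
have cvg_g y : g ^~ y @ \oo --> ge s y * mon w y.
  have -> : ge s y * mon w y = ge t y * mon w y * expR (lam * sqn y).
    rewrite mulrAC /ge -expRD; congr (expR _ * _); rewrite /lam; field.
    by rewrite !gt_eqF.
  rewrite (_ : g ^~ y = (fun n => ge t y * mon w y * series (exp_coeff (lam * sqn y)) n)).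
    by apply: cvgMr; exact: is_cvg_series_exp_coeff.
  apply/funext => n; rewrite /g /series/= big_mkord mulr_sumr; apply: eq_bigr => r _.
  rewrite /exp_coeff/= (exprMn r lam) sqn_exp !mulr_sumr mulr_suml mulr_sumr; apply: eq_bigr => w' _.
  by rewrite mon_cat; field; rewrite pnatr_eq0 -lt0n fact_gt0.
apply: hle_lim cvg_g => n; apply: hleW; last first.
  apply: hle_sum => r _; apply: hleZ; apply: hle_sum => w' _; exact: hle_mon.
rewrite -/S; apply: (@le_trans _ _ (\sum_(r < n) 2^-1 ^+ r * S)); last first.
  by rewrite -mulr_suml ler_wpM2r ?sqrtr_ge0// sum_half_le.
apply: ler_sum => r _.
(* [T] bounds the norm for every word [w ++ (w' ++ w')]: two uses of [fact_add_le] extract from the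
   factorial of the total length the square of [r!], whose root cancels the [r!] of the series. *)
pose T : R := 4 ^+ r * r`!%:R * (2 * t) ^+ r * S.
apply: (@le_trans _ _ (lam ^+ r / r`!%:R * (d%:R ^+ r * T))).
  rewrite ger0_norm ?divr_ge0 ?exprn_ge0// ler_wpM2l ?divr_ge0 ?exprn_ge0//.
  apply: (@le_trans _ _ (\sum_(w' <- words d r) T)); last first.
    by rewrite big_const_seq count_predT size_words_pow iter_addr_0 -natrX mulr_natl.
  rewrite big_seq_cond [leRHS]big_seq_cond; apply: ler_sum => w'.
  rewrite size_words andbT => /eqP sw'; rewrite !size_cat sw'.
  have T0 : 0 <= T by rewrite !mulr_ge0 ?exprn_ge0 ?mulr_ge0 ?sqrtr_ge0 ?ltW.
  rewrite -[leRHS](ger0_norm T0) -sqrtr_sqr ler_wsqrtr//.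
  have t20 : 0 <= 2 * t by rewrite mulr_ge0// ltW.
  rewrite [T ^+ 2]exprMn [S ^+ 2]sqr_sqrtr; last by rewrite mulr_ge0 ?exprn_ge0 ?mulr_ge0 ?ltW.
  apply: (@le_trans _ _ ((2 ^ (size w + (r + r)) * ((size w)`! * (2 ^ (r + r) * (r`! * r`!))))%:R
      * (2 * t) ^+ (size w + (r + r)))).
    rewrite ler_wpM2r ?exprn_ge0// ler_nat (leq_trans (fact_add_le _ _))//.
    by rewrite leq_mul2l; apply/orP; right; rewrite leq_mul2l fact_add_le orbT.
  have -> : (4 : R) = 2 * 2 by ring.
  rewrite !natrM !natrX !exprD !exprMn le_eqVlt; apply/orP; left; apply/eqP.
  by ring.
rewrite /T !mulrA ler_wpM2r ?sqrtr_ge0//.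
(* The series is geometric with ratio [2 * d * (s - t) / s], which the hypothesis on the widths
   makes at most one half. *)
have -> : lam ^+ r / r`!%:R * d%:R ^+ r * 4 ^+ r * r`!%:R * (2 * t) ^+ r =
    (lam * d%:R * 4 * (2 * t)) ^+ r.
  by rewrite !exprMn; field; rewrite pnatr_eq0 -lt0n fact_gt0.
rewrite lerXn2r ?nnegrE ?invr_ge0//.
  by apply: mulr_ge0; [apply: mulr_ge0 => //; exact: mulr_ge0|rewrite mulr_ge0// ltW].
rewrite (_ : _ * _ = 4 * d%:R * (s - t) / (2 * s)).
  by rewrite ler_pdivrMr ?mulr_gt0// mulrA mulVf ?mul1r// pnatr_eq0.
by rewrite /lam; field; rewrite !gt_eqF.
Qed.

End GaussianBandwidth.

(** * Changes of variable on the real line *)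

Section RealLineIntegrals.
Variable R : realType.
Local Notation mu := (@lebesgue_measure R).
Local Open Scope ereal_scope.

Lemma ge0_integralT_split (f : R -> R) : continuous f -> (forall x, 0 <= f x)%R ->
  \int[mu]_x (f x)%:E = \int[mu]_(x in `[0%R, +oo[) (f x + f (- x))%:E.
Proof.
move=> cf f0.
have mf : measurable_fun [set: R] f by exact: continuous_measurable_fun.
have mfN : measurable_fun [set: R] (f \o -%R) by exact: measurableT_comp.
rewrite -(setUv `[0%R, +oo[%classic) ge0_integral_setU//=; last 4 first.
  exact: measurableC.
  by apply/measurable_EFinP; rewrite setUv.
  by move=> x _; rewrite lee_fin.
  exact/disj_setPCl.
rewrite setCitvr integral_itv_bndo_bndc; last exact/measurable_EFinP/measurable_funTS.
rewrite -{2}oppr0 ge0_integration_by_substitutionNy//; last exact: continuous_subspaceT.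
rewrite -ge0_integralD//=.
- by move=> x _; rewrite lee_fin.
- exact/measurable_EFinP/measurable_funTS.
- by move=> x _; rewrite lee_fin.
- exact/measurable_EFinP/measurable_funTS.
Qed.

Lemma derive1_shift (c : R) : (fun x : R => x + c)%R^`()%classic = cst 1%R.
Proof.
by apply/funext => x; rewrite derive1E deriveD// derive_id derive_cst addr0.
Qed.

Lemma ge0_integralT_shift (c : R) (f : R -> R) : continuous f -> (forall x, 0 <= f x)%R ->
  \int[mu]_x (f x)%:E = \int[mu]_x (f (x + c)%R)%:E.
Proof.
move=> cf f0.
rewrite (@increasing_ge0_integration_by_substitutionT R (fun x => x + c)%R f)//.
- by apply: eq_integral => x _; rewrite fctE derive1_shift mulr1.
- by move=> x y xy; rewrite ltrD2r.
- by rewrite derive1_shift => ?; exact: cvg_cst.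
- by rewrite derive1_shift; exact: is_cvg_cst.
- by rewrite derive1_shift; exact: is_cvg_cst.
- exact: cvg_addrr_Ny.
- exact: cvg_addrr.
Qed.

(** The substitution is made on the compact intervals from [expR (- n)] to [expR n] and passes to
    the limit by monotone convergence, since [g] may be singular at 0, as the Gamma density is for
    exponents below 1. *)
Lemma ge0_integral_itv0y_expR (g : R -> R) : {in `]0%R, +oo[, continuous g} ->
  (forall x, 0 <= g x)%R ->
  \int[mu]_(t in `]0%R, +oo[) (g t)%:E = \int[mu]_x (g (expR x) * expR x)%:E.
Proof.
move=> cg g0.
have dE : (@expR R)^`()%classic = @expR R by apply/funext => x; rewrite derive1E (congr1 (fun f => f x) (derive_expR R)).
have step (n : nat) : \int[mu]_(t in `[expR (- n%:R), expR n%:R]) (g t)%:E =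
    \int[mu]_(x in `[(- n%:R)%R, n%:R]) (g (expR x) * expR x)%:E.
  rewrite (@integration_by_substitution_increasing R expR g)//.
  - by apply: eq_integral => x _; rewrite fctE dE.
  - by rewrite lerNl (le_trans _ (ler0n _ _))// oppr_le0.
  - by move=> x y _ _ xy; rewrite ltr_expR.
  - by rewrite dE => x _; exact: continuous_expR.
  - by rewrite dE; apply/cvg_ex; eexists; apply: cvg_at_right_filter; exact: continuous_expR.
  - by rewrite dE; apply/cvg_ex; eexists; apply: cvg_at_left_filter; exact: continuous_expR.
  - split; first by move=> x _; exact: derivable_expR.
      by apply: cvg_at_right_filter; exact: continuous_expR.
    by apply: cvg_at_left_filter; exact: continuous_expR.
  - apply: continuous_in_subspaceT => x; rewrite inE/= in_itv/= => /andP[xn _].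
    by apply: cg; rewrite in_itv/= andbT (lt_le_trans _ xn)// expR_gt0.
have mg : measurable_fun (`]0%R, +oo[%classic : set R) g.
  by apply: open_continuous_measurable_fun => // x; rewrite inE/=; exact: cg.
have mge : measurable_fun [set: R] (fun x => g (expR x) * expR x)%R.
  apply: continuous_measurable_fun => x; apply: cvgM; last exact: continuous_expR.
  apply: continuous_comp; first exact: continuous_expR.
  by apply: cg; rewrite in_itv/= andbT expR_gt0.
have U1 : \bigcup_n `[expR (- n%:R), expR n%:R]%classic = `]0%R, +oo[%classic :> set R.
  apply/seteqP; split => x /=; rewrite in_itv/= ?andbT.
    by move=> [n _]/=; rewrite in_itv/= => /andP[+ _]; apply: lt_le_trans; rewrite expR_gt0.
  move=> x0; exists (Num.bound `|ln x|%R) => //=.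
  rewrite in_itv/= -[X in (_ <= X <= _)%R](@lnK _ x)// !ler_expR -ler_norml ltW//.
  exact: archi_boundP.
have U2 : \bigcup_n `[(- n%:R)%R, n%:R]%classic = [set: R].
  apply/seteqP; split => // x _.
  exists (Num.bound `|x|%R) => //=; rewrite in_itv/= -ler_norml ltW//.
  exact: archi_boundP.
have c2 : (fun n : nat => \int[mu]_(x in `[(- n%:R)%R, n%:R]) (g (expR x) * expR x)%:E)
    @ \oo --> \int[mu]_x (g (expR x) * expR x)%:E.
  rewrite -U2; apply: ge0_nondecreasing_set_cvg_integral => //.
  - apply/nondecreasing_seqP => n; apply/subsetPset => x /=; rewrite !in_itv/=.
    move=> /andP[h1 h2]; apply/andP; split.
      by rewrite (le_trans _ h1)// lerN2 ler_nat.
    by rewrite (le_trans h2)// ler_nat.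
  - by move=> i; apply/measurable_EFinP; exact: measurable_funTS.
  - by move=> i x _; rewrite lee_fin mulr_ge0 ?expR_ge0.
have c1 : (fun n : nat => \int[mu]_(t in `[expR (- n%:R), expR n%:R]) (g t)%:E)
    @ \oo --> \int[mu]_(t in `]0%R, +oo[) (g t)%:E.
  rewrite -U1; apply: ge0_nondecreasing_set_cvg_integral => //.
  - apply/nondecreasing_seqP => n; apply/subsetPset => x /=; rewrite !in_itv/=.
    move=> /andP[h1 h2]; apply/andP; split.
      by rewrite (le_trans _ h1)// ler_expR lerN2 ler_nat.
    by rewrite (le_trans h2)// ler_expR ler_nat.
  - move=> i; apply/measurable_EFinP; apply: measurable_funS mg => //.
    move=> x /=; rewrite !in_itv/= andbT => /andP[h _].
    by rewrite (lt_le_trans _ h)// expR_gt0.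
  - by move=> i x _; rewrite lee_fin.
rewrite -(cvg_lim _ c1)// -(cvg_lim _ c2)//.
by congr (limn _); exact/funext.
Qed.

End RealLineIntegrals.

(** * The Matern kernel as a Gamma mixture of Gaussian kernels *)

Section MaternMixture.
Variable R : realType.
Local Notation mu := (@lebesgue_measure R).

(** The Gamma weight [t ^ (a - 1) * exp (- t)] in the variable [x = ln t], Jacobian included: a
    continuous function on the whole line for every [a]. *)
Definition wgt (a x : R) : R := expR (a * x - expR x).

Lemma wgt_ge0 a x : 0 <= wgt a x. Proof. exact: expR_ge0. Qed.

Lemma continuous_wgt a : continuous (wgt a).
Proof.
move=> x; apply: continuous_comp; last exact: continuous_expR.
by apply: cvgB; [exact: mulrl_continuous|exact: continuous_expR].
Qed.

Lemma wgt_integrable a : 0 < a -> mu.-integrable setT (EFin \o wgt a).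
Proof.
move=> a0; have cw := @continuous_wgt a.
have mw : measurable_fun [set: R] (wgt a) by exact: continuous_measurable_fun.
apply/integrableP; split; first exact/measurable_EFinP.
under eq_integral do rewrite /= ger0_norm ?wgt_ge0//.
rewrite ge0_integralT_split//; last by move=> x; exact: wgt_ge0.
(* The tangent to [expR] at [c] has slope [2 * a], so [a * x - expR x] is at most a constant minus
   [a * x]. On both half lines the weight is then dominated by a multiple of an exponential density
   of rate [a]. *)
pose c := ln (2 * a); pose C := (expR (2 * a * (c - 1)) + 1) / a.
have C0 : 0 <= C by rewrite divr_ge0 ?addr_ge0 ?expR_ge0// ltW.
have bnd x : 0 <= x -> wgt a x + wgt a (- x) <= C * exponential_pdf a x.
  move=> x0; rewrite exponential_pdfE// mulrA divfK ?gt_eqF// mulrDl mul1r.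
  apply: lerD; rewrite /wgt -?expRD ler_expR.
    have : 2 * a * (1 + (x - c)) <= expR x.
      rewrite -[in leRHS](subrK c x) expRD mulrC [expR c]lnK ?posrE ?mulr_gt0//.
      by rewrite ler_wpM2r ?expR_ge1Dx// mulr_ge0// ltW.
    by lra.
  by rewrite mulrN mulNr lerBlDr lerDl expR_ge0.
apply: (@le_lt_trans _ _ (\int[mu]_(x in `[0%R, +oo[) (C%:E * (exponential_pdf a x)%:E))%E).
  apply: ge0_le_integral => //.
  - by move=> x _; rewrite lee_fin addr_ge0 ?wgt_ge0.
  - apply/measurable_EFinP/measurable_funTS/measurable_funD => //.
    exact: measurableT_comp.
  - apply/measurable_EFinP/measurable_funTS/measurable_funM => //.
    exact: measurable_exponential_pdf.
  - by move=> x /=; rewrite in_itv/= andbT -EFinM lee_fin; exact: bnd.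
rewrite ge0_integralZl//=; last 2 first.
  by apply/measurable_EFinP/measurable_funTS; exact: measurable_exponential_pdf.
  by move=> x _; rewrite lee_fin exponential_pdf_ge0// ltW.
apply: lte_mul_pinfty => //; apply: (@le_lt_trans _ _ (\int[mu]_x (exponential_pdf a x)%:E)%E).
  apply: ge0_subset_integral => //.
    by apply/measurable_EFinP; exact: measurable_exponential_pdf.
  by move=> x _; rewrite lee_fin exponential_pdf_ge0// ltW.
by rewrite integral_exponential_pdf// ltry.
Qed.

Definition mix (a : R) (F : R -> R) : R := \int[mu]_x (F x * wgt a x).

Lemma mix_integrable a (F : R -> R) (C : R) : 0 < a -> continuous F ->
  (forall x, `|F x| <= C) -> mu.-integrable setT (EFin \o (fun x => F x * wgt a x)).
Proof.
move=> a0 cF FC.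
apply: (@le_integrable _ _ _ mu setT measurableT _ (EFin \o (fun x => C * wgt a x))).
- apply/measurable_EFinP; apply: continuous_measurable_fun => x.
  by apply: continuousM; [exact: cF|exact: continuous_wgt].
- move=> x _ /=; rewrite lee_fin normrM (ger0_norm (wgt_ge0 _ _)).
  by apply: le_trans (ler_norm _); rewrite ler_wpM2r ?wgt_ge0.
- exact: (integrableZl measurableT C (wgt_integrable a0)).
Qed.

Lemma gamma_fun_wgt a : 0 < a -> gamma_fun a = \int[mu]_x wgt a x.
Proof.
move=> a0; rewrite /gamma_fun /Rintegral.
rewrite ge0_integral_itv0y_expR.
- congr fine; apply: eq_integral => x _; congr EFin.
  rewrite /wgt -expRM -!expRD; congr expR; ring.
- move=> t tp; apply: cvgM.
    by have /derivable1_diffP/differentiable_continuous := @derivable_powR R 1 (a - 1) t tp.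
  apply: continuous_comp; first exact: continuousN.
  exact: continuous_expR.
- by move=> x; rewrite mulr_ge0 ?powR_ge0 ?expR_ge0.
Qed.

Lemma mix_lower a (F : R -> R) (C t1 t2 c : R) : 0 < a -> continuous F ->
  (forall x, `|F x| <= C) -> (forall x, 0 <= F x) -> 0 < t1 -> t1 <= t2 -> 0 <= c ->
  (forall x, t1 <= expR x <= t2 -> c <= F x) ->
  c * (t1 `^ a * expR (- t2) * ln (t2 / t1)) <= mix a F.
Proof.
move=> a0 cF FC F0 t10 t12 c0 Fc.
have t20 : 0 < t2 by exact: lt_le_trans t12.
have iF := mix_integrable a0 cF FC.
rewrite -lee_fin /mix /Rintegral fineK; last exact: integrable_fin_num.
have ltt : ln t1 <= ln t2 by rewrite ler_ln.
have F0w x : 0 <= F x * wgt a x by rewrite mulr_ge0 ?wgt_ge0.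
apply: (@le_trans _ _ (\int[mu]_(x in `[ln t1, ln t2]) (F x * wgt a x)%:E)%E); last first.
  apply: ge0_subset_integral => //; last by move=> x _; rewrite lee_fin.
  exact: (measurable_int mu).
apply: (@le_trans _ _ (\int[mu]_(x in `[ln t1, ln t2])
    (cst (c * (t1 `^ a * expR (- t2)))%:E x))%E); last first.
  apply: ge0_le_integral => //.
  - by move=> x _; rewrite lee_fin !mulr_ge0 ?powR_ge0 ?expR_ge0.
  - by apply: measurable_funTS; exact: (measurable_int mu).
  - move=> x /=; rewrite in_itv/= => /andP[h1 h2]; rewrite lee_fin.
    have e1 : t1 <= expR x by rewrite -[t1]lnK ?posrE// ler_expR.
    have e2 : expR x <= t2 by rewrite -[t2]lnK ?posrE// ler_expR.
    rewrite ler_pM ?mulr_ge0 ?powR_ge0 ?expR_ge0// ?Fc ?e1//.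
    rewrite /wgt expRD ler_pM ?powR_ge0 ?expR_ge0//.
      by rewrite /powR gt_eqF// ler_expR ler_wpM2l// ltW.
    by rewrite ler_expR lerN2.
rewrite integral_cst//= lebesgue_measure_itv/=.
case: ifPn => [_|]; first by rewrite -EFinD -EFinM lee_fin ln_div ?posrE// mulrA.
rewrite lte_fin -leNgt => h; rewrite mule0 lee_fin.
by rewrite (_ : ln _ = 0) ?mulr0// ln_div ?posrE//; apply/eqP; rewrite subr_eq0 eq_le h ltt.
Qed.

Lemma mix_sum a (T : finType) (c : T -> R) (F : T -> R -> R) (C : R) : 0 < a ->
  (forall t, continuous (F t)) -> (forall t x, `|F t x| <= C) ->
  \sum_t c t * mix a (F t) = mix a (fun x => \sum_t c t * F t x).
Proof.
move=> a0 cF FC.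
have key (r : seq T) : mu.-integrable setT (EFin \o (fun x => \sum_(t <- r) c t * F t x * wgt a x)) /\
    \sum_(t <- r) c t * mix a (F t) = \int[mu]_x (\sum_(t <- r) c t * F t x * wgt a x).
  elim: r => [|t r [i1 IH]].
    split.
      apply: (eq_integrable _ (cst 0%E)) => //; last exact: integrable0.
      by move=> x _; rewrite /= big_nil.
    rewrite big_nil; under eq_Rintegral do rewrite big_nil.
    by rewrite Rintegral_cst// mul0r.
  have i2 : mu.-integrable setT (EFin \o (fun x => c t * (F t x * wgt a x))).
    exact: (integrableZl measurableT _ (mix_integrable a0 (cF t) (FC t))).
  split.
    pose A x := c t * (F t x * wgt a x); pose B x := \sum_(t <- r) c t * F t x * wgt a x.
    rewrite (_ : EFin \o _ = ((EFin \o A) \+ (EFin \o B))%E); first exact: (integrableD measurableT i2 i1).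
    by apply/funext => x; rewrite /= /A /B big_cons EFinD mulrA.
  rewrite big_cons IH -RintegralZl//; last exact: mix_integrable (FC t).
  rewrite -RintegralD//; apply: eq_Rintegral => x _.
  by rewrite big_cons mulrA.
rewrite (key (index_enum T)).2; apply: eq_Rintegral => x _.
by rewrite mulr_suml.
Qed.

(** The bound allows a singularity [t ^ (- p) + t ^ (- q)] at [t = expR x] near 0; its integral is a
    sum of Gamma functions, finite because [p] and [q] are below [a]. The uniform bound [C] serves
    only integrability and does not enter the estimate. *)
Lemma mix_upper a (F : R -> R) (C D p q : R) : continuous F ->
  (forall x, `|F x| <= C) -> p < a -> q < a -> 0 < a ->
  (forall x, `|F x| <= D * (expR (- p * x) + expR (- q * x))) ->
  `|mix a F| <= D * (gamma_fun (a - p) + gamma_fun (a - q)).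
Proof.
move=> cF FC pa qa a0 FD.
have iF := mix_integrable a0 cF FC.
have ip : mu.-integrable setT (EFin \o wgt (a - p)) by apply: wgt_integrable; rewrite subr_gt0.
have iq : mu.-integrable setT (EFin \o wgt (a - q)) by apply: wgt_integrable; rewrite subr_gt0.
have ipq : mu.-integrable setT (EFin \o (fun x => wgt (a - p) x + wgt (a - q) x)).
  exact: (integrableD measurableT ip iq).
rewrite !gamma_fun_wgt ?subr_gt0// -RintegralD// -RintegralZl//.
apply: le_trans (le_normr_Rintegral _ _) _ => //.
apply: le_Rintegral => //.
- exact: (integrable_norm iF).
- exact: (integrableZl measurableT _ ipq).
- move=> x _; rewrite normrM (ger0_norm (wgt_ge0 _ _)).
  apply: le_trans (ler_wpM2r (wgt_ge0 _ _) (FD x)) _.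
  rewrite /wgt -mulrA mulrDl -!expRD le_eqVlt; apply/orP; left; apply/eqP.
  by congr (_ * (expR _ + expR _)); ring.
Qed.

Lemma mix_cst1 a : 0 < a -> mix a (cst 1) = gamma_fun a.
Proof.
by move=> a0; rewrite gamma_fun_wgt//; apply: eq_Rintegral => x _; rewrite mul1r.
Qed.

Lemma gamma_fun_gt0 (a : R) : 0 < a -> 0 < gamma_fun a.
Proof.
move=> a0; rewrite -mix_cst1//.
apply: lt_le_trans (@mix_lower a (cst 1) 1 1 (expR 1) 1 a0 _ _ _ _ _ _ _) => //.
- by rewrite powR1 !mul1r divr1 expRK mulr1 expR_gt0.
- exact: cst_continuous.
- by move=> x; rewrite /= normr1.
- by rewrite -[leLHS]expR0 ler_expR.
Qed.

Lemma continuous_gk_expR d (x y : 'rV[R]_d) : continuous (fun z => gk (expR z) x y).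
Proof.
have -> : (fun z => gk (expR z) x y) =
    (fun z => expR (- (sqn (x - y) / 4 * expR (- z)))).
  apply/funext => z; rewrite /gk; congr (expR (- _)).
  by rewrite expRN; field; rewrite expR_eq0.
move=> z; apply: continuous_comp; last exact: continuous_expR.
apply: cvgN; apply: cvgMr; apply: continuous_comp; last exact: continuous_expR.
exact: continuousN.
Qed.

Lemma norm_gk_le1 d (t : R) (x y : 'rV[R]_d) : 0 <= t -> `|gk t x y| <= 1.
Proof. by move=> t0; rewrite ger0_norm ?gk_ge0// gk_le1. Qed.

Lemma sqr_norm2 d (x : 'rV[R]_d) : norm2 x ^+ 2 = sqn x.
Proof. by rewrite /norm2 sqr_sqrtr// sqn_ge0. Qed.

Lemma sqn_eq0 d (x : 'rV[R]_d) : (sqn x == 0) = (x == 0).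
Proof.
apply/idP/eqP => [|->]; last by rewrite /sqn big1// => i _; rewrite mxE expr0n.
rewrite psumr_eq0 => [/allP h|i _]; last exact: sqr_ge0.
apply/rowP => i; have := h i (mem_index_enum _); rewrite sqrf_eq0 mxE.
by move=> /eqP.
Qed.

(** The hyperbolic cosine of [a * t] folds the half line into an integral over the line. Translating
    the variable by [ln (r / 2)] turns the two exponentials in the exponent into [expR z] and
    [r ^+ 2 / (4 * expR z)]: the first belongs to the Gamma weight, the second is the Gaussian
    kernel. *)
Lemma besselK_mix d (a : R) (x y : 'rV[R]_d) : 0 < a -> x != y ->
  besselK a (norm2 (x - y)) =
  2^-1 * ((norm2 (x - y) / 2) `^ (- a) * mix a (fun z => gk (expR z) x y)).
Proof.
move=> a0 xy; set r := norm2 (x - y).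
have r0 : 0 < r.
  by rewrite lt_def sqrtr_ge0 andbT -sqrf_eq0 sqr_norm2 sqn_eq0 subr_eq0.
pose B z := expR (- (r / 2 * (expR z + expR (- z))) + a * z).
have cB : continuous B.
  move=> z; apply: continuous_comp; last exact: continuous_expR.
  apply: cvgD; last exact: mulrl_continuous.
  apply: cvgN; apply: cvgMr; apply: cvgD; first exact: continuous_expR.
  by apply: continuous_comp; [exact: continuousN|exact: continuous_expR].
have B0 z : 0 <= B z by exact: expR_ge0.
have iG := mix_integrable a0 (@continuous_gk_expR d x y)
  (fun z => norm_gk_le1 x y (expR_ge0 z)).
have IB : (\int[mu]_z (B z)%:E)%E =
    ((r / 2) `^ (- a) * mix a (fun z => gk (expR z) x y))%:E.
  rewrite (@ge0_integralT_shift R (- ln (r / 2)))//.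
  rewrite EFinM /mix /Rintegral fineK; last exact: integrable_fin_num.
  rewrite -integralZl//; apply: eq_integral => z _; rewrite -EFinM; congr EFin.
  have r20 : 0 < r / 2 by rewrite divr_gt0.
  rewrite /B /gk /wgt -[(r / 2) `^ _](lnK _) ?posrE ?powR_gt0// ln_powR -!expRD.
  congr expR; rewrite opprD opprK !expRD expRN lnK ?posrE//.
  rewrite -sqr_norm2 -/r expRN; field.
  by rewrite expR_eq0 gt_eqF.
rewrite /besselK /Rintegral.
rewrite (_ : (\int[_]_(_ in _) _)%E = (2^-1)%:E * (\int[mu]_z (B z)%:E))%E; last first.
  rewrite ge0_integralT_split// -ge0_integralZl//.
  - apply: eq_integral => z _; rewrite -EFinM; congr EFin.
    rewrite /B opprK [expR (- z) + _]addrC !expRD mulrN.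
    have -> : r * ((expR z + expR (- z)) / 2) = r / 2 * (expR z + expR (- z)) by ring.
    by ring.
  - apply/measurable_EFinP/measurable_funTS; apply: continuous_measurable_fun => z.
    apply: cvgD; first exact: cB.
    by apply: continuous_comp; [exact: continuousN|exact: cB].
  - by move=> z _; rewrite lee_fin addr_ge0.
by rewrite IB -EFinM.
Qed.

Lemma matern_mix d (a : R) (x y : 'rV[R]_d) : 0 < a ->
  matern a x y = (gamma_fun a)^-1 * mix a (fun z => gk (expR z) x y).
Proof.
move=> a0; rewrite /matern; case: eqVneq => [->|xy].
  rewrite (_ : (fun z => _) = cst 1); last by apply/funext => z; rewrite gkxx.
  by rewrite mix_cst1// mulVf// gt_eqF// gamma_fun_gt0.
rewrite besselK_mix//; set r := norm2 _; set m := mix _ _.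
have r0 : 0 < r.
  by rewrite lt_def sqrtr_ge0 andbT -sqrf_eq0 sqr_norm2 sqn_eq0 subr_eq0.
rewrite powRM ?invr_ge0 ?(ltW r0)// powRB ?pnatr_eq0 ?implybT// powRr1//.
rewrite -[2^-1 in X in _ * (_ * (_ * X * _))]powR_inv1// -powRrM mulN1r opprK.
rewrite powRN; field.
by rewrite !gt_eqF ?powR_gt0 ?gamma_fun_gt0.
Qed.

Lemma matern_sum_mix d (a : R) (T : finType) (c : T -> R) (x y : T -> 'rV[R]_d) :
  0 < a -> \sum_t c t * matern a (x t) (y t) =
  (gamma_fun a)^-1 * mix a (fun z => \sum_t c t * gk (expR z) (x t) (y t)).
Proof.
move=> a0; rewrite -(@mix_sum a T c _ 1)//.
- by rewrite mulr_sumr; apply: eq_bigr => t _; rewrite matern_mix//; ring.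
- by move=> t; exact: continuous_gk_expR.
- by move=> t z; rewrite norm_gk_le1// expR_ge0.
Qed.

End MaternMixture.

(** * Moments of order two of normal laws *)

Section NormalMoments.
Variable R : realType.
Local Notation mu := (@lebesgue_measure R).

Lemma is_derive_normal_pdf (s x : R) : s != 0 ->
  is_derive x 1 (normal_pdf 0 s) (- (x / s ^+ 2) * normal_pdf 0 s x).
Proof.
move=> s0; rewrite normal_pdfE//.
rewrite (_ : (fun y => _) = (fun y => normal_peak s * expR (- (s ^+ 2 *+ 2)^-1 * (y * y)))); last first.
  by apply/funext => y; rewrite /normal_fun subr0; congr (_ * expR _); ring.
apply: is_derive_eq.
rewrite /normal_fun /GRing.scale/= subr0.
rewrite (_ : - (s ^+ 2 *+ 2)^-1 * (x * x) = - x ^+ 2 / (s ^+ 2 *+ 2)); last by ring.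
by field.
Qed.

(** Integration by parts: with [p] the density, [- s ^+ 2 * (x * p x)] is an antiderivative of
    [(x ^+ 2 - s ^+ 2) * p x]. *)
Lemma sqr_normal_pdf_int0n (s : R) (n : nat) : s != 0 ->
  (\int[mu]_(x in `[0%R, n.+1%:R]) (x ^+ 2 * normal_pdf 0 s x)%:E =
   (- s ^+ 2 * (n.+1%:R * normal_pdf 0 s n.+1%:R))%:E +
   (s ^+ 2)%:E * \int[mu]_(x in `[0%R, n.+1%:R]) (normal_pdf 0 s x)%:E)%E.
Proof.
move=> s0.
pose F (x : R) : R := - s ^+ 2 * (x * normal_pdf 0 s x).
have dF (x : R) : is_derive x 1 F (x ^+ 2 * normal_pdf 0 s x - s ^+ 2 * normal_pdf 0 s x).
  have := is_derive_normal_pdf x s0 => h.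
  by rewrite /F; apply: is_derive_eq; rewrite /GRing.scale/=; field.
have cp := @continuous_normal_pdf R 0 s s0.
have cf : continuous (fun x : R => x ^+ 2 * normal_pdf 0 s x - s ^+ 2 * normal_pdf 0 s x).
  move=> x; apply: cvgB; last by apply: cvgMr; exact: cp.
  by apply: cvgM; [exact: exprn_continuous|exact: cp].
have cF : continuous F.
  by move=> x; apply: differentiable_continuous; apply/derivable1_diffP; exact: ex_derive.
have h : (\int[mu]_(x in `[0%R, n.+1%:R])
    (x ^+ 2 * normal_pdf 0 s x - s ^+ 2 * normal_pdf 0 s x)%:E = (F n.+1%:R)%:E - (F 0)%:E)%E.
  apply: continuous_FTC2; first by rewrite ltr0n.
  - exact: continuous_subspaceT.
  - split; first by move=> x _; exact: ex_derive.
      by apply: cvg_at_right_filter; exact: cF.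
    by apply: cvg_at_left_filter; exact: cF.
  - by move=> x _; rewrite derive1E derive_val.
rewrite {2}/F !mul0r mulr0 sube0 in h; rewrite -h.
have ip : mu.-integrable `[0%R, n.+1%:R] (EFin \o normal_pdf 0 s).
  by apply: integrableS (integrable_normal_pdf 0 s).
rewrite -integralZl//= -integralD//=.
- apply: eq_integral => x _; rewrite -EFinD; congr EFin; ring.
- apply: continuous_compact_integrable; first exact: segment_compact.
  exact: continuous_subspaceT.
- exact: (integrableZl _ (s ^+ 2) ip).
Qed.

Lemma normal_pdf0N (s x : R) : normal_pdf 0 s (- x) = normal_pdf 0 s x :> R \/ s = 0.
Proof.
have [->|s0] := eqVneq s 0; [by right|left].
by rewrite normal_pdfE// /normal_fun !subr0 sqrrN.
Qed.

Lemma cvg_mul_normal_pdf (s : R) : s != 0 ->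
  (fun n => n.+1%:R * normal_pdf 0 s n.+1%:R) @ \oo --> (0 : R).
Proof.
move=> s0; pose C := normal_peak s * (s ^+ 2 *+ 2).
have C0 : 0 <= C by rewrite mulr_ge0 ?normal_peak_ge0// mulrn_wge0// sqr_ge0.
have cC : (fun n => C * harmonic n) @ \oo --> (0 : R).
  by rewrite -[X in _ --> X](mulr0 C); apply: cvgMr; exact: cvg_harmonic.
apply: (squeeze_cvgr _ (cvg_cst (0 : R)) cC); near=> n.
have n0 : 0 < n.+1%:R :> R by rewrite ltr0n.
rewrite mulr_ge0 ?normal_pdf_ge0 ?ler0n//= normal_pdfE// /normal_fun subr0.
have s20 : 0 < s ^+ 2 *+ 2 by rewrite pmulrn_lgt0// exprn_even_gt0.
have e : expR (- n.+1%:R ^+ 2 / (s ^+ 2 *+ 2)) <= (s ^+ 2 *+ 2) / n.+1%:R ^+ 2.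
  rewrite mulNr expRN -[leRHS]invrK lef_pV2 ?posrE ?expR_gt0 ?invr_gt0 ?divr_gt0 ?exprn_gt0//.
  by rewrite invf_div (le_trans _ (expR_ge1Dx _))// lerDr.
rewrite mulrCA /C -mulrA ler_wpM2l ?normal_peak_ge0//.
rewrite (_ : _ * harmonic n = n.+1%:R * ((s ^+ 2 *+ 2) / n.+1%:R ^+ 2)).
  by rewrite ler_wpM2l// ltW.
by rewrite /harmonic/=; field; rewrite gt_eqF// addrC natr1.
Unshelve. all: end_near. Qed.

Lemma normal_second_moment (s : R) : s != 0 ->
  (\int[mu]_x (x ^+ 2 * normal_pdf 0 s x)%:E = (s ^+ 2)%:E)%E.
Proof.
move=> s0.
have cp := @continuous_normal_pdf R 0 s s0.
have c2 : continuous (fun x : R => x ^+ 2 * normal_pdf 0 s x).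
  by move=> x; apply: cvgM; [exact: exprn_continuous|exact: cp].
have p0 x : 0 <= normal_pdf 0 s x by exact: normal_pdf_ge0.
have p20 x : 0 <= x ^+ 2 * normal_pdf 0 s x by rewrite mulr_ge0 ?sqr_ge0.
have pN x : normal_pdf 0 s (- x) = normal_pdf 0 s x.
  by have [//|s00] := normal_pdf0N s x; rewrite s00 eqxx in s0.
have mp : measurable_fun [set: R] (normal_pdf 0 s) by exact: measurable_normal_pdf.
have m2 : measurable_fun [set: R] (fun x : R => x ^+ 2 * normal_pdf 0 s x).
  exact: continuous_measurable_fun.
have l1 := @ge0_cvgn_integral R mu _ p20 m2.
have l0 := @ge0_cvgn_integral R mu _ p0 mp.
set I0 := (\int[mu]_(x in `[0%R, +oo[) (normal_pdf 0 s x)%:E)%E in l0.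
have key : (\int[mu]_(x in `[0%R, +oo[) (x ^+ 2 * normal_pdf 0 s x)%:E = (s ^+ 2)%:E * I0)%E.
  rewrite -(cvg_lim _ l1)//; apply/cvg_lim => //; rewrite -cvg_shiftS/=.
  under eq_fun do rewrite sqr_normal_pdf_int0n//.
  have -> : ((s ^+ 2)%:E * I0 = 0%:E + (s ^+ 2)%:E * I0)%E by rewrite add0e.
  apply: cvgeD => //.
  - apply/fine_cvgP; split; first exact: nearW.
    have h : (fun n => - s ^+ 2 * (n.+1%:R * normal_pdf 0 s n.+1%:R)) @ \oo --> - s ^+ 2 * 0.
      by apply: cvgMr; exact: cvg_mul_normal_pdf.
    by rewrite mulr0 in h.
  - apply: cvgeZl => //.
    by rewrite -cvg_shiftS in l0.
rewrite ge0_integralT_split//.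
transitivity ((s ^+ 2)%:E * \int[mu]_x (normal_pdf 0 s x)%:E)%E; last first.
  by rewrite integral_normal_pdf mule1.
rewrite ge0_integralT_split//.
have sp (f : R -> R) : (forall x, 0 <= f x) -> measurable_fun [set: R] f ->
    (forall x, f (- x) = f x) ->
    (\int[mu]_(x in `[0%R, +oo[) (f x + f (- x))%:E =
     2%:E * \int[mu]_(x in `[0%R, +oo[) (f x)%:E)%E.
  move=> f0 mf fN; rewrite -ge0_integralZl//.
  - by apply: eq_integral => x _; rewrite fN -EFinM mulr_natl mulr2n.
  - by apply/measurable_EFinP; exact: measurable_funTS.
  - by move=> x _; rewrite lee_fin.
rewrite (sp (normal_pdf 0 s))// (sp (fun x => x ^+ 2 * normal_pdf 0 s x))//; last first.
  by move=> x; rewrite sqrrN pN.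
by rewrite key muleCA.
Qed.

Lemma normal_pdf_shift (m s x : R) : s != 0 -> normal_pdf m s (x + m) = normal_pdf 0 s x.
Proof. by move=> s0; rewrite !normal_pdfE// /normal_fun addrK subr0. Qed.

Lemma continuous_sqrD (b : R) : continuous (fun x : R => (x + b) ^+ 2).
Proof.
move=> x; apply: (@continuous_comp _ _ _ (fun x : R => x + b) (fun y : R => y ^+ 2)).
  by apply: cvgD; [exact: cvg_id|exact: cvg_cst].
exact: exprn_continuous.
Qed.

Lemma int_normal_sq (m s c : R) : s != 0 ->
  (\int[mu]_x ((x + c) ^+ 2 * normal_pdf m s x)%:E = ((m + c) ^+ 2 + s ^+ 2)%:E)%E.
Proof.
move=> s0.
have cp := @continuous_normal_pdf R 0 s s0.
have p0 x : 0 <= normal_pdf 0 s x by exact: normal_pdf_ge0.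
have pN x : normal_pdf 0 s (- x) = normal_pdf 0 s x.
  by have [//|s00] := normal_pdf0N s x; rewrite s00 eqxx in s0.
have cq (b : R) : continuous (fun x : R => (x + b) ^+ 2).
  exact: continuous_sqrD.
have c2 (b : R) : continuous (fun x : R => (x + b) ^+ 2 * normal_pdf 0 s x).
  by move=> x; apply: cvgM; [exact: cq|exact: cp].
rewrite (@ge0_integralT_shift R m); last first.
- by move=> x; rewrite mulr_ge0 ?sqr_ge0 ?normal_pdf_ge0.
- move=> x; apply: cvgM; first exact: cq.
  exact: continuous_normal_pdf.
under eq_integral do rewrite normal_pdf_shift// -addrA.
set b := m + c.
have c3 : continuous (fun x : R => x ^+ 2 * normal_pdf 0 s x).
  by have := c2 0; under eq_fun do rewrite addr0.
transitivity (\int[mu]_x ((x ^+ 2 * normal_pdf 0 s x)%:E + (b ^+ 2 * normal_pdf 0 s x)%:E))%E.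
  rewrite ge0_integralT_split; [|exact: c2|by move=> x; rewrite mulr_ge0 ?sqr_ge0].
  under [RHS]eq_integral do rewrite -EFinD.
  rewrite [RHS]ge0_integralT_split//.
  - have alg (u v p : R) : (u + v) ^+ 2 * p + (- u + v) ^+ 2 * p =
        u ^+ 2 * p + v ^+ 2 * p + ((- u) ^+ 2 * p + v ^+ 2 * p) by ring.
    by apply: eq_integral => x _; congr EFin; rewrite !pN; exact: alg.
  - move=> x; apply: cvgD; first exact: c3.
    by apply: cvgMr; exact: cp.
  - by move=> x; apply: addr_ge0; apply: mulr_ge0; rewrite ?sqr_ge0 ?normal_pdf_ge0.
rewrite ge0_integralD//=.
- rewrite normal_second_moment//.
  under eq_integral do rewrite EFinM.
  rewrite ge0_integralZl//=.
  + by rewrite integral_normal_pdf mule1 -EFinD addrC.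
  + by apply/measurable_EFinP; exact: measurable_normal_pdf.
  + by move=> x _; rewrite lee_fin normal_pdf_ge0.
  + by rewrite lee_fin sqr_ge0.
- by move=> x _; rewrite lee_fin mulr_ge0 ?sqr_ge0.
- by apply/measurable_EFinP; exact: continuous_measurable_fun.
- by move=> x _; rewrite lee_fin mulr_ge0 ?sqr_ge0.
- apply/measurable_EFinP; apply: measurable_funM => //; exact: measurable_normal_pdf.
Qed.

(* A normal law has the same moments of order at most 2 as the uniform law on
   {m - s, m + s}. *)
Lemma int_normal_quad (m s A B C : R) : s != 0 ->
  (\int[mu]_x ((A + B * x + C * x ^+ 2) * normal_pdf m s x)%:E =
   (2^-1 * ((A + B * (m + s) + C * (m + s) ^+ 2) +
            (A + B * (m - s) + C * (m - s) ^+ 2)))%:E)%E.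
Proof.
move=> s0.
have iq (c : R) : mu.-integrable setT (EFin \o (fun x => (x + c) ^+ 2 * normal_pdf m s x)).
  apply/integrableP; split.
    apply/measurable_EFinP; apply: continuous_measurable_fun => x.
    by apply: cvgM; [exact: continuous_sqrD|exact: continuous_normal_pdf].
  have n0 (x : R) : `|(x + c) ^+ 2 * normal_pdf m s x| = (x + c) ^+ 2 * normal_pdf m s x.
    by rewrite ger0_norm// mulr_ge0 ?sqr_ge0 ?normal_pdf_ge0.
  under eq_integral do rewrite /= n0.
  by rewrite int_normal_sq// ltry.
have ip := integrable_normal_pdf m s.
have iZ (k : R) (f : R -> R) : mu.-integrable setT (EFin \o f) ->
    mu.-integrable setT (EFin \o (fun x => k * f x)).
  by move=> h; exact: (integrableZl measurableT k h).
pose f (c x : R) := (x + c) ^+ 2 * normal_pdf m s x.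
(* Polarization: [B * x] is [k1] times the difference of the squares of [x + 1] and [x - 1], so that
   only the nonnegative integrands of [int_normal_sq] occur. *)
pose k1 := B / 4; pose k2 := C.
transitivity (\int[mu]_x (((k1 * f 1 x)%:E + (- k1 * f (-1) x)%:E) +
    ((k2 * f 0 x)%:E + (A * normal_pdf m s x)%:E)))%E.
  have alg (x p : R) : (A + B * x + C * x ^+ 2) * p =
      (k1 * ((x + 1) ^+ 2 * p) + - k1 * ((x + -1) ^+ 2 * p)) +
      (k2 * ((x + 0) ^+ 2 * p) + A * p) by rewrite /k1 /k2; field.
  by apply: eq_integral => x _; rewrite -!EFinD; congr EFin; exact: alg.
have i1 := iZ k1 _ (iq 1); have i2 := iZ (- k1) _ (iq (-1)).
have i3 := iZ k2 _ (iq 0); have i4 := iZ A _ ip.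
rewrite integralD//=; last 2 first.
  exact: (integrableD measurableT i1 i2).
  exact: (integrableD measurableT i3 i4).
rewrite !integralD//=.
under eq_integral do rewrite EFinM.
rewrite integralZl//; last exact: iq.
under [X in (_ + X + _)%E]eq_integral do rewrite EFinM.
rewrite integralZl//; last exact: iq.
under [X in (_ + (X + _))%E]eq_integral do rewrite EFinM.
rewrite integralZl//; last exact: iq.
under [X in (_ + (_ + X))%E]eq_integral do rewrite EFinM.
rewrite integralZl// !int_normal_sq// integral_normal_pdf -!EFinM -!EFinD; congr EFin.
by rewrite /k1 /k2; field.
Qed.

End NormalMoments.

(** * Gaussian vectors given by a triangular recursion *)

Section SequentialGaussian.
Variable R : realType.

Definition fcons n (x : R) (f : 'I_n -> R) : 'I_n.+1 -> R :=
  fun i => if unlift ord0 i is Some j then f j else x.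

Lemma fcons0 n x (f : 'I_n -> R) : fcons x f ord0 = x.
Proof. by rewrite /fcons unlift_none. Qed.

Lemma fconsS n x (f : 'I_n -> R) i : fcons x f (lift ord0 i) = f i.
Proof. by rewrite /fcons liftK. Qed.

Lemma tnth_fcons n x (z : n.-tuple R) : tnth [tuple of x :: z] = fcons x (tnth z).
Proof.
by apply/funext => i; case: (unliftP ord0 i) => [j|] ->; rewrite ?fcons0 ?fconsS ?tnthS.
Qed.

(** The expectation over independent uniform signs. It replaces a standard Gaussian vector, with
    which it shares the moments of order at most two; as a finite average it needs no
    integrability. *)
Fixpoint sign_avg n : (('I_n -> R) -> R) -> R :=
  match n with
  | 0 => fun F => F (fun=> 0)
  | n'.+1 => fun F => 2^-1 * (sign_avg (fun e => F (fcons 1 e)) +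
                              sign_avg (fun e => F (fcons (-1) e)))
  end.

Lemma eq_sign_avg n (F G : ('I_n -> R) -> R) : (forall e, F e = G e) ->
  sign_avg F = sign_avg G.
Proof. by move=> h; congr sign_avg; apply/funext. Qed.

Lemma sign_avgD n (F G : ('I_n -> R) -> R) :
  sign_avg (fun e => F e + G e) = sign_avg F + sign_avg G.
Proof. by elim: n F G => //= n IH F G; rewrite !IH; ring. Qed.

Lemma sign_avgZ n (F : ('I_n -> R) -> R) c :
  sign_avg (fun e => c * F e) = c * sign_avg F.
Proof. by elim: n F => //= n IH F; rewrite !IH; ring. Qed.

Lemma sign_avg_cst n (c : R) : sign_avg (fun _ : 'I_n -> R => c) = c.
Proof. by elim: n => //= n IH; rewrite !IH; field. Qed.

Lemma sign_avg_sum n (I : Type) (r : seq I) (F : I -> ('I_n -> R) -> R) :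
  sign_avg (fun e => \sum_(i <- r) F i e) = \sum_(i <- r) sign_avg (F i).
Proof.
elim: r => [|i r IH].
  by under eq_sign_avg do rewrite big_nil; rewrite big_nil sign_avg_cst.
by under eq_sign_avg do rewrite big_cons; rewrite big_cons sign_avgD IH.
Qed.

Lemma sign_avg1 n (k : 'I_n) : sign_avg (fun e => e k) = 0.
Proof.
elim: n k => [|n IH] k /=; first by case: k.
case: (unliftP ord0 k) => [j|] ->.
  under eq_sign_avg do rewrite fconsS.
  by under [X in _ + X]eq_sign_avg do rewrite fconsS; rewrite IH addr0 mulr0.
under eq_sign_avg do rewrite fcons0.
by under [X in _ + X]eq_sign_avg do rewrite fcons0; rewrite !sign_avg_cst subrr mulr0.
Qed.

Lemma sign_avg2 n (k j : 'I_n) : sign_avg (fun e => e k * e j) = (k == j)%:R.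
Proof.
elim: n k j => [|n IH] k j /=; first by case: k.
case: (unliftP ord0 k) => [k'|] ->; case: (unliftP ord0 j) => [j'|] ->.
- under eq_sign_avg do rewrite !fconsS.
  under [X in _ + X]eq_sign_avg do rewrite !fconsS.
  have h (t : R) : 2^-1 * (t + t) = t by field.
  by rewrite IH h (inj_eq lift_inj).
- under eq_sign_avg do rewrite fconsS fcons0 mulrC.
  under [X in _ + X]eq_sign_avg do rewrite fconsS fcons0 mulrC.
  by rewrite !sign_avgZ sign_avg1 !mulr0 addr0 mulr0.
- under eq_sign_avg do rewrite fconsS fcons0.
  under [X in _ + X]eq_sign_avg do rewrite fconsS fcons0.
  by rewrite !sign_avgZ sign_avg1 !mulr0 addr0 mulr0.
- under eq_sign_avg do rewrite fcons0.
  under [X in _ + X]eq_sign_avg do rewrite fcons0.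
  by rewrite !sign_avg_cst eqxx mulr1 mulrNN mulr1 -[1 + 1]/(2 : R) mulVf ?pnatr_eq0.
Qed.

(* The solution z of z_i = y_i + sum_(k < i) W i k z_k. *)
Fixpoint solve n : ('I_n -> 'I_n -> R) -> ('I_n -> R) -> 'I_n -> R :=
  match n with
  | 0 => fun _ _ => fun=> 0
  | n'.+1 => fun W y => fcons (y ord0)
      (solve (fun i k => W (lift ord0 i) (lift ord0 k))
             (fun i => y (lift ord0 i) + W (lift ord0 i) ord0 * y ord0))
  end.

Lemma solve_linear n (W : 'I_n -> 'I_n -> R) y1 y2 x i :
  solve W (fun k => y1 k + x * y2 k) i = solve W y1 i + x * solve W y2 i.
Proof.
elim: n W y1 y2 i => [|n IH] W y1 y2 i /=; first by rewrite mulr0 addr0.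
case: (unliftP ord0 i) => [j|] ->; rewrite ?fcons0// !fconsS -IH.
by congr (solve _ _ _); apply/funext => k; ring.
Qed.

Definition partial_mean n (W : 'I_n -> 'I_n -> R) (z : 'I_n -> R) (i : 'I_n) : R :=
  \sum_(k < n | (k < i)%N) W i k * z k.

Lemma partial_mean0 n (W : 'I_n.+1 -> 'I_n.+1 -> R) z : partial_mean W z ord0 = 0.
Proof. by rewrite /partial_mean big_pred0. Qed.

Lemma partial_meanS n (W : 'I_n.+1 -> 'I_n.+1 -> R) z i :
  partial_mean W z (lift ord0 i) = W (lift ord0 i) ord0 * z ord0 +
    partial_mean (fun i k => W (lift ord0 i) (lift ord0 k)) (fun k => z (lift ord0 k)) i.
Proof.
rewrite /partial_mean big_mkcond big_ord_recl/=; congr (_ + _).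
rewrite [RHS]big_mkcond; apply: eq_bigr => k _.
by rewrite /bump !leq0n !add1n ltnS.
Qed.

Lemma solveP n (W : 'I_n -> 'I_n -> R) y i :
  solve W y i = y i + partial_mean W (solve W y) i.
Proof.
elim: n W y i => [|n IH] W y i; first by case: i.
case: (unliftP ord0 i) => [j|] ->; last by rewrite partial_mean0 addr0/= fcons0.
rewrite partial_meanS/= fconsS fcons0 IH addrA; congr (_ + _).
by apply: eq_bigr => k _; rewrite fconsS.
Qed.

Lemma sum_fcons n (l : 'I_n.+1 -> R) x (z : 'I_n -> R) :
  \sum_i l i * fcons x z i = l ord0 * x + \sum_i l (lift ord0 i) * z i.
Proof.
rewrite big_ord_recl fcons0; congr (_ + _).
by apply: eq_bigr => i _; rewrite fconsS.
Qed.

(** By induction the inner integral is a quadratic polynomial in the first coordinate, which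
    [int_normal_quad] integrates by averaging its values at mean plus and minus standard deviation:
    this is the sign of the first coordinate. The offset [b] is there to absorb the contribution of
    that coordinate to the later means. *)
Lemma integral_tuple_gauss n (b : 'I_n -> R) (W : 'I_n -> 'I_n -> R)
    (sd : 'I_n -> R) (c1 c2 : R) (l1 l2 : 'I_n -> R) : (forall i, sd i != 0) ->
  integral_tuple (fun z : n.-tuple R =>
    ((c1 + \sum_i l1 i * tnth z i) * (c2 + \sum_i l2 i * tnth z i) *
     \prod_i normal_pdf (b i + partial_mean W (tnth z) i) (sd i) (tnth z i))%:E) =
  (sign_avg (fun e => let z := solve W (fun i => b i + sd i * e i) in
    (c1 + \sum_i l1 i * z i) * (c2 + \sum_i l2 i * z i)))%:E.
Proof.
elim: n b W sd c1 c2 l1 l2 => [|n IH] b W sd c1 c2 l1 l2 sd0 /=.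
  by rewrite !big_ord0 mulr1.
pose W' (i k : 'I_n) := W (lift ord0 i) (lift ord0 k).
pose v (i : 'I_n) := W (lift ord0 i) ord0.
pose b' (i : 'I_n) := b (lift ord0 i); pose sd' (i : 'I_n) := sd (lift ord0 i).
pose l1' (i : 'I_n) := l1 (lift ord0 i); pose l2' (i : 'I_n) := l2 (lift ord0 i).
pose u e := solve W' (fun i => b' i + sd' i * e i).
pose al c (l : 'I_n -> R) e := c + \sum_i l i * u e i.
pose be c (l : 'I_n -> R) := c + \sum_i l i * solve W' v i.
have sE x e : solve W' (fun i => b' i + v i * x + sd' i * e i) =
    (fun i => u e i + x * solve W' v i).
  apply/funext => i; rewrite -solve_linear; congr solve.
  by apply/funext => k; ring.
have lin c c0 (l : 'I_n -> R) x e : c + c0 * x + \sum_i l i * (u e i + x * solve W' v i) =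
    al c l e + be c0 l * x.
  rewrite /al /be mulrDl mulr_suml addrACA -big_split/=; congr (_ + _).
  by apply: eq_bigr => i _; ring.
pose Q0 := sign_avg (fun e => al c1 l1' e * al c2 l2' e).
pose Q1 := sign_avg (fun e => al c1 l1' e * be (l2 ord0) l2' + be (l1 ord0) l1' * al c2 l2' e).
pose Q2 := be (l1 ord0) l1' * be (l2 ord0) l2'.
have quad x : sign_avg (fun e => (al c1 l1' e + be (l1 ord0) l1' * x) *
    (al c2 l2' e + be (l2 ord0) l2' * x)) = Q0 + Q1 * x + Q2 * x ^+ 2.
  have -> : Q1 * x = sign_avg (fun e => x *
      (al c1 l1' e * be (l2 ord0) l2' + be (l1 ord0) l1' * al c2 l2' e)).
    by rewrite sign_avgZ mulrC.
  rewrite -[Q2 * _](sign_avg_cst n) -!sign_avgD.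
  by apply: eq_sign_avg => e; rewrite /Q2; ring.
transitivity (\int[@lebesgue_measure R]_x
    ((Q0 + Q1 * x + Q2 * x ^+ 2) * normal_pdf (b ord0) (sd ord0) x)%:E)%E.
  apply: eq_integral => x _.
  (* The density of the first coordinate is moved into the first affine factor, so that the
     induction hypothesis applies with [c1] and [l1] multiplied by it. *)
  transitivity (integral_tuple (fun z : n.-tuple R =>
      ((normal_pdf (b ord0) (sd ord0) x * (c1 + l1 ord0 * x) +
         \sum_i normal_pdf (b ord0) (sd ord0) x * l1' i * tnth z i) *
       (c2 + l2 ord0 * x + \sum_i l2' i * tnth z i) *
     \prod_i normal_pdf (b' i + v i * x + partial_mean W' (tnth z) i) (sd' i) (tnth z i))%:E)).
    congr integral_tuple; apply/funext => z; congr EFin.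
    rewrite tnth_fcons !sum_fcons -!/(l1' _) -!/(l2' _).
    rewrite big_ord_recl/= !fcons0 partial_mean0 addr0.
    have -> : \prod_(i < n) normal_pdf (b (lift ord0 i) +
         partial_mean W (fcons x (tnth z)) (lift ord0 i)) (sd (lift ord0 i))
         (fcons x (tnth z) (lift ord0 i)) =
      \prod_i normal_pdf (b' i + v i * x + partial_mean W' (tnth z) i) (sd' i) (tnth z i).
      apply: eq_bigr => i _; rewrite partial_meanS fcons0 fconsS addrA.
      by rewrite (_ : (fun k => fcons x (tnth z) (lift ord0 k)) = tnth z)//;
        apply/funext => k; rewrite fconsS.
    have -> : \sum_i normal_pdf (b ord0) (sd ord0) x * l1' i * tnth z i =
        normal_pdf (b ord0) (sd ord0) x * \sum_i l1' i * tnth z i.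
      by rewrite mulr_sumr; apply: eq_bigr => i _; rewrite mulrA.
    by rewrite /l1' /l2'; ring.
  rewrite IH; last by move=> i; exact: sd0.
  congr EFin; rewrite -quad [RHS]mulrC -sign_avgZ; apply: eq_sign_avg => e /=.
  rewrite sE -(lin c1) -(lin c2).
  have -> : \sum_i normal_pdf (b ord0) (sd ord0) x * l1' i * (u e i + x * solve W' v i) =
      normal_pdf (b ord0) (sd ord0) x * \sum_i l1' i * (u e i + x * solve W' v i).
    by rewrite mulr_sumr; apply: eq_bigr => i _; rewrite mulrA.
  by ring.
rewrite int_normal_quad// -!quad; congr (_ * (_ + _))%:E; apply: eq_sign_avg => e.
  rewrite !sum_fcons -!lin !addrA fcons0 mulr1.
  have -> : (fun i => b (lift ord0 i) + sd (lift ord0 i) * fcons 1 e (lift ord0 i) +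
      W (lift ord0 i) ord0 * (b ord0 + sd ord0)) =
      (fun i => b' i + v i * (b ord0 + sd ord0) + sd' i * e i).
    by apply/funext => i; rewrite fconsS /b' /v /sd'; ring.
  by rewrite sE.
rewrite !sum_fcons -!lin !addrA fcons0 mulrN1.
have -> : (fun i => b (lift ord0 i) + sd (lift ord0 i) * fcons (-1) e (lift ord0 i) +
    W (lift ord0 i) ord0 * (b ord0 - sd ord0)) =
    (fun i => b' i + v i * (b ord0 - sd ord0) + sd' i * e i).
  by apply/funext => i; rewrite fconsS /b' /v /sd'; ring.
by rewrite sE.
Qed.

End SequentialGaussian.

(** * Covariance of the Vecchia process and its inverse *)

Lemma invmx_uniq (R : comUnitRingType) n (A B : 'M[R]_n) : A *m B = 1%:M -> invmx A = B.
Proof.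
move=> AB; have [uA _] := mulmx1_unit AB.
by rewrite -[LHS]mulmx1 -AB mulmxA mulVmx// mul1mx.
Qed.

Section VecchiaCovariance.
Variables (R : realType) (d n : nat) (alpha tau s : R).
Variables (X : 'I_n -> 'rV[R]_d) (pa : 'I_n -> {set 'I_n}).
Hypothesis pa_lt : forall i k : 'I_n, k \in pa i -> (k < i)%N.
Hypothesis cv_gt0 : forall i, 0 < cond_var alpha tau s X pa i.

Definition krig_weight (i k : 'I_n) : R :=
  \sum_(a < #|pa i| | enum_val a == k) kriging alpha tau X pa i ord0 a.

Lemma cond_meanE i z : cond_mean alpha tau X pa i z =
  \sum_a kriging alpha tau X pa i ord0 a * z (enum_val a).
Proof. by rewrite /cond_mean mxE; apply: eq_bigr => a _; rewrite [X in _ * X]mxE. Qed.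

Lemma cond_mean_weight i z :
  cond_mean alpha tau X pa i z = \sum_k krig_weight i k * z k.
Proof.
rewrite cond_meanE (partition_big (fun a => enum_val a) xpredT)//=.
apply: eq_bigr => k _; rewrite mulr_suml; apply: eq_bigr => a.
by move=> /eqP ->.
Qed.

Lemma krig_weight0 i k : k \notin pa i -> krig_weight i k = 0.
Proof.
move=> kpa; rewrite /krig_weight big_pred0// => a.
by apply/eqP => ak; move: (enum_valP a); rewrite ak (negbTE kpa).
Qed.

Lemma cond_mean_partial i z :
  cond_mean alpha tau X pa i z = partial_mean krig_weight z i.
Proof.
rewrite cond_mean_weight /partial_mean [RHS]big_mkcond/=; apply: eq_bigr => k _.
case: ifPn => // ki; rewrite krig_weight0 ?mul0r//.
by apply/negP => /pa_lt; rewrite (negbTE ki).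
Qed.

Let sd i := Num.sqrt (cond_var alpha tau s X pa i).

Lemma vecchia_expect_affine2 (c1 c2 : R) (l1 l2 : 'I_n -> R) :
  vecchia_expect alpha tau s X pa (fun z =>
    (c1 + \sum_i l1 i * z i) * (c2 + \sum_i l2 i * z i)) =
  sign_avg (fun e => let z := solve krig_weight (fun i => sd i * e i) in
    (c1 + \sum_i l1 i * z i) * (c2 + \sum_i l2 i * z i)).
Proof.
rewrite /vecchia_expect.
have sd0 i : sd i != 0 by rewrite gt_eqF// sqrtr_gt0.
have := integral_tuple_gauss (fun=> 0) krig_weight c1 c2 l1 l2 sd0.
rewrite (_ : (fun z : n.-tuple R => _) = (fun z : n.-tuple R =>
    ((c1 + \sum_i l1 i * tnth z i) * (c2 + \sum_i l2 i * tnth z i) *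
     vecchia_pdf alpha tau s X pa (tnth z))%:E)); last first.
  apply/funext => z; congr (_ * _)%:E; apply: eq_bigr => i _.
  by rewrite add0r cond_mean_partial.
move=> -> /=; apply: eq_sign_avg => e.
by rewrite (_ : (fun i => 0 + sd i * e i) = (fun i => sd i * e i))//; apply/funext => i; rewrite add0r.
Qed.

(** Column [k] is the response of the recursion to a unit input at vertex [k]; thus [L] is the
    inverse of [1%:M - W], see [mulWL]. *)
Let L : 'M[R]_n := \matrix_(i, k) solve krig_weight (fun j => (j == k)%:R) i.
Let D : 'rV[R]_n := \row_i cond_var alpha tau s X pa i.
Let W : 'M[R]_n := \matrix_(i, k) krig_weight i k.

Lemma solve_sum n' (V : 'I_n' -> 'I_n' -> R) (y : 'I_n' -> R) i :
  solve V y i = \sum_k y k * solve V (fun j => (j == k)%:R) i.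
Proof.
have key (r : seq 'I_n') : solve V (fun j => \sum_(k <- r) y k * (j == k)%:R) i =
    \sum_(k <- r) y k * solve V (fun j => (j == k)%:R) i.
  elim: r => [|k r IH].
    rewrite big_nil (_ : (fun j => _) = (fun j => 0 + (-1) * 0)); last first.
      by apply/funext => j; rewrite big_nil mulr0 addr0.
    by rewrite (solve_linear V (fun=> 0) (fun=> 0)) mulN1r subrr.
  rewrite big_cons -IH addrC -solve_linear; congr (solve _ _ _).
  by apply/funext => j; rewrite big_cons addrC.
rewrite -key; congr (solve _ _ _); apply/funext => j.
rewrite (bigD1_seq j) ?mem_index_enum ?index_enum_uniq//= eqxx mulr1 big1 ?addr0// => k kj.
by rewrite eq_sym (negbTE kj) mulr0.
Qed.

Lemma sum_delta (m : 'I_n -> R) i : \sum_k (k == i)%:R * m k = m i.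
Proof.
rewrite (bigD1 i)//= eqxx mul1r big1 ?addr0// => k ki.
by rewrite (negbTE ki) mul0r.
Qed.

(** The vector is [L] applied to independent signs scaled by the conditional standard deviations.
    For the means, a coordinate is written as a product of two affine functions, the second being
    the constant 1, so that [vecchia_expect_affine2] covers both moments. *)
Lemma vecchia_covE : vecchia_cov alpha tau s X pa = L *m diag_mx D *m L^T.
Proof.
have E1 i : vecchia_expect alpha tau s X pa (fun z => z i) = 0.
  rewrite (_ : (fun z => z i) = (fun z => (0 + \sum_k (k == i)%:R * z k) *
    (1 + \sum_k 0 * z k))); last first.
    by apply/funext => z; rewrite sum_delta add0r big1 ?addr0 ?mulr1// => k _; rewrite mul0r.
  rewrite vecchia_expect_affine2/=.
  under eq_sign_avg => e.
    rewrite sum_delta add0r [X in _ * (_ + X)]big1 ?addr0 ?mulr1; last by move=> k _; rewrite mul0r.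
    rewrite solve_sum; under eq_bigr do rewrite mulrAC.
    over.
  rewrite sign_avg_sum big1// => k _.
  by rewrite sign_avgZ sign_avg1 mulr0.
apply/matrixP => i k; rewrite /vecchia_cov mxE !E1.
rewrite (_ : (fun z => _) = (fun z => (0 + \sum_j (j == i)%:R * z j) *
    (0 + \sum_j (j == k)%:R * z j))); last first.
  by apply/funext => z; rewrite !sum_delta !add0r !subr0.
rewrite vecchia_expect_affine2/=.
have sdE j : cond_var alpha tau s X pa j = sd j * sd j.
  by rewrite -expr2 sqr_sqrtr// ltW.
under eq_sign_avg => e.
  rewrite !sum_delta !add0r (solve_sum _ _ i) (solve_sum _ _ k) big_distrl/=.
  under eq_bigr => a _.
    rewrite big_distrr/=.
    under eq_bigr => b _.
      have -> : sd a * e a * solve krig_weight (fun j => (j == a)%:R) i *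
        (sd b * e b * solve krig_weight (fun j => (j == b)%:R) k) =
        (sd a * solve krig_weight (fun j => (j == a)%:R) i *
        (sd b * solve krig_weight (fun j => (j == b)%:R) k)) * (e a * e b) by ring.
      over.
    over.
  over.
rewrite sign_avg_sum mxE; apply: eq_bigr => a _.
rewrite sign_avg_sum mul_mx_diag !mxE (bigD1 a)//= sign_avgZ sign_avg2 eqxx mulr1.
rewrite big1 ?addr0 => [|b ba]; last by rewrite sign_avgZ sign_avg2 eq_sym (negbTE ba) mulr0.
by rewrite sdE; ring.
Qed.

Lemma mulWL : (1%:M - W) *m L = 1%:M.
Proof.
apply/matrixP => i k; rewrite mulmxBl mul1mx !mxE.
rewrite solveP; set t := partial_mean _ _ _.
rewrite (_ : \sum_j _ = t) ?addrK//.
rewrite /t -cond_mean_partial cond_mean_weight; apply: eq_bigr => j _.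
by rewrite !mxE.
Qed.

Let LW : L *m (1%:M - W) = 1%:M.
Proof. exact: mulmx1C mulWL. Qed.

Let Dinv : 'rV[R]_n := \row_i (cond_var alpha tau s X pa i)^-1.

Let DDinv : diag_mx D *m diag_mx Dinv = 1%:M.
Proof.
apply/matrixP => i k; rewrite mul_diag_mx !mxE; case: eqVneq => [->|_].
  by rewrite mulr1n divff// gt_eqF.
by rewrite mulr0n mulr0.
Qed.

Lemma vecchia_cov_mul1 : vecchia_cov alpha tau s X pa *m
  ((1%:M - W)^T *m diag_mx Dinv *m (1%:M - W)) = 1%:M.
Proof.
rewrite vecchia_covE !mulmxA -(mulmxA _ L^T) -trmx_mul mulWL trmx1 mulmx1.
by rewrite -(mulmxA L) DDinv mulmx1 LW.
Qed.

Lemma vecchia_cov_unit : vecchia_cov alpha tau s X pa \in unitmx.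
Proof. by have [] := mulmx1_unit vecchia_cov_mul1. Qed.

Lemma invmx_vecchia_cov : invmx (vecchia_cov alpha tau s X pa) =
  (1%:M - W)^T *m diag_mx Dinv *m (1%:M - W).
Proof.
exact: invmx_uniq vecchia_cov_mul1.
Qed.

Lemma rkhs_sqnormE f : rkhs_sqnorm alpha tau s X pa f =
  \sum_i (f i - cond_mean alpha tau X pa i f) ^+ 2 / cond_var alpha tau s X pa i.
Proof.
rewrite /rkhs_sqnorm invmx_vecchia_cov.
set fX := \col_i f i.
have -> : fX^T *m ((1%:M - W)^T *m diag_mx Dinv *m (1%:M - W)) *m fX =
    ((1%:M - W) *m fX)^T *m diag_mx Dinv *m ((1%:M - W) *m fX).
  by rewrite trmx_mul !mulmxA.
have E i : ((1%:M - W) *m fX) i ord0 = f i - cond_mean alpha tau X pa i f.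
  rewrite mulmxBl mul1mx !mxE cond_mean_weight; congr (_ - _).
  by apply: eq_bigr => k _; rewrite !mxE.
rewrite mxE; apply: eq_bigr => i _.
by rewrite mul_mx_diag E mxE mxE E !mxE; ring.
Qed.

Lemma vecchia_rkhsT f : vecchia_rkhs alpha tau s X pa f.
Proof.
pose C := vecchia_cov alpha tau s X pa.
pose a : 'rV[R]_n := (\row_i f i) *m invmx C.
exists (fun i => a ord0 i); apply/funext => k.
have := mulmxKV vecchia_cov_unit (\row_i f i).
move/(congr1 (fun M : 'M[R]_(1, n) => M ord0 k)); rewrite -/C -/a !mxE => <-.
by [].
Qed.

End VecchiaCovariance.

(** * Norms for the Matern kernel *)

Section Bandwidth.
Variables (R : realType) (d : nat).
Hypothesis d0 : (0 < d)%N.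

Definition kap : R := 1 - (4 * d%:R)^-1.

Lemma d4_gt1 : 1 < 4 * d%:R :> R.
Proof. by rewrite -natrM ltr1n; lia. Qed.

Lemma kap_gt0 : 0 < kap.
Proof. by rewrite subr_gt0 invf_lt1 ?d4_gt1// (lt_trans _ d4_gt1). Qed.

Lemma kap_lt1 : kap < 1.
Proof. by rewrite gtrBl invr_gt0 (lt_trans _ d4_gt1). Qed.

Lemma kap_band (s t : R) : kap * s <= t -> 4 * d%:R * (s - t) <= s.
Proof.
have d1 := lt_trans ltr01 d4_gt1.
rewrite /kap mulrBl mul1r lerBlDr -lerBlDl -(ler_pM2l d1) mulrA divff ?gt_eqF//.
by rewrite mul1r.
Qed.

End Bandwidth.

Section MaternRKHS.
Variables (R : realType) (d : nat) (a : R).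
Hypotheses (d0 : (0 < d)%N) (a0 : 0 < a).
Implicit Types (x y : 'rV[R]_d).

Local Notation K := (@matern R d a).
Local Notation kap := (kap R d).
Local Notation kap_gt0 := (kap_gt0 R d0).
Local Notation kap_lt1 := (kap_lt1 R d0).

Lemma qf_matern (I : finType) (u : I -> R) (x : I -> 'rV[R]_d) :
  qf K u x = (gamma_fun a)^-1 * mix a (fun z => qf (gk (expR z)) u x).
Proof.
rewrite /qf pair_bigA/= (matern_sum_mix (fun p : I * I => u p.1 * u p.2)
  (fun p => x p.1) (fun p => x p.2) a0).
by congr (_ * mix _ _); apply/funext => z; rewrite pair_bigA.
Qed.

Lemma qf_gk_cont (I : finType) (u : I -> R) (x : I -> 'rV[R]_d) :
  continuous (fun z => qf (gk (expR z)) u x).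
Proof.
move=> z; apply: cvg_big => [|i _]; first exact: add_continuous.
apply: cvg_big => [|j _]; first exact: add_continuous.
by apply: cvgMr; exact: continuous_gk_expR.
Qed.

Lemma qf_gk_bound (I : finType) (u : I -> R) (x : I -> 'rV[R]_d) z :
  `|qf (gk (expR z)) u x| <= \sum_i \sum_j `|u i * u j|.
Proof.
apply: le_trans (ler_norm_sum _ _ _) _; apply: ler_sum => i _.
apply: le_trans (ler_norm_sum _ _ _) _; apply: ler_sum => j _.
by rewrite normrM ler_piMr// norm_gk_le1// expR_ge0.
Qed.

Lemma qf_matern_lower (I : finType) (u : I -> R) (x : I -> 'rV[R]_d) (t1 t2 c : R) :
  0 < t1 -> t1 <= t2 -> 0 <= c ->
  (forall t, t1 <= t <= t2 -> c <= qf (gk t) u x) ->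
  c * ((gamma_fun a)^-1 * (t1 `^ a * expR (- t2) * ln (t2 / t1))) <= qf K u x.
Proof.
move=> t10 t12 c0 h; rewrite qf_matern mulrCA ler_wpM2l//.
  by rewrite invr_ge0 ltW// gamma_fun_gt0.
apply: (mix_lower a0 (@qf_gk_cont _ u x) (@qf_gk_bound _ u x)) => // z.
  by apply: qf_gk_ge0; exact: expR_gt0.
exact: h.
Qed.

Lemma qf_matern_ge0 (I : finType) (u : I -> R) (x : I -> 'rV[R]_d) : 0 <= qf K u x.
Proof.
have := @qf_matern_lower _ u x 1 1 0 ltr01 (lexx _) (lexx _).
rewrite mul0r; apply => t /andP[t1 _].
by apply: qf_gk_ge0; exact: lt_le_trans t1.
Qed.

(** [Cmat * s ^ (- (a / 2))] is the inverse square root of a lower bound for the Gamma probability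
    of the window from [kap * s] to [s]; [expR 1] comes from [s <= 1]. *)
Definition Cmat : R :=
  Num.sqrt (gamma_fun a * expR 1 / (kap `^ a * ln kap^-1)).

Lemma ln_kap_gt0 : 0 < ln kap^-1.
Proof. by rewrite ln_gt0// invf_gt1 ?kap_gt0 ?kap_lt1. Qed.

Lemma Cmat_gt0 : 0 < Cmat.
Proof.
rewrite sqrtr_gt0 divr_gt0 ?mulr_gt0 ?powR_gt0 ?ln_kap_gt0 ?kap_gt0 ?expR_gt0//.
exact: gamma_fun_gt0.
Qed.

(** The Matern form dominates the part of the mixture over the window, where each Gaussian form is
    at least the square of the pairing divided by [N ^+ 2]. The window has Gamma mass of order
    [s ^ a], whence the factor [s ^ (- (a / 2))]. *)
Lemma hle_matern (s N : R) g : 0 < s -> s <= 1 ->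
  (forall t, kap * s <= t <= s -> hle (gk t) N g) ->
  hle K (N * Cmat * s `^ (- (a / 2))) g.
Proof.
move=> s0 s1 h; have k0 := kap_gt0.
have ks : kap * s <= s by rewrite ger_pMl// ltW// kap_lt1.
have ks0 : 0 < kap * s by rewrite mulr_gt0.
have N0 : 0 <= N by have [] := h s; rewrite ?lexx ?ks.
split; first by rewrite !mulr_ge0 ?powR_ge0// ltW// Cmat_gt0.
move=> I u x; set S := \sum_i _; have q0 := qf_matern_ge0 u x.
(* The pairing vanishes when [N = 0], a case set apart because the main argument divides by [N]. *)
have [N00|Nn0] := eqVneq N 0.
  have [_ /(_ I u x)] := h s ltac:(by rewrite lexx ks).
  by rewrite N00 !mul0r.
have Np : 0 < N by rewrite lt_def Nn0.
pose D := (gamma_fun a)^-1 * ((kap * s) `^ a * expR (- 1) * ln kap^-1).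
have D0 : 0 < D.
  rewrite mulr_gt0 ?invr_gt0 ?gamma_fun_gt0// mulr_gt0 ?ln_kap_gt0//.
  by rewrite mulr_gt0 ?expR_gt0 ?powR_gt0.
have H : S ^+ 2 / N ^+ 2 * D <= qf K u x.
  apply: le_trans (@qf_matern_lower _ u x _ _ (S ^+ 2 / N ^+ 2) ks0 ks _ _); last 2 first.
  - by rewrite divr_ge0 ?sqr_ge0.
  - move=> t /andP[t1 t2]; rewrite ler_pdivrMr ?exprn_gt0// mulrC.
    have ht : hle (gk t) N g by apply: h; rewrite t1 t2.
    by apply: hle_sqr ht _ _ _ _; apply: qf_gk_ge0; exact: lt_le_trans t1.
  rewrite ler_wpM2l ?divr_ge0 ?sqr_ge0// ler_wpM2l ?invr_ge0 ?(ltW (gamma_fun_gt0 _))//.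
  have -> : s / (kap * s) = kap^-1 by field; rewrite !gt_eqF.
  rewrite ler_wpM2r ?(ltW ln_kap_gt0)// ler_wpM2l ?powR_ge0//.
  by rewrite ler_expR lerN2.
have CE : Cmat * s `^ (- (a / 2)) = Num.sqrt D^-1.
  have -> : s `^ (- (a / 2)) = Num.sqrt (s `^ (- a)).
    by rewrite -powR12_sqrt ?powR_ge0// -powRrM mulNr.
  rewrite -sqrtrM ?divr_ge0 ?mulr_ge0 ?powR_ge0 ?expR_ge0 ?(ltW ln_kap_gt0) ?(ltW (gamma_fun_gt0 _))//.
  congr Num.sqrt; rewrite /D powRM ?(ltW k0) ?(ltW s0)// powRN expRN; field.
  by rewrite !gt_eqF ?powR_gt0 ?ln_kap_gt0 ?expR_gt0 ?gamma_fun_gt0.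
rewrite -mulrA -mulrA (mulrA Cmat) CE -sqrtrM ?invr_ge0 ?(ltW D0)//.
rewrite -ler_pdivrMl// mulrC -[leLHS]ger0_norm ?divr_ge0// -sqrtr_sqr ler_wsqrtr//.
rewrite expr_div_n real_normK ?num_real//.
by rewrite [leRHS]mulrC ler_pdivlMr.
Qed.

(* A polynomial in [y], with value 1 at 0 and vanishing at the point [e] as
   soon as some [v] in the list has [dot e v = 1]. *)
Definition sep (A : seq 'rV[R]_d) (y : 'rV[R]_d) : R := \prod_(v <- A) (1 - dot y v).

(** Induction on [A]: a factor [1 - dot y v] either leaves the word alone or adds one of [d]
    letters. A letter costs [2 * Num.sqrt s], so a factor costs [1 + d * th * (2 * Num.sqrt s)].
    Bounding all lengths by the same [P] fixes the factorial once for all. *)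
Lemma hle_sep (s t th : R) (P : nat) (w : seq 'I_d) (A : seq 'rV[R]_d) :
  0 < t -> t <= s -> kap * s <= t -> 0 <= th ->
  (size w + size A <= P)%N -> (forall v, v \in A -> forall c, `|v ord0 c| <= th) ->
  hle (gk t) (2 * Num.sqrt P`!%:R * (2 * Num.sqrt s) ^+ size w *
      (1 + d%:R * th * (2 * Num.sqrt s)) ^+ size A)
    (fun y => ge s y * mon w y * sep A y).
Proof.
move=> t0 ts kst th0; have s0 : 0 < s by exact: lt_le_trans ts.
elim: A w => [|v A IH] w sP hA /=.
  rewrite expr0 mulr1.
  apply: (@hle_eq _ _ _ _ (fun y => ge s y * mon w y)).
    by move=> y; rewrite /sep big_nil mulr1.
  apply: hleW (hle_ge_mon w d0 t0 ts (kap_band d0 kst)).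
  rewrite -mulrA ler_wpM2l// -[X in _ <= _ * X]ger0_norm ?exprn_ge0 ?mulr_ge0 ?sqrtr_ge0//.
  have E : ((2 * Num.sqrt s) ^+ size w) ^+ 2 = (4 * s) ^+ size w.
    by rewrite exprAC; congr (_ ^+ _); rewrite exprMn sqr_sqrtr ?(ltW s0)//; ring.
  rewrite -sqrtr_sqr -sqrtrM// ler_wsqrtr// E.
  rewrite ler_pM ?exprn_ge0 ?mulr_ge0 ?(ltW t0)//.
    by rewrite ler_nat; apply: leq_fact; rewrite addn0 in sP.
  by rewrite lerXn2r ?nnegrE ?mulr_ge0 ?(ltW t0) ?(ltW s0)// ler_wpM2l.
have hA' v' : v' \in A -> forall c, `|v' ord0 c| <= th.
  by move=> v'A; apply: hA; rewrite in_cons v'A orbT.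
have sq0 : 0 <= 2 * Num.sqrt s by rewrite mulr_ge0 ?sqrtr_ge0.
have h1 := IH w (leq_trans (leq_add (leqnn _) (leqnSn _)) sP) hA'.
have h2 c := hleZ (v ord0 c) (IH (c :: w) (leq_trans (eq_leq (esym (addnS _ _))) sP) hA').
have := hleB h1 (@hle_sum _ _ _ _ (index_enum 'I_d) xpredT _ _ (fun c _ => h2 c)).
set N1 := (X in X + _); move=> h.
have {h} : hle (gk t) (N1 + \sum_c `|v ord0 c| * (2 * Num.sqrt P`!%:R *
    (2 * Num.sqrt s) ^+ (size w).+1 * (1 + d%:R * th * (2 * Num.sqrt s)) ^+ size A))
    (fun y => ge s y * mon w y * sep (v :: A) y).
  apply: hle_eq h => y; rewrite /sep big_cons mulrBl mul1r mulrBr; congr (_ - _).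
  rewrite /dot mulr_suml mulr_sumr; apply: eq_bigr => c _.
  by rewrite mon_cons; ring.
apply: hleW.
apply: (@le_trans _ _ (N1 + \sum_(c < d) th * (N1 * (2 * Num.sqrt s)))).
  rewrite lerD2l; apply: ler_sum => c _.
  have -> : 2 * Num.sqrt P`!%:R * (2 * Num.sqrt s) ^+ (size w).+1 *
    (1 + d%:R * th * (2 * Num.sqrt s)) ^+ size A = N1 * (2 * Num.sqrt s).
    by rewrite /N1 exprS; ring.
  rewrite ler_wpM2r ?hA ?mem_head// mulr_ge0//.
  by have [] := h1.
rewrite sumr_const card_ord -[_ *+ d]mulr_natr /N1 exprS.
rewrite le_eqVlt; apply/orP; left; apply/eqP; ring.
Qed.

(** Each factor [1 - f] splits the function into [g] and [g * f]. By [hle_mul] the second lies in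
    the space of [gk (t / m.+2)] when [g] lies in that of [gk (t / m.+1)]; this is why [m] is
    general in the induction, and the final width is divided by the number of factors. *)
Lemma hle_prod_sep (s N Nf : R) (m : nat) (g : 'rV[R]_d -> R) (L : seq ('rV[R]_d -> R)) :
  0 < s -> s <= 1 ->
  (forall t, kap * s <= t <= s -> hle (gk (t / m.+1%:R)) N g) ->
  (forall f, List.In f L -> forall t, kap * s <= t <= s -> hle (gk t) Nf f) ->
  0 <= Nf ->
  hle K (N * (1 + Nf) ^+ size L * Cmat * (s / (m + size L).+1%:R) `^ (- (a / 2)))
    (fun y => g y * \prod_(f <- L) (1 - f y)).
Proof.
move=> s0 s1 hg hL Nf0; have k0 := kap_gt0.
have ks : kap * s <= s by rewrite ger_pMl// ltW// kap_lt1.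
have mono (p q : nat) : (p <= q)%N ->
    (s / p.+1%:R) `^ (- (a / 2)) <= (s / q.+1%:R) `^ (- (a / 2)).
  move=> pq; rewrite !powRN lef_pV2 ?posrE ?powR_gt0 ?divr_gt0 ?ltr0n//.
  rewrite ge0_ler_powR ?nnegrE ?divr_ge0 ?ler0n ?(ltW s0) ?(ltW a0)//.
  by rewrite ler_wpM2l ?(ltW s0)// lef_pV2 ?posrE ?ltr0n// ler_nat.
elim: L m N g hg hL => [|f L IH] m N g hg hL /=.
  rewrite addn0 expr0 mulr1.
  apply: (@hle_eq _ _ _ _ g); first by move=> y; rewrite big_nil mulr1.
  apply: hle_matern; first by rewrite divr_gt0 ?ltr0n.
    by rewrite ler_pdivrMr ?ltr0n// mul1r (le_trans s1)// ler1n.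
  move=> t /andP[t1 t2].
  have -> : t = (t * m.+1%:R) / m.+1%:R by rewrite mulfK// pnatr_eq0.
  apply: hg; rewrite ler_pdivlMr ?ltr0n// in t2; rewrite t2 andbT.
  by rewrite mulrA ler_pdivrMr ?ltr0n in t1.
have hL' f' : List.In f' L -> forall t, kap * s <= t <= s -> hle (gk t) Nf f'.
  by move=> h; apply: hL; right.
have h1 := IH m N g hg hL'.
have hgf t : kap * s <= t <= s -> hle (gk (t / m.+2%:R)) (N * Nf) (fun y => g y * f y).
  move=> ht; have t0 : 0 < t.
    by move/andP: ht => [h _]; apply: lt_le_trans h; rewrite mulr_gt0.
  have t0' : 0 < t / m.+1%:R by rewrite divr_gt0 ?ltr0n.
  have := hle_mul t0' t0 (hg t ht) (hL f (or_introl erefl) t ht).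
  congr (hle (gk _) _ _); rewrite -[m.+2%:R]natr1.
  have m0 : 0 < 1 + m%:R :> R by have := ler0n R m; lra.
  field; apply/and3P; split; rewrite gt_eqF//; apply: addr_gt0 => //.
  exact: mulr_gt0.
have h2 := IH m.+1 (N * Nf) _ hgf hL'.
have N0 : 0 <= N by have [] := hg s ltac:(by rewrite lexx ks).
apply: hleW (hle_eq _ (hleB h1 h2)).
  rewrite addSnnS exprS.
  set X := _ `^ _; set Y := _ `^ _.
  have XY : X <= Y by apply: mono; rewrite addnS.
  have -> : N * ((1 + Nf) * (1 + Nf) ^+ size L) * Cmat * Y =
    N * (1 + Nf) ^+ size L * Cmat * Y + N * Nf * (1 + Nf) ^+ size L * Cmat * Y by ring.
  rewrite lerD2r ler_wpM2l// !mulr_ge0 ?exprn_ge0 ?addr_ge0 ?(ltW Cmat_gt0)//.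
by move=> y; rewrite /= big_cons; ring.
Qed.

End MaternRKHS.

(** * Lower bounds for Matern quadratic forms *)

Section MaternBounds.
Variables (R : realType) (d : nat) (a : R).
Hypotheses (d0 : (0 < d)%N) (a0 : 0 < a).
Implicit Types (x y z : 'rV[R]_d).

Local Notation K := (@matern R d a).

Lemma matern_shift x y z : K (x - z) (y - z) = K x y.
Proof. by rewrite /matern opprB addrA subrK (inj_eq (addIr _)). Qed.

Lemma norm_coord_le_sqn x c : `|x ord0 c| ^+ 2 <= sqn x.
Proof.
rewrite real_normK ?num_real// /sqn (bigD1 c)//= lerDl.
by apply: sumr_ge0 => i _; exact: sqr_ge0.
Qed.

(** The test function is a Gaussian bump of width [del] at [x i0] times a polynomial vanishing at
    the other points of the support of [u]: its pairing with [u] is [u i0]. Bounding the size of the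
    support, rather than that of [I], keeps [C] independent of the number of vertices. *)
Lemma matern_point_lower (p : nat) : exists2 C : R, 0 < C &
  forall (I : finType) (u : I -> R) (x : I -> 'rV[R]_d) (i0 : I) (del : R),
  (#|[pred i | u i != 0%R]| <= p)%N -> 0 < del -> del <= 1 ->
  (forall i, i != i0 -> u i != 0 -> del ^+ 2 <= sqn (x i - x i0)) ->
  `|u i0| <= C * del `^ (- a) * Num.sqrt (qf K u x).
Proof.
pose N : R := 2 * Num.sqrt p`!%:R * (1 + d%:R * 2) ^+ p.
have N0 : 0 < N.
  apply: mulr_gt0; first by rewrite mulr_gt0// sqrtr_gt0 ltr0n fact_gt0.
  by apply: exprn_gt0; rewrite ltr_wpDr// mulr_ge0.
exists (N * Cmat d a); first by rewrite mulr_gt0 ?Cmat_gt0.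
move=> I u x i0 del Ip del0 del1 hsep.
pose z i := x i - x i0.
(* The vector [z / sqn z] has dot product 1 with [z], and its coordinates are at most [del^-1]. At
   width [del] each factor of [sep] then costs [1 + d * 2], whatever [del] is. *)
pose A := [seq (sqn (z i))^-1 *: z i | i <- enum I & (i != i0) && (u i != 0)].
have sA : (size A <= p)%N.
  rewrite size_map (leq_trans _ Ip)// cardE; apply: uniq_leq_size => [|i].
    by apply: filter_uniq; exact: enum_uniq.
  by rewrite mem_filter mem_enum => /andP[/andP[_ ui] _].
have zpos i : i != i0 -> u i != 0 -> 0 < sqn (z i).
  by move=> ii0 ui; apply: lt_le_trans (hsep _ ii0 ui); rewrite exprn_gt0.
have hth v : v \in A -> forall c, `|v ord0 c| <= del^-1.
  move=> /mapP[i]; rewrite mem_filter => /andP[/andP[ii0 ui] _] -> c.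
  rewrite mxE normrM ger0_norm ?invr_ge0 ?sqn_ge0// mulrC.
  rewrite ler_pdivrMr ?zpos// mulrC ler_pdivlMr//.
  rewrite -[leRHS]ger0_norm ?sqn_ge0// -[leLHS]ger0_norm ?mulr_ge0 ?(ltW del0)//.
  rewrite -ler_sqr ?nnegrE// !real_normK ?num_real// exprMn expr2.
  rewrite ler_pM ?sqr_ge0// ?norm_coord_le_sqn//.
    exact: hsep.
have s0 : 0 < del ^+ 2 by rewrite exprn_gt0.
have s1 : del ^+ 2 <= 1 by rewrite exprn_ile1// ltW.
have th0 : 0 <= del^-1 by rewrite invr_ge0 ltW.
have sq : Num.sqrt (del ^+ 2) = del by rewrite sqrtr_sqr ger0_norm// ltW.
pose g y := ge (del ^+ 2) (y - x i0) * mon [::] (y - x i0) * sep A (y - x i0).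
have hg : hle K (N * Cmat d a * (del ^+ 2) `^ (- (a / 2))) g.
  apply: hle_matern => // t /andP[t1 t2].
  have t0 : 0 < t by apply: lt_le_trans t1; rewrite mulr_gt0// kap_gt0.
  apply: (@hle_shift _ _ t N (fun y => ge (del ^+ 2) y * mon [::] y * sep A y) (x i0)).
  apply: hleW (@hle_sep R d d0 _ _ _ p [::] A t0 t2 t1 th0 _ hth) => //.
  rewrite /= expr0 mulr1 sq ler_wpM2l ?mulr_ge0 ?sqrtr_ge0//.
  have -> : 1 + d%:R * del^-1 * (2 * del) = 1 + d%:R * 2 by field; rewrite gt_eqF.
  by rewrite ler_weXn2l// lerDl mulr_ge0.
have [_ /(_ I u x)] := hg.
rewrite (bigD1 i0)//= big1 => [|i ii0]; last first.
  have [->|ui] := eqVneq (u i) 0; first by rewrite mul0r.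
  rewrite /g /sep (big_rem ((sqn (z i))^-1 *: z i))/=; last first.
    by apply: map_f; rewrite mem_filter ii0 ui mem_enum.
  rewrite (_ : dot _ _ = 1) ?subrr ?mul0r ?mulr0//.
  rewrite /dot -[RHS](mulVf (lt0r_neq0 (zpos _ ii0 ui))) {3}/sqn mulr_sumr.
  by apply: eq_bigr => c _; rewrite [X in _ * X]mxE -/(z i) expr2; ring.

rewrite addr0 /g subrr mon_nil /ge /sqn big1 => [|c _]; last by rewrite mxE expr0n.
rewrite mul0r oppr0 expR0 /sep big1 => [|v _].
  rewrite !mulr1 => /le_trans; apply.
  rewrite ler_wpM2r ?sqrtr_ge0// ler_wpM2l ?mulr_ge0 ?(ltW N0) ?(ltW (Cmat_gt0 _ _))//.
  rewrite -powR_mulrn ?(ltW del0)// -powRrM le_eqVlt; apply/orP; left; apply/eqP.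
  by congr (_ `^ _); field.
by rewrite /dot big1 ?subr0// => c _; rewrite mxE mul0r.
Qed.

Lemma sum_geom_flat (E : R) (n : nat) : \sum_(j < n) E * (1 - E) ^+ j = 1 - (1 - E) ^+ n.
Proof.
elim: n => [|n IH]; first by rewrite big_ord0 expr0 subrr.
by rewrite big_ord_recr/= IH exprS; ring.
Qed.

Lemma one_sub_ge_le (s : R) y : 0 < s -> 0 <= 1 - ge s y <= sqn y / (4 * s).
Proof.
move=> s0; rewrite subr_ge0 ge_le1 ?(ltW s0)//=.
by rewrite lerBlDr -lerBlDl (le_trans _ (expR_ge1Dx _)).
Qed.

(* y ^ w (1 - (1 - exp(-|y|^2/4))^(l+1)) is a finite sum of polynomials times
   Gaussians, and it agrees with y ^ w up to order 2(l+1) at 0. *)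
Lemma moment_bound (l : nat) : exists2 C : R, 0 < C &
  forall (I : finType) (u : I -> R) (x : I -> 'rV[R]_d) (h : R) (w : seq 'I_d),
  0 <= h -> h <= 1 -> (forall i c, `|x i ord0 c| <= h) -> (size w <= l)%N ->
  `|\sum_i u i * mon w (x i)| <=
    C * Num.sqrt (qf K u x) + C * h ^+ (2 * l.+1) * \sum_i `|u i|.
Proof.
pose C0 : R := 2 * Num.sqrt (l`!%:R * 4 ^+ l).
have C00 : 0 < C0 by rewrite mulr_gt0// sqrtr_gt0 mulr_gt0 ?exprn_gt0// ltr0n fact_gt0.
pose C1 : R := \sum_(j < l.+1) C0 * (1 + 2) ^+ j * Cmat d a * (1 / (0 + j).+1%:R) `^ (- (a / 2)).
have C10 : 0 <= C1.
  apply: sumr_ge0 => j _; rewrite !mulr_ge0 ?powR_ge0 ?exprn_ge0 ?(ltW C00)//.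
  by rewrite ltW ?Cmat_gt0.
exists (1 + C1 + d%:R ^+ l.+1); first by rewrite ltr_wpDr ?exprn_ge0// ltr_wpDr.
move=> I u x h w h0 h1 hx wl.
(* Writing [1 - (1 - E) ^+ l.+1] as the sum of [E * (1 - E) ^+ j] leaves a Gaussian next to the
   monomial in each term, which is the form treated by [hle_prod_sep]. *)
pose G y := \sum_(j < l.+1) (ge 1 y * mon w y) * \prod_(f <- nseq j (@ge R d 1)) (1 - f y).
have band t : kap R d * 1 <= t <= 1 -> [/\ 0 < t, t <= 1 & 4 * d%:R * (1 - t) <= 1].
  move=> /andP[t1 t2]; split => //; first by apply: lt_le_trans t1; rewrite mulr1 kap_gt0.
  by apply: (kap_band d0).
have hG : hle K C1 G.
  apply: hle_sum => j _.
  have := @hle_prod_sep R d a d0 a0 1 C0 2 0 (fun y => ge 1 y * mon w y)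
    (nseq j (@ge R d 1)) ltr01 (lexx _).
  rewrite size_nseq; apply.
  - move=> t /band[t0 t1 tb]; rewrite divr1.
    apply: hleW (hle_ge_mon w d0 t0 t1 tb).
    rewrite ler_wpM2l// ler_wsqrtr// ler_pM ?exprn_ge0 ?mulr_ge0 ?(ltW t0)//.
      by rewrite ler_nat leq_fact.
    rewrite (@le_trans _ _ (4 ^+ size w))//.
      by rewrite lerXn2r ?nnegrE ?mulr_ge0 ?(ltW t0)// ger_pMr.
    by rewrite ler_weXn2l// ler1n.
  - move=> f fL t /band[t0 t1 tb].
    have -> : f = ge 1 by elim: (j : nat) fL => //= n IH [<-//|/IH].
    have := hle_ge_mon [::] d0 t0 t1 tb; rewrite /= fact0 mul1r expr0 sqrtr1 mulr1.
    by apply: hle_eq => y; rewrite mon_nil mulr1.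
  - by [].
have GE y : G y = mon w y * (1 - (1 - ge 1 y) ^+ l.+1).
  rewrite -sum_geom_flat mulr_sumr; apply: eq_bigr => j _.
  by rewrite big_nseq iter_mulr_1; ring.
have -> : \sum_i u i * mon w (x i) = \sum_i u i * G (x i) +
    \sum_i u i * (mon w (x i) * (1 - ge 1 (x i)) ^+ l.+1).
  by rewrite -big_split; apply: eq_bigr => i _ /=; rewrite GE; ring.
apply: le_trans (ler_normD _ _) _; apply: lerD.
  apply: le_trans (hG.2 I u x) _; rewrite ler_wpM2r ?sqrtr_ge0//.
  by rewrite addrAC lerDr addr_ge0 ?exprn_ge0.
rewrite mulr_sumr; apply: le_trans (ler_norm_sum _ _ _) _; apply: ler_sum => i _.
rewrite normrM mulrC ler_wpM2r// normrM.
rewrite (@le_trans _ _ (1 * (d%:R * h ^+ 2) ^+ l.+1))//.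
  rewrite ler_pM//.
    by rewrite (le_trans (mon_le w (hx i)))// exprn_ile1.
  have /andP[e0 e1] := @one_sub_ge_le 1 (x i) ltr01.
  rewrite ger0_norm ?exprn_ge0// lerXn2r ?nnegrE ?mulr_ge0 ?exprn_ge0//.
  apply: le_trans e1 _; rewrite mulr1; apply: le_trans (sqn_le (hx i)).
  by rewrite ler_pdivrMr// ler_peMr ?sqn_ge0// ler1n.
rewrite mul1r exprMn -exprM ler_wpM2r ?exprn_ge0//.
by rewrite lerDr addr_ge0.
Qed.

End MaternBounds.

(** * Bilinear forms of functionals that annihilate polynomials *)

Section ExpTaylor.
Variable R : realType.

Definition exp_rem (n : nat) (x : R) : R :=
  expR (- x) - \sum_(r < n) (- x) ^+ r / r`!%:R.

Lemma is_derive_exp_rem n (x : R) : is_derive x 1 (exp_rem n.+1) (- exp_rem n x).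
Proof.
have h (m : nat) : is_derive x 1 (fun y : R => \sum_(r < m.+1) (- y) ^+ r / r`!%:R)
    (- \sum_(r < m) (- x) ^+ r / r`!%:R).
  elim: m => [|m IH].
    rewrite (_ : (fun y : R => _) = cst 1); last first.
      by apply/funext => y; rewrite big_ord_recl big_ord0 expr0 fact0 divr1 addr0.
    by rewrite big_ord0 oppr0; exact: is_derive_cst.
  rewrite (_ : (fun y : R => _) = (fun y : R => \sum_(r < m.+1) (- y) ^+ r / r`!%:R) +
      (fun y => (m.+1)`!%:R^-1 * (- y) ^+ m.+1)); last first.
    by apply/funext => y; rewrite big_ord_recr/= [X in _ + X]mulrC.
  have h2 : is_derive x 1 (fun y : R => (m.+1)`!%:R^-1 * (- y) ^+ m.+1)
      (- ((- x) ^+ m / m`!%:R)).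
    have h3 := is_deriveZ ((m.+1)`!%:R^-1) (is_deriveX m.+1 (is_deriveNid x (1 : R))).
    rewrite (_ : (fun y : R => _) = (m.+1)`!%:R^-1 \*: ((-%R : R -> R) ^+ m.+1)); last first.
      by apply/funext => y; rewrite /= exprfctE.
    apply: (is_derive_eq h3); rewrite /GRing.scale/= factS natrM invfM.
    have m0 : m.+1%:R != 0 :> R by rewrite pnatr_eq0.
    have mf : m`!%:R != 0 :> R by rewrite pnatr_eq0 -lt0n fact_gt0.
    by rewrite -mulr_natl; field; rewrite mf addrC natr1.
  apply: (is_derive_eq (is_deriveD IH h2)).
  by rewrite big_ord_recr/= opprD.
rewrite (_ : exp_rem n.+1 = (fun y => expR (- y)) -
    (fun y : R => \sum_(r < n.+1) (- y) ^+ r / r`!%:R)); last by apply/funext.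
have := h n => hn.
apply: is_derive_eq; rewrite /exp_rem /GRing.scale/=; ring.
Qed.

Lemma exp_rem_le n (x : R) : 0 <= x -> `|exp_rem n x| <= x ^+ n.
Proof.
elim: n x => [|n IH] x x0.
  by rewrite /exp_rem big_ord0 subr0 expr0 ger0_norm ?expR_ge0// expR_le1 oppr_le0.
have r0 : exp_rem n.+1 0 = 0.
  rewrite /exp_rem oppr0 expR0 big_ord_recl expr0 fact0 divr1 big1 ?addr0 ?subrr// => i _.
  by rewrite expr0n mul0r.
rewrite le_eqVlt in x0; case/orP: x0 => [/eqP <-|x0].
  by rewrite r0 normr0 expr0n.
have dif (z : R) : z \in `]0, x[ -> is_derive z 1 (exp_rem n.+1) (- exp_rem n z).
  by move=> _; exact: is_derive_exp_rem.
have [|z] := MVT x0 dif.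
  apply: continuous_subspaceT => z; apply: differentiable_continuous.
  by apply/derivable1_diffP; apply: ex_derive; exact: is_derive_exp_rem.
rewrite in_itv/= => /andP[z0 zx]; rewrite r0 !subr0 => ->.
rewrite normrM normrN (ger0_norm (ltW x0)) exprSr ler_wpM2r ?(ltW x0)//.
apply: le_trans (IH z (ltW z0)) _.
by rewrite lerXn2r ?nnegrE ?(ltW z0) ?(ltW x0)// ltW.
Qed.

End ExpTaylor.

Section Bilinear.
Variables (R : realType) (d l : nat).
Variables (I J : finType) (v : J -> R) (u : I -> R).
Variables (z : J -> 'rV[R]_d) (y : I -> 'rV[R]_d).
Variables (B M h : R).
Hypotheses (B0 : 0 <= B) (M0 : 0 <= M) (h0 : 0 < h).
Hypotheses (zh : forall i c, `|z i ord0 c| <= h) (yh : forall i c, `|y i ord0 c| <= h).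
Hypothesis vB : \sum_i `|v i| <= B.
Hypothesis vP : forall w, (size w <= l)%N -> \sum_i v i * mon w (z i) = 0.
Hypothesis uM : forall w, (size w <= l)%N -> `|\sum_i u i * mon w (y i)| <= M.
Hypothesis uB : \sum_i `|u i| <= B * h ^- l * M.

Let Lam (F : 'rV[R]_d -> 'rV[R]_d -> R) : R :=
  \sum_i \sum_k v i * u k * F (z i) (y k).

Let LamD F G : Lam (fun x x' => F x x' + G x x') = Lam F + Lam G.
Proof.
rewrite /Lam -big_split; apply: eq_bigr => i _; rewrite -big_split/=.
by apply: eq_bigr => k _; rewrite mulrDr.
Qed.

Let LamZ c F : Lam (fun x x' => c * F x x') = c * Lam F.
Proof.
rewrite /Lam mulr_sumr; apply: eq_bigr => i _; rewrite mulr_sumr.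
by apply: eq_bigr => k _; ring.
Qed.

Let Lam_sum (T : Type) (r : seq T) (F : T -> 'rV[R]_d -> 'rV[R]_d -> R) :
  Lam (fun x x' => \sum_(t <- r) F t x x') = \sum_(t <- r) Lam (F t).
Proof.
rewrite /Lam [RHS]exchange_big; apply: eq_bigr => i _.
by rewrite [RHS]exchange_big; apply: eq_bigr => k _; rewrite mulr_sumr.
Qed.

Let Lam_le F e : 0 <= e -> (forall i k, `|F (z i) (y k)| <= e) -> `|Lam F| <= B * (B * h ^- l * M) * e.
Proof.
move=> e0 Fe; apply: le_trans (ler_norm_sum _ _ _) _.
apply: (@le_trans _ _ (\sum_i \sum_k `|v i| * `|u k| * e)).
  apply: ler_sum => i _; apply: le_trans (ler_norm_sum _ _ _) _.
  by apply: ler_sum => k _; rewrite !normrM ler_wpM2l// mulr_ge0.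
under eq_bigr => i _ do rewrite -mulr_suml -mulr_sumr.
rewrite -!mulr_suml ler_wpM2r// ler_pM//.
- exact: sumr_ge0.
- exact: sumr_ge0.
Qed.

(** The letters of [x - x'] are distributed between [p] and [q], whose lengths add up to [2 * r], at
    most [2 * l]. If [p] has at most [l] letters, [v] annihilates it. Otherwise [q] has at most [l]
    letters and its moment is at most [M], while the length of [p] exceeds [l] and hence is at least
    [al]. *)
Let Lam_mon (t : R) (r : nat) (p q cs : seq 'I_d) : h ^+ 2 <= t -> (r <= l)%N ->
  forall al : R, l%:R < al <= l.+1%:R ->
  (size p + size q + size cs = r + r)%N ->
  `|Lam (fun x x' => mon p x * mon q x' * mon cs (x - x'))| <=
    2 ^+ size cs * (B * M * h `^ al * t ^+ r *
      (t `^ (- (al / 2)) + t `^ (- ((al + l%:R) / 2)))).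
Proof.
move=> ht rl al /andP[al1 al2].
have t0 : 0 < t by apply: lt_le_trans ht; rewrite exprn_gt0.
have al0 : 0 <= al by apply: le_trans (ltW al1).
elim: cs p q => [|c cs IH] p q /=.
  rewrite addn0 expr0 mul1r => spq.
  have -> : Lam (fun x x' => mon p x * mon q x' * mon [::] (x - x')) =
      (\sum_i v i * mon p (z i)) * (\sum_k u k * mon q (y k)).
    rewrite /Lam big_distrl/=; apply: eq_bigr => i _; rewrite big_distrr/=.
    by apply: eq_bigr => k _; rewrite mon_nil; ring.
  have [pl|lp] := leqP (size p) l.
    rewrite vP// mul0r normr0 !mulr_ge0 ?powR_ge0 ?exprn_ge0 ?addr_ge0 ?powR_ge0//.
    exact: ltW.
  have ql : (size q <= l)%N by clear -spq lp rl; lia.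
  have v1 : `|\sum_i v i * mon p (z i)| <= B * h ^+ size p.
    apply: le_trans (ler_norm_sum _ _ _) _.
    apply: (@le_trans _ _ (\sum_i `|v i| * h ^+ size p)).
      by apply: ler_sum => i _; rewrite normrM ler_wpM2l// mon_le.
    by rewrite -mulr_suml ler_wpM2r ?exprn_ge0 ?(ltW h0).
  rewrite normrM (le_trans (ler_pM _ _ v1 (uM ql)))//.
  rewrite mulrAC -!mulrA ler_wpM2l// ler_wpM2l//.
  have -> : t ^+ r = t `^ ((size p)%:R / 2) * t `^ ((size q)%:R / 2).
    rewrite -powRD ?(gt_eqF t0) ?implybT// -mulrDl -natrD spq natrD mulrDl -splitr.
    by rewrite powR_mulrn// ltW.
  have e1 : h ^+ size p <= h `^ al * t `^ ((size p)%:R / 2) * t `^ (- (al / 2)).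
    have -> : h ^+ size p = h `^ al * h `^ ((size p)%:R - al).
      by rewrite -powRD ?(gt_eqF h0) ?implybT// addrC subrK powR_mulrn// ltW.
    rewrite -mulrA ler_wpM2l ?powR_ge0// -powRD ?(gt_eqF t0) ?implybT// -mulrBl mulrC powRrM.
    have pal : 0 <= (size p)%:R - al.
      by rewrite subr_ge0 (le_trans al2)// ler_nat.
    rewrite ge0_ler_powR ?nnegrE ?powR_ge0 ?(ltW h0)//.
    rewrite powR12_sqrt ?(ltW t0)// -[leLHS]ger0_norm ?(ltW h0)// -sqrtr_sqr.
    exact: ler_wsqrtr.
  (* The two terms [1] and [t ^ (- (l / 2))] serve [1 <= t] and [t < 1]; the latter uses that [q]
     has at most [l] letters. *)
  have e2 : 1 <= t `^ ((size q)%:R / 2) * (1 + t `^ (- (l%:R / 2))).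
    have [t1|t1] := leP 1 t.
      have : 1 <= t `^ ((size q)%:R / 2).
        by rewrite -[leLHS](powRr0 t) ler_powR// divr_ge0.
      move=> hq; rewrite mulrDr mulr1 (le_trans hq)// lerDl mulr_ge0 ?powR_ge0//.
    rewrite mulrDr mulr1 -powRD ?(gt_eqF t0) ?implybT// ler_wpDl ?powR_ge0//.
    rewrite -[leLHS](powRr0 t) ger_powR ?t0 ?(ltW t1)//.
    by rewrite -mulrBl pmulr_lle0 ?invr_gt0// subr_le0 ler_nat.
  apply: le_trans e1 _; rewrite -!mulrA ler_wpM2l ?powR_ge0// ler_wpM2l ?powR_ge0//.
  rewrite mulrDl opprD powRD ?(gt_eqF t0) ?implybT//.
  rewrite -[X in X + _]mulr1 -mulrDr mulrCA -[leLHS]mulr1 ler_wpM2l ?powR_ge0//.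
move=> spq.
have -> : Lam (fun x x' => mon p x * mon q x' * mon (c :: cs) (x - x')) =
    Lam (fun x x' => mon (c :: p) x * mon q x' * mon cs (x - x')) +
    (-1) * Lam (fun x x' => mon p x * mon (c :: q) x' * mon cs (x - x')).
  rewrite -LamZ -LamD; apply: eq_bigr => i _; apply: eq_bigr => k _.
  by rewrite !mon_cons !mxE; ring.
apply: le_trans (ler_normD _ _) _; rewrite normrM normrN1 mul1r.
rewrite exprS -mulrA mulrDl mul1r lerD// IH//=; clear -spq; lia.
Qed.

(** For [t < h ^+ 2] the kernel is bounded by 1, and the loss [h ^- l] in the total mass of [u]
    becomes the power of [t] with exponent [- ((al + l) / 2)]. For larger [t] the kernel is expanded
    up to order [l]: the Taylor terms are handled by [Lam_mon], and the remainder, of order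
    [(h ^+ 2 / t) ^+ l.+1], compensates the mass of [u]. *)
Lemma bilinear_gauss (t al : R) : 0 < t -> l%:R < al <= l.+1%:R ->
  `|Lam (gk t)| <= (B * (B * M) * d%:R ^+ l.+1 + B * (B * M) + \sum_(r < l.+1) d%:R ^+ r * (B * M)) *
    h `^ al * (t `^ (- (al / 2)) + t `^ (- ((al + l%:R) / 2))).
Proof.
move=> t0 /andP[al1 al2].
have al0 : 0 <= al by apply: le_trans (ltW al1).
set P1 := t `^ _; set P2 := t `^ _.
have P10 : 0 <= P1 by exact: powR_ge0.
have P20 : 0 <= P2 by exact: powR_ge0.
have BM : 0 <= B * M by exact: mulr_ge0.
have BBM : 0 <= B * (B * M) by exact: mulr_ge0.
have S0 : 0 <= \sum_(r < l.+1) d%:R ^+ r * (B * M).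
  by apply: sumr_ge0 => r _; rewrite mulr_ge0 ?exprn_ge0.
have hl : h ^- l = h `^ al * (h ^+ 2) `^ (- ((al + l%:R) / 2)).
  have -> : h ^+ 2 = h `^ 2%:R by rewrite powR_mulrn// ltW.
  rewrite -powRrM -powRD ?(gt_eqF h0) ?implybT//.
  by rewrite -powR_invn ?(ltW h0)//; congr (_ `^ _); field.
have [th|/ltW ht] := leP t (h ^+ 2).
  apply: (@le_trans _ _ (B * (B * h ^- l * M) * 1)).
    by apply: Lam_le => // i k; rewrite norm_gk_le1 ?(ltW t0).
  have hP2 : h ^- l <= h `^ al * (P1 + P2).
    rewrite hl ler_wpM2l ?powR_ge0// ler_wpDl// /P2 !powRN.
    rewrite lef_pV2 ?posrE ?powR_gt0 ?exprn_gt0// ge0_ler_powR ?nnegrE ?(ltW t0) ?exprn_ge0 ?(ltW h0)//.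
    by rewrite divr_ge0 ?addr_ge0.
  rewrite mulr1 (_ : B * _ = B * (B * M) * h ^- l); last by ring.
  apply: le_trans (ler_wpM2l BBM hP2) _; rewrite [leLHS]mulrA ler_wpM2r ?addr_ge0//.
  rewrite ler_wpM2r ?powR_ge0// addrAC lerDr addr_ge0// mulr_ge0// exprn_ge0//.
pose T (r : nat) x x' : R := (-1) ^+ r / (4 * t) ^+ r / r`!%:R *
    \sum_(w <- words d r) (mon [::] x * mon [::] x' * mon (w ++ w) (x - x')).
have TE (r : nat) : Lam (T r) = (-1) ^+ r / (4 * t) ^+ r / r`!%:R *
    \sum_(w <- words d r) Lam (fun x x' => mon [::] x * mon [::] x' * mon (w ++ w) (x - x')).
  by rewrite /T LamZ Lam_sum.
have -> : Lam (gk t) = \sum_(r < l.+1) Lam (T r) +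
    Lam (fun x x' => exp_rem l.+1 (sqn (x - x') / (4 * t))).
  rewrite -(Lam_sum _ (fun r : 'I_l.+1 => T r)) -LamD.
  apply: eq_bigr => i _; apply: eq_bigr => k _; congr (_ * _).
  rewrite (_ : \sum_(r < _) _ = \sum_(r < l.+1)
    (- (sqn (z i - y k) / (4 * t))) ^+ r / r`!%:R); first by rewrite /exp_rem addrC subrK.
  apply: eq_bigr => r _; rewrite /T -[- (_ / _)]mulN1r [(-1 * _) ^+ _]exprMn expr_div_n sqn_exp.
  under eq_bigr do rewrite !mon_nil !mul1r.
  by ring.
have t4 : 0 < 4 * t by rewrite mulr_gt0.
apply: le_trans (ler_normD _ _) _; rewrite addrC.
have -> : (B * (B * M) * d%:R ^+ l.+1 + B * (B * M) + \sum_(r < l.+1) d%:R ^+ r * (B * M)) *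
    h `^ al * (P1 + P2) = B * (B * M) * d%:R ^+ l.+1 * h `^ al * (P1 + P2) +
    (\sum_(r < l.+1) d%:R ^+ r * (B * M)) * h `^ al * (P1 + P2) +
    B * (B * M) * (h `^ al * (P1 + P2)) by ring.
have P120 : 0 <= P1 + P2 by exact: addr_ge0.
have hP0 : 0 <= h `^ al * (P1 + P2) by rewrite mulr_ge0// powR_ge0.
rewrite -[leLHS]addr0; apply: lerD; last exact: (mulr_ge0 BBM hP0).
have ht1 : h ^+ 2 / t <= 1 by rewrite ler_pdivrMr// mul1r.
have ht0 : 0 <= h ^+ 2 / t by rewrite divr_ge0 ?exprn_ge0 ?(ltW h0) ?(ltW t0).
apply: lerD.
  have e0 : 0 <= (d%:R * (h ^+ 2 / t)) ^+ l.+1 by rewrite exprn_ge0// mulr_ge0.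
  apply: le_trans (Lam_le e0 _) _.
    move=> i k; apply: le_trans (exp_rem_le _ _) _; first by rewrite divr_ge0 ?sqn_ge0 ?(ltW t4).
    have q1 : 0 <= sqn (z i - y k) / (4 * t) by rewrite divr_ge0 ?sqn_ge0 ?(ltW t4).
    have q2 : 0 <= d%:R * (h ^+ 2 / t) by rewrite mulr_ge0.
    rewrite lerXn2r ?nnegrE// ler_pdivrMr// (le_trans (@sqn_le _ _ _ (2 * h) _))//.
      move=> c; rewrite !mxE (le_trans (ler_normB _ _))// mulr2n mulrDl mul1r.
      exact: lerD.
    rewrite le_eqVlt; apply/orP; left; apply/eqP; field.
    by rewrite gt_eqF.
  have e3 : h ^- l * (h ^+ 2 / t) ^+ l.+1 <= h `^ al * P2.
    rewrite hl -mulrA ler_wpM2l ?powR_ge0// -[(h ^+ 2 / t) ^+ _]powR_mulrn//.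
    apply: (@le_trans _ _ ((h ^+ 2) `^ (- ((al + l%:R) / 2)) * (h ^+ 2 / t) `^ ((al + l%:R) / 2))).
      rewrite ler_wpM2l ?powR_ge0// ger_powR//.
        by rewrite ht1 andbT divr_gt0 ?exprn_gt0.
      by move: al2; rewrite -natr1; lra.
    have pn (e : R) : (h ^+ 2) `^ (- e) * (h ^+ 2) `^ e = 1.
      by rewrite powRN mulVf// gt_eqF// powR_gt0// exprn_gt0.
    rewrite powRM ?exprn_ge0 ?invr_ge0 ?(ltW h0) ?(ltW t0)// mulrA pn mul1r.
    by rewrite -powR_inv1 ?(ltW t0)// -powRrM mulN1r.
  rewrite exprMn (_ : B * _ * _ = B * (B * M) * d%:R ^+ l.+1 * (h ^- l * (h ^+ 2 / t) ^+ l.+1)); last by ring.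
  rewrite -[leRHS]mulrA ler_wpM2l//; first by rewrite mulr_ge0 ?exprn_ge0.
  by apply: le_trans e3 _; rewrite ler_wpM2l ?powR_ge0// lerDr.
apply: le_trans (ler_norm_sum _ _ _) _; rewrite !mulr_suml; apply: ler_sum => r _.
have rl : (r <= l)%N by rewrite -ltnS.
rewrite TE normrM normf_div normf_div normrX normrN1 expr1n !normr_nat.
rewrite [X in X * _ <= _](_ : _ = (4 * t) ^- r / r`!%:R); last first.
  by rewrite ger0_norm ?exprn_ge0 ?(ltW t4)// mul1r.
apply: (@le_trans _ _ ((4 * t) ^- r / r`!%:R * \sum_(w <- words d r)
   2 ^+ (r + r) * (B * M * h `^ al * t ^+ r * (P1 + P2)))).
  rewrite ler_wpM2l ?divr_ge0 ?invr_ge0 ?exprn_ge0 ?(ltW t4)//.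
  apply: le_trans (ler_norm_sum _ _ _) _.
  rewrite big_seq_cond [leRHS]big_seq_cond; apply: ler_sum => w.
  rewrite size_words andbT => /eqP sw.
  have := @Lam_mon t r [::] [::] (w ++ w) ht rl al.
  rewrite size_cat sw; apply; [by rewrite al1 al2|by []].
rewrite big_const_seq count_predT size_words_pow iter_addr_0 -[_ *+ (d ^ r)]mulr_natl natrX.
have -> : (4 * t) ^- r / r`!%:R * (d%:R ^+ r * (2 ^+ (r + r) * (B * M * h `^ al * t ^+ r * (P1 + P2)))) =
    d%:R ^+ r * (B * M) * h `^ al * (P1 + P2) / r`!%:R.
  have -> : 2 ^+ (r + r) = 4 ^+ r :> R by rewrite exprD -exprMn; congr (_ ^+ _); ring.
  rewrite exprMn; field; rewrite pnatr_eq0 -lt0n fact_gt0 !expf_neq0//.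
  by rewrite gt_eqF.
rewrite ler_pdivrMr ?ltr0n ?fact_gt0// ler_peMr//.
  by rewrite !mulr_ge0 ?exprn_ge0 ?powR_ge0.
by rewrite ler1n fact_gt0.
Qed.

End Bilinear.

(** * Kriging weights compared with interpolation weights *)

Section KrigingWeights.
Variables (R : realType) (d l : nat) (a : R).
Hypotheses (d0 : (0 < d)%N) (a0 : 0 < a) (la : l%:R < a <= l.+1%:R).

Local Notation K := (@matern R d a).

(** [bilinear_gauss] is integrated against the Gamma weight: both exponents [a / 2] and
    [(a + l) / 2] are below [a], the second because [l < a]. *)
Lemma bilinear_matern (B : R) : 0 <= B -> exists2 C : R, 0 <= C &
  forall (I J : finType) (v : J -> R) (u : I -> R) (z : J -> 'rV[R]_d) (y : I -> 'rV[R]_d)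
    (M h : R),
  0 <= M -> 0 < h -> h <= 1 ->
  (forall i c, `|z i ord0 c| <= h) -> (forall i c, `|y i ord0 c| <= h) ->
  \sum_i `|v i| <= B ->
  (forall w, (size w <= l)%N -> \sum_i v i * mon w (z i) = 0) ->
  (forall w, (size w <= l)%N -> `|\sum_i u i * mon w (y i)| <= M) ->
  \sum_i `|u i| <= B * h ^- l * M ->
  `|\sum_i \sum_k v i * u k * K (z i) (y k)| <= C * h `^ a * M.
Proof.
move=> B0; case/andP: (la) => la1 la2.
pose cB : R := B * B * d%:R ^+ l.+1 + B * B + \sum_(r < l.+1) d%:R ^+ r * B.
have cB0 : 0 <= cB.
  rewrite !addr_ge0 ?mulr_ge0 ?exprn_ge0// sumr_ge0// => r _.
  by rewrite mulr_ge0 ?exprn_ge0.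
have pa : a / 2 < a by move: a0; lra.
have qa : (a + l%:R) / 2 < a by lra.
have g1 := gamma_fun_gt0 a0.
have g2 : 0 < gamma_fun (a - a / 2) by rewrite gamma_fun_gt0// subr_gt0.
have g3 : 0 < gamma_fun (a - (a + l%:R) / 2) by rewrite gamma_fun_gt0// subr_gt0.
exists ((gamma_fun a)^-1 * (cB * (gamma_fun (a - a / 2) + gamma_fun (a - (a + l%:R) / 2)))).
  by rewrite mulr_ge0 ?invr_ge0 ?(ltW g1)// mulr_ge0// addr_ge0 ?(ltW g2) ?(ltW g3).
move=> I J v u z y M h M0 h0 h1 zh yh vB vP uM uB.
rewrite pair_bigA/= (matern_sum_mix (fun p : J * I => v p.1 * u p.2)
  (fun p => z p.1) (fun p => y p.2) a0).
rewrite normrM ger0_norm ?invr_ge0 ?(ltW g1)// -!mulrA ler_wpM2l ?invr_ge0 ?(ltW g1)//.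
have bd x : `|\sum_(p : J * I) v p.1 * u p.2 * gk (expR x) (z p.1) (y p.2)| <=
    \sum_(p : J * I) `|v p.1 * u p.2|.
  apply: le_trans (ler_norm_sum _ _ _) _; apply: ler_sum => p _.
  by rewrite normrM ler_piMr// norm_gk_le1// expR_ge0.
apply: le_trans (@mix_upper R a _ _ (cB * M * h `^ a) _ _ _ bd pa qa a0 _) _.
- move=> x; apply: cvg_big => [|p _]; first exact: add_continuous.
  by apply: cvgMr; exact: continuous_gk_expR.
- move=> x; rewrite -(pair_bigA _ (fun i k => v i * u k * gk (expR x) (z i) (y k)))/=.
  apply: le_trans (bilinear_gauss B0 M0 h0 zh yh vB vP uM uB (expR_gt0 x) la) _.
  have e (p : R) : expR x `^ (- p) = expR (- p * x) by rewrite -expRM mulrC.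
  rewrite !e [X in X * _ * _ <= _](_ : _ = cB * M)//.
  rewrite /cB !mulrDl mulr_suml; congr (_ + _ + _); try ring.
  by apply: eq_bigr => r _; rewrite mulrA.
- by rewrite le_eqVlt; apply/orP; left; apply/eqP; ring.
Qed.

(** Let [M] be the sum of the absolute moments of [u = wK - wP] and [q] its Matern form.
    [moment_bound] gives [M] of order [Num.sqrt q]. The normal equations of kriging rewrite [q] as a
    bilinear form between [u] and the residual of interpolation, which annihilates polynomials, so
    [q] is of order [h ^ a * M]. Dividing by [M] closes the loop. *)
Lemma krig_diff (B : R) : 0 <= B -> exists h0 C : R, [/\ 0 < h0, h0 <= 1, 0 < C &
  forall (I : finType) (y : I -> 'rV[R]_d) (wP wK : I -> R) (h : R),
  0 < h -> h <= h0 -> (forall i c, `|y i ord0 c| <= h) ->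
  (forall w, (size w <= l)%N -> \sum_i wP i * mon w (y i) = mon w 0) ->
  \sum_i `|wP i| <= B ->
  (forall (u : I -> R) (M : R), (forall w, (size w <= l)%N -> `|\sum_i u i * mon w (y i)| <= M) ->
    \sum_i `|u i| <= B * h ^- l * M) ->
  (forall i, \sum_k wK k * K (y k) (y i) = K 0 (y i)) ->
  (forall w, (size w <= l)%N -> `|\sum_i (wK i - wP i) * mon w (y i)| <= C * h `^ a) /\
  \sum_i `|wK i - wP i| <= C * h `^ (a - l%:R)].
Proof.
move=> B0; case/andP: (la) => la1 la2.
have [C1 C10 bil] := bilinear_matern (addr_ge0 ler01 B0).
have [C2 C20 mom] := @moment_bound R d a d0 a0 l.
pose Nw : R := \sum_(k < l.+1) d%:R ^+ k.
have Nw1 : 1 <= Nw.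
  by rewrite /Nw big_ord_recl expr0 lerDl sumr_ge0// => k _; rewrite exprn_ge0.
have Nw0 : 0 < Nw by exact: lt_le_trans Nw1.
(* For [h <= h0] the term of [moment_bound] that involves the total mass of [u] is at most half of
   [M] and is absorbed on the left. *)
pose h0 : R := (1 + 2 * Nw * C2 * B)^-1.
have den : 1 <= 1 + 2 * Nw * C2 * B by rewrite lerDl !mulr_ge0 ?(ltW Nw0) ?(ltW C20).
have h00 : 0 < h0 by rewrite invr_gt0 (lt_le_trans _ den).
have h01 : h0 <= 1 by rewrite invf_le1// (lt_le_trans _ den).
pose C3 : R := (2 * Nw * C2) ^+ 2 * C1.
have C30 : 0 <= C3 by rewrite mulr_ge0 ?sqr_ge0.
exists h0, ((1 + B) * (C3 + 1)); split => //.
  by apply: mulr_gt0; lra.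
move=> I y wP wK h hp hh0 yh hP wPB uB nrm.
have h1 : h <= 1 by exact: le_trans h01.
pose u i := wK i - wP i.
pose m w := `|\sum_i u i * mon w (y i)|.
pose M : R := \sum_(k < l.+1) \sum_(w <- words d k) m w.
have m0 w : 0 <= m w by exact: normr_ge0.
have s0 k : 0 <= \sum_(w <- words d k) m w by apply: sumr_ge0 => w _.
have M0 : 0 <= M by apply: sumr_ge0 => k _.
have mM w : (size w <= l)%N -> m w <= M.
  move=> wl; rewrite /M (bigD1 (Ordinal (wl : (size w < l.+1)%N)))//=.
  rewrite (big_rem w) ?size_words//= -addrA lerDl; apply: addr_ge0.
    by apply: sumr_ge0 => w' _.
  by apply: sumr_ge0 => k _.
have Mle (e : R) : 0 <= e -> (forall w, (size w <= l)%N -> m w <= e) -> M <= Nw * e.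
  move=> e0 he; rewrite /M /Nw mulr_suml; apply: ler_sum => k _.
  apply: (@le_trans _ _ (\sum_(w <- words d k) e)).
    rewrite big_seq_cond [leRHS]big_seq_cond; apply: ler_sum => w.
    by rewrite size_words andbT => /eqP sw; apply: he; rewrite sw -ltnS.
  by rewrite big_const_seq count_predT size_words_pow iter_addr_0 -[_ *+ (_ ^ _)]mulr_natl natrX.
have u1 : \sum_i `|u i| <= B * h ^- l * M by apply: uB => w /mM.
pose q := qf K u y.
have q0 : 0 <= q by exact: qf_matern_ge0.
have Mq : M <= 2 * Nw * C2 * Num.sqrt q.
  have : M <= Nw * (C2 * Num.sqrt q + C2 * h ^+ (2 * l.+1) * (B * h ^- l * M)).
    apply: Mle => [|w wl].
      rewrite addr_ge0 ?mulr_ge0 ?sqrtr_ge0 ?exprn_ge0 ?invr_ge0 ?exprn_ge0 ?(ltW C20) ?(ltW hp)//.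
    apply: le_trans (mom I u y h w (ltW hp) h1 yh wl) _.
    by rewrite lerD2l ler_wpM2l// mulr_ge0 ?exprn_ge0 ?(ltW C20) ?(ltW hp).
  have hl : h ^+ (2 * l.+1) * h ^- l <= h.
    rewrite mul2n -addnn addSnnS.
    rewrite exprD mulrAC divff ?expf_neq0 ?gt_eqF// mul1r exprSr ler_piMl ?(ltW hp)//.
    by rewrite exprn_ile1// ltW.
  have hb : Nw * (C2 * h ^+ (2 * l.+1) * (B * h ^- l * M)) <= 2^-1 * M.
    have E (p q' r t b m' : R) : p * (q' * r * (b * t * m')) = p * q' * b * (r * t) * m' by ring.
    rewrite E.
    apply: ler_wpM2r; first exact: M0.
    apply: (@le_trans _ _ (Nw * C2 * B * h0)).
      by rewrite ler_wpM2l ?mulr_ge0 ?(ltW Nw0) ?(ltW C20)// (le_trans hl).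
    rewrite /h0 ler_pdivrMr ?(lt_le_trans _ den)//.
    have : 0 <= Nw * C2 * B by rewrite !mulr_ge0 ?(ltW Nw0) ?(ltW C20).
    lra.
  rewrite mulrDr => /le_trans/(_ (lerD (lexx _) hb)).
  by rewrite -!mulrA; set X := Nw * _; lra.
(* The orthogonality of the kriging residual to the span of the parents. *)
pose v (i : option I) := if i is Some k then - wP k else 1.
pose z (i : option I) := if i is Some k then y k else 0.
have sumO (F : option I -> R) : \sum_i F i = F None + \sum_k F (Some k).
  rewrite (bigD1 None)//=; congr (_ + _).
  rewrite (reindex_omap Some id)/=; last by case.
  by apply: eq_bigl => k; rewrite eqxx.
have qE : q = \sum_i \sum_k v i * u k * K (z i) (y k).
  rewrite sumO/= /q /qf.
  transitivity (\sum_k u k * (K 0 (y k) - \sum_b wP b * K (y b) (y k))).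
    rewrite exchange_big/=; apply: eq_bigr => k _.
    rewrite -nrm -sumrB mulr_sumr; apply: eq_bigr => b _.
    by rewrite /u; ring.
  rewrite [X in _ + X]exchange_big/= -big_split/=; apply: eq_bigr => k _.
  rewrite mulrBr mulr_sumr -sumrN; congr (_ + _); first by rewrite mul1r.
  by apply: eq_bigr => b _; ring.
have Bq : q <= C1 * h `^ a * M.
  apply: (@le_trans _ _ `|q|); first exact: ler_norm.
  rewrite [in X in X <= _]qE; apply: (bil I (option I) v u z y M h M0 hp h1).
  - by case=> [k|] c //=; rewrite mxE normr0 ltW.
  - exact: yh.
  - rewrite sumO/= normr1 lerD2l; apply: le_trans wPB.
    by apply: ler_sum => k _; rewrite normrN.
  - move=> w wl; rewrite sumO/= mul1r -(hP w wl) -big_split/= big1// => k _.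
    by rewrite mulNr subrr.
  - by move=> w /mM.
  - apply: le_trans u1 _; rewrite ler_wpM2r// ler_wpM2r ?invr_ge0 ?exprn_ge0 ?(ltW hp)//.
    by rewrite lerDr ler01.
have M3 : M <= C3 * h `^ a.
  have [->|Mn] := eqVneq M 0; first by rewrite mulr_ge0 ?powR_ge0.
  have Mp : 0 < M by rewrite lt_def Mn.
  rewrite -(ler_pM2r Mp) -expr2.
  apply: (@le_trans _ _ ((2 * Nw * C2) ^+ 2 * q)).
    rewrite -[q in leRHS](sqr_sqrtr q0) -exprMn lerXn2r ?nnegrE//.
    by rewrite !mulr_ge0 ?sqrtr_ge0 ?(ltW Nw0) ?(ltW C20).
  have E (p r t m' : R) : p * r * t * m' = p * (r * t * m') by ring.
  by rewrite /C3 (E ((2 * Nw * C2) ^+ 2) C1 (h `^ a) M) ler_wpM2l ?sqr_ge0.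
have hag : 0 <= h `^ a by exact: powR_ge0.
have C31 : C3 <= (1 + B) * (C3 + 1).
  rewrite mulrDl mul1r -addrA lerDl addr_ge0// mulr_ge0// addr_ge0//.
split.
  move=> w wl; apply: le_trans (mM w wl) _; apply: le_trans M3 _.
  by rewrite ler_wpM2r.
apply: le_trans u1 _.
have -> : h `^ (a - l%:R) = h ^- l * h `^ a.
  by rewrite powRB ?(gt_eqF hp) ?implybT// powR_mulrn ?(ltW hp)// mulrC.
have E1 (p r t : R) : p * r * t = r * (p * t) by ring.
have E2 (p r t : R) : p * (r * t) = r * (p * t) by ring.
rewrite (E1 B) [leRHS]E2 ler_wpM2l ?invr_ge0 ?exprn_ge0 ?(ltW hp)//.
apply: (@le_trans _ _ (B * (C3 * h `^ a))); first by rewrite ler_wpM2l.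
rewrite mulrA ler_wpM2r// mulrDl mul1r mulrDr mulr1.
have : 0 <= B * C3 by exact: mulr_ge0.
by lra.
Qed.

End KrigingWeights.

(** * Polynomials in words and bounds of their coefficients *)

Section WordPolynomials.
Variables (R : realType) (d : nat).
Implicit Types (y : 'rV[R]_d) (w : seq 'I_d) (L : seq (R * seq 'I_d)).

(** A list of weighted words, possibly with repeated or permuted words: only the function it defines
    matters, which makes sums and products immediate. Coefficients become canonical only in
    [poly_coef_bound]. *)
Definition wpoly L y : R := \sum_(p <- L) p.1 * mon p.2 y.

Definition wsize (l : nat) L : bool := all (fun p => (size p.2 <= l)%N) L.

Definition polyw (l : nat) (f : 'rV[R]_d -> R) : Prop :=
  exists2 L, wsize l L & forall y, f y = wpoly L y.

Lemma polywW l l' f : (l <= l')%N -> polyw l f -> polyw l' f.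
Proof.
move=> ll [L sL fL]; exists L => //; apply: sub_all sL => p /= h.
exact: leq_trans ll.
Qed.

Lemma polyw_cst l (c : R) : polyw l (fun=> c).
Proof. by exists [:: (c, [::])] => // y; rewrite /wpoly big_seq1 mon_nil mulr1. Qed.

Lemma polywD l f g : polyw l f -> polyw l g -> polyw l (fun y => f y + g y).
Proof.
move=> [L sL fL] [L' sL' gL']; exists (L ++ L'); first by rewrite /wsize all_cat; apply/andP.
by move=> y; rewrite /wpoly big_cat/= fL gL'.
Qed.

Lemma polywZ l c f : polyw l f -> polyw l (fun y => c * f y).
Proof.
move=> [L sL fL]; exists [seq (c * p.1, p.2) | p <- L]; first by rewrite /wsize all_map.
by move=> y; rewrite /wpoly big_map fL mulr_sumr; apply: eq_bigr => p _; rewrite mulrA.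
Qed.

Lemma polyw_sum l (T : eqType) (r : seq T) (F : T -> 'rV[R]_d -> R) :
  (forall t, t \in r -> polyw l (F t)) -> polyw l (fun y => \sum_(t <- r) F t y).
Proof.
elim: r => [|t r IH] h.
  have [L sL fL] := polyw_cst l 0; exists L => // y.
  by rewrite big_nil -fL.
have ht : polyw l (F t) by apply: h; rewrite mem_head.
have hr : polyw l (fun y => \sum_(t <- r) F t y).
  by apply: IH => t' t'r; apply: h; rewrite in_cons t'r orbT.
have [L sL fL] := polywD ht hr.
by exists L => // y; rewrite big_cons fL.
Qed.

Lemma polyw_mul_coord l f (al be : R) (c : 'I_d) : polyw l f ->
  polyw l.+1 (fun y => (al + be * y ord0 c) * f y).
Proof.
move=> pf; have [L sL fL] := pf.
have h2 : polyw l.+1 (fun y => be * (y ord0 c * f y)).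
  apply: polywZ; exists [seq (p.1, c :: p.2) | p <- L]; first by rewrite /wsize all_map.
  move=> y; rewrite /wpoly big_map fL mulr_sumr; apply: eq_bigr => p _.
  by rewrite /= mon_cons; ring.
have [L' sL' fL'] := polywD (polywZ al (polywW (leqnSn l) pf)) h2.
by exists L' => // y; rewrite -fL'; ring.
Qed.

Lemma mon_count w y : mon w y = \prod_c y ord0 c ^+ count_mem c w.
Proof.
elim: w => [|c w IH]; first by rewrite mon_nil big1.
rewrite mon_cons IH (bigD1 c)//= [in RHS](bigD1 c)//= eqxx/= add1n exprS mulrA.
by congr (_ * _); apply: eq_bigr => i ic; rewrite eq_sym (negbTE ic).
Qed.

Lemma mon_perm w w' y : perm_eq w w' -> mon w y = mon w' y.
Proof. by move=> ww'; rewrite /mon (perm_big _ ww'). Qed.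

Definition leI (i j : 'I_d) : bool := (i <= j)%N.

Lemma sortI_perm w w' : perm_eq w w' = (sort leI w == sort leI w').
Proof.
apply/idP/eqP => [|h].
  move/perm_sortP; apply.
  - by move=> i j; exact: leq_total.
  - by move=> i j k; exact: leq_trans.
  - by move=> i j h; apply/val_inj/eqP; rewrite eqn_leq.
by rewrite -(perm_sort leI w) h perm_sort.
Qed.

Lemma uniq_words k : uniq (words d k).
Proof.
elim: k => //= k IH; apply: allpairs_uniq => //; first exact: enum_uniq.
by move=> [c w] [c' w'] _ _ [-> ->].
Qed.

Definition allwords l : seq (seq 'I_d) := flatten [seq words d k | k <- iota 0 l.+1].

Lemma mem_allwords l w : (w \in allwords l) = (size w <= l)%N.
Proof.
apply/flatten_mapP/idP => [[k]|wl].
  by rewrite mem_iota size_words => /andP[_ kl] /eqP ->.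
by exists (size w); rewrite ?mem_iota ?size_words//= add0n ltnS.
Qed.

Lemma uniq_allwords l : uniq (allwords l).
Proof.
rewrite /allwords; elim: l.+1 0%N => //= n IH m; rewrite cat_uniq uniq_words IH andbT/=.
apply/hasPn => w /flatten_mapP[k]; rewrite mem_iota => /andP[mk _].
by rewrite !size_words => /eqP ->; rewrite neq_ltn mk orbT.
Qed.

Definition node (l : nat) (g : 'I_l.+1) : R := g%:R / l.+1%:R.

Lemma node_ge0 l g : 0 <= node g :> R /\ @node l g <= 1.
Proof.
split; first by rewrite divr_ge0.
by rewrite ler_pdivrMr ?ltr0n// mul1r ler_nat ltnW.
Qed.

(** Column [k] holds the weights that recover the coefficient of degree [k] of a one-variable
    polynomial of degree at most [l] from its values at the nodes. *)
Definition lagr (l : nat) : 'M[R]_l.+1 := invmx (Vandermonde l.+1 (\row_g @node l g)).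

Lemma lagrP l (j k : 'I_l.+1) : \sum_g lagr l g k * @node l g ^+ j = (j == k)%:R.
Proof.
have u : Vandermonde l.+1 (\row_g @node l g) \in unitmx.
  rewrite unitmxE det_Vandermonde unitfE; apply/prodf_neq0 => i _.
  apply/prodf_neq0 => i' ii'; rewrite !mxE subr_eq0 /node.
  rewrite (inj_eq (mulIf _)) ?invr_eq0 ?pnatr_eq0// eqr_nat.
  by rewrite neq_ltn ii' orbT.
have := mulmxV u; rewrite -/(lagr l) => /matrixP/(_ j k); rewrite !mxE => <-.
by apply: eq_bigr => g _; rewrite !mxE mulrC.
Qed.

(* The coefficients of a polynomial are linear combinations of its values on a
   grid contained in a given orthant cube. *)
Lemma poly_coef_bound (l : nat) : exists2 C : R, 0 <= C &
  forall (f : 'rV[R]_d -> R) (sg : 'I_d -> bool) (H S : R), polyw l f -> 0 < H ->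
  (forall y, (forall c, 0 <= (-1) ^+ sg c * y ord0 c <= H) -> `|f y| <= S) ->
  exists cf : seq 'I_d -> R,
    (forall y, f y = \sum_(w <- allwords l) cf w * mon w y) /\
    (forall w, (size w <= l)%N -> `|cf w| <= C * H ^- size w * S).
Proof.
pose lam w (g : {ffun 'I_d -> 'I_l.+1}) : R := \prod_c lagr l (g c) (inord (count_mem c w)).
pose Lam w := \sum_g `|lam w g|.
exists (\sum_(w <- allwords l) Lam w).
  by apply: sumr_ge0 => w _; apply: sumr_ge0 => g _.
move=> f sg H S [L sL fL] H0 fS.
(* Sorted words represent the monomials; all other words receive coefficient 0. *)
pose cf w := if sort leI w == w then \sum_(p <- L | sort leI p.2 == w) p.1 else 0.
exists cf; split.
  move=> y; rewrite fL /wpoly.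
  transitivity (\sum_(p <- L) \sum_(w <- allwords l) (if sort leI p.2 == w then p.1 else 0) * mon w y).
    rewrite big_seq_cond [RHS]big_seq_cond; apply: eq_bigr => p; rewrite andbT => pL.
    have pl : sort leI p.2 \in allwords l.
      by rewrite mem_allwords size_sort; exact: (allP sL).
    rewrite (bigD1_seq _ pl (uniq_allwords l))/= eqxx big1 ?addr0.
      by congr (_ * _); apply: mon_perm; rewrite perm_sym perm_sort.
    by move=> w; rewrite eq_sym => /negbTE ->; rewrite mul0r.
  rewrite exchange_big/=; apply: eq_bigr => w _; rewrite -mulr_suml -big_mkcond/=.
  rewrite /cf; case: ifPn => // sw; rewrite big_pred0 ?mul0r// => p.
  apply/eqP => e; move/negP: sw; apply; rewrite -e sorted_sort//.
  - by move=> i j k; exact: leq_trans.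
  - by apply: sort_sorted => i j; exact: leq_total.
move=> w wl.
pose yg (g : {ffun 'I_d -> 'I_l.+1}) : 'rV[R]_d := \row_c ((-1) ^+ sg c * (H * node (g c))).
have yS g : `|f (yg g)| <= S.
  apply: fS => c; rewrite mxE mulrA -expr2 sqrr_sign mul1r.
  have [n0 n1] := @node_ge0 l (g c).
  by rewrite mulr_ge0 ?(ltW H0)//= ger_pMr.
have S0 : 0 <= S by apply: le_trans (yS [ffun=> ord0]).
have LamC : Lam w <= \sum_(w' <- allwords l) Lam w'.
  rewrite (big_rem w) ?mem_allwords//= lerDl; apply: sumr_ge0 => w' _.
  exact: sumr_ge0.
have Lam0 : 0 <= Lam w by exact: sumr_ge0.
rewrite /cf; case: ifPn => [/eqP sw|_]; last first.
  rewrite normr0 !mulr_ge0 ?invr_ge0 ?exprn_ge0 ?(ltW H0)//.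
  exact: le_trans LamC.
have small v : (size v <= l)%N -> forall c, (count_mem c v < l.+1)%N.
  by move=> vl c; rewrite ltnS (leq_trans (count_size _ _)).
pose sgn v : R := \prod_c ((-1) ^+ sg c * H) ^+ count_mem c v.
have ext v : (size v <= l)%N -> \sum_g lam w g * mon v (yg g) =
    (sort leI v == w)%:R * sgn v.
  move=> vl.
  transitivity (\sum_(g : {ffun 'I_d -> 'I_l.+1}) \prod_c
      (lagr l (g c) (inord (count_mem c w)) *
       (((-1) ^+ sg c * H) ^+ count_mem c v * node (g c) ^+ count_mem c v))).
    apply: eq_bigr => g _; rewrite mon_count /lam -big_split/=; apply: eq_bigr => c _.
    by rewrite mxE mulrA exprMn.
  rewrite -(bigA_distr_bigA (fun c (gc : 'I_l.+1) => lagr l gc (inord (count_mem c w)) *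
       (((-1) ^+ sg c * H) ^+ count_mem c v * node gc ^+ count_mem c v)))/=.
  have E c : \sum_gc lagr l gc (inord (count_mem c w)) *
       (((-1) ^+ sg c * H) ^+ count_mem c v * node gc ^+ count_mem c v) =
       ((-1) ^+ sg c * H) ^+ count_mem c v * (count_mem c v == count_mem c w)%:R.
    have := @lagrP l (inord (count_mem c v)) (inord (count_mem c w)).
    rewrite -val_eqE/= !inordK ?small// => <-; rewrite mulr_sumr.
    by apply: eq_bigr => gc _; ring.
  under eq_bigr do rewrite E.
  rewrite big_split/= -/(sgn v) mulrC; congr (_ * _).
  have -> : (sort leI v == w) = [forall c, count_mem c v == count_mem c w].
    rewrite -[X in _ == X]sw -sortI_perm; apply/idP/forallP => [/permP h c|h].
      by rewrite h.
    by apply/allP => c _ /=; exact: h.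
  case: forallP => [h|h]; first by rewrite big1// => c _; rewrite h.
  have [c hc] : exists c, count_mem c v != count_mem c w.
    apply/existsP; rewrite -negb_forall; apply/negP => /forallP; exact: h.
  by rewrite (bigD1 c)//= (negbTE hc) mul0r.
have key : \sum_g lam w g * f (yg g) = (\sum_(p <- L | sort leI p.2 == w) p.1) * sgn w.
  under eq_bigr do rewrite fL /wpoly mulr_sumr.
  rewrite exchange_big/= mulr_suml [RHS]big_mkcond/=.
  rewrite big_seq_cond [RHS]big_seq_cond; apply: eq_bigr => p; rewrite andbT => pL.
  transitivity (p.1 * \sum_g lam w g * mon p.2 (yg g)).
    by rewrite mulr_sumr; apply: eq_bigr => g _; ring.
  rewrite ext; last exact: (allP sL).
  case: eqP => [e|_]; last by rewrite mul0r mulr0.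
  rewrite mul1r; congr (_ * _); apply: eq_bigr => c _; congr (_ ^+ _).
  have : perm_eq p.2 w by rewrite sortI_perm e sw.
  by move/permP; apply.
have nsgn : `|sgn w| = H ^+ size w.
  have -> : H ^+ size w = mon w (const_mx H).
    elim: (w) => [|c v IH]; first by rewrite mon_nil.
    by rewrite mon_cons mxE/= exprS IH.
  rewrite mon_count /sgn normr_prod; apply: eq_bigr => c _.
  by rewrite normrX normrM normrX normrN1 expr1n mul1r ger0_norm ?(ltW H0)// mxE.
have Hw : 0 < H ^+ size w by rewrite exprn_gt0.
rewrite -(ler_pM2r Hw) -nsgn -normrM -key nsgn.
rewrite (_ : _ * S * H ^+ size w = (\sum_(w' <- allwords l) Lam w') * S); last first.
  by field; rewrite gt_eqF.
apply: le_trans (ler_norm_sum _ _ _) _; apply: le_trans (_ : Lam w * S <= _); last first.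
  by rewrite ler_wpM2r.
rewrite /Lam mulr_suml; apply: ler_sum => g _.
by rewrite normrM ler_wpM2l.
Qed.

End WordPolynomials.

Section PolyFunctional.
Variables (R : realType) (d : nat).

Lemma poly_functional_bound (l : nat) : exists2 C : R, 0 <= C &
  forall (f : 'rV[R]_d -> R) (sg : 'I_d -> bool) (H S M : R) (I : finType)
    (u : I -> R) (y : I -> 'rV[R]_d),
  polyw l f -> 0 < H -> H <= 1 ->
  (forall z : 'rV[R]_d, (forall c, 0 <= (-1) ^+ sg c * z ord0 c <= H) -> `|f z| <= S) ->
  (forall w, (size w <= l)%N -> `|\sum_i u i * mon w (y i)| <= M) ->
  `|\sum_i u i * f (y i)| <= C * H ^- l * S * M.
Proof.
have [C C0 coef] := poly_coef_bound R d l.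
exists ((size (allwords d l))%:R * C); first by rewrite mulr_ge0.
move=> f sg H S M I u y pf H0 H1 fS uM.
have [cf [fE cfS]] := coef f sg H S pf H0 fS.
have M0 : 0 <= M by apply: le_trans (uM [::] _).
have S0 : 0 <= S by apply: le_trans (fS 0 _) => // c; rewrite mxE mulr0 lexx ltW.
have -> : \sum_i u i * f (y i) = \sum_(w <- allwords d l) cf w * \sum_i u i * mon w (y i).
  under eq_bigr do rewrite fE mulr_sumr.
  rewrite exchange_big/=; apply: eq_bigr => w _; rewrite mulr_sumr.
  by apply: eq_bigr => i _; ring.
apply: le_trans (ler_norm_sum _ _ _) _.
apply: (@le_trans _ _ (\sum_(w <- allwords d l) C * H ^- l * S * M)).
  rewrite big_seq_cond [leRHS]big_seq_cond; apply: ler_sum => w.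
  rewrite andbT mem_allwords => wl; rewrite normrM ler_pM ?uM//.
  apply: le_trans (cfS w wl) _; rewrite ler_wpM2r// ler_wpM2l//.
  rewrite lef_pV2 ?posrE ?exprn_gt0//.
  by rewrite -(subnKC wl) exprD ler_piMr ?exprn_ge0 ?(ltW H0)// exprn_ile1// ltW.
rewrite big_const_seq count_predT iter_addr_0 -[_ *+ _]mulr_natl.
by rewrite !mulrA.
Qed.

End PolyFunctional.

(** * Multivariate interpolation and norming sets *)

Section MultivariatePolynomials.
Variables (R : realType) (d : nat).
Implicit Types (x y : 'rV[R]_d) (P : mpoly d R).

Lemma polyw_pow l f x0 (r : R) (c : 'I_d) e : polyw l f ->
  polyw (e + l) (fun y => (x0 + r *: y) ord0 c ^+ e * f y).
Proof.
move=> pf; elim: e => [|e IH].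
  by have [L sL fL] := pf; exists L => // y; rewrite expr0 mul1r fL.
have [L sL fL] := polyw_mul_coord (x0 ord0 c) r c IH.
by exists L => // y; rewrite -fL exprS !mxE; ring.
Qed.

Lemma polyw_meval l P x0 (r : R) : (msize P <= l.+1)%N ->
  polyw l (fun y => meval ((x0 + r *: y) ord0) P).
Proof.
move=> Pl; have h : polyw l (fun y => \sum_(m <- msupp P)
    mcoeff m P * \prod_c (x0 + r *: y) ord0 c ^+ m c).
  apply: polyw_sum => m mP; apply: polywZ.
  have : (mdeg m <= l)%N by rewrite -ltnS (leq_trans (msize_mdeg_lt mP)).
  rewrite mdegE => /polywW; apply.
  elim: (index_enum _) => [|c s IH].
    have [L sL fL] := @polyw_cst R d (\sum_(i <- [::]) m i) 1.
    by exists L => // y; rewrite big_nil -fL.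
  have [L sL fL] := polyw_pow x0 r c (m c) IH.
  by exists L => [|y]; rewrite big_cons// -fL.
by have [L sL fL] := h; exists L => // y; rewrite mevalE -fL.
Qed.

Lemma mon_mpoly (w : seq 'I_d) x0 (r : R) : exists2 P : mpoly d R,
  (msize P <= (size w).+1)%N & forall x, meval (x ord0) P = mon w (r *: (x - x0)).
Proof.
elim: w => [|c w [P sP PE]].
  by exists 1; [rewrite msize1|move=> x; rewrite meval1 mon_nil].
pose Q : mpoly d R := r *: (mpolyX R (mnm1 c) - mpolyC d (x0 ord0 c)).
exists (Q * P).
  have sQ : (msize Q <= 2)%N.
    apply: leq_trans (msizeZ_le _ _) _; rewrite msizeE.
    apply/bigmax_leqP_seq => m /msuppB_le; rewrite mem_cat msuppX msuppC => + _.
    by rewrite inE; case/orP => [/eqP ->|]; [rewrite mdeg1|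
      case: ifP => // _; rewrite inE => /eqP ->; rewrite mdeg0].
  have [->|Q0] := eqVneq Q 0; first by rewrite mul0r msize0.
  have [->|P0] := eqVneq P 0; first by rewrite mulr0 msize0.
  rewrite msizeM//; apply: (@leq_trans (2 + (size w).+1).-1) => //.
  by rewrite -!subn1 leq_sub2r// leq_add.
move=> x; rewrite mevalM PE mon_cons /Q mevalZ mevalB mevalXU mevalC.
by rewrite !mxE.
Qed.

Lemma multinom_count (l : nat) : (0 < d)%N -> exists L : seq (multinom d),
  [/\ uniq L, forall m, (m \in L) = (mdeg m <= l)%N & size L = 'C(l + d, l)].
Proof.
move=> d0.
pose B k : seq (multinom d) := [seq s2m (tval t) | t <- enum (basis d k)].
have mB k m : (m \in B k) = (mdeg m == k) by rewrite basis_cover.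
have uB k : uniq (B k) by exact: uniq_basis.
elim: l => [|l [L [uL mL sL]]].
  exists (B 0%N); split => //.
    by move=> m; rewrite mB leqn0.
  by case: d d0 @B mB uB => // n _ B mB uB; rewrite /B size_basis !bin0.
exists (L ++ B l.+1); split.
- rewrite cat_uniq uL uB andbT /=; apply/hasPn => m.
  by rewrite mB mL => /eqP ->; rewrite ltnn.
- by move=> m; rewrite mem_cat mL mB orbC -leq_eqVlt.
- rewrite size_cat sL; case: d d0 @B mB uB {L uL mL sL} => // n _ B mB uB.
  rewrite /B size_basis !addnS [RHS]binS addSn addnC; congr (_ + _)%N.
Qed.

End MultivariatePolynomials.

Section InterpolationWeights.
Variables (R : realType) (d : nat).
Hypothesis d0 : (0 < d)%N.
Implicit Types (x y : 'rV[R]_d) (P : mpoly d R).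

(** The order refines the total degree. If the multi-index of rank [r] had degree above [l], all the
    ['C(l + d, l)] multi-indices of degree at most [l] would be among the first [r], which are too
    few. *)
Lemma mdeg_mindex l r : (r < 'C(l + d, l))%N -> (mdeg (mindex d r) <= l)%N.
Proof.
move=> rl; rewrite /mindex.
set S := [seq bmnm m | m : bmultinom d r.+1]; set T := sort _ S.
have mS (m : multinom d) : (m \in S) = (mdeg m < r.+1)%N.
  apply/idP/idP => [/mapP[b _ ->]|h]; first exact: bmdeg.
  by apply/mapP; exists (BMultinom h) => //; rewrite mem_enum.
have uS : uniq S by rewrite map_inj_uniq ?enum_uniq//; exact: val_inj.
have [rT|rT] := leqP (size T) r; first by rewrite nth_default// mdeg0.
have hT : (mdeg (nth mnm0 T r) < r.+1)%N by rewrite -mS -(mem_sort <=%O) mem_nth.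
have [rl'|lr] := leqP r l; first by rewrite (leq_trans _ rl')// -ltnS.
rewrite leqNgt; apply/negP => hd.
have [L [uL mL sL]] := multinom_count l d0.
have sub : {subset L <= take r T}.
  move=> m; rewrite mL => ml.
  have mT : m \in T by rewrite mem_sort mS (leq_ltn_trans ml)// ltnS ltnW.
  have [h|h] := ltnP (index m T) r; first by rewrite in_take_leq// ltnW.
  have iT : (index m T < size T)%N by rewrite index_mem.
  have := @sorted_leq_nth _ (<=%O : rel (multinom d)) le_trans le_refl mnm0 T (sort_sorted le_total _) r (index m T) rT iT h.
  rewrite nth_index// => /lemc_mdeg h2.
  by move: (leq_trans h2 ml); rewrite leqNgt hd.
have := uniq_leq_size uL sub; rewrite sL size_take rT.
by rewrite leqNgt rl.
Qed.

Variables (p l : nat) (pts : 'I_p -> 'rV[R]_d).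
Hypothesis hp : p = 'C(l + d, l).
Hypothesis uV : vandermonde pts \in unitmx.

Definition interp_weight x : 'rV[R]_p := (monomials p x)^T *m (invmx (vandermonde pts))^T.

Lemma interp_weight_mono x (r : 'I_p) :
  \sum_k interp_weight x ord0 k * monomial (mindex d r) (pts k) = monomial (mindex d r) x.
Proof.
have : vandermonde pts *m (interp_weight x)^T = monomials p x.
  by rewrite /interp_weight trmx_mul !trmxK mulmxA mulmxV// mul1mx.
move/matrixP/(_ r ord0); rewrite !mxE => <-.
by apply: eq_bigr => k _; rewrite !mxE mulrC.
Qed.

(** Equal multi-indices would produce two equal rows in the Vandermonde matrix, against its
    invertibility. *)
Lemma mindex_inj : injective (fun r : 'I_p => mindex d r).
Proof.
move=> r1 r2 e.
have : row r1 (vandermonde pts) = row r2 (vandermonde pts).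
  by apply/rowP => k; rewrite !mxE e.
move/(congr1 (fun M => M *m invmx (vandermonde pts))).
rewrite -!row_mul mulmxV// => /rowP/(_ r2); rewrite !mxE eqxx.
by case: eqVneq => // _ /eqP; rewrite eq_sym oner_eq0.
Qed.

Lemma mindex_cover (m : multinom d) : (mdeg m <= l)%N -> exists r : 'I_p, mindex d r = m.
Proof.
move=> ml; have [L [uL mL sL]] := multinom_count l d0.
have uI : uniq [seq mindex d r | r : 'I_p].
  by rewrite map_inj_uniq ?enum_uniq//; exact: mindex_inj.
have sub : {subset [seq mindex d r | r : 'I_p] <= L}.
  by move=> m' /mapP[r _ ->]; rewrite mL mdeg_mindex// -hp.
have [//|_ e] := uniq_min_size uI sub _.
  by rewrite sL size_map -cardE card_ord hp.
have : m \in L by rewrite mL.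
by rewrite -e => /mapP[r _ ->]; exists r.
Qed.

Lemma interp_weight_meval x P : (msize P <= l.+1)%N ->
  \sum_k interp_weight x ord0 k * meval (pts k ord0) P = meval (x ord0) P.
Proof.
move=> Pl; under eq_bigr do rewrite mevalE mulr_sumr.
rewrite exchange_big/= mevalE big_seq_cond [RHS]big_seq_cond; apply: eq_bigr => m.
rewrite andbT => mP; have ml : (mdeg m <= l)%N by rewrite -ltnS (leq_trans (msize_mdeg_lt mP)).
have [r rm] := mindex_cover ml.
have := interp_weight_mono x r; rewrite rm /monomial => <-; rewrite mulr_sumr.
by apply: eq_bigr => k _; ring.
Qed.

Lemma interp_weight_mon x (r : R) (w : seq 'I_d) : (size w <= l)%N ->
  \sum_k interp_weight x ord0 k * mon w (r *: (pts k - x)) = mon w (0 : 'rV[R]_d).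
Proof.
move=> wl; have [P sP PE] := mon_mpoly w x r.
have := interp_weight_meval x (leq_trans sP (wl : (size w < l.+1)%N)).
rewrite PE subrr scaler0 => <-; apply: eq_bigr => k _.
by rewrite PE.
Qed.

Lemma exists_poly_values (val : 'I_p -> R) : exists2 P : mpoly d R,
  (msize P <= l.+1)%N & forall k, meval (pts k ord0) P = val k.
Proof.
pose q : 'rV[R]_p := (\row_k val k) *m invmx (vandermonde pts).
exists (\sum_r q ord0 r *: mpolyX R (mindex d r)).
  apply: leq_trans (msize_sum _ _ _) _; apply/bigmax_leqP => r _.
  by rewrite (leq_trans (msizeZ_le _ _))// msizeX ltnS mdeg_mindex// -hp.
move=> k; have : q *m vandermonde pts = \row_k val k by rewrite mulmxKV.
move/rowP/(_ k); rewrite !mxE => <-.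
rewrite raddf_sum/=; apply: eq_bigr => r _.
by rewrite mevalZ mevalX !mxE.
Qed.

(** The sum of the absolute weights is the value at [x] of the polynomial that takes their signs at
    the nodes; the norming inequality bounds this polynomial by [cN]. *)
Lemma interp_weight_norm1 x (cN : R) (Om : set 'rV[R]_d) :
  (forall P, (msize P <= l.+1)%N -> (forall k, `|meval (pts k ord0) P| <= 1) ->
    forall y, Om y -> `|meval (y ord0) P| <= cN) ->
  Om x -> \sum_k `|interp_weight x ord0 k| <= cN.
Proof.
move=> hP Omx; have [P sP PE] := exists_poly_values (fun k => Num.sg (interp_weight x ord0 k)).
have -> : \sum_k `|interp_weight x ord0 k| = meval (x ord0) P.
  rewrite -(interp_weight_meval x sP); apply: eq_bigr => k _.
  by rewrite PE mulrC -normrEsg.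
apply: le_trans (ler_norm _) (hP P sP _ x Omx) => k.
by rewrite PE normr_sg lern1 leq_b1.
Qed.

End InterpolationWeights.

Section Norming.
Variables (R : realType) (d : nat).

(** Extracts pointwise bounds from real suprema: boundedness of [Om], through [B], ensures that the
    supremum over [Om] is an upper bound, and for empty [A] the supremum is 0 by convention. *)
Lemma norming_set_bound l (Om A : set 'rV[R]_d) (cN : R) (P : mpoly d R) (n : nat)
    (pts : 'I_n -> 'rV[R]_d) (S : R) (B : R) :
  0 <= cN -> 0 <= S ->
  norming_set l Om A cN -> (forall x, A x -> exists k, pts k = x) ->
  (forall x, Om x -> forall c, `|x ord0 c| <= B) ->
  (msize P <= l.+1)%N -> (forall k, `|meval (pts k ord0) P| <= S) ->
  forall x, Om x -> `|meval (x ord0) P| <= cN * S.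
Proof.
move=> cN0 S0 [AOm hN] hA OmB Pl PS x Omx.
apply: le_trans (_ : _ <= sup [set `|meval (y ord0) P| | y in Om]) _.
  apply: ub_le_sup; last by exists x.
  exists (\sum_(m <- msupp P) `|mcoeff m P| * B ^+ mdeg m) => _ [y Omy <-].
  rewrite mevalE; apply: le_trans (ler_norm_sum _ _ _) _; apply: ler_sum => m _.
  rewrite normrM ler_wpM2l// normr_prod mdegE -prodrXr; apply: ler_prod => c _.
  rewrite normr_ge0 normrX lerXn2r ?nnegrE ?OmB//.
  by apply: le_trans (OmB _ Omy c).
apply: le_trans (hN P Pl) _; rewrite ler_wpM2l//.
have [A0|/set0P An] := eqVneq A set0.
  by rewrite A0 (_ : [set _ | _ in set0] = set0) ?sup0// image_set0.
apply: ge_sup; first by case: An => y Ay; exists `|meval (y ord0) P|, y.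
by move=> _ [y Ay <-]; have [k <-] := hA y Ay.
Qed.

End Norming.

(** * Kriging residuals and conditional variances *)

Section VertexKriging.
Variables (R : realType) (d n : nat) (alpha tau s : R).
Variables (X : 'I_n -> 'rV[R]_d) (pa : 'I_n -> {set 'I_n}).
Hypotheses (d0 : (0 < d)%N) (al0 : 0 < alpha) (tau0 : 0 < tau) (s0 : 0 < s).
Hypotheses (Xinj : injective X) (pa_irr : forall i, i \notin pa i).

Local Notation K := (@matern R d alpha).
Local Notation Y := (fun k : 'I_n => tau *: X k).
Local Notation SP i := (@scaled_parents R d n tau X pa i).
Local Notation kw := (krig_weight alpha tau X pa).
Local Notation kap_ i := (fun a => kriging alpha tau X pa i ord0 a).

Lemma matern_sym (x y : 'rV[R]_d) : K x y = K y x.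
Proof.
have N : norm2 (x - y) = norm2 (y - x).
  rewrite /norm2; congr Num.sqrt; apply: eq_bigr => c _.
  by rewrite -[x - y]opprB mxE sqrrN.
by rewrite /matern eq_sym N.
Qed.

Lemma matern_xx (x : 'rV[R]_d) : K x x = 1. Proof. by rewrite /matern eqxx. Qed.

Lemma exists_separation (I : finType) (x : I -> 'rV[R]_d) (i0 : I) : injective x ->
  exists del : R, [/\ 0 < del, del <= 1 & forall i, i != i0 -> del ^+ 2 <= sqn (x i - x i0)].
Proof.
move=> xinj.
pose del : R := \big[Num.min/1]_(i | i != i0) Num.sqrt (sqn (x i - x i0)).
have pos i : i != i0 -> 0 < Num.sqrt (sqn (x i - x i0)).
  move=> ii0; rewrite sqrtr_gt0 lt_def sqn_ge0 sqn_eq0 subr_eq0 andbT.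
  by apply: contra ii0 => /eqP/xinj ->.
exists del; split.
- rewrite /del; elim/big_ind: _ => // a b a0 b0.
  by rewrite lt_min a0.
- by rewrite /del; apply: bigmin_le_id.
- move=> i ii0; rewrite -[leRHS]sqr_sqrtr ?sqn_ge0// lerXn2r ?nnegrE ?sqrtr_ge0//.
    by rewrite /del; apply/bigmin_geP; split => // j _; exact: sqrtr_ge0.
  by rewrite /del; apply: bigmin_le_cond.
Qed.

Lemma qf_matern_gt0 (I : finType) (x : I -> 'rV[R]_d) (u : I -> R) : injective x ->
  (exists i, u i != 0) -> 0 < qf K u x.
Proof.
move=> xinj [i0 ui0]; have [C C0 hC] := @matern_point_lower R d alpha d0 al0 #|I|.
have [del [del0 del1 sep]] := exists_separation i0 xinj.
have := hC I u x i0 del (max_card _) del0 del1 (fun i ii0 _ => sep i ii0).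
rewrite lt_def qf_matern_ge0// andbT; apply: contraTN => /eqP ->.
by rewrite sqrtr0 mulr0 -ltNge normr_gt0.
Qed.

Lemma parent_mx_unit i :
  matern_mx alpha (SP i) (SP i) \in unitmx.
Proof.
rewrite -row_free_unit; apply: inj_row_free => v vM.
apply/rowP => a; rewrite mxE; apply/eqP; apply: contraT => va.
have inj : injective (SP i).
  move=> a1 a2 /(scalerI (lt0r_neq0 tau0))/Xinj; exact: enum_val_inj.
have := @qf_matern_gt0 _ _ (fun a => v ord0 a) inj (ex_intro _ a va).
rewrite (_ : qf _ _ _ = (v *m matern_mx alpha (SP i)
    (SP i) *m v^T) ord0 ord0).
  by rewrite vM mul0mx mxE ltxx.
rewrite mxE /qf exchange_big; apply: eq_bigr => b _; rewrite !mxE mulr_suml.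
by apply: eq_bigr => c _; rewrite mxE; ring.
Qed.

Lemma kriging_normal i (a : 'I_#|pa i|) :
  \sum_b kap_ i b * K (Y (enum_val b)) (Y (enum_val a)) = K (Y i) (Y (enum_val a)).
Proof.
have := mulmxKV (parent_mx_unit i)
  (matern_mx alpha (scaled_vertex tau X i) (SP i)).
rewrite -/(kriging alpha tau X pa i) => /matrixP/(_ ord0 a); rewrite !mxE => <-.
by apply: eq_bigr => b _; rewrite [X in _ = _ * X]mxE.
Qed.

Lemma krig_sum i (F : 'I_n -> R) :
  \sum_k kw i k * F k = \sum_a kap_ i a * F (enum_val a).
Proof. by rewrite -cond_meanE cond_mean_weight. Qed.

(** The kriging residual as a functional on all the vertices: coefficient 1 at [i] and minus the
    weights at its parents, since [i] is not its own parent. Its Matern form is the conditional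
    variance divided by [s ^+ 2], see [cond_varE]. *)
Definition resid i : 'I_n -> R := fun k => (k == i)%:R - kw i k.

Lemma resid_sum i (F : 'I_n -> R) :
  \sum_k resid i k * F k = F i - \sum_a kap_ i a * F (enum_val a).
Proof.
rewrite -krig_sum; under eq_bigr do rewrite mulrBl.
by rewrite sumrB sum_delta.
Qed.

Lemma resid_orth i (a : 'I_#|pa i|) :
  \sum_k resid i k * K (Y k) (Y (enum_val a)) = 0.
Proof. by rewrite (resid_sum i (fun k => K (Y k) (Y (enum_val a)))) kriging_normal subrr. Qed.

Lemma qf_resid i : qf K (resid i) Y =
  1 - \sum_a kap_ i a * K (Y (enum_val a)) (Y i).
Proof.
rewrite /qf exchange_big/=.
under eq_bigr => j _.
  under eq_bigr => k _ do rewrite mulrAC mulrC.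
  rewrite -mulr_sumr; over.
rewrite (resid_sum i (fun j => \sum_k resid i k * K (Y k) (Y j))).
rewrite [X in _ - X]big1 => [|a _]; last by rewrite resid_orth mulr0.
by rewrite subr0 (resid_sum i (fun k => K (Y k) (Y i))) matern_xx.
Qed.

Lemma cond_varE i : cond_var alpha tau s X pa i = s ^+ 2 * qf K (resid i) Y.
Proof.
rewrite /cond_var qf_resid; congr (_ * _); rewrite 3!mxE /scaled_vertex matern_xx mxE.
by congr (_ - _); apply: eq_bigr => a _; rewrite [X in _ * X]mxE.
Qed.

Lemma resid_self i : resid i i = 1.
Proof. by rewrite /resid eqxx krig_weight0 ?subr0. Qed.

Lemma card_resid_supp i : (#|[pred k | resid i k != 0%R]| <= #|pa i|.+1)%N.
Proof.
apply: (@leq_trans #|i |: pa i|); last by rewrite cardsU1 pa_irr add1n.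
apply: subset_leq_card; apply/fintype.subsetP => k; rewrite inE in_setU1 /resid.
case: (eqVneq k i) => //= ki; apply: contraR => kpa.
by rewrite krig_weight0 ?subrr.
Qed.

Lemma cond_var_gt0 i : 0 < cond_var alpha tau s X pa i.
Proof.
rewrite cond_varE mulr_gt0 ?exprn_gt0//; apply: qf_matern_gt0.
  by move=> a b /(scalerI (lt0r_neq0 tau0))/Xinj.
by exists i; rewrite resid_self oner_neq0.
Qed.

Lemma sum_kap_cov i : \sum_a kap_ i a * K (Y (enum_val a)) (Y i) <= 1.
Proof. by rewrite -subr_ge0 -qf_resid qf_matern_ge0. Qed.

Lemma qf_kap i : qf K (kap_ i) (fun a => Y (enum_val a)) =
  \sum_a kap_ i a * K (Y (enum_val a)) (Y i).
Proof.
rewrite /qf exchange_big/=; apply: eq_bigr => a _.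
rewrite (matern_sym _ (Y i)) -kriging_normal mulr_sumr; apply: eq_bigr => b _.
by ring.
Qed.

(** The variance cancels: a residual bounded by [N] times the norm of its own functional has a cost
    that stays bounded however small the conditional variance is. *)
Lemma resid_sqr_le i (f : 'I_n -> R) (N : R) : 0 <= N ->
  `|\sum_k resid i k * f k| <= N * Num.sqrt (qf K (resid i) Y) ->
  (f i - cond_mean alpha tau X pa i f) ^+ 2 / cond_var alpha tau s X pa i <= N ^+ 2 / s ^+ 2.
Proof.
move=> N0; rewrite resid_sum -cond_meanE => h.
rewrite ler_pdivrMr ?cond_var_gt0// cond_varE.
rewrite mulrA divfK ?expf_neq0 ?gt_eqF// -real_normK ?num_real//.
rewrite -[X in _ <= _ * X](sqr_sqrtr (qf_matern_ge0 al0 _ _)) -exprMn.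
by rewrite lerXn2r ?nnegrE ?mulr_ge0 ?sqrtr_ge0.
Qed.

End VertexKriging.

(** * Taylor polynomials of Hoelder functions *)

Section Taylor.
Variables (R : realType).

(** [u] is on the segment from 0 to [t]; the multiplicative form treats both signs of [t] at
    once. *)
Definition btw (t u : R) : Prop := exists2 th : R, 0 <= th <= 1 & u = th * t.

Lemma mvt_bound (f df : R -> R) (t M : R) :
  (forall u, btw t u -> is_derive u 1 f (df u)) -> (forall u, btw t u -> `|df u| <= M) ->
  `|f t - f 0| <= M * `|t|.
Proof.
move=> hd hM.
have [->|t0] := eqVneq t 0; first by rewrite subrr !normr0 mulr0.
wlog : / exists a b, [/\ a < b, `|f t - f 0| = `|f b - f a|, `|t| = b - a &
   forall u, u \in `[a, b] -> btw t u].
  apply; have [tp|tn] := ltP 0 t.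
    exists 0, t; split => //; first by rewrite subr0 gtr0_norm.
    move=> u; rewrite in_itv/= => /andP[u0 ut]; exists (u / t); last by field.
    by apply/andP; split; [rewrite divr_ge0// ltW|rewrite ler_pdivrMr// mul1r].
  have {}tn : t < 0 by rewrite lt_neqAle t0.
  exists t, 0; split => //; [by rewrite distrC|by rewrite sub0r ltr0_norm|].
  move=> u; rewrite in_itv/= => /andP[u0 ut]; exists (u / t); last by field.
  by apply/andP; split; [rewrite ler_ndivlMr// mul0r|rewrite ler_ndivrMr// mul1r].
move=> [a [b [ab -> -> hb]]].
have [c cab ->] : exists2 c : R, c \in `]a, b[ & f b - f a = df c * (b - a).
  apply: MVT => //.
  - by move=> x xab; apply: hd; apply: hb; move: xab; rewrite !in_itv/= => /andP[/ltW -> /ltW ->].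
  - by apply: derivable_within_continuous => x xab; apply: ex_derive; apply: hd; exact: hb.
rewrite normrM (gtr0_norm (_ : 0 < b - a)) ?subr_gt0// ler_pM2r ?subr_gt0//.
by apply: hM; apply: hb; move: cab; rewrite !in_itv/= => /andP[/ltW -> /ltW ->].
Qed.

Lemma is_derive_taylor (n : nat) (a : nat -> R) (u : R) :
  is_derive u 1 (fun v : R => \sum_(k < n.+1) a k * (v ^+ k / k`!%:R))
    (\sum_(k < n) a k.+1 * (u ^+ k / k`!%:R)).
Proof.
elim: n => [|n IH].
  rewrite big_ord0.
  have -> : (fun v : R => \sum_(k < 1) a k * (v ^+ k / k`!%:R)) = cst (a 0%N).
    by apply/funext => v; rewrite big_ord1 expr0 fact0 divr1 mulr1.
  exact: is_derive_cst.
have -> : (fun v : R => \sum_(k < n.+2) a k * (v ^+ k / k`!%:R)) =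
   (fun v : R => \sum_(k < n.+1) a k * (v ^+ k / k`!%:R)) +
   (a n.+1 / (n.+1)`!%:R) *: ((@id R) ^+ n.+1).
  apply/funext => v; rewrite big_ord_recr/=; congr (_ + _).
  by rewrite exprfctE; rewrite /GRing.scale/= mulrCA mulrC.
rewrite [in X in is_derive _ _ _ X]big_ord_recr/=.
have dX := is_deriveX n.+1 (is_derive_id u (1 : R)).
have X := is_deriveD IH (is_deriveZ (a n.+1 / (n.+1)`!%:R) dX).
apply: (is_derive_eq X); congr (_ + _).
rewrite /GRing.scale/= mulr1 factS natrM.
have h1 : n`!%:R != 0 :> R by rewrite pnatr_eq0 gtn_eqF// fact_gt0.
have h2 : n.+1%:R != 0 :> R by rewrite pnatr_eq0.
by field; apply/andP.
Qed.

Lemma btw_trans (t u v : R) : btw t u -> btw u v -> btw t v.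
Proof.
move=> [a /andP[a0 a1] ->] [b /andP[b0 b1] ->]; exists (b * a); last by ring.
by rewrite mulr_ge0//= mulr_ile1.
Qed.

Lemma btw_abs (t u : R) : btw t u -> `|u| <= `|t|.
Proof.
by move=> [a /andP[a0 a1] ->]; rewrite normrM ger0_norm// ler_piMl.
Qed.

(** [F k] stands for the derivative of order [k]. The remainder vanishes at 0 and its derivative is
    the remainder of the shifted family, so [mvt_bound] gains one power of [t] at each step. *)
Lemma taylor1 (m : nat) (F : nat -> R -> R) (t b0 : R) :
  (forall k u, (k < m)%N -> btw t u -> is_derive u 1 (F k) (F k.+1 u)) ->
  (forall u, btw t u -> `|F m u - F m 0| <= `|u| `^ b0) -> 0 <= b0 ->
  `|F 0%N t - \sum_(k < m.+1) F k 0 * (t ^+ k / k`!%:R)| <= `|t| ^+ m * `|t| `^ b0.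
Proof.
move=> hd hh b00; elim: m F t hd hh => [|m IH] F t hd hh.
  rewrite big_ord1 expr0 fact0 divr1 mulr1 mul1r; apply: hh.
  by exists 1; rewrite ?ler01 ?lexx// mul1r.
pose f (u : R) : R := F 0%N u - \sum_(k < m.+2) F k 0 * (u ^+ k / k`!%:R).
pose df (u : R) : R := F 1%N u - \sum_(k < m.+1) F k.+1 0 * (u ^+ k / k`!%:R).
have f0 : f 0 = 0.
  rewrite /f big_ord_recl/= expr0 fact0 divr1 mulr1 big1 ?addr0 ?subrr// => k _.
  by rewrite exprS !mul0r mulr0.
have := @mvt_bound f df t (`|t| ^+ m * `|t| `^ b0).
rewrite f0 subr0 -/(f t) => X.
have -> : `|t| ^+ m.+1 * `|t| `^ b0 = `|t| ^+ m * `|t| `^ b0 * `|t| by rewrite exprS; ring.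
apply: X.
- move=> u tu; have hF := hd 0%N u (ltn0Sn m) tu.
  exact: (is_deriveB hF (is_derive_taylor m.+1 (fun k => F k 0) u)).
- move=> u tu.
  apply: (le_trans (IH (fun k => F k.+1) u _ _)).
  + by move=> k v km uv; apply: hd => //; exact: btw_trans uv.
  + by move=> v uv; apply: hh; exact: btw_trans uv.
  + by apply: ler_pM; rewrite ?exprn_ge0 ?powR_ge0// ?lerXn2r ?nnegrE ?btw_abs// ge0_ler_powR ?nnegrE// btw_abs.
Qed.
End Taylor.

Section Whitney.
Variables (R : realType) (d : nat).
Implicit Types (x y z e : 'rV[R]_d) (g h : 'rV[R]_d -> R).

Local Notation ev c := (delta_mx (ord0 : 'I_1) (c : 'I_d) : 'rV[R]_d).

Definition inner x : Prop := forall c : 'I_d, 0 < x ord0 c < 1.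

Definition holder_on (m : nat) (b0 : R) g : Prop :=
  [/\ forall s c x, (size s < m)%N -> inner x -> derivable (pderiv s g) x (ev c),
      forall s x, (size s <= m)%N -> inner x -> `|pderiv s g x| <= 1 &
      forall s x y, size s = m -> inner x -> inner y ->
        `|pderiv s g x - pderiv s g y| <= norm2 (x - y) `^ b0].

Lemma holder_on_pderiv m b0 g s0 : (size s0 <= m)%N -> holder_on m b0 g ->
  holder_on (m - size s0) b0 (pderiv s0 g).
Proof.
move=> sm [hd hb hh].
have E s : pderiv s (pderiv s0 g) = pderiv (s ++ s0) g by rewrite /pderiv foldr_cat.
split => [s c x|s x|s x y] ss; rewrite E; [apply: hd|apply: hb|apply: hh];
  rewrite size_cat; lia.
Qed.

Lemma is_derive_line h z v (u : R) : derivable h (z + u *: v) v ->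
  is_derive u 1 (fun w : R => h (z + w *: v)) ('D_v h (z + u *: v)).
Proof.
move=> hd.
have E : (fun k : R => k^-1 *: (((fun w : R => h (z + w *: v)) \o shift u) (k *: (1 : R)) -
    h (z + u *: v))) =
  (fun k : R => k^-1 *: ((h \o shift (z + u *: v)) (k *: v) - h (z + u *: v))).
  apply/funext => k /=; congr (_ *: (h _ - _)).
  by rewrite -[k *: (1 : R)]/(k * 1) mulr1 scalerDl addrCA.
by split; rewrite /derivable/derive E.
Qed.

Lemma norm2_ev (t : R) (c : 'I_d) : norm2 (t *: ev c) = `|t|.
Proof.
rewrite /norm2 (bigD1 c)//= big1 => [|k kc]; first by rewrite !mxE !eqxx mulr1 addr0 sqrtr_sqr.
by rewrite !mxE (negbTE kc) andbF mulr0 expr0n.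
Qed.

Lemma polyw_mul_powcoord l (f : 'rV[R]_d -> R) (c : 'I_d) k : polyw l f ->
  polyw (k + l) (fun y => y ord0 c ^+ k * f y).
Proof.
move=> pf; elim: k => [|k IH].
  have [L sL fL] := pf; exists L => // y; rewrite expr0 mul1r; exact: fL.
have [L sL fL] := polyw_mul_coord 0 1 c IH.
by exists L => // y; rewrite -fL exprS; ring.
Qed.

(** The coordinates in [cs], those in which [z] may differ from the centre [e], are treated one at a
    time: [g] is expanded along [c], and the pure derivatives along [c] are then expanded in the
    remaining coordinates by induction. The order [m] varies because these derivatives have less
    smoothness; [q] keeps the constant uniform. *)
Lemma taylor_coords (q : nat) (b0 : R) (cs : seq 'I_d) : 0 <= b0 -> uniq cs ->
  exists2 C : R, 0 <= C & forall m g e, (m <= q)%N -> holder_on m b0 g -> inner e ->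
  exists P, [/\ polyw m P,
    forall y y', (forall c, c \in cs -> y ord0 c = y' ord0 c) -> P y = P y' &
    forall z, inner z -> (forall c, c \notin cs -> z ord0 c = e ord0 c) ->
    forall del, 0 < del -> (forall c, `|z ord0 c - e ord0 c| <= del) ->
      `|g z - P (z - e)| <= C * (del ^+ m * del `^ b0)].
Proof.
move=> b00; elim: cs => [_|c cs IH /= /andP[ccs ucs]].
  exists 0 => // m g e mq hg ie; exists (fun=> g e); split => //.
    exact: polyw_cst.
  move=> z iz ze del del0 hz; rewrite mul0r.
  suff -> : z = e by rewrite subrr normr0.
  by apply/rowP => c; exact: ze.
have {IH ucs} [C C0 hC] := IH ucs.
exists (1 + q.+1%:R * C); first by rewrite addr_ge0// mulr_ge0.
move=> m g e mq hg ie.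
have hPk (k : 'I_m.+1) : exists P, [/\ polyw (m - k) P,
    forall y y', (forall c, c \in cs -> y ord0 c = y' ord0 c) -> P y = P y' &
    forall z, inner z -> (forall c, c \notin cs -> z ord0 c = e ord0 c) ->
    forall del, 0 < del -> (forall c, `|z ord0 c - e ord0 c| <= del) ->
      `|pderiv (nseq k c) g z - P (z - e)| <= C * (del ^+ (m - k) * del `^ b0)].
  apply: hC => //; first by lia.
  have := @holder_on_pderiv m b0 g (nseq k c) _ hg.
  by rewrite size_nseq; apply; rewrite -ltnS.
have [Pk {hPk}hPk] := choice hPk.
exists (fun y => \sum_(k < m.+1) (k`!%:R)^-1 * (y ord0 c ^+ k * Pk k y)); split.
- apply: polyw_sum => k _; apply: polywZ.
  have [pk _ _] := hPk k.
  have := polyw_mul_powcoord c k pk; rewrite subnKC -1?ltnS//; exact.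
- move=> y y' hyy; apply: eq_bigr => k _; have [_ hk _] := hPk k.
  rewrite (hyy c) ?mem_head//; congr (_ * (_ * _)); apply: hk => c' c'cs.
  by apply: hyy; rewrite in_cons c'cs orbT.
move=> z iz ze del del0 hz.
(* [z'] is [z] with its coordinate [c] reset to that of [e]. The polynomials [Pk] ignore this
   coordinate, so their values at [z' - e] and [z - e] agree. *)
pose t := z ord0 c - e ord0 c; pose z' := z - t *: ev c.
have z'E c' : z' ord0 c' = if c' == c then e ord0 c else z ord0 c'.
  rewrite /z' !mxE /=; have [->|cc] := eqVneq c' c.
    by rewrite ?eqxx /= mulr1 /t subKr.
  by rewrite ?andbF mulr0 subr0.
have iz' : inner z' by move=> c'; rewrite z'E; case: eqP => _; [exact: ie|exact: iz].
have zE : z = z' + t *: ev c by rewrite subrK.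
have hz' c' : `|z' ord0 c' - e ord0 c'| <= del.
  by rewrite z'E; case: eqP => [->|_]; [rewrite subrr normr0 ltW|exact: hz].
have z'e c' : c' \notin cs -> z' ord0 c' = e ord0 c'.
  move=> c'cs; rewrite z'E; case: eqP => [->//|/eqP cc].
  by apply: ze; rewrite in_cons negb_or cc.
have seg u : btw t u -> inner (z' + u *: ev c).
  move=> [th /andP[th0 th1] ->] c'; rewrite mxE z'E !mxE /=; have [_|cc] := eqVneq c' c; last first.
    by rewrite mulr0 addr0; exact: iz.
  rewrite mulr1 /t.
  have /andP[e0 e1] := ie c; have /andP[z0 z1] := iz c.
  move: (e ord0 c) (z ord0 c) e0 e1 z0 z1 => a b a0 a1 b0' b1.
  have th2 : 0 <= 1 - th by rewrite subr_ge0.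
  have [ab|/ltW ab] := lerP a b.
    have h1 : 0 <= th * (b - a) by rewrite mulr_ge0// subr_ge0.
    have h2 : 0 <= (1 - th) * (b - a) by rewrite mulr_ge0// subr_ge0.
    by apply/andP; split; lra.
  have h1 : 0 <= th * (a - b) by rewrite mulr_ge0// subr_ge0.
  have h2 : 0 <= (1 - th) * (a - b) by rewrite mulr_ge0// subr_ge0.
  by apply/andP; split; lra.
have td : `|t| <= del by exact: hz.
have main : `|g z - \sum_(k < m.+1) pderiv (nseq k c) g z' * (t ^+ k / k`!%:R)| <=
    del ^+ m * del `^ b0.
  have [hd hb hh] := hg.
  pose F (k : nat) (u : R) : R := pderiv (nseq k c) g (z' + u *: ev c).
  have := @taylor1 R m F t b0; rewrite /F !scale0r !addr0/= -zE => X.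
  apply: le_trans (X _ _ b00) _ => [k u km tu|u tu|].
  - have := @is_derive_line (pderiv (nseq k c) g) z' (ev c) u; apply.
    by apply: hd; rewrite ?size_nseq//; exact: seg.
  - apply: le_trans (hh _ _ _ _ _ _) _; rewrite ?size_nseq//; first exact: seg.
    by rewrite addrAC subrr add0r norm2_ev.
  - by apply: ler_pM; rewrite ?exprn_ge0 ?powR_ge0// ?lerXn2r ?nnegrE ?(ltW del0)// ge0_ler_powR ?nnegrE// ltW.
rewrite mulrDl mul1r.
have -> : g z - \sum_(k < m.+1) (k`!%:R)^-1 * ((z - e) ord0 c ^+ k * Pk k (z - e)) =
  (g z - \sum_(k < m.+1) pderiv (nseq k c) g z' * (t ^+ k / k`!%:R)) +
  \sum_(k < m.+1) (t ^+ k / k`!%:R) * (pderiv (nseq k c) g z' - Pk k (z' - e)).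
  rewrite -addrA; congr (_ + _); rewrite -!sumrN -big_split/=; apply: eq_bigr => k _.
  have [_ hk _] := hPk k.
  have -> : Pk k (z' - e) = Pk k (z - e).
    apply: hk => c' c'cs; rewrite mxE z'E [RHS]mxE; case: eqP => // cc.
    by move: ccs; rewrite -cc c'cs.
  by rewrite !mxE -/t; ring.
apply: le_trans (ler_normD _ _) _; apply: lerD => //.
apply: le_trans (ler_norm_sum _ _ _) _.
apply: (@le_trans _ _ (\sum_(k < m.+1) C * (del ^+ m * del `^ b0))); last first.
  rewrite sumr_const card_ord -[leLHS]mulr_natl -[leRHS]mulrA ler_wpM2r ?ler_nat//.
  by rewrite !mulr_ge0 ?powR_ge0 ?exprn_ge0 ?(ltW del0).
apply: ler_sum => k _; have [_ _ hk] := hPk k.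
rewrite normrM normrM.
have hk1 : `|(k`!%:R : R)^-1| <= 1.
  by rewrite ger0_norm ?invr_ge0// invf_le1 ?ler1n ?ltr0n ?fact_gt0.
have hk2 : `|t ^+ k| <= del ^+ k by rewrite normrX lerXn2r ?nnegrE// ltW.
have hk3 := hk z' iz' z'e del del0 hz'.
have km : del ^+ m = del ^+ k * del ^+ (m - k) by rewrite -exprD subnKC// -ltnS.
rewrite km.
have -> : C * (del ^+ k * del ^+ (m - k) * del `^ b0) =
  del ^+ k * 1 * (C * (del ^+ (m - k) * del `^ b0)) by ring.
by rewrite !ler_pM.
Qed.

Lemma strict_floorP (a : R) : 0 < a ->
  (strict_floor a)%:R < a <= (strict_floor a).+1%:R.
Proof.
move=> a0; rewrite /strict_floor.
have := ceil_itv a; have : 0 <= Num.ceil a - 1 by rewrite subr_ge0 -gtz0_ge1 ceil_gt0.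
case: (Num.ceil a - 1) (subrK 1 (Num.ceil a)) => // k <- _ /=.
by rewrite -natr1 intrD.
Qed.

Lemma inner_interior x : inner x -> (@unit_cube R d)° x.
Proof.
move=> ix; rewrite /interior/=.
have : nbhs x (fun y : 'rV[R]_d => forall c : 'I_d, y ord0 c \in `]0, 1[%R).
  apply: (@filter_forall _ _ (fun c (y : 'rV[R]_d) => y ord0 c \in `]0, 1[%R) (nbhs x)) => c.
  have hc : x ord0 c \in `]0, 1[%R by rewrite in_itv/= ix.
  exact: (@coord_continuous R 1 d ord0 c x _ (near_in_itvoo hc)).
apply: filterS => y hy c; have := hy c; rewrite in_itv/= => /andP[/ltW -> /ltW ->//].
Qed.

Lemma holder_ball_on (b : R) f : (0 < d)%N -> 0 < b -> holder_ball b f ->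
  holder_on (strict_floor b) (b - (strict_floor b)%:R) f.
Proof.
move=> d0 b0 [_ hd hn].
rewrite /holder_norm in hn.
set A := ereal_sup _ in hn; set B := ereal_sup _ in hn.
(* These two inner points show that both suprema of the norm are nonnegative, so that each of them,
   and not only their sum, is at most 1. *)
pose p1 : 'rV[R]_d := const_mx (1 / 2); pose p2 : 'rV[R]_d := const_mx (1 / 4).
have i1 : inner p1 by move=> c; rewrite mxE; apply/andP; split; lra.
have i2 : inner p2 by move=> c; rewrite mxE; apply/andP; split; lra.
have A0 : (0 <= A)%E.
  apply: (@le_trans _ _ (`|pderiv [::] f p1|)%:E); first by rewrite lee_fin.
  by apply: ereal_sup_ubound; exists [::], p1; split => //; exact: inner_interior.
have B0 : (0 <= B)%E.
  pose s := nseq (strict_floor b) (Ordinal d0).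
  apply: (@le_trans _ _ (`|pderiv s f p1 - pderiv s f p2| /
              norm2 (p1 - p2) `^ (b - (strict_floor b)%:R))%:E).
    by rewrite lee_fin divr_ge0// powR_ge0.
  apply: ereal_sup_ubound; exists s, p1, p2; split => //; try exact: inner_interior.
    by rewrite size_nseq.
  apply/eqP => /rowP/(_ (Ordinal d0)); rewrite !mxE; lra.
have A1 : (A <= 1)%E by apply: le_trans hn; rewrite leeDl.
have B1 : (B <= 1)%E by apply: le_trans hn; rewrite leeDr.
split.
- by move=> s c x ss ix; apply: hd => //; exact: inner_interior.
- move=> s x ss ix; rewrite -lee_fin; apply: le_trans A1.
  by apply: ereal_sup_ubound; exists s, x; split => //; exact: inner_interior.
- move=> s x y ss ix iy; have [->|xy] := eqVneq x y; first by rewrite subrr normr0 powR_ge0.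
  have n0 : 0 < norm2 (x - y) `^ (b - (strict_floor b)%:R).
    apply: powR_gt0; rewrite lt_neqAle sqrtr_ge0 andbT eq_sym; apply/eqP => n0.
    have : sqn (x - y) == 0 by rewrite -sqr_norm2 n0 expr0n.
    by rewrite sqn_eq0 subr_eq0 (negbTE xy).
  rewrite -[leRHS]mul1r -ler_pdivrMr// -lee_fin; apply: le_trans B1.
  by apply: ereal_sup_ubound; exists s, x, y; split => //; exact: inner_interior.
Qed.

Lemma polyw_scale l (f : 'rV[R]_d -> R) (r : R) : polyw l f -> polyw l (fun y => f (r *: y)).
Proof.
move=> [L sL fL]; exists [seq (p.1 * r ^+ size p.2, p.2) | p <- L]; first by rewrite /wsize all_map.
by move=> y; rewrite fL /wpoly big_map; apply: eq_bigr => p _; rewrite /= monZ mulrA.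
Qed.

Lemma polyw_shift l (f : 'rV[R]_d -> R) v : polyw l f -> polyw l (fun y => f (y + v)).
Proof.
move=> [L sL fL].
have [L' sL' E] : polyw l (fun y => \sum_(p <- L) p.1 * mon p.2 (y + v)).
  apply: (@polyw_sum _ _ _ _ L (fun p y => p.1 * mon p.2 (y + v))) => p pL; apply: polywZ.
  apply: (polywW (allP sL _ pL)); elim: p.2 => [|c w IH].
    by have [L0 s0 E0] := polyw_cst d 0 (1 : R); exists L0 => // y; rewrite mon_nil; exact: E0.
  have [L' sL' E] := polyw_mul_coord (v ord0 c) 1 c IH.
  by exists L' => // y; rewrite -E mon_cons mxE mul1r addrC.
by exists L' => // y; rewrite -E fL.
Qed.

Definition shrink (r : R) x : 'rV[R]_d := const_mx (1 / 2) + (1 - r) *: (x - const_mx (1 / 2)).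

Lemma shrink_sub (r : R) x y : shrink r x - shrink r y = (1 - r) *: (x - y).
Proof. by rewrite /shrink opprD addrACA subrr add0r -scalerBr opprB addrA subrK. Qed.

Lemma inner_shrink (r : R) x : 0 < r -> r < 1 -> unit_cube x -> inner (shrink r x).
Proof.
move=> r0 r1 ux c; rewrite !mxE; have /andP[x0 x1] := ux c.
have h : 0 <= (1 - r) * x ord0 c by rewrite mulr_ge0// subr_ge0 ltW.
have h' : 0 <= (1 - r) * (1 - x ord0 c) by apply: mulr_ge0; lra.
by apply/andP; split; lra.
Qed.

Lemma shrink_approx (f : 'rV[R]_d -> R) (I : finType) (X : I -> 'rV[R]_d) (eps : R) :
  {within @unit_cube R d, continuous f} -> (forall i, unit_cube (X i)) -> 0 < eps ->
  exists r : R, [/\ 0 < r, r < 1 & forall i, `|f (shrink r (X i)) - f (X i)| <= eps].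
Proof.
move=> fc uX e0.
have : \forall r \near (0 : R)^'+, forall i, `|f (shrink r (X i)) - f (X i)| <= eps.
  apply: (@filter_forall _ _ (fun i (r : R) => `|f (shrink r (X i)) - f (X i)| <= eps)) => i.
  have /subspace_continuousP/(_ (X i) (uX i)) fi := fc.
  have sc : (shrink^~ (X i)) r @[r --> (0 : R)^'+] --> within (@unit_cube R d) (nbhs (X i)).
    have s0 : shrink^~ (X i) r @[r --> (0 : R)^'+] --> X i.
      have E : X i = shrink 0 (X i) by rewrite /shrink subr0 scale1r addrC subrK.
      rewrite [X in _ --> X]E; apply: cvg_at_right_filter.
      apply: cvgD; first exact: cvg_cst.
      apply: cvgZr_tmp.
      by apply: cvgB; [exact: cvg_cst|exact: cvg_id].
    move=> A /= hA.
    have H1 : \forall r \near (0 : R)^'+, unit_cube (shrink r (X i)).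
      near=> r => c; have r0 : 0 < r by near: r; exact: nbhs_right_gt.
      have r1 : r < 1 by near: r; exact: nbhs_right_lt.
      by have /andP[/ltW -> /ltW ->] := inner_shrink r0 r1 (uX i) c.
    have H2 : \forall r \near (0 : R)^'+, unit_cube (shrink r (X i)) -> A (shrink r (X i)).
      exact: (s0 _ hA).
    rewrite /nbhs/=; apply: filterS2 H1 H2 => r h1 h2; exact: h2.
  have := cvg_comp _ _ sc fi.
  move=> /cvgrPdist_le/(_ _ e0); apply: filterS => r /=; by rewrite distrC.
move=> h.
near (0 : R)^'+ => r; exists r; split; [near: r; exact: nbhs_right_gt|near: r; exact: nbhs_right_lt|near: r; exact: h].
Unshelve. all: by end_near.
Qed.

Lemma powRD_nat (x : R) (m : nat) (b0 : R) : 0 < x -> x ^+ m * x `^ b0 = x `^ (m%:R + b0).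
Proof. by move=> x0; rewrite powRD ?powR_mulrn ?(ltW x0)// lt0r_neq0// implybT. Qed.

(* The functions of the Hoelder ball are only differentiable inside the cube:
   composing with a slight contraction of the cube gives Taylor polynomials at
   every point of the closed cube. *)
Lemma whitney (b : R) : (0 < d)%N -> 0 < b -> exists2 C : R, 0 <= C &
  forall f, holder_ball b f -> forall (I : finType) (X : I -> 'rV[R]_d) (eps : R),
  (forall i, unit_cube (X i)) -> 0 < eps ->
  exists f1, [/\ forall i, `|f1 (X i) - f (X i)| <= eps,
    forall x, unit_cube x -> `|f1 x| <= 1 &
    forall e, unit_cube e -> exists2 P, polyw (strict_floor b) P &
      forall x (del : R), unit_cube x -> 0 < del ->
        (forall c, `|x ord0 c - e ord0 c| <= del) ->
        `|f1 x - P (x - e)| <= C * del `^ b].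
Proof.
move=> d0 b0; set q := strict_floor b.
have /andP[qb bq] := strict_floorP b0.
have b00 : 0 <= b - q%:R by rewrite subr_ge0 ltW.
have [C C0 hC] := taylor_coords q b00 (enum_uniq 'I_d).
exists C => // f hf I X eps uX e0.
have [fc _ _] := hf.
have [r [r0 r1 hr]] := shrink_approx fc uX e0.
have hg := holder_ball_on d0 b0 hf.
exists (fun x => f (shrink r x)); split => //.
  by move=> x ux; have [_ hb _] := hg; apply: (hb [::]) => //; exact: inner_shrink.
move=> e ue.
have [P [Pq _ hP]] := hC q f (shrink r e) (leqnn q) hg (inner_shrink r0 r1 ue).
exists (fun y => P ((1 - r) *: y)); first exact: polyw_scale.
move=> x del ux del0 hx.
have X0 : b = q%:R + (b - q%:R) by rewrite addrC subrK.
rewrite [in X in _ `^ X]X0 -powRD_nat// -shrink_sub; apply: hP => //.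
- exact: inner_shrink.
- by move=> c; rewrite mem_enum.
- move=> c; have -> : shrink r x ord0 c - shrink r e ord0 c = (1 - r) * (x ord0 c - e ord0 c).
    have := congr1 (fun M : 'rV[R]_d => M ord0 c) (shrink_sub r x e).
    by rewrite !mxE.
  have r1' : 0 <= 1 - r by rewrite subr_ge0 ltW.
  rewrite normrM ger0_norm//; apply: le_trans (hx c).
  by rewrite ler_piMl// lerBlDr lerDl ltW.
Qed.
End Whitney.

(** * Clusters and extension from the early vertices *)

Section ClusterLift.
Variables (R : realType) (d : nat) (a : R).
Hypotheses (d0 : (0 < d)%N) (a0 : 0 < a).
Implicit Types (x y z : 'rV[R]_d).

Local Notation K := (@matern R d a).

Lemma dot_self x : dot x x = sqn x.
Proof. by rewrite /dot /sqn; apply: eq_bigr => c _; rewrite expr2. Qed.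

Lemma dotZr x y (r : R) : dot x (r *: y) = r * dot x y.
Proof. by rewrite /dot mulr_sumr; apply: eq_bigr => c _; rewrite mxE mulrCA. Qed.

Lemma mon0 (w : seq 'I_d) : mon w (0 : 'rV[R]_d) = (w == [::])%:R.
Proof. by case: w => [|c w]; rewrite ?mon_nil// mon_cons mxE mul0r. Qed.

(* Gaussian bumps of width [del], multiplied by factors that vanish at the
   points of the other clusters, are glued by
   [sum_k D_k phi_k prod_(k' before k) (1 - phi_k')]. *)
Lemma cluster_lift (q p : nat) : exists2 C : R, 0 < C &
  forall (I : finType) (z : I -> 'rV[R]_d) (cls : I -> I) (cf : I -> seq 'I_d -> R)
    (D : I -> 'rV[R]_d -> R) (M del : R),
  (#|I| <= p)%N -> 0 < del -> del <= 1 -> 0 <= M ->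
  (forall i j, cls i != cls j -> del ^+ 2 <= sqn (z i - z j)) ->
  (forall i y, D i y = \sum_(w <- allwords d q) cf i w * mon w (y - z i)) ->
  (forall i w, (size w <= q)%N -> `|cf i w| <= M * del ^- size w) ->
  (forall i j y, cls i = cls j -> D i y = D j y) ->
  forall u : I -> R,
    `|\sum_i u i * D i (z i)| <= C * M * del `^ (- a) * Num.sqrt (qf K u z).
Proof.
pose P := (q + p)%N.
pose Nf : R := 2 * Num.sqrt P`!%:R * (1 + 2 * d%:R) ^+ p.
have Nf0 : 0 < Nf.
  apply: mulr_gt0; first by rewrite mulr_gt0// sqrtr_gt0 ltr0n fact_gt0.
  by apply: exprn_gt0; rewrite ltr_wpDr// mulr_ge0.
pose nw : R := (size (allwords d q))%:R.
pose C1 : R := nw * (Nf * 2 ^+ q) * (1 + Nf) ^+ p * Cmat d a * (p.+1%:R `^ (a / 2)).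
have C10 : 0 <= C1.
  rewrite !mulr_ge0 ?exprn_ge0 ?powR_ge0 ?addr_ge0 ?(ltW Nf0)//.
  by rewrite ltW// Cmat_gt0.
exists (p%:R * C1 + 1); first by rewrite ltr_wpDl// mulr_ge0.
move=> I z cls cf D M del Ip del0 del1 M0 sp DE cfM Dcls u.
pose v k b : 'rV[R]_d := (sqn (z b - z k))^-1 *: (z b - z k).
pose A k := [seq v k b | b <- enum I & cls b != cls k].
pose phi k y := ge (del ^+ 2) (y - z k) * sep (A k) (y - z k).
pose L k (r : seq I) := [seq phi k' | k' <- r & cls k' == cls k].
pose fix S (r : seq I) : 'rV[R]_d -> R := match r with
  | [::] => fun=> 0
  | k :: r' => fun y => S r' y + D k y * phi k y * \prod_(f <- L k r') (1 - f y)
  end.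
have phi1 k : phi k (z k) = 1.
  have sq0 : sqn (0 : 'rV[R]_d) = 0 by rewrite -dot_self /dot big1// => c _; rewrite mxE mul0r.
  rewrite /phi subrr /ge sq0 mul0r oppr0 expR0 mul1r /sep big1_seq// => w _.
  by rewrite /dot big1 ?subr0// => c _; rewrite mxE mul0r.
have sqpos i k : cls i != cls k -> 0 < sqn (z i - z k).
  by move=> ik; apply: lt_le_trans (sp i k ik); rewrite exprn_gt0.
have phi0 i k : cls i != cls k -> phi k (z i) = 0.
  move=> ik; rewrite /phi /sep (big_rem (v k i))/=; last first.
    by apply/mapP; exists i => //; rewrite mem_filter ik mem_enum.
  by rewrite dotZr dot_self mulVf ?gt_eqF ?sqpos// subrr mul0r mulr0.
(* At a point of the cluster of [i], bumps centred in other clusters vanish and the polynomials of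
   its own cluster agree with [D i], so the sum telescopes. Once [i] belongs to [r], the product
   contains the factor [1 - phi i (z i) = 0]. *)
have SE i (r : seq I) : S r (z i) = D i (z i) *
    (1 - \prod_(k <- r | cls k == cls i) (1 - phi k (z i))).
  elim: r => [|k r IH] /=; first by rewrite big_nil subrr mulr0.
  rewrite IH big_cons; case: ifPn => [/eqP ki|ki].
    rewrite (Dcls k i)// /L big_map big_filter ki.
    set X := \prod_(_ <- _ | _) _; ring.
  by rewrite (phi0 i k) ?mulr0 ?mul0r ?addr0// eq_sym.
have {}hS (r : seq I) : (size r <= p)%N -> hle K ((size r)%:R * (C1 * M * del `^ (- a))) (S r).
  have s0 : 0 < del ^+ 2 by rewrite exprn_gt0.
  have s1 : del ^+ 2 <= 1 by rewrite exprn_ile1// ltW.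
  have sq : Num.sqrt (del ^+ 2) = del by rewrite sqrtr_sqr gtr0_norm.
  have vb k v' : v' \in A k -> forall c, `|v' ord0 c| <= del^-1.
    move=> /mapP[b]; rewrite mem_filter => /andP[bk _] -> c; have b0 := sqpos _ _ bk.
    rewrite mxE normrM ger0_norm ?invr_ge0 ?(ltW b0)// mulrC ler_pdivrMr//.
    rewrite ler_pdivlMl//; set t := `|_|.
    have t2 : t ^+ 2 <= sqn (z b - z k) by exact: norm_coord_le_sqn.
    rewrite -ler_sqr ?nnegrE ?mulr_ge0 ?(ltW del0) ?(ltW b0) ?normr_ge0// exprMn.
    by rewrite [leRHS]expr2 ler_pM ?sqr_ge0// sp.
  have sA k : (size (A k) <= p)%N.
    by rewrite size_map size_filter (leq_trans (count_size _ _))// -cardE.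
  have dth : 1 + d%:R * del^-1 * (2 * Num.sqrt (del ^+ 2)) = 1 + 2 * d%:R.
    by rewrite sq; field; rewrite gt_eqF.
  have c1 : 1 <= 1 + 2 * d%:R :> R by rewrite lerDl mulr_ge0.
  have hmon k (w : seq 'I_d) (t : R) : (size w <= q)%N -> kap R d * del ^+ 2 <= t <= del ^+ 2 ->
      hle (gk t) (Nf * (2 * del) ^+ size w)
        (fun y => ge (del ^+ 2) (y - z k) * mon w (y - z k) * sep (A k) (y - z k)).
    move=> wq /andP[t1 t2]; have t0 : 0 < t by apply: lt_le_trans t1; rewrite mulr_gt0 ?kap_gt0.
    apply: (@hle_shift _ _ _ _ (fun y => ge (del ^+ 2) y * mon w y * sep (A k) y)).
    apply: hleW (@hle_sep R d d0 (del ^+ 2) t del^-1 P w (A k) t0 t2 t1 _ _ (vb k)).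
    - rewrite dth sq /Nf [leRHS]mulrAC ler_wpM2l ?mulr_ge0 ?exprn_ge0 ?mulr_ge0 ?sqrtr_ge0 ?(ltW del0)//.
      by rewrite ler_weXn2l.
    - by rewrite invr_ge0 ltW.
    - by rewrite /P leq_add.
  have hphi k r' f : List.In f (L k r') -> forall t, kap R d * del ^+ 2 <= t <= del ^+ 2 ->
    hle (gk t) Nf f.
    rewrite /L; elim: [seq _ <- _ | _] => //= k' s' IHs [<-|/IHs//] t ht.
    apply: hleW (hle_eq _ (hmon k' [::] t (leq0n q) ht)); first by rewrite expr0 mulr1.
    by move=> y; rewrite mon_nil mulr1.
  elim: r => [_|k r IH /= rp].
    by rewrite mul0r; exact: hle0.
  rewrite -natr1 mulrDl mul1r; apply: hleD; first exact: IH (ltnW rp).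
  have hg t : kap R d * del ^+ 2 <= t <= del ^+ 2 ->
      hle (gk t) (M * (nw * (Nf * 2 ^+ q))) (fun y => D k y * phi k y).
    move=> ht.
    have hw w : w \in allwords d q -> hle (gk t) (M * (Nf * 2 ^+ q)) (fun y =>
        cf k w * (ge (del ^+ 2) (y - z k) * mon w (y - z k) * sep (A k) (y - z k))).
      rewrite mem_allwords => wq; apply: hleW (hleZ (cf k w) (hmon k w t wq ht)).
      apply: (@le_trans _ _ (M * del ^- size w * (Nf * (2 * del) ^+ size w))).
        by rewrite ler_wpM2r ?cfM// !mulr_ge0 ?exprn_ge0 ?mulr_ge0 ?(ltW Nf0) ?(ltW del0).
      have E (m n t' k' : R) : t' != 0 -> m * t'^-1 * (n * (k' * t')) = m * (n * k').
        by move=> t0; field.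
      rewrite exprMn E ?expf_neq0 ?gt_eqF//.
      by rewrite (ler_wpM2l M0)// (ler_wpM2l (ltW Nf0))// ler_weXn2l// ler1n.
    suff gen (W : seq (seq 'I_d)) : {subset W <= allwords d q} ->
      hle (gk t) ((size W)%:R * (M * (Nf * 2 ^+ q))) (fun y => \sum_(w <- W)
        cf k w * (ge (del ^+ 2) (y - z k) * mon w (y - z k) * sep (A k) (y - z k))).
      apply: hleW (hle_eq _ (gen (allwords d q) (fun _ => id))); first by rewrite mulrCA.
      move=> y; rewrite /phi DE mulr_suml; apply: eq_bigr => w _; ring.
    elim: W => [_|w W IHW sW] /=.
      by rewrite mul0r; apply: hle_eq (hle0 _) => y; rewrite big_nil.
    rewrite -natr1 mulrDl mul1r addrC.
    apply: hle_eq (hleD (hw w (sW w (mem_head _ _))) (IHW _)) => [y|w' w'W].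
      by rewrite big_cons.
    by apply: sW; rewrite in_cons w'W orbT.
  apply: hleW (@hle_prod_sep R d a d0 a0 (del ^+ 2) (M * (nw * (Nf * 2 ^+ q))) Nf 0
    (fun y => D k y * phi k y) (L k r) s0 s1 _ (hphi k r) (ltW Nf0)); last first.
    by move=> t ht; rewrite divr1; exact: hg.
  have sL : (size (L k r) <= p)%N.
    by rewrite size_map size_filter (leq_trans (count_size _ _))// ltnW.
  have -> : C1 * M * del `^ (- a) = M * (nw * (Nf * 2 ^+ q)) * (1 + Nf) ^+ p * Cmat d a *
      (del `^ (- a) * p.+1%:R `^ (a / 2)) by rewrite /C1; ring.
  have Cm := Cmat_gt0 d0 a0.
  have Y : (del ^+ 2 / (0 + size (L k r)).+1%:R) `^ (- (a / 2)) <=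
      del `^ (- a) * p.+1%:R `^ (a / 2).
    rewrite powRM ?invr_ge0 ?(ltW s0)// -powR_mulrn ?(ltW del0)// -powRrM.
    rewrite (_ : 2%:R * - (a / 2) = - a); last by field.
    rewrite ler_wpM2l ?powR_ge0// -powR_inv1// -powRrM mulrN mulN1r opprK.
    by rewrite ge0_ler_powR ?nnegrE ?divr_ge0 ?(ltW a0)// ler_nat.
  have X1 : (1 + Nf) ^+ size (L k r) <= (1 + Nf) ^+ p.
    by rewrite ler_weXn2l// lerDl ltW.
  have B0 : 0 <= M * (nw * (Nf * 2 ^+ q)) by rewrite !mulr_ge0 ?exprn_ge0 ?(ltW Nf0).
  apply: ler_pM Y; rewrite ?powR_ge0//; last by rewrite ler_wpM2r ?(ltW Cm)// ler_wpM2l.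
  by rewrite !mulr_ge0 ?exprn_ge0 ?addr_ge0 ?(ltW Nf0) ?(ltW Cm).
have eI : (size (enum I) <= p)%N by rewrite -cardE.
have h := (hS (enum I) eI).2 I u z; rewrite -cardE in h.
have -> : \sum_i u i * D i (z i) = \sum_i u i * S (enum I) (z i).
  apply: eq_bigr => i _; rewrite SE (big_rem i)/= ?mem_enum// eqxx.
  by rewrite phi1 subrr mul0r subr0 mulr1.
apply: le_trans h _; rewrite ler_wpM2r ?sqrtr_ge0//.
have h1 : 0 <= M * del `^ (- a) by rewrite mulr_ge0 ?powR_ge0.
have h2 : #|I|%:R <= p%:R :> R by rewrite ler_nat.
have h3 : #|I|%:R * C1 <= p%:R * C1 by rewrite ler_wpM2r.
rewrite -[C1 * M * _]mulrA -[leRHS]mulrA [leLHS]mulrA ler_wpM2r//.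
by rewrite (le_trans h3)// lerDl.
Qed.

End ClusterLift.

Section Clusters.
Variables (R : realType) (d : nat) (I : finType) (x : I -> 'rV[R]_d).

Definition near_rel (sg : R) : rel I := fun i j => sqn (x i - x j) < sg ^+ 2.

Lemma near_sym sg : connect_sym (near_rel sg).
Proof. by apply: sym_connect_sym => i j; rewrite /near_rel -sqnN opprB. Qed.

(** Single-linkage clusters, named by a representative. Distinct clusters are at distance at least
    [sg], while a chain visits at most [#|I|] points, so a cluster has diameter of order [sg] too:
    separation and accuracy refer to the same scale. *)
Definition clus (sg : R) (i : I) : I := fingraph.root (near_rel sg) i.

Lemma clus_sep sg i j : clus sg i != clus sg j -> sg ^+ 2 <= sqn (x i - x j).
Proof.
rewrite /clus root_connect; last exact: near_sym.
by rewrite leNgt; apply: contra => h; exact: connect1.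
Qed.

Lemma clus_refine (s1 s2 : R) i j : 0 <= s1 -> s1 <= s2 -> clus s1 i = clus s1 j -> clus s2 i = clus s2 j.
Proof.
move=> s10 s12 /eqP; rewrite root_connect; last exact: near_sym.
move=> h; apply/eqP; rewrite root_connect; last exact: near_sym.
apply: connect_sub h => k l kl; apply: connect1.
apply: lt_le_trans kl _; rewrite lerXn2r ?nnegrE//; exact: le_trans s12.
Qed.

Lemma clus_diam sg i c : 0 < sg -> `|x (clus sg i) ord0 c - x i ord0 c| <= #|I|%:R * sg.
Proof.
move=> sg0; have : connect (near_rel sg) i (clus sg i) by exact: connect_root.
move=> /connectP[p0 + ->] => hp; case: (shortenP hp) => p pp up _.
have step (k l : I) : near_rel sg k l -> `|x l ord0 c - x k ord0 c| <= sg.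
  move=> kl; rewrite -ler_sqr ?nnegrE ?normr_ge0 ?(ltW sg0)// distrC.
  have := norm_coord_le_sqn (x k - x l) c; rewrite !mxE => h.
  by apply: ltW (le_lt_trans h kl).
have : `|x (last i p) ord0 c - x i ord0 c| <= (size p)%:R * sg.
  elim: p i {hp up} pp => [|k p IH] i /=; first by rewrite subrr normr0 mul0r.
  move=> /andP[ik kp]; rewrite -natr1 mulrDl mul1r.
  rewrite -(subrKA (x k ord0 c)); apply: le_trans (ler_normD _ _) _.
  by apply: lerD; [exact: IH|exact: step].
move/le_trans; apply; rewrite ler_wpM2r ?(ltW sg0)// ler_nat ltnW//.
by have /card_uniqP cu := up; have := max_card (mem (i :: p)); rewrite cu.
Qed.
End Clusters.

Section EarlyExtension.
Variables (R : realType) (d : nat) (a b Cw : R) (q p : nat).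
Hypotheses (d0 : (0 < d)%N) (a0 : 0 < a) (b0 : 0 < b) (ba : b <= a) (Cw0 : 0 <= Cw).
Implicit Types (x y z : 'rV[R]_d).

Local Notation K := (@matern R d a).
Local Notation e := (a - b + d%:R / 2).

(* Clusters of early vertices are refined scale by scale; at scale [sg m] every
   vertex uses the Taylor polynomial of the representative of its cluster. *)
Lemma multiscale : exists2 C : R, 0 < C &
  forall (I : finType) (x : I -> 'rV[R]_d) (f : 'rV[R]_d -> R) (P : I -> 'rV[R]_d -> R) (tau s0 : R),
  (#|I| <= p)%N -> (forall i, unit_cube (x i)) -> 0 < tau -> 0 < s0 -> s0 <= 2^-1 -> tau * s0 <= 1 ->
  (forall z, unit_cube z -> `|f z| <= 1) ->
  (forall i, polyw q (P i)) ->
  (forall i z (del : R), unit_cube z -> 0 < del -> (forall c, `|z ord0 c - x i ord0 c| <= del) ->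
     `|f z - P i (z - x i)| <= Cw * del `^ b) ->
  forall (m : nat) (u : I -> R),
  `|\sum_i u i * P (clus x (s0 / 2 ^+ m) i) (x i - x (clus x (s0 / 2 ^+ m) i))| <=
   C * ((tau * s0) `^ (- a) + \sum_(k < m) tau `^ (- a) * (s0 / 2 ^+ k) `^ (b - a)) *
     Num.sqrt (qf K u (fun i => tau *: x i)).
Proof.
have invp (t r : R) : 0 < t -> (t^-1) `^ (- r) = t `^ r.
  by move=> tp; rewrite -powR_inv1 ?(ltW tp)// -powRrM mulN1r opprK.
have p1 (t : R) : 1 `^ t = 1 :> R by rewrite powR1.
have [C1 C10 lift] := cluster_lift d0 a0 q p.
have [C2 C20 coef] := @poly_coef_bound R d q.
pose Cb : R := 1 + 2 * Cw * p.+1%:R `^ b.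
have Cb0 : 0 < Cb by rewrite ltr_wpDr// !mulr_ge0 ?powR_ge0.
pose C : R := C1 * ((C2 + 1) * Cb) * 2 `^ a.
have C0 : 0 < C by rewrite !mulr_gt0 ?powR_gt0// ltr_wpDl.
exists C => // I x f P tau s0 Ip ux t0 s00 s0h ts0 f1 Pq hP m u.
pose sg k : R := s0 / 2 ^+ k.
have sgp k : 0 < sg k by rewrite divr_gt0 ?exprn_gt0.
have sgS k : sg k.+1 = sg k / 2 by rewrite /sg exprSr invfM mulrA.
have sg_mono k : sg k.+1 <= sg k.
  by rewrite sgS ler_pdivrMr// ler_peMr ?(ltW (sgp k))//; lra.
have sgl k : sg k <= s0 by rewrite /sg ler_pdivrMr ?exprn_gt0// ler_peMr ?(ltW s00)// exprn_ege1//; lra.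
pose G i z := P i (z - x i).
(* a step of the refinement, whose first instance is from the zero function *)
have step (cls : I -> I) (D : I -> 'rV[R]_d -> R) (S del : R) :
    0 < del -> del <= 2^-1 -> tau * del <= 1 -> 0 <= S ->
    (forall i j, cls i != cls j -> del ^+ 2 <= sqn (x i - x j)) ->
    (forall i j z, cls i = cls j -> D i z = D j z) ->
    (forall i, polyw q (fun v => D i (v + x i))) ->
    (forall i z, unit_cube z -> (forall c, `|z ord0 c - x i ord0 c| <= del) -> `|D i z| <= S) ->
    forall v : I -> R, `|\sum_i v i * D i (x i)| <= C1 * ((C2 + 1) * S) * (tau * del) `^ (- a) *
      Num.sqrt (qf K v (fun i => tau *: x i)).
  move=> del0 del1 td S0 csep Dc Dq DS v.
  have H0 : 0 < tau * del by rewrite mulr_gt0.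
  pose D' i y := D i (tau^-1 *: y).
  have hcf i : exists cf : seq 'I_d -> R,
    (forall y, D' i (y + tau *: x i) = \sum_(w <- allwords d q) cf w * mon w y) /\
    (forall w, (size w <= q)%N -> `|cf w| <= C2 * (tau * del) ^- size w * S).
    (* The orthant points from [x i] towards the inside of the unit cube; as [del <= 2^-1], the part
       of the cube of side [del] in that orthant stays in the unit cube, where [D i] is bounded. *)
    apply: (coef _ (fun c => 2^-1 < x i ord0 c)) => //.
      have [L sL E] := polyw_scale tau^-1 (Dq i); exists L => // y.
      by rewrite -E /D' scalerDr scalerA mulVf ?gt_eqF// scale1r.
    move=> y hy.
    have zE c : (tau^-1 *: (y + tau *: x i)) ord0 c = x i ord0 c + y ord0 c / tau.
      by rewrite !mxE; field; rewrite gt_eqF.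
    have ht c : 0 <= (-1) ^+ (2^-1 < x i ord0 c)%R * (y ord0 c / tau) <= del.
      have /andP[h1 h2] := hy c.
      by rewrite mulrA ler_pdivlMr// ler_pdivrMr// mul0r h1 mulrC mulrC [del * tau]mulrC.
    apply: (DS i) => c; rewrite zE; have := ht c; have /andP[x0 x1] := ux i c;
      case: ltP => xc /=; rewrite ?expr0 ?expr1 ?mulN1r ?mul1r => /andP[t1 t2].
    - by apply/andP; split; lra.
    - by apply/andP; split; lra.
    - by rewrite addrAC subrr add0r -normrN ger0_norm.
    - by rewrite addrAC subrr add0r ger0_norm.
  have [cf {}hcf] := choice hcf.
  have X := lift I (fun i => tau *: x i) cls cf D' ((C2 + 1) * S) (tau * del) Ip H0 td.
  have E i : D i (x i) = D' i (tau *: x i) by rewrite /D' scalerA mulVf ?gt_eqF// scale1r.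
  under eq_bigr do rewrite E; apply: X.
  - by rewrite mulr_ge0// addr_ge0.
  - move=> i j /csep h; rewrite -scalerBr sqnZ exprMn ler_pM2l// exprn_gt0//.
  - move=> i y; have [h _] := hcf i; rewrite -h subrK//.
  - move=> i w wq; have [_ h] := hcf i; apply: le_trans (h w wq) _.
    rewrite mulrAC ler_wpM2r ?invr_ge0 ?exprn_ge0 ?(ltW H0)//.
    by rewrite ler_wpM2r// lerDl.
  - by move=> i j y ij; rewrite /D' (Dc i j).
have Gerr (k : nat) (i : I) z (del : R) : unit_cube z -> 0 < del -> sg k <= del ->
  (forall c, `|z ord0 c - x i ord0 c| <= del) ->
  `|f z - G (clus x (sg k) i) z| <= Cw * (p.+1%:R * del) `^ b.
  move=> uz del0 sd hz; apply: hP => //; first by rewrite mulr_gt0.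
  move=> c; have h1 := hz c; have h2 := clus_diam x i c (sgp k).
  have h3 : #|I|%:R * sg k <= p%:R * del by rewrite ler_pM ?(ltW (sgp k))// ler_nat.
  set t := x (clus _ _ _) ord0 c in h2 *.
  have -> : z ord0 c - t = (z ord0 c - x i ord0 c) - (t - x i ord0 c) by ring.
  by apply: le_trans (ler_normB _ _) _; rewrite -natr1 mulrDl mul1r; lra.
have Gpoly (k : nat) (i : I) : polyw q (fun v => G (clus x (sg k) i) (v + x i)).
  have [L sL E] := polyw_shift (x i - x (clus x (sg k) i)) (Pq (clus x (sg k) i)).
  by exists L => // v; rewrite -E /G addrA.
have Cge : C1 * ((C2 + 1) * Cb) <= C.
  have h2 : 1 <= 2 `^ a :> R by rewrite -[leLHS](p1 a) ge0_ler_powR ?nnegrE ?(ltW a0)// ler1n.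
  rewrite /C ler_peMr//; apply: mulr_ge0; first exact: ltW.
  by apply: mulr_ge0; [rewrite addr_ge0|exact: ltW].
elim: m u => [|m IH] u.
  rewrite big_ord0 addr0.
  have := step (clus x (sg 0%N)) (fun i => G (clus x (sg 0%N) i)) Cb s0 s00 s0h ts0 (ltW Cb0).
  have sg0 : sg 0%N = s0 by rewrite /sg expr0 divr1.
  move=> X; apply: le_trans (X _ _ _ _ u) _.
  - by move=> i j; rewrite -[in s0 ^+ 2]sg0; exact: clus_sep.
  - by move=> i j z ->.
  - by move=> i; exact: Gpoly.
  - move=> i z uz hz; have := Gerr 0%N i z s0 uz s00; rewrite sg0 => /(_ (lexx _) hz) h.
    set Gz := G _ z; have -> : Gz = f z - (f z - Gz) by ring.
    apply: le_trans (ler_normB _ _) _.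
    apply: lerD; first exact: f1.
    apply: le_trans h _; rewrite (powRM b (ler0n R p.+1) (ltW s00)).
    have CY : 0 <= Cw * p.+1%:R `^ b by rewrite mulr_ge0 ?powR_ge0.
    have Z1 : s0 `^ b <= 1.
      rewrite -[leRHS](p1 b) ge0_ler_powR ?nnegrE ?(ltW s00) ?(ltW b0)//; lra.
    have := ler_wpM2l CY Z1; rewrite mulr1 mulrA; lra.
  - by rewrite ler_wpM2r ?sqrtr_ge0// ler_wpM2r ?powR_ge0.
rewrite big_ord_recr/= addrA mulrDr mulrDl.
set g1 := fun i => P (clus x (s0 / 2 ^+ m.+1) i) (x i - x (clus x (s0 / 2 ^+ m.+1) i)).
set g0 := fun i => P (clus x (s0 / 2 ^+ m) i) (x i - x (clus x (s0 / 2 ^+ m) i)).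
have -> : \sum_i u i * g1 i = \sum_i u i * g0 i + \sum_i u i * (g1 i - g0 i).
  by rewrite -big_split/=; apply: eq_bigr => i _; ring.
apply: le_trans (ler_normD _ _) _; apply: lerD; first exact: IH.
(* The increment between two scales compares two approximations of [f], so it is of size [sg m ^ b].
   It is constant on the finer clusters because the coarser ones are unions of them. Its norm is of
   order [tau ^ (- a) * sg m ^ (b - a)]. *)
have X := step (clus x (sg m.+1)) (fun i z => G (clus x (sg m.+1) i) z - G (clus x (sg m) i) z)
  (Cb * sg m `^ b) (sg m.+1) (sgp _) (le_trans (sgl _) s0h).
have td : tau * sg m.+1 <= 1 by apply: le_trans ts0; rewrite ler_pM2l.
have S0 : 0 <= Cb * sg m `^ b by rewrite mulr_ge0 ?powR_ge0 ?(ltW Cb0).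
apply: le_trans (X td S0 _ _ _ _ u) _.
- by move=> i j; exact: clus_sep.
- move=> i j z ij; rewrite ij; congr (_ - G _ _).
  exact: clus_refine (ltW (sgp _)) (sg_mono m) ij.
- move=> i; have [L sL E] := polywD (Gpoly m.+1 i) (polywZ (-1) (Gpoly m i)).
  by exists L => // v; rewrite -E mulN1r.
- move=> i z uz hz.
  have hz' c : `|z ord0 c - x i ord0 c| <= sg m by apply: le_trans (hz c) (sg_mono m).
  have h1 := Gerr m.+1 i z (sg m) uz (sgp m) (sg_mono m) hz'.
  have h2 := Gerr m i z (sg m) uz (sgp m) (lexx _) hz'.
  set g1z := G (clus x (sg m.+1) i) z; set g0z := G (clus x (sg m) i) z.
  have -> : g1z - g0z = (f z - g0z) - (f z - g1z) by ring.
  apply: le_trans (ler_normB _ _) _; apply: le_trans (lerD h2 h1) _.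
  rewrite powRM ?(ltW (sgp m))// /Cb mulrDl mul1r.
  set Y := p.+1%:R `^ b; set Z := sg m `^ b.
  have Z0 : 0 <= Z by exact: powR_ge0.
  by rewrite (_ : _ + _ = 2 * Cw * Y * Z) ?lerDr//; ring.
- rewrite ler_wpM2r ?sqrtr_ge0// le_eqVlt; apply/orP; left; apply/eqP.
  have -> : tau * sg m.+1 = (tau * sg m) / 2 by rewrite sgS mulrA.
  rewrite (powRM _ (mulr_ge0 (ltW t0) (ltW (sgp m)))) ?invr_ge0//.
  rewrite (powRM _ (ltW t0) (ltW (sgp m))) invp//.
  rewrite [_ `^ (b - a)]powRD ?(gt_eqF (sgp m)) ?implybT// /C -/(sg m); ring.
Qed.

(** For [a = b] all the terms are 1 and the sum counts the scales. The summand [d / 2] in the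
    exponent turns this into geometric growth, and the target rate has room for it: twice
    [a - b + d / 2] is the exponent [2 * (a - b) + d] of the theorem. *)
Lemma geometric_scales : exists2 C : R, 0 < C & forall (s0 : R) (m : nat), 0 < s0 -> s0 <= 1 ->
  \sum_(k < m) (s0 / 2 ^+ k) `^ (b - a) <= C * (s0 / 2 ^+ m) `^ (- e).
Proof.
have e0 : 0 < e by rewrite ltr_wpDl ?subr_ge0// divr_gt0// ltr0n.
have E1 : 1 < 2 `^ e :> R.
  have := @gt0_ltr_powR _ e e0 1 2; rewrite powR1; apply; rewrite ?nnegrE//.
  by rewrite ltr1n.
have inv2 : (2^-1) `^ (- e) = 2 `^ e :> R by rewrite -powR_inv1// -powRrM mulN1r opprK.
have C0 : 0 < (2 `^ e - 1)^-1 :> R by rewrite invr_gt0 subr_gt0.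
exists (2 `^ e - 1)^-1 => // s0 m s00 s01; elim: m => [|m IH].
  by rewrite big_ord0 mulr_ge0 ?powR_ge0 ?(ltW C0).
have sm0 : 0 < s0 / 2 ^+ m by rewrite divr_gt0 ?exprn_gt0.
have sm1 : s0 / 2 ^+ m <= 1.
  rewrite ler_pdivrMr ?exprn_gt0// mul1r; apply: le_trans s01 _.
  by rewrite exprn_ege1// ler1n.
rewrite big_ord_recr/= exprSr invfM mulrA (powRM _ (ltW sm0)) ?invr_ge0// inv2.
have X : (s0 / 2 ^+ m) `^ (b - a) <= (s0 / 2 ^+ m) `^ (- e).
  apply: ger_powR; first by rewrite sm0.
  have : 0 <= d%:R / 2 :> R by rewrite divr_ge0.
  lra.
apply: le_trans (lerD IH X) _; rewrite le_eqVlt; apply/orP; left; apply/eqP.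
field; move: E1; rewrite -subr_gt0 => E1; rewrite gt_eqF//.
Qed.

Lemma early_extension : exists2 C : R, 0 < C &
  forall (I : finType) (x : I -> 'rV[R]_d) (f : 'rV[R]_d -> R) (P : I -> 'rV[R]_d -> R) (tau eps : R),
  (#|I| <= p)%N -> (forall i, unit_cube (x i)) -> 0 < tau -> 0 < eps ->
  (forall z, unit_cube z -> `|f z| <= 1) ->
  (forall i, polyw q (P i)) ->
  (forall i z (del : R), unit_cube z -> 0 < del -> (forall c, `|z ord0 c - x i ord0 c| <= del) ->
     `|f z - P i (z - x i)| <= Cw * del `^ b) ->
  exists (g : I -> R) (N : R), [/\ 0 <= N, forall i, `|g i - f (x i)| <= eps,
    forall u : I -> R, `|\sum_i u i * g i| <= N * Num.sqrt (qf K u (fun i => tau *: x i)) &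
    N <= C * (1 + tau `^ (- a) + tau `^ (- a) * eps `^ (- (e / b)))].
Proof.
have [C1 C10 ms] := multiscale; have [C2 C20 geo] := geometric_scales.
pose kp : R := (Cw + 1) `^ (- b^-1) / p.+1%:R.
have kp0 : 0 < kp by rewrite divr_gt0// powR_gt0// ltr_wpDl.
exists (C1 * (2 `^ a + C2 * (kp / 2) `^ (- e))).
  apply: mulr_gt0 => //; apply: addr_gt0; first by rewrite powR_gt0.
  by apply: mulr_gt0 => //; apply: powR_gt0; apply: divr_gt0.
move=> I x f P tau eps Ip ux t0 eps0 f1 Pq hP.
have invp (t r : R) : 0 < t -> (t^-1) `^ (- r) = t `^ r.
  by move=> tp; rewrite -powR_inv1 ?(ltW tp)// -powRrM mulN1r opprK.
(* The coarsest scale must satisfy [s0 <= 2^-1] and [tau * s0 <= 1] for [multiscale], and still be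
   large enough for its cost to be of order [1 + tau ^ (- a)]. *)
pose s0 : R := Num.min 1 tau^-1 / 2.
have mn0 : 0 < Num.min 1 tau^-1 by rewrite lt_min ltr01 invr_gt0.
have mn1 : Num.min 1 tau^-1 <= 1 by rewrite ge_min lexx.
have s00 : 0 < s0 by rewrite divr_gt0.
have s0h : s0 <= 2^-1 by rewrite /s0; move: mn1; lra.
have ts0 : tau * s0 <= 1.
  have : tau * Num.min 1 tau^-1 <= 1 by rewrite -ler_pdivlMl// mulr1 ge_min lexx orbT.
  have : 0 <= tau * Num.min 1 tau^-1 by rewrite mulr_ge0// ltW.
  rewrite /s0; lra.
have ts0a : (tau * s0) `^ (- a) <= 2 `^ a * (1 + tau `^ (- a)).
  rewrite /s0 mulrA powRM ?invr_ge0 ?mulr_ge0 ?(ltW t0) ?(ltW mn0)// invp// mulrC ler_wpM2l ?powR_ge0//.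
  rewrite /Num.min; case: ifP => _; last by rewrite mulfV ?gt_eqF// powR1 lerDl powR_ge0.
  by rewrite mulr1 lerDr.
(* At scale [t] a vertex and its representative differ by at most [p.+1 * t] in each coordinate,
   where the Taylor error is at most [eps]. Taking the first dyadic scale below [t] keeps it above
   [t / 2] when at least one halving was made. *)
pose t : R := kp * eps `^ (b^-1).
have tp : 0 < t by rewrite mulr_gt0// powR_gt0.
have exM : exists m, s0 / 2 ^+ m <= t.
  exists (Num.truncn (s0 / t)).+1; rewrite ler_pdivrMr ?exprn_gt0// mulrC -ler_pdivrMr//.
  have := truncnS_gt (s0 / t); set k := (Num.truncn _).+1 => h.
  apply: ltW (lt_le_trans h _); rewrite -natrX ler_nat ltnW// ltn_expl//.
case: (ex_minnP exM) => m sm mmin.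
exists (fun i => P (clus x (s0 / 2 ^+ m) i) (x i - x (clus x (s0 / 2 ^+ m) i))).
exists (C1 * ((tau * s0) `^ (- a) + \sum_(k < m) tau `^ (- a) * (s0 / 2 ^+ k) `^ (b - a))).
have smp k : 0 < s0 / 2 ^+ k by rewrite divr_gt0 ?exprn_gt0.
split.
- rewrite mulr_ge0 ?(ltW C10)// addr_ge0 ?powR_ge0// sumr_ge0// => k _.
  by rewrite mulr_ge0 ?powR_ge0.
- move=> i; rewrite distrC.
  have h : forall c, `|x i ord0 c - x (clus x (s0 / 2 ^+ m) i) ord0 c| <= p.+1%:R * t.
    move=> c; rewrite distrC; apply: le_trans (clus_diam x i c (smp m)) _.
    by rewrite ler_pM ?(ltW (smp m))// ler_nat ltnW.
  apply: le_trans (hP _ _ _ (ux i) _ h) _; first by rewrite mulr_gt0.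
  have -> : p.+1%:R * t = (Cw + 1) `^ (- b^-1) * eps `^ (b^-1).
    by rewrite /t /kp mulrA mulrCA mulfV ?pnatr_eq0// mulr1.
  rewrite powRM ?powR_ge0// -!powRrM mulNr mulVf ?gt_eqF// powRr1 ?(ltW eps0)//.
  rewrite powR_inv1 ?addr_ge0// mulrA ler_piMl ?(ltW eps0)//.
  by rewrite ler_pdivrMr ?mul1r ?lerDl// ltr_wpDl.
- by move=> u; exact: (ms I x f P tau s0 Ip ux t0 s00 s0h ts0 f1 Pq hP m u).
- rewrite -[leRHS]mulrA ler_wpM2l ?(ltW C10)//.
  have T0 : 0 <= tau `^ (- a) by exact: powR_ge0.
  set T := tau `^ (- a) in T0 ts0a *.
  set E := eps `^ (- (e / b)); have E0 : 0 <= E by exact: powR_ge0.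
  set kk := (kp / 2) `^ (- e); have kk0 : 0 <= kk by exact: powR_ge0.
  have S : \sum_(k < m) T * (s0 / 2 ^+ k) `^ (b - a) <= C2 * kk * (T * E).
    rewrite -mulr_sumr (_ : C2 * kk * (T * E) = T * (C2 * (kk * E))); last by ring.
    apply: ler_wpM2l => //.
    case: m mmin sm => [|m] mmin sm; first by rewrite big_ord0 !mulr_ge0 ?(ltW C20).
    have lt : t < s0 / 2 ^+ m by rewrite ltNge; apply/negP => /mmin; rewrite ltnn.
    have s01 : s0 <= 1 by lra.
    apply: le_trans (geo s0 m.+1 s00 s01) _; rewrite ler_wpM2l ?(ltW C20)//.
    have -> : kk * E = (t / 2) `^ (- e).
      have -> : t / 2 = kp / 2 * eps `^ (b^-1) by rewrite /t; ring.
      have kh : 0 <= kp / 2 by apply: divr_ge0 => //; exact: ltW.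
      rewrite (powRM (- e) kh (powR_ge0 _ _)) -powRrM.
      by rewrite /E; congr (_ * _ `^ _); rewrite mulrN; congr (- _); exact: mulrC.
    have e0 : 0 <= e by rewrite addr_ge0 ?subr_ge0 ?divr_ge0.
    have hlt : t / 2 <= s0 / 2 ^+ m.+1.
      by rewrite exprSr invfM mulrA ler_pM2r ?invr_gt0// ltW.
    have th : 0 < t / 2 by exact: divr_gt0.
    rewrite !powRN lef_pV2 ?posrE ?(powR_gt0 _ th) ?(powR_gt0 _ (smp _))//.
    by apply: ge0_ler_powR => //; rewrite nnegrE; apply: ltW => //; exact: smp.
  have A2 : 0 <= 2 `^ a :> R by exact: powR_ge0.
  apply: le_trans (lerD ts0a S) _.
  rewrite mulrDl; apply: lerD.
    by rewrite ler_wpM2l// lerDl mulr_ge0.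
  rewrite ler_wpM2l ?mulr_ge0 ?(ltW C20)// lerDr addr_ge0//.
Qed.
End EarlyExtension.

(** * Interpolation weights at a single vertex *)

Section LocalWeights.
Variables (R : realType) (d : nat).
Implicit Types (x y : 'rV[R]_d).

Lemma rv_norm_le x (M : R) : 0 <= M -> (forall c, `|x ord0 c| <= M) -> `|x| <= M.
Proof.
move=> M0 h; rewrite /Num.norm/= mx_normrE; apply: bigmax_le => // -[i c] _ /=.
by rewrite (ord1 i).
Qed.

Lemma rv_norm_sqn x : `|x| ^+ 2 <= sqn x.
Proof.
rewrite -[leRHS]sqr_sqrtr ?sqn_ge0// lerXn2r ?nnegrE ?sqrtr_ge0//.
apply: rv_norm_le => [|c]; first exact: sqrtr_ge0.
by rewrite -sqrtr_sqr ler_wsqrtr// -real_normK ?num_real// norm_coord_le_sqn.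
Qed.

Lemma cube_sub (v : 'rV[R]_d) (h : R) x y c : cube v h x -> cube v h y ->
  `|x ord0 c - y ord0 c| <= h.
Proof.
move=> /(_ c)/andP[x1 x2] /(_ c)/andP[y1 y2].
by rewrite ler_norml; apply/andP; split; lra.
Qed.

Hypothesis d0 : (0 < d)%N.

(** Verifies the hypotheses of [krig_diff] in coordinates scaled by [tau] and centred at [x]. For
    the last one, the polynomial with the signs of [u] as values at the nodes is bounded by [cN] on
    the cube, and its pairing with [u] is bounded through the moments by [poly_functional_bound]. *)
Lemma local_weights (l : nat) (cd cL cN : R) : 0 < cd -> 0 < cL -> 0 < cN ->
  exists2 B : R, 0 <= B &
  forall (p : nat) (pts : 'I_p -> 'rV[R]_d) x v (h tau r : R) (A : set 'rV[R]_d),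
  p = 'C(l + d, l) -> vandermonde pts \in unitmx ->
  0 < tau -> 0 < r -> 0 < h <= cL * r ->
  cube v h x -> (forall k, cube v h (pts k)) -> (forall k, cd * r <= `|pts k - x|) ->
  norming_set l (cube v h) A cN -> (forall y, A y -> exists k, pts k = y) ->
  [/\ forall k c, `|(tau *: (pts k - x)) ord0 c| <= tau * r * cL,
      \sum_k `|interp_weight pts x ord0 k| <= cN &
      tau * r * cL <= 1 ->
      forall (u : 'I_p -> R) (M : R),
      (forall w, (size w <= l)%N -> `|\sum_k u k * mon w (tau *: (pts k - x))| <= M) ->
      \sum_k `|u k| <= B * (tau * r * cL) ^- l * M].
Proof.
move=> cd0 cL0 cN0; have [C C0 pf] := poly_functional_bound R d l.
exists (C * (2 * cL / cd) ^+ l * cN).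
  by rewrite !mulr_ge0 ?exprn_ge0 ?divr_ge0 ?mulr_ge0 ?(ltW cd0) ?(ltW cL0) ?(ltW cN0).
move=> p pts x v h tau r A pE uV tau0 r0 /andP[h0 hr] cx cp sep nA hA.
have bnd (P : mpoly d R) (S : R) : 0 <= S -> (msize P <= l.+1)%N ->
    (forall k, `|meval (pts k ord0) P| <= S) ->
    forall y, cube v h y -> `|meval (y ord0) P| <= cN * S.
  move=> S0 Pl PS; apply: (@norming_set_bound R d l _ A cN P p pts S (`|v| + h)) => //.
    exact: ltW.
  move=> y cy c; have /andP[y1 y2] := cy c.
  have hv : `|v ord0 c| <= `|v| by rewrite {2}/Num.norm/= mx_normrE; exact: (le_bigmax _ (fun i => `|v i.1 i.2|) ((ord0, c) : 'I_1 * 'I_d)).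
  by move: hv; rewrite !ler_norml => /andP[v1 v2]; apply/andP; split; lra.
have ysub k c : `|(tau *: (pts k - x)) ord0 c| <= tau * r * cL.
  rewrite !mxE normrM gtr0_norm// -mulrA ler_pM2l// mulrC.
  by apply: le_trans hr; exact: cube_sub (cp k) cx.
split => //.
  apply: (@interp_weight_norm1 R d d0 p l pts pE uV x cN (cube v h)) => // P Pl P1 y cy.
  by rewrite -[cN]mulr1; apply: bnd.
move=> hc1 u M uM.
have [P sP PE] := exists_poly_values d0 pE uV (fun k => Num.sg (u k)).
have -> : \sum_k `|u k| = \sum_k u k * meval ((x + tau^-1 *: (tau *: (pts k - x))) ord0) P.
  apply: eq_bigr => k _; rewrite scalerA mulVf ?gt_eqF// scale1r addrC subrK PE.
  by rewrite mulrC -normrEsg.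
have p0 : (0 < p)%N by rewrite pE bin_gt0 leq_addr.
(* The distance from one node to [x] bounds the side of the cube from below, so an orthant cube of
   side comparable with [r] fits inside it. *)
have hcd : cd * r <= h.
  apply: le_trans (sep (Ordinal p0)) _; apply: rv_norm_le => [|c]; first exact: ltW.
  by rewrite !mxE; exact: cube_sub (cp _) cx.
have cdL : cd <= cL by rewrite -(ler_pM2r r0); exact: le_trans hr.
pose H := tau * r * cd / 2.
have H0 : 0 < H by rewrite /H !mulr_gt0.
have H1 : H <= 1.
  apply: le_trans hc1; rewrite /H -mulrA ler_pM2l ?mulr_gt0//; lra.
(* the half cube around [x] which lies inside [cube v h] *)
pose sg c := v ord0 c + h / 2 < x ord0 c.
apply: (@le_trans _ _ (C * H ^- l * cN * M)); last first.
  rewrite le_eqVlt; apply/orP; left; apply/eqP.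
  have E : H = tau * r * cL * (2 * cL / cd)^-1.
    by rewrite /H; field; rewrite !gt_eqF.
  by rewrite E exprMn invfM exprVn invrK; ring.
apply: le_trans (ler_norm _) _.
apply: (pf (fun y => meval ((x + tau^-1 *: y) ord0) P) sg H cN M _ u (fun k => tau *: (pts k - x))) => //.
  exact: polyw_meval.
move=> z zH; rewrite -[cN]mulr1; apply: bnd => // [k|c]; first by rewrite PE normr_sg lern1 leq_b1.
rewrite !mxE.
have : 0 <= (-1) ^+ sg c * (tau^-1 * z ord0 c) <= h / 2.
  have /andP[z1 z2] := zH c; rewrite mulrCA mulr_ge0 ?invr_ge0 ?(ltW tau0)//=.
  rewrite ler_pdivrMl//; apply: le_trans z2 _; rewrite /H -!mulrA ler_pM2l//; lra.
have /andP[x1 x2] := cx c.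
rewrite /sg; case: ltP => hc; rewrite ?expr0 ?expr1 ?mul1r ?mulN1r => /andP[z1 z2];
  by apply/andP; split; lra.
Qed.

End LocalWeights.

(** * Propagation of errors through the layers *)

Section LayerError.
Variables (R : realType) (d n J : nat) (X : 'I_n -> 'rV[R]_d).
Variables (pa : 'I_n -> {set 'I_n}) (lay : 'I_n -> 'I_J.+1).
Hypothesis pa_lay : forall i k, k \in pa i -> (lay k < lay i)%N.
Hypothesis layJ : exists i, (lay i < J)%N.
Implicit Types (f g e : 'I_n -> R).

Local Notation interp := (interp X pa).
Local Notation ext := (extend_layer X pa lay).
Local Notation nrm := (norm_layers lay).
Local Notation theta := (interp_const X pa lay).
Local Notation wt i := ((monomials #|pa i| (X i))^T *m
   (invmx (vandermonde (parent_pts X pa i)))^T).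

Lemma norm_layers_ge0 j f : 0 <= nrm j f.
Proof. exact: bigmax_ge_id. Qed.

Lemma norm_layers_ge j f i : (lay i <= j)%N -> `|f i| <= nrm j f.
Proof. by move=> ij; apply: (le_bigmax_cond _ (fun i => `|f i|)). Qed.

Lemma norm_layers_le j f (M : R) : 0 <= M -> (forall i, (lay i <= j)%N -> `|f i| <= M) ->
  nrm j f <= M.
Proof. by move=> M0 h; apply: bigmax_le. Qed.

Lemma interp_sum f i : interp f i = \sum_a wt i ord0 a * f (enum_val a).
Proof. by rewrite /Defs.interp mxE; apply: eq_bigr => a _; rewrite [X in _ * X]mxE. Qed.

Lemma ext_sum (T : finType) (G : T -> 'I_n -> R) j i :
  ext j (fun i => \sum_t G t i) i = \sum_t ext j (G t) i.
Proof.
rewrite /extend_layer; case: ifP => // _; case: ifP => _; last by rewrite big1.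
rewrite interp_sum; under [RHS]eq_bigr do rewrite interp_sum.
by rewrite exchange_big; apply: eq_bigr => a _; rewrite mulr_sumr.
Qed.

Lemma extD f g j i : ext j (fun i => f i + g i) i = ext j f i + ext j g i.
Proof.
rewrite /extend_layer; case: ifP => // _; case: ifP => _; last by rewrite addr0.
by rewrite !interp_sum -big_split; apply: eq_bigr => a _; rewrite mulrDr.
Qed.

Lemma eq_ext f g j i : (forall k, (lay k <= j)%N -> f k = g k) -> ext j f i = ext j g i.
Proof.
move=> fg; rewrite /extend_layer; case: ifP => [ij|_]; first exact: fg.
case: ifP => // /eqP ij; rewrite !interp_sum; apply: eq_bigr => a _; congr (_ * _).
by apply: fg; rewrite -ltnS -ij; apply/pa_lay/enum_valP.
Qed.

Definition prolong j m f : 'I_n -> R := foldl (fun g j => ext j g) f (iota j m).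

Arguments prolong : simpl never.

Lemma prolongS j m f : prolong j m.+1 f = ext (j + m) (prolong j m f).
Proof. by rewrite /prolong -addn1 iotaD foldl_cat. Qed.

Lemma ext_id j f i : (lay i <= j)%N -> ext j f i = f i.
Proof. by rewrite /extend_layer => ->. Qed.

Lemma prolong_id j m f i : (lay i <= j)%N -> prolong j m f i = f i.
Proof.
by move=> ij; elim: m => // m IH; rewrite prolongS ext_id// (leq_trans ij) ?leq_addr.
Qed.

(** A crude bound depending on the design. Its purpose is that the set defining [interp_const] is
    bounded above, so that its supremum is indeed an upper bound. *)
Lemma prolong_bound : exists2 W : R, 1 <= W &
  forall j m f, nrm (j + m) (prolong j m f) <= W ^+ m * nrm j f.
Proof.
pose W : R := 1 + \sum_i \sum_a `|wt i ord0 a|.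
have sW i : \sum_a `|wt i ord0 a| <= W.
  rewrite /W (bigD1 i)//= addrCA lerDl addr_ge0// sumr_ge0// => k _.
  by rewrite sumr_ge0.
have W1 : 1 <= W by rewrite lerDl sumr_ge0// => k _; rewrite sumr_ge0.
have W0 : 0 <= W by apply: le_trans W1.
exists W => // j m f; elim: m => [|m IH]; first by rewrite addn0 mul1r.
rewrite prolongS addnS exprS -mulrA.
apply: (@le_trans _ _ (W * nrm (j + m) (prolong j m f))); last by rewrite ler_wpM2l.
apply: norm_layers_le => [|i]; first by rewrite mulr_ge0 ?norm_layers_ge0.
rewrite leq_eqVlt /extend_layer ltnS => /orP[/eqP ii|ij]; last first.
  by rewrite ij; apply: le_trans (norm_layers_ge _ ij) _; rewrite ler_peMl ?norm_layers_ge0.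
rewrite ii ltnn eqxx interp_sum; apply: le_trans (ler_norm_sum _ _ _) _.
apply: (@le_trans _ _ (\sum_a `|wt i ord0 a| * nrm (j + m) (prolong j m f))).
  apply: ler_sum => a _; rewrite normrM ler_wpM2l// norm_layers_ge//.
  by rewrite -ltnS -ii; apply/pa_lay/enum_valP.
by rewrite -mulr_suml ler_wpM2r ?norm_layers_ge0.
Qed.

Lemma interp_const_ub j m f : (j + m.+1 <= J)%N -> (exists2 i, (lay i <= j)%N & f i != 0) ->
  nrm (j + m.+1) (prolong j m.+1 f) / nrm j f <= theta.
Proof.
move=> jm fi; have [W W1 hW] := prolong_bound.
apply: ub_le_sup; last first.
  exists j, (j + m)%N, f; split; rewrite ?leq_addr//; first by rewrite -addnS.
  by rewrite addnS /extend_layers /prolong addKn.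
exists (W ^+ J) => _ [j1 [j2 [g [j12 j2J [i ij gi] ->]]]].
have g0 : 0 < nrm j1 g by apply: lt_le_trans (norm_layers_ge _ ij); rewrite normr_gt0.
rewrite ler_pdivrMr//; have := hW j1 (j2 - j1).+1 g.
rewrite addnS subnKC// => /le_trans; apply; rewrite ler_wpM2r ?norm_layers_ge0//.
by rewrite ler_weXn2l//; apply: leq_trans j2J; rewrite ltnS leq_subr.
Qed.

Lemma interp_const_ge1 : 1 <= theta.
Proof.
have [i iJ] := layJ.
have ex : exists2 k, (lay k <= lay i)%N & (cst 1 : 'I_n -> R) k != 0.
  by exists i => //; rewrite oner_neq0.
have h := @interp_const_ub (lay i) 0 (cst 1) _ ex; apply: le_trans (h _); last by rewrite addn1.
have n1 : nrm (lay i) (cst (1 : R)) = 1 :> R.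
  apply/eqP; rewrite eq_le norm_layers_le//=; last by move=> k _; rewrite normr1.
  by have := norm_layers_ge (cst 1) (leqnn (lay i)); rewrite normr1.
rewrite n1 divr1; have := @norm_layers_ge (lay i + 1) (prolong (lay i) 1 (cst 1)) i (leq_addr _ _).
by rewrite prolong_id// normr1.
Qed.

Lemma prolong_le j m f : (j + m <= J)%N ->
  nrm (j + m) (prolong j m f) <= theta * nrm j f.
Proof.
have t1 := interp_const_ge1; have t0 := le_trans ler01 t1.
case: m => [|m] jm; first by rewrite addn0 ler_peMl ?norm_layers_ge0.
have [/existsP[i /andP[ij fi]]|/existsPn h] := boolP [exists i, (lay i <= j)%N && (f i != 0)].
  rewrite -ler_pdivrMr; first by apply: interp_const_ub => //; exists i.
  by apply: lt_le_trans (norm_layers_ge _ ij); rewrite normr_gt0.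
have f0 k : (lay k <= j)%N -> `|f k| <= 0.
  by move=> kj; have := h k; rewrite kj/= negbK => /eqP ->; rewrite normr0.
have [W W1 hW] := prolong_bound.
have z : nrm j f = 0 by apply/eqP; rewrite eq_le norm_layers_ge0 norm_layers_le.
by have := hW j m.+1 f; rewrite z !mulr0.
Qed.

(** Telescoping: up to layer [j + m], [e] is the prolongation of its values up to layer [j] plus the
    prolonged defects [e - interp e] of the later layers. Each defect is carried in one go from its
    own layer to the top, so it is multiplied by the interpolation constant once and not once per
    layer. *)
Lemma prolong_error e j m i : (lay i <= j + m)%N ->
  e i = prolong j m e i + \sum_(t < m) prolong (j + t.+1) (m - t.+1)
    (fun k => (lay k == (j + t.+1)%N :> nat)%:R * (e k - interp e k)) i.
Proof.
pose D (t : nat) k : R := (lay k == (j + t.+1)%N :> nat)%:R * (e k - interp e k).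
rewrite -[RHS]/(prolong j m e i + \sum_(t < m) prolong (j + t.+1) (m - t.+1) (D t) i).
elim: m i => [|m IH] i im; first by rewrite big_ord0 addr0 prolong_id// -(addn0 j).
rewrite big_ord_recr subnn [prolong _ 0 _ _]/(D m i) prolongS/=.
under eq_bigr => t _ do
  rewrite subSS -(subnSK (ltn_ord t)) prolongS -addnA subnKC ?ltn_ord//.
have -> : ext (j + m) (prolong j m e) i +
    (\sum_(t < m) ext (j + m) (prolong (j + t.+1) (m - t.+1) (D t)) i + D m i) =
    ext (j + m) e i + D m i.
  rewrite addrA; congr (_ + _); rewrite -ext_sum -extD; apply: eq_ext => k km.
  by rewrite -IH.
rewrite /D /extend_layer/= !addnS; case: leqP => ijm.
  by rewrite ltn_eqF ?mul0r ?addr0// ltnS.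
have -> : lay i = (j + m).+1 :> nat by apply/eqP; rewrite eqn_leq ijm -addnS im.
by rewrite eqxx mul1r addrC subrK.
Qed.

Lemma gronwall (m : nat) (a : nat -> R) (u : nat -> R) (A : R) :
  (forall t, 0 <= a t) -> 0 <= A ->
  (forall k, (k <= m)%N -> u k <= A + \sum_(t < k) a t * u t) ->
  u m <= A * expR (\sum_(t < m) a t).
Proof.
move=> a0 A0 h.
have P k : (k <= m)%N -> u k <= A * \prod_(t < k) (1 + a t) /\
    A + \sum_(t < k) a t * u t <= A * \prod_(t < k) (1 + a t).
  have S k' : (k' <= m)%N -> A + \sum_(t < k') a t * u t <= A * \prod_(t < k') (1 + a t).
    elim: k' => [|k' IH] km; first by rewrite !big_ord0 addr0 mulr1.
    rewrite !big_ord_recr/= addrA mulrA mulrDr mulr1 lerD ?IH ?(ltnW km)//.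
    rewrite mulrC ler_wpM2r// (le_trans (h _ _)) ?(ltnW km)//.
    by apply: IH; exact: ltnW.
  by move=> km; split; [apply: le_trans (h _ km) _; exact: S | exact: S].
have [um _] := P m (leqnn m); apply: le_trans um _; rewrite ler_wpM2l// expR_sum.
by apply: ler_prod => t _; rewrite expR_ge1Dx addr_ge0.
Qed.

(** [b] is the part of the defects independent of [e] and [a] the part proportional to earlier
    errors. Only the latter enters the exponential, multiplied by the cost of prolongation. *)
Lemma layer_error e j m (A : R) (a b : nat -> R) : (j + m <= J)%N ->
  nrm j e <= A -> (forall t, 0 <= a t) -> (forall t, 0 <= b t) ->
  (forall t i, (t < m)%N -> lay i = (j + t.+1)%N :> nat ->
     `|e i - interp e i| <= b t + a t * nrm (j + t) e) ->
  nrm (j + m) e <= theta * (A + \sum_(t < m) b t) * expR (theta * \sum_(t < m) a t).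
Proof.
move=> jm eA a0 b0 he; have t1 := interp_const_ge1; have t0 := le_trans ler01 t1.
have A0 : 0 <= A by exact: le_trans (norm_layers_ge0 _ _) eA.
rewrite mulr_sumr.
apply: (@gronwall m (fun t => theta * a t) (fun t => nrm (j + t) e)) => [t| |k km].
- exact: mulr_ge0.
- by rewrite mulr_ge0// addr_ge0 ?sumr_ge0.
have a0' (t : nat) : 0 <= b t + a t * nrm (j + t) e by rewrite addr_ge0// mulr_ge0 ?norm_layers_ge0.
apply: (@le_trans _ _ (theta * (A + \sum_(t < k) (b t + a t * nrm (j + t) e)))); last first.
  rewrite big_split/= addrA mulrDr; apply: lerD; last first.
    by rewrite mulr_sumr; apply: ler_sum => t _; rewrite mulrA.
  rewrite ler_wpM2l// lerD2l (big_ord_widen_cond _ predT b km)/= [leRHS](bigID (fun t : 'I_m => (t < k)%N))/=.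
  by rewrite lerDl sumr_ge0.
apply: norm_layers_le => [|i ik].
  by rewrite mulr_ge0// addr_ge0// sumr_ge0.
rewrite (prolong_error e ik) (le_trans (ler_normD _ _))// mulrDr lerD//.
  apply: le_trans (norm_layers_ge _ ik) _; apply: le_trans (prolong_le _ _) _.
    by apply: leq_trans jm; rewrite leq_add2l.
  by rewrite ler_wpM2l.
apply: le_trans (ler_norm_sum _ _ _) _; rewrite mulr_sumr; apply: ler_sum => t _.
set D := fun _ => _ * _.
have E : (j + t.+1 + (k - t.+1) = j + k)%N by rewrite -addnA subnKC.
have ik' : (lay i <= j + t.+1 + (k - t.+1))%N by rewrite E.
apply: le_trans (norm_layers_ge _ ik') _; apply: le_trans (prolong_le _ _) _.
  by rewrite E; apply: leq_trans jm; rewrite leq_add2l.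
rewrite ler_wpM2l//; apply: norm_layers_le => [|i' _]; first exact: a0'.
rewrite /D; case: eqP => [ii|_]; last by rewrite mul0r normr0 a0'.
by rewrite mul1r he// (leq_trans (ltn_ord t)).
Qed.

(** A single interpolation is a prolongation by one layer of the values cut off outside the parents,
    so [interp_const] bounds it even when the vertex is early. *)
Lemma interp_le f i (M : R) : (0 < lay i)%N -> 0 <= M ->
  (forall k, k \in pa i -> `|f k| <= M) -> `|interp f i| <= theta * M.
Proof.
move=> li M0 fM; pose g k := if k \in pa i then f k else 0.
have -> : interp f i = prolong (lay i).-1 1 g i.
  rewrite prolongS /extend_layer addn0 prednK// leqNgt ltn_predL li/= eqxx !interp_sum.
  by apply: eq_bigr => a _; rewrite /prolong/= /g enum_valP.
have t0 := le_trans ler01 interp_const_ge1.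
have E : ((lay i).-1 + 1)%N = lay i by rewrite addn1 prednK.
have ij : (lay i <= (lay i).-1 + 1)%N by rewrite E.
apply: le_trans (norm_layers_ge _ ij) _; apply: le_trans (prolong_le _ _) _.
  by rewrite E -ltnS.
rewrite ler_wpM2l// norm_layers_le// => k _.
by rewrite /g; case: ifP => [/fM//|_]; rewrite normr0.
Qed.

End LayerError.

(** * Kriging estimates at a vertex *)

Section KrigingBounds.
Variables (R : realType) (d l : nat) (a b cd cL cN Cw : R).
Hypotheses (d0 : (0 < d)%N) (la : l%:R < a <= l.+1%:R).
Hypotheses (cd0 : 0 < cd) (cL0 : 0 < cL) (cN0 : 0 < cN).

Let a0 : 0 < a. Proof. by case/andP: la => + _; exact: le_lt_trans. Qed.
Local Notation K := (@matern R d a).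

(** What the layered and norming conditions provide at a vertex of index at least [i0]; it is used
    with [r] equal to [gamma ^- lay i]. *)
Definition local_design n (X : 'I_n -> 'rV[R]_d) (pa : 'I_n -> {set 'I_n}) i (r : R) : Prop :=
  [/\ #|pa i| = 'C(l + d, l), vandermonde (parent_pts X pa i) \in unitmx,
      forall k1 k2, k1 \in i |: pa i -> k2 \in i |: pa i -> k1 != k2 -> cd * r <= `|X k1 - X k2| &
      exists (v : 'rV[R]_d) (h : R), [/\ 0 < h <= cL * r, cube v h (X i),
        forall k, k \in pa i -> cube v h (X k) &
        norming_set l (cube v h) [set X k | k in [set` pa i]] cN]].

Definition taylor_at (f P : 'rV[R]_d -> R) (z : 'rV[R]_d) : Prop := forall (x : 'rV[R]_d) (del : R),
  unit_cube x -> 0 < del -> (forall c, `|x ord0 c - z ord0 c| <= del) ->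
  `|f x - P (x - z)| <= Cw * del `^ b.

Lemma krig_near : exists C kp : R, [/\ 0 < C, 0 < kp & forall (n : nat) (tau : R)
    (X : 'I_n -> 'rV[R]_d) (pa : 'I_n -> {set 'I_n}) i (r : R),
  0 < tau -> injective X -> 0 < r -> i \notin pa i -> local_design X pa i r ->
  let kw k := kriging a tau X pa i ord0 k in
  let wP k := interp_weight (parent_pts X pa i) (X i) ord0 k in
  \sum_k `|wP k| <= cN /\
  (tau * r <= kp ->
   (forall w, (size w <= l)%N ->
     `|\sum_k (kw k - wP k) * mon w (tau *: (parent_pts X pa i k - X i))| <= C * (tau * r) `^ a) /\
   \sum_k `|kw k - wP k| <= C * (tau * r) `^ (a - l%:R))].
Proof.
have [B B0 lw] := @local_weights R d d0 l cd cL cN cd0 cL0 cN0.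
have [h0 [C [h00 h01 C0 kd]]] := @krig_diff R d l a d0 a0 la (B + cN) (addr_ge0 B0 (ltW cN0)).
exists (C * (cL `^ a + cL `^ (a - l%:R))), (h0 / cL); split.
- by rewrite mulr_gt0// addr_gt0// powR_gt0.
- exact: divr_gt0.
move=> n tau X pa i r tau0 Xinj r0 ipa [pE uV sep [v [h [hr ci cp nA]]]] kw wP.
have cp' k : cube v h (parent_pts X pa i k) by apply/cp/enum_valP.
have sep' k : cd * r <= `|parent_pts X pa i k - X i|.
  apply: sep; rewrite ?in_setU1 ?eqxx ?enum_valP ?orbT//.
  by apply: contra ipa => /eqP e; rewrite -{1}e enum_valP.
have hA y : [set X k | k in [set` pa i]] y -> exists k, parent_pts X pa i k = y.
  by move=> [k /= kpa <-]; exists (enum_rank_in kpa k); rewrite /parent_pts enum_rankK_in.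
have [yh wN uB] := lw _ _ _ _ _ _ _ _ pE uV tau0 r0 hr ci cp' sep' nA hA.
split => // tk.
have hp : 0 < tau * r * cL by rewrite !mulr_gt0.
have hh : tau * r * cL <= h0 by rewrite -ler_pdivlMr.
have [||||mom wt] := kd _ (fun k => tau *: (parent_pts X pa i k - X i)) wP kw (tau * r * cL) hp hh yh.
- move=> w wl; rewrite (interp_weight_mon d0 pE uV (X i) tau wl).
  by congr mon; rewrite -[0]/(0 : 'rV[R]_d).
- by apply: le_trans wN _; rewrite lerDr.
- move=> u M uM; apply: le_trans (uB (le_trans hh h01) u M uM) _.
  have M0 : 0 <= M by apply: le_trans (uM [::] _).
  rewrite ler_wpM2r// ler_wpM2r ?invr_ge0 ?exprn_ge0 ?(ltW hp)//.
  by rewrite lerDl ltW.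
- move=> k.
  have kn : \sum_m kw m * K (tau *: X (enum_val m)) (tau *: X (enum_val k)) =
      K (tau *: X i) (tau *: X (enum_val k)) by exact: (kriging_normal d0 a0 tau0 Xinj k).
  have e m : tau *: (parent_pts X pa i m - X i) = tau *: X (enum_val m) - tau *: X i.
    by rewrite scalerBr.
  have e0 : K 0 (tau *: (parent_pts X pa i k - X i)) = K (tau *: X i) (tau *: X (enum_val k)).
    exact: etrans (f_equal2 (@matern R d a) (esym (subrr (tau *: X i))) (e k)) (matern_shift _ _ _ _).
  have ek m : K (tau *: (parent_pts X pa i m - X i)) (tau *: (parent_pts X pa i k - X i)) =
      K (tau *: X (enum_val m)) (tau *: X (enum_val k)).
    exact: etrans (f_equal2 (@matern R d a) (e m) (e k)) (matern_shift _ _ _ _).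
  have eq1 : \sum_m kw m * K (tau *: (parent_pts X pa i m - X i)) (tau *: (parent_pts X pa i k - X i)) =
      \sum_m kw m * K (tau *: X (enum_val m)) (tau *: X (enum_val k)).
    by apply: eq_bigr => m _; exact: (congr1 ( *%R (kw m)) (ek m)).
  have eq2 := etrans eq1 (etrans kn (esym e0)).
  exact: eq2.
have tr0 : 0 <= tau * r by rewrite ltW// mulr_gt0.
split=> [w wl|].
  apply: le_trans (mom w wl) _; rewrite powRM ?(ltW cL0)// mulrCA mulrC ler_wpM2r ?powR_ge0//.
  by rewrite ler_pM2l// lerDl powR_ge0.
apply: le_trans wt _; rewrite powRM ?(ltW cL0)// mulrCA mulrC ler_wpM2r ?powR_ge0//.
by rewrite ler_pM2l// lerDr powR_ge0.
Qed.

Lemma powRN_min (x : R) : 0 < x -> (Num.min 1 x) `^ (- a) <= 1 + x `^ (- a).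
Proof.
by move=> x0; rewrite /Num.min; case: ifP => _; rewrite ?powR1 ?lerDl ?lerDr ?powR_ge0.
Qed.

Lemma design_separation n (tau : R) (X : 'I_n -> 'rV[R]_d) pa i (r : R) k1 k2 :
  0 < tau -> 0 < r -> local_design X pa i r -> k1 \in i |: pa i -> k2 \in i |: pa i -> k1 != k2 ->
  Num.min 1 (tau * r * cd) ^+ 2 <= sqn (tau *: X k1 - tau *: X k2).
Proof.
move=> t0 r0 [_ _ sep _] k1i k2i k12; have := sep k1 k2 k1i k2i k12 => h.
have m0 : 0 <= Num.min 1 (tau * r * cd) by rewrite le_min ler01 !mulr_ge0 ?ltW.
apply: (@le_trans _ _ ((tau * `|X k1 - X k2|) ^+ 2)).
  rewrite lerXn2r ?nnegrE//; first by rewrite mulr_ge0// ltW.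
  apply: (@le_trans _ _ (tau * r * cd)); first by rewrite ge_min lexx orbT.
  by rewrite -mulrA ler_pM2l// mulrC.
by rewrite -scalerBr sqnZ exprMn ler_wpM2l ?sqr_ge0// rv_norm_sqn.
Qed.

Let min_gt0 (tau r : R) : 0 < tau -> 0 < r -> 0 < Num.min 1 (tau * r * cd).
Proof. by move=> t0 r0; rewrite lt_min ltr01 !mulr_gt0. Qed.

Let min_powR (tau r : R) : 0 < tau -> 0 < r ->
  Num.min 1 (tau * r * cd) `^ (- a) <= (1 + cd `^ (- a)) * (1 + (tau * r) `^ (- a)).
Proof.
move=> t0 r0; have x0 : 0 < tau * r * cd by rewrite !mulr_gt0.
apply: le_trans (powRN_min x0) _; rewrite powRM ?mulr_ge0 ?(ltW t0) ?(ltW r0) ?(ltW cd0)//.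
have := powR_ge0 cd (- a); have := powR_ge0 (tau * r) (- a).
by rewrite mulrDl mul1r mulrDr mulr1; set u := _ `^ _; set w := cd `^ _; rewrite (mulrC u); lra.
Qed.

(** The Matern form of the kriging weights is the variance of the prediction, at most 1, and the
    separation of the parents turns this into a bound for each weight by [matern_point_lower]. It
    serves when [tau * r] is not small. *)
Lemma krig_far : exists2 C : R, 0 < C & forall (n : nat) (tau : R)
    (X : 'I_n -> 'rV[R]_d) (pa : 'I_n -> {set 'I_n}) i (r : R),
  0 < tau -> injective X -> (forall i, i \notin pa i) -> 0 < r -> local_design X pa i r ->
  \sum_k `|kriging a tau X pa i ord0 k| <= C * (1 + (tau * r) `^ (- a)).
Proof.
have [C C0 low] := matern_point_lower d0 a0 'C(l + d, l).
exists ('C(l + d, l)%:R * (C * (1 + cd `^ (- a)))).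
  rewrite mulr_gt0 ?ltr0n ?bin_gt0 ?leq_addr// mulr_gt0// ltr_pwDl ?powR_ge0//.
move=> n tau X pa i r tau0 Xinj pa_irr r0 D; have [pE _ _ _] := D.
pose kw k := kriging a tau X pa i ord0 k.
pose Y (k : 'I_#|pa i|) := tau *: X (enum_val k).
have q1 : qf K kw Y <= 1.
  by rewrite (qf_kap pa d0 a0 tau0 Xinj i) (sum_kap_cov pa d0 a0 tau0 Xinj).
have kb k : `|kw k| <= C * (1 + cd `^ (- a)) * (1 + (tau * r) `^ (- a)).
  have cA : (#|[pred k | kw k != 0%R]| <= 'C(l + d, l))%N.
    by rewrite -pE -[leqRHS]card_ord max_card.
  have := low _ kw Y k (Num.min 1 (tau * r * cd)) cA.
  rewrite min_gt0// ge_min lexx => /(_ isT isT) h.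
  apply: le_trans (h _) _.
    move=> j jk _; apply: (design_separation tau0 r0 D); rewrite ?in_setU1 ?enum_valP ?orbT//.
    by apply: contra jk => /eqP/enum_val_inj ->.
  apply: (@le_trans _ _ (C * Num.min 1 (tau * r * cd) `^ (- a))).
    rewrite ler_piMr ?mulr_ge0 ?powR_ge0 ?(ltW C0)//.
    by rewrite -[leRHS]sqrtr1 ler_wsqrtr.
  by rewrite -[leRHS]mulrA ler_pM2l// min_powR.
apply: le_trans (ler_sum _ (fun k _ => kb k)) _.
by rewrite sumr_const card_ord -[_ *+ _]mulr_natl pE !mulrA.
Qed.

(** The residual has coefficient 1 at the vertex itself and is supported on it and its parents, so
    [matern_point_lower] bounds its form from below. *)
Lemma cond_var_lower : exists2 C : R, 0 < C & forall (n : nat) (tau s : R)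
    (X : 'I_n -> 'rV[R]_d) (pa : 'I_n -> {set 'I_n}) i (r : R),
  0 < tau -> 0 < s -> injective X -> (forall i, i \notin pa i) -> 0 < r -> local_design X pa i r ->
  (cond_var a tau s X pa i)^-1 <= C * s ^- 2 * (1 + (tau * r) `^ (- a)) ^+ 2.
Proof.
have [C C0 low] := matern_point_lower d0 a0 'C(l + d, l).+1.
exists ((C * (1 + cd `^ (- a))) ^+ 2).
  by rewrite exprn_gt0// mulr_gt0// ltr_pwDl ?powR_ge0.
move=> n tau s X pa i r tau0 s0 Xinj pa_irr r0 D; have [pE _ _ _] := D.
pose Y (k : 'I_n) := tau *: X k; pose u := resid a tau X pa i.
have q0 : 0 < qf K u Y.
  have := cond_var_gt0 d0 a0 tau0 s0 Xinj pa_irr i; rewrite (cond_varE s pa d0 a0 tau0 Xinj i).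
  by rewrite pmulr_rgt0 ?exprn_gt0.
have h : 1 <= C * (1 + cd `^ (- a)) * (1 + (tau * r) `^ (- a)) * Num.sqrt (qf K u Y).
  have := low _ u Y i (Num.min 1 (tau * r * cd)).
  rewrite -pE card_resid_supp// min_gt0// ge_min lexx => /(_ isT isT isT).
  rewrite /u resid_self// normr1 => h.
  apply: le_trans (h _) _.
    move=> j ji uj; apply: (design_separation tau0 r0 D); rewrite ?in_setU1 ?eqxx//.
    rewrite (negbTE ji)/=; apply: contraNT uj => jpa; rewrite /resid (negbTE ji).
    by rewrite krig_weight0 ?subrr.
  by rewrite ler_wpM2r ?sqrtr_ge0// -[leRHS]mulrA ler_pM2l// min_powR.
rewrite (cond_varE s pa d0 a0 tau0 Xinj i) -/u -[fun k => tau *: X k]/Y invfM.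
rewrite [leRHS](_ : _ = s ^- 2 * (C * (1 + cd `^ (- a)) * (1 + (tau * r) `^ (- a))) ^+ 2); last by ring.
rewrite ler_pM2l ?invr_gt0 ?exprn_gt0// -[leLHS]mul1r ler_pdivrMr//.
by rewrite -[X in _ * X]sqr_sqrtr ?(ltW q0)// -exprMn expr_ge1 ?(le_trans ler01 h).
Qed.

End KrigingBounds.
Section VertexBounds.
Variables (R : realType) (d l q : nat) (a b cd cL cN Cw : R).
Hypotheses (d0 : (0 < d)%N) (la : l%:R < a <= l.+1%:R) (ql : (q <= l)%N).
Hypotheses (ba : b <= a) (cd0 : 0 < cd) (cL0 : 0 < cL) (cN0 : 0 < cN).
Hypothesis Cw0 : 0 <= Cw.

Let a0 : 0 < a. Proof. by case/andP: la => + _; exact: le_lt_trans. Qed.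
Local Notation design := (local_design l cd cL cN).
Local Notation taylor := (taylor_at b Cw).

Lemma parent_weights_le : exists C : R, [/\ 0 < C & forall (n : nat) (tau : R)
    (X : 'I_n -> 'rV[R]_d) (pa : 'I_n -> {set 'I_n}) i (r : R),
  0 < tau -> injective X -> (forall i, i \notin pa i) -> 0 < r -> design X pa i r ->
  \sum_k `|kriging a tau X pa i ord0 k| <= C].
Proof.
have [C1 [kp [C10 kp0 near]]] := krig_near d0 la cd0 cL0 cN0.
have [C2 C20 far] := krig_far cL cN d0 la cd0.
have al0 : 0 <= a - l%:R by case/andP: la => /ltW; rewrite subr_ge0.
exists (C1 * kp `^ (a - l%:R) + cN + C2 * (1 + kp `^ (- a))); split.
  by rewrite ltr_wpDl ?addr_ge0 ?mulr_ge0 ?powR_ge0 ?(ltW C10) ?(ltW cN0)// mulr_gt0// ltr_pwDl ?powR_ge0.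
move=> n tau X pa i r t0 Xinj pa_irr r0 D; have tr0 : 0 < tau * r by rewrite mulr_gt0.
have [tk|tk] := leP (tau * r) kp; last first.
  apply: le_trans (far n tau X pa i r t0 Xinj pa_irr r0 D) _.
  rewrite -[leLHS]add0r lerD ?addr_ge0 ?mulr_ge0 ?powR_ge0 ?(ltW C10) ?(ltW cN0)//.
  rewrite ler_pM2l// lerD2l !powRN lef_pV2 ?posrE ?powR_gt0//.
  by apply: ge0_ler_powR; rewrite ?nnegrE ?ltW.
have [wN /(_ tk)[_ wd]] := near n tau X pa i r t0 Xinj r0 (pa_irr i) D.
set kw := kriging a tau X pa i; pose wP := interp_weight (parent_pts X pa i) (X i).
have h : \sum_k `|kw ord0 k| <= \sum_k `|kw ord0 k - wP ord0 k| + \sum_k `|wP ord0 k|.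
  rewrite -big_split; apply: ler_sum => k _.
  by rewrite -{1}[kw ord0 k](subrK (wP ord0 k)) ler_normD.
apply: le_trans h _; rewrite -[leLHS]addr0; apply: lerD.
  apply: lerD => //; apply: le_trans wd _; rewrite ler_pM2l//.
  by apply: ge0_ler_powR; rewrite ?nnegrE ?(ltW tr0) ?(ltW kp0).
by rewrite mulr_ge0 ?(ltW C20)// addr_ge0 ?powR_ge0.
Qed.

(* If [tau < 1], the loss due to the unscaled derivatives is compensated by the
   excess of [a] over their order. *)
Lemma tau_power_le (tau r : R) k : 0 < tau -> 0 < r -> r <= 1 -> (k <= l)%N ->
  tau ^- k * (tau * r) `^ a <= r `^ b + (tau * r) `^ a.
Proof.
move=> t0 r0 r1 kl; have pr := powR_ge0 (tau * r) a.
have [t1|t1] := leP 1 tau.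
  rewrite -[leLHS]add0r lerD ?powR_ge0// ler_piMl// invf_le1 ?exprn_gt0//.
  exact: exprn_ege1.
rewrite -[leLHS]addr0; apply: lerD => //.
rewrite (powRM _ (ltW t0) (ltW r0)) mulrA.
apply: (@le_trans _ _ (1 * r `^ a)); last by rewrite mul1r ger_powR// r0.
rewrite ler_wpM2r ?powR_ge0// -powR_mulrn ?(ltW t0)// -powRN -powRD; last first.
  by rewrite (gt_eqF t0) implybT.
rewrite -{2}(powRr0 tau) ger_powR ?t0 ?(ltW t1)//.
case/andP: la => + _; have : k%:R <= l%:R :> R by rewrite ler_nat.
by lra.
Qed.

(** Interpolation reproduces [P] exactly, so only the difference of the weights acts on it. The
    moments of this difference are small in coordinates scaled by [tau], whereas [P] is expanded in
    unscaled ones; [tau_power_le] pays for the powers of [tau^-1]. *)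
Lemma cond_mean_poly : exists C kp : R, [/\ 0 < C, 0 < kp & forall (n : nat) (tau : R)
    (X : 'I_n -> 'rV[R]_d) (pa : 'I_n -> {set 'I_n}) i (r : R) P,
  0 < tau -> injective X -> unit_cube (X i) -> 0 < r -> r <= 1 -> i \notin pa i -> design X pa i r ->
  polyw q P -> (forall x, unit_cube x -> `|P (x - X i)| <= 1 + Cw) -> tau * r <= kp ->
  `|\sum_k kriging a tau X pa i ord0 k * P (parent_pts X pa i k - X i) - P 0| <=
    C * (r `^ b + (tau * r) `^ a)].
Proof.
have [C1 [kp [C10 kp0 near]]] := krig_near d0 la cd0 cL0 cN0.
have [C2 C20 coef] := poly_coef_bound R d q.
pose Cc : R := C2 * 2 ^+ q * (1 + Cw).
have Cc0 : 0 <= Cc by rewrite !mulr_ge0 ?addr_ge0.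
exists ((size (allwords d q))%:R * (Cc * C1) + 1), kp; split => //.
  by rewrite ltr_wpDl// mulr_ge0// mulr_ge0// ltW.
move=> n tau X pa i r P t0 Xinj ux r0 r1 ipa D Pq PB tk.
have [_ /(_ tk)[mom _]] := near n tau X pa i r t0 Xinj r0 ipa D.
have [pE uV _ _] := D.
set kw := kriging a tau X pa i in mom *; pose wP := interp_weight (parent_pts X pa i) (X i).
have h0 : 0 < 1 / 2 :> R by rewrite divr_gt0.
have [|cf [PE cfB]] := coef P (fun c => 1 / 2 < X i ord0 c) (1 / 2) (1 + Cw) Pq h0.
  move=> y yB; rewrite -[y](addrK (X i)); apply: PB => c; rewrite !mxE.
  have := yB c; have /andP[x0 x1] := ux c.
  case: ltP => hc; rewrite ?expr0 ?expr1 ?mul1r ?mulN1r => /andP[y1 y2];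
    by apply/andP; split; lra.
have -> : \sum_k kw ord0 k * P (parent_pts X pa i k - X i) - P 0 =
    \sum_(w <- allwords d q) cf w * (tau ^- size w *
      \sum_k (kw ord0 k - wP ord0 k) * mon w (tau *: (parent_pts X pa i k - X i))).
  under eq_bigr do rewrite PE mulr_sumr.
  rewrite exchange_big PE -sumrB !big_seq; apply: eq_bigr => w; rewrite mem_allwords => wq.
  have E : \sum_k wP ord0 k * mon w (tau *: (parent_pts X pa i k - X i)) = mon w 0.
    exact: (interp_weight_mon d0 pE uV (X i) tau (leq_trans wq ql)).
  under [X in _ * (_ * X)]eq_bigr do rewrite mulrBl.
  have m0 : mon w 0 = tau ^- size w * mon w (0 : 'rV[R]_d).
    by rewrite mon0; case: w {wq E} => [|c w]; rewrite ?expr0 ?invr1 ?mul1r ?mulr0.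
  rewrite sumrB E mulrBr -m0 mulrBr mulrA !mulr_sumr; congr (_ - _).
  apply: eq_bigr => k _; rewrite monZ.
  have : tau ^+ size w != 0 by rewrite expf_neq0 ?gt_eqF.
  by move=> tn; field.
apply: le_trans (ler_norm_sum _ _ _) _.
apply: (@le_trans _ _ (\sum_(w <- allwords d q) Cc * C1 * (r `^ b + (tau * r) `^ a))); last first.
  rewrite big_const_seq count_predT iter_addr_0 -[_ *+ _]mulr_natl mulrA.
  by rewrite ler_wpM2r ?addr_ge0 ?powR_ge0// lerDl.
rewrite !big_seq; apply: ler_sum => w; rewrite mem_allwords => wq.
rewrite normrM -mulrA ler_pM//.
  apply: le_trans (cfB w wq) _; rewrite /Cc ler_wpM2r ?addr_ge0// ler_wpM2l// mul1r exprVn invrK.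
  by rewrite ler_weXn2l// ler1n.
rewrite normrM (ger0_norm (_ : 0 <= tau ^- _)) ?invr_ge0 ?exprn_ge0 ?(ltW t0)//.
apply: (@le_trans _ _ (tau ^- size w * (C1 * (tau * r) `^ a))).
  by rewrite ler_wpM2l ?invr_ge0 ?exprn_ge0 ?(ltW t0)// mom// (leq_trans wq).
by rewrite mulrCA ler_pM2l// tau_power_le// (leq_trans wq).
Qed.

(** The minimum with 1 in the third estimate reflects two regimes: a power of [t] when kriging is
    close to interpolation, and a mere bound on coarse layers. It lets the estimate be multiplied by
    the inverse standard deviation, of order [1 + t ^ (- a)], without loss. *)
Lemma kriging_bounds : exists C kp : R, [/\ 0 < C, 0 < kp & forall (n : nat) (tau s : R)
    (X : 'I_n -> 'rV[R]_d) (pa : 'I_n -> {set 'I_n}) i (r : R),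
  0 < tau -> 0 < s -> injective X -> (forall i, i \notin pa i) -> (forall i, unit_cube (X i)) ->
  0 < r -> r <= 1 -> design X pa i r ->
  let t := tau * r in
  [/\ forall z M, (forall k, k \in pa i -> `|z k| <= M) -> `|cond_mean a tau X pa i z| <= C * M,
      (cond_var a tau s X pa i)^-1 <= C * s ^- 2 * (1 + t `^ (- a)) ^+ 2,
      forall f P, (forall x, unit_cube x -> `|f x| <= 1) -> polyw q P -> taylor f P (X i) ->
        `|f (X i) - cond_mean a tau X pa i (fun k => f (X k))| <= C * (r `^ b + Num.min 1 (t `^ a)) &
      forall z M, t <= kp -> (forall k, k \in pa i -> `|z k| <= M) ->
        `|cond_mean a tau X pa i z - interp X pa z i| <= C * t `^ (a - l%:R) * M]].
Proof.
have [C1 [C10 wb]] := parent_weights_le.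
have [C2 [kp2 [C20 kp20 poly]]] := cond_mean_poly.
have [C3 [kp3 [C30 kp30 near]]] := krig_near d0 la cd0 cL0 cN0.
have [C4 C40 var] := cond_var_lower cL cN d0 la cd0.
pose kp := Num.min 1 (Num.min kp2 kp3).
have kp0 : 0 < kp by rewrite !lt_min ltr01 kp20.
pose C5 : R := Cw * cL `^ b * (1 + C1) + C2 + (1 + C1) * (1 + kp `^ (- a)).
have [Q1 Q2] : 0 <= Cw * cL `^ b * (1 + C1) /\ 0 <= (1 + C1) * (1 + kp `^ (- a)).
  by rewrite !mulr_ge0 ?addr_ge0 ?powR_ge0 ?(ltW C10).
have C50 : 0 <= C5 by rewrite !addr_ge0// ltW.
have CC0 : 0 < C1 + C3 + C4 + C5 by rewrite ltr_pwDl// !addr_gt0.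
have [i1 i3 i4 i5] : [/\ C1 <= C1 + C3 + C4 + C5, C3 <= C1 + C3 + C4 + C5,
    C4 <= C1 + C3 + C4 + C5 & C5 <= C1 + C3 + C4 + C5].
  by split; lra.
exists (C1 + C3 + C4 + C5), kp; split => //.
move=> n tau s X pa i r t0 s0 Xinj pa_irr ux r0 r1 D t.
have tp : 0 < t by rewrite mulr_gt0.
have w1 := wb n tau X pa i r t0 Xinj pa_irr r0 D.
have cmB z M : (forall k, k \in pa i -> `|z k| <= M) -> `|cond_mean a tau X pa i z| <= C1 * M.
  move=> zM; rewrite cond_meanE; apply: le_trans (ler_norm_sum _ _ _) _.
  have p0 : (0 < #|pa i|)%N by have [pE _ _ _] := D; rewrite pE bin_gt0 leq_addr.
  have M0 : 0 <= M by apply: le_trans (zM _ (enum_valP (Ordinal p0))).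
  apply: le_trans (_ : _ <= \sum_k `|kriging a tau X pa i ord0 k| * M) _.
    by apply: ler_sum => k _; rewrite normrM ler_wpM2l// zM ?enum_valP.
  by rewrite -mulr_suml ler_wpM2r.
have p0 : (0 < #|pa i|)%N by have [pE _ _ _] := D; rewrite pE bin_gt0 leq_addr.
split.
- move=> z M zM; apply: le_trans (cmB z M zM) _; rewrite ler_wpM2r//.
  exact: le_trans (zM _ (enum_valP (Ordinal p0))).
- apply: le_trans (var n tau s X pa i r t0 s0 Xinj pa_irr r0 D) _.
  by rewrite ler_wpM2r ?sqr_ge0// ler_wpM2r// invr_ge0 sqr_ge0.
- move=> f P f1 Pq Pf.
  have rb0 : 0 <= r `^ b by exact: powR_ge0.
  have m0 : 0 <= Num.min 1 (t `^ a) by rewrite le_min ler01 powR_ge0.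
  apply: (@le_trans _ _ (C5 * (r `^ b + Num.min 1 (t `^ a)))); last by rewrite ler_wpM2r ?addr_ge0.
  have [tk|tk] := leP t kp; last first.
    apply: (@le_trans _ _ (1 + C1)).
      apply: le_trans (ler_normB _ _) _; apply: lerD; first exact: f1.
      by rewrite -[C1]mulr1; apply: cmB => k _; exact: f1.
    have h : 1 <= (1 + kp `^ (- a)) * Num.min 1 (t `^ a).
      have kk : kp `^ (- a) * kp `^ a = 1 by rewrite powRN mulVf// gt_eqF// powR_gt0.
      have ka : kp `^ a <= t `^ a by apply: ge0_ler_powR; rewrite ?nnegrE ?ltW.
      rewrite /Num.min; case: ifP => _; first by rewrite mulr1 lerDl powR_ge0.
      rewrite mulrDl mul1r -{1}kk -[leLHS]add0r lerD ?powR_ge0// ler_wpM2l ?powR_ge0//.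
    apply: le_trans (_ : _ <= (1 + C1) * (1 + kp `^ (- a)) * Num.min 1 (t `^ a)) _.
      by rewrite -mulrA ler_peMr// addr_ge0 ?(ltW C10).
    rewrite ler_pM// ?lerDr//; rewrite /C5; have := ltW C20; lra.
  have tk2 : tau * r <= kp2 by apply: le_trans tk _; rewrite !ge_min lexx orbT.
  have PB x : unit_cube x -> `|P (x - X i)| <= 1 + Cw.
    move=> cx; have h : `|f x - P (x - X i)| <= Cw.
      have := Pf x 1 cx ltr01; rewrite powR1 mulr1; apply => c.
      have /andP[x1 x2] := cx c; have /andP[y1 y2] := ux i c.
      by rewrite ler_norml; apply/andP; split; lra.
    rewrite -[P _](subrK (f x)) addrC; apply: le_trans (ler_normD _ _) _.
    by rewrite lerD ?f1// distrC.
  have hp := poly n tau X pa i r P t0 Xinj (ux i) r0 r1 (pa_irr i) D Pq PB tk2.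
  have [_ _ _ [v [h [/andP[h0 hr] ci cp _]]]] := D.
  have del0 : 0 < cL * r by rewrite mulr_gt0.
  pose e k := f (X k) - P (X k - X i).
  have eB k : k \in i |: pa i -> `|e k| <= Cw * cL `^ b * r `^ b.
    rewrite in_setU1 => ki; rewrite -mulrA -powRM ?(ltW cL0) ?(ltW r0)//.
    apply: Pf => // c; apply: le_trans hr; apply: (@cube_sub R d v h (X k) (X i)) => //.
    by case/orP: ki => [/eqP ->|kpa]; [exact: ci | exact: cp kpa].
  (* [f] is split into its Taylor polynomial at [X i] and the remainder [e], which vanishes to order
     [r ^ b] at the parents; the weights have bounded total mass on [e]. *)
  have -> : f (X i) - cond_mean a tau X pa i (fun k => f (X k)) =
      (e i - cond_mean a tau X pa i e) -
      (\sum_k kriging a tau X pa i ord0 k * P (parent_pts X pa i k - X i) - P 0).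
    rewrite !cond_meanE /e subrr.
    under [X in _ = _ - X - _]eq_bigr do rewrite mulrBr.
    rewrite sumrB.
    set u := \sum_k _ * f _; set w := \sum_k _ * P _; ring.
  have ei := eB i (setU11 _ _).
  have ec := cmB e _ (fun k kp => eB k (setU1r _ kp)).
  apply: le_trans (ler_normB _ _) _.
  apply: le_trans (lerD (ler_normB _ _) (lexx _)) _.
  apply: le_trans (lerD (lerD ei ec) hp) _.
  have t1 : t <= 1 by apply: le_trans tk _; rewrite ge_min lexx.
  have ta1 : t `^ a <= 1.
    by have := @ge0_ler_powR R a (ltW a0) t 1; rewrite powR1; apply; rewrite ?nnegrE// ltW.
  have -> : Num.min 1 (t `^ a) = t `^ a by rewrite minEle; case: ifP => // h1; apply/eqP; rewrite eq_le h1 ta1.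
  have ta0 : 0 <= t `^ a by exact: powR_ge0.
  rewrite -/t [X in X + _](_ : _ = Cw * cL `^ b * (1 + C1) * r `^ b); last by ring.
  rewrite /C5 mulrDl mulrDl -[leLHS]addr0 lerD//; last by apply: mulr_ge0 => //; exact: addr_ge0.
  by rewrite lerD2r ler_wpM2l// lerDl.
- move=> z M tk zM; have tk3 : tau * r <= kp3 by apply: le_trans tk _; rewrite !ge_min lexx !orbT.
  have [_ /(_ tk3)[_ wd]] := near n tau X pa i r t0 Xinj r0 (pa_irr i) D.
  rewrite cond_meanE interp_sum -sumrB; apply: le_trans (ler_norm_sum _ _ _) _.
  have M0 : 0 <= M by apply: le_trans (zM _ (enum_valP (Ordinal p0))).
  apply: (@le_trans _ _ (C3 * t `^ (a - l%:R) * M)); last by rewrite ler_wpM2r// ler_wpM2r ?powR_ge0.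
  apply: le_trans (ler_wpM2r M0 wd); rewrite mulr_suml; apply: ler_sum => k _.
  by rewrite -mulrBl normrM ler_wpM2l// zM ?enum_valP.
Qed.

End VertexBounds.

(** * Counting of vertices and balance of the two resolutions *)

Section Packing.
Variables (R : realType) (d n : nat).

(** A grid cell of side [del] contains at most one of the points; [F] sends a point to its cell. *)
Lemma card_separated_le (X : 'I_n -> 'rV[R]_d) (A : {set 'I_n}) (del : R) : 0 < del ->
  (forall i, unit_cube (X i)) ->
  {in A &, forall i k, i != k -> del <= `|X i - X k|} ->
  #|A|%:R <= (1 + del^-1) ^+ d.
Proof.
move=> del0 uX sep; pose N := Num.truncn del^-1.
have invd : 0 <= del^-1 by rewrite invr_ge0 ltW.
have [N1 N2] : N%:R <= del^-1 /\ del^-1 < N.+1%:R by have /andP := truncn_itv invd.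
have xN i c : (Num.truncn (X i ord0 c / del) < N.+1)%N.
  have /andP[x0 x1] := uX i c.
  rewrite ltnS truncn_ge_nat//; apply: le_trans (_ : _ <= X i ord0 c / del) _.
    by rewrite truncn_le divr_ge0// ltW.
  by rewrite ler_piMl.
pose F i : {ffun 'I_d -> 'I_N.+1} := [ffun c => Ordinal (xN i c)].
have Finj : {in A &, injective F}.
  move=> i k iA kA /ffunP Fik; apply/eqP; apply: contraT => ik.
  have := sep i k iA kA ik; rewrite leNgt => /negP[].
  have lt c : `|(X i - X k) ord0 c| < del.
    have /(congr1 val) := Fik c; rewrite !ffunE/= => e.
    have xd j : 0 <= X j ord0 c / del.
      by have /andP[x0 _] := uX j c; rewrite divr_ge0// ltW.
    have /andP[a1 a2] := truncn_itv (xd i); have /andP[b1 b2] := truncn_itv (xd k).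
    rewrite e in a1 a2; rewrite -natr1 in a2; rewrite -natr1 in b2.
    have : `|X i ord0 c / del - X k ord0 c / del| < 1.
      by rewrite ltr_norml; apply/andP; split; lra.
    by rewrite -mulrBl normrM (gtr0_norm (_ : 0 < del^-1)) ?invr_gt0// ltr_pdivrMr// mul1r !mxE.
  pose M : R := \big[Num.max/0]_c `|(X i - X k) ord0 c|.
  have M1 : M < del by rewrite /M; elim/big_ind: _ => // x y x1 y1; rewrite gt_max x1.
  apply: le_lt_trans M1; apply: rv_norm_le => [|c]; first exact: bigmax_ge_id.
  exact: (le_bigmax _ (fun c => `|(X i - X k) ord0 c|)).
have := @leq_card_in _ _ F _ Finj; rewrite card_ffun !card_ord => h.
apply: (@le_trans _ _ (N.+1 ^ d)%:R); first by rewrite ler_nat.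
by rewrite natrX lerXn2r ?nnegrE ?addr_ge0// -natr1 addrC lerD2l.
Qed.

End Packing.

Section Budget.
Variable R : realType.

Lemma sum_geometric_le (rho : R) m : 0 < rho < 1 -> \sum_(t < m) rho ^+ t.+1 <= (1 - rho)^-1.
Proof.
move=> /andP[r0 r1]; have d0 : 0 < 1 - rho by rewrite subr_gt0.
have : (1 - rho) * \sum_(t < m) rho ^+ t <= 1.
  have := subrX1 rho m; rewrite -opprB -[rho - 1]opprB mulNr => /oppr_inj <-.
  by rewrite gerBl exprn_ge0// ltW.
rewrite -ler_pdivlMl// mulr1; apply: le_trans; apply: ler_sum => t _.
by rewrite exprS ler_piMl ?exprn_ge0// ltW.
Qed.

Lemma powR_decay (K c del : R) : 0 <= K -> 0 < c -> 0 < del ->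
  exists2 B : R, 1 <= B & forall x, B <= x -> K * x `^ (- c) <= del.
Proof.
move=> K0 c0 del0; exists (1 + (K / del) `^ (c^-1)) => [|x Bx]; first by rewrite lerDl powR_ge0.
have x1 : 1 <= x by apply: le_trans Bx; rewrite lerDl powR_ge0.
have x0 : 0 < x by apply: lt_le_trans x1.
rewrite powRN -ler_pdivlMr ?invr_gt0 ?powR_gt0// invrK -ler_pdivrMl// mulrC.
have -> : K / del = (K / del) `^ (c^-1) `^ c.
  by rewrite -powRrM mulVf ?gt_eqF// powRr1// divr_ge0// ltW.
apply: ge0_ler_powR; rewrite ?nnegrE ?powR_ge0 ?(ltW c0) ?(ltW x0)//.
by apply: le_trans Bx; rewrite lerDr.
Qed.

(* [U] is the resolution dictated by the smoothness of the function, [V] the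
   one dictated by that of the process; with [m] their maximum, the cost is
   dominated by [V] when [U <= V] and by [U] otherwise. *)
Lemma budget (a b U V eps tau : R) (d : nat) : 0 < b -> b <= a -> 1 <= U -> 0 < V ->
  0 < eps -> 0 < tau -> eps * U `^ b = 1 -> eps * V `^ a = tau `^ a ->
  let m := Num.max U V in let y := U `^ (a - b) * tau `^ (- a) in
  [/\ m `^ (a - b) * tau `^ (- a) <= 1 + y, eps * m `^ a * tau `^ (- a) <= 1 + y &
      m ^+ d * (1 + y) ^+ 2 <= 4 * (V ^+ d + y ^+ 2 * U ^+ d)].
Proof.
move=> b0 ba U1 V0 e0 t0 eU eV m y.
have U0 : 0 < U by apply: lt_le_trans U1.
have a0 : 0 < a by apply: lt_le_trans ba.
have ab0 : 0 <= a - b by rewrite subr_ge0.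
have y0 : 0 <= y by rewrite mulr_ge0 ?powR_ge0.
have ta : tau `^ a * tau `^ (- a) = 1 by rewrite powRN mulfV// gt_eqF// powR_gt0.
have powB x : 0 < x -> x `^ (a - b) = x `^ a * x `^ (- b).
  by move=> x0; rewrite powRD// (gt_eqF x0) implybT.
have Ue : U `^ (- b) = eps.
  by rewrite powRN -[LHS]mul1r -eU mulfK// gt_eqF// powR_gt0.
have yE : y = eps * U `^ a * tau `^ (- a) by rewrite /y powB// Ue; ring.
have [UV|VU] := leP U V.
  have mE : m = V by rewrite /m maxEle UV.
  have VE : eps * V `^ a * tau `^ (- a) = 1 by rewrite eV.
  have Vb : V `^ (- b) <= eps.
    rewrite -Ue !powRN lef_pV2 ?posrE ?powR_gt0//.
    by apply: ge0_ler_powR; rewrite ?nnegrE ?(ltW b0) ?(ltW U0) ?(ltW V0).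
  have Vy : V `^ (a - b) * tau `^ (- a) <= 1.
    rewrite -[leRHS]VE powB// [leLHS](_ : _ = V `^ (- b) * V `^ a * tau `^ (- a)); last by ring.
    by rewrite -!mulrA ler_wpM2r// mulr_ge0 ?powR_ge0.
  have y1 : y <= 1.
    apply: le_trans Vy; rewrite ler_wpM2r ?powR_ge0//.
    by apply: ge0_ler_powR; rewrite ?nnegrE ?(ltW U0) ?(ltW V0).
  rewrite mE; split.
  - by apply: le_trans Vy _; rewrite lerDl.
  - by rewrite VE lerDl.
  - apply: (@le_trans _ _ (V ^+ d * 4)).
      rewrite ler_wpM2l ?exprn_ge0 ?(ltW V0)// [leRHS](_ : _ = 2 ^+ 2); last by ring.
      by rewrite lerXn2r ?nnegrE ?addr_ge0//; lra.
    by rewrite mulrC ler_pM2l// lerDl mulr_ge0 ?sqr_ge0 ?exprn_ge0 ?(ltW U0).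
have mE : m = U by rewrite /m maxEle leNgt VU.
have y1 : 1 <= y.
  rewrite yE -ta ler_wpM2r ?powR_ge0// -eV ler_pM2l//.
  by apply: ge0_ler_powR; rewrite ?nnegrE ?(ltW a0) ?(ltW U0) ?(ltW V0) ?(ltW VU).
rewrite mE -/y -yE; split; rewrite ?lerDr//.
apply: (@le_trans _ _ (U ^+ d * (2 * y) ^+ 2)).
  rewrite ler_wpM2l ?exprn_ge0 ?(ltW U0)// lerXn2r ?nnegrE ?addr_ge0 ?mulr_ge0 ?powR_ge0//.
  by rewrite mulr_natl mulr2n lerD2r.
rewrite [leLHS](_ : _ = 4 * (y ^+ 2 * U ^+ d)); last by ring.
by rewrite ler_pM2l// lerDr exprn_ge0// ltW.
Qed.

End Budget.

(** * Continuation by kriging and computation of the rates *)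

Section Completion.
Variables (R : realType) (d n : nat) (a tau s : R).
Variables (X : 'I_n -> 'rV[R]_d) (pa : 'I_n -> {set 'I_n}).
Hypothesis pa_lt : forall i k : 'I_n, k \in pa i -> (k < i)%N.

(** The requirement is a triangular system, as parents precede their children; on [D] the row of
    weights is emptied so that the prescribed value is taken. *)
Lemma kriging_continuation (D : pred 'I_n) (y : 'I_n -> R) : exists f : 'I_n -> R,
  (forall i, D i -> f i = y i) /\ (forall i, ~~ D i -> f i = cond_mean a tau X pa i f).
Proof.
pose W i k := if D i then 0 else krig_weight a tau X pa i k.
exists (solve W (fun i => if D i then y i else 0)); split=> i Di; rewrite solveP.
  rewrite Di /partial_mean big1 ?addr0// => k _.
  by rewrite /W Di mul0r.
rewrite (negbTE Di) add0r (cond_mean_partial _ _ _ pa_lt) /partial_mean; apply: eq_bigr => k _.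
by rewrite {1}/W (negbTE Di).
Qed.

Hypotheses (d0 : (0 < d)%N) (a0 : 0 < a) (tau0 : 0 < tau) (s0 : 0 < s) (Xinj : injective X).

(* The first vertices only have parents among themselves. *)
Lemma early_cost (p : nat) (g : {k : 'I_n | (k < p)%N} -> R) (N : R) (f : 'I_n -> R) :
  0 <= N ->
  (forall u : {k : 'I_n | (k < p)%N} -> R,
     `|\sum_k u k * g k| <= N * Num.sqrt (qf (@matern R d a) u (fun k => tau *: X (val k)))) ->
  (forall k, f (val k) = g k) ->
  forall i : 'I_n, (i < p)%N ->
  (f i - cond_mean a tau X pa i f) ^+ 2 / cond_var a tau s X pa i <= N ^+ 2 / s ^+ 2.
Proof.
move=> N0 hg fg i ip.
have pa_irr k : k \notin pa k by apply/negP => /pa_lt; rewrite ltnn.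
have r0 (k : 'I_n) : ~~ (k < p)%N -> resid a tau X pa i k = 0.
  move=> kp; have ki : k != i by apply: contraNneq kp => ->.
  rewrite /resid (negbTE ki) krig_weight0 ?subrr//.
  by apply: contra kp => /pa_lt h; exact: ltn_trans ip.
have sumE (F : 'I_n -> R) : \sum_k resid a tau X pa i k * F k =
    \sum_(k : {k : 'I_n | (k < p)%N}) resid a tau X pa i (val k) * F (val k).
  rewrite (bigID (fun k : 'I_n => (k < p)%N))/= [X in _ + X]big1 ?addr0; last first.
    by move=> k kp; rewrite r0 ?mul0r.
  exact: (big_sub (fun k : 'I_n => (k < p)%N)).
apply: resid_sqr_le => //.
rewrite sumE; under eq_bigr do rewrite fg.
apply: le_trans (hg _) _; rewrite ler_wpM2l// ler_wsqrtr// le_eqVlt; apply/orP; left; apply/eqP.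
have qE (J : finType) (v : J -> R) (z : J -> 'rV[R]_d) :
    qf (@matern R d a) v z = \sum_k v k * \sum_j v j * matern a (z k) (z j).
  apply: eq_bigr => k _; rewrite mulr_sumr; apply: eq_bigr => j _.
  by rewrite mulrA.
pose G k := \sum_j resid a tau X pa i j * matern a (tau *: X k) (tau *: X j).
rewrite !qE (sumE G); apply: eq_bigr => k _; congr (_ * _).
exact: (esym (sumE (fun j => matern a (tau *: X (val k)) (tau *: X j)))).
Qed.

End Completion.
Section Rates.
Variable R : realType.
Implicit Types (a b c gamma tau eps : R).

Lemma strict_floor_le a b : 0 < b -> b <= a -> (strict_floor b <= strict_floor a)%N.
Proof.
move=> b0 ba; have a0 : 0 < a by exact: lt_le_trans ba.
have /andP[qb _] := strict_floorP b0; have /andP[_ al] := strict_floorP a0.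
by rewrite -ltnS -(ltr_nat R) (lt_le_trans qb)// (le_trans ba).
Qed.

Lemma expn_unbounded gamma (A : R) : 1 < gamma -> exists j, A <= gamma ^+ j.
Proof.
move=> g1; have g0 : 0 < gamma by exact: lt_trans g1.
have l0 : 0 < ln gamma by rewrite ln_gt0.
exists (Num.truncn (A / ln gamma)).+1; set j := _.+1.
have h : A / ln gamma < j%:R by exact: truncnS_gt.
have -> : gamma ^+ j = expR (j%:R * ln gamma).
  by rewrite expRM_natl lnK// posrE.
apply: le_trans (expR_ge1Dx _); rewrite -[leLHS]add0r lerD//.
by rewrite -ler_pdivrMr// ltW.
Qed.

Lemma sum_layers_le gamma c (x : R) (j m : nat) : 1 < gamma -> 0 < c -> 0 <= x ->
  \sum_(t < m) (x * gamma ^- (j + t.+1)) `^ c <= (1 - gamma `^ (- c))^-1 * (x * gamma ^- j) `^ c.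
Proof.
move=> g1 c0 x0; have g0 : 0 < gamma by exact: lt_trans g1.
have e k : (gamma ^- k) `^ c = (gamma `^ (- c)) ^+ k.
  by rewrite -powR_invn ?(ltW g0)// -powRrM -powR_mulrn ?powR_ge0// -powRrM; congr (_ `^ _); ring.
have gn k : 0 <= gamma ^- k by rewrite invr_ge0 exprn_ge0// ltW.
apply: (@le_trans _ _ (\sum_(t < m) (x * gamma ^- j) `^ c * (gamma `^ (- c)) ^+ t.+1)).
  by apply: ler_sum => t _; rewrite !powRM// !e exprD mulrA.
rewrite -mulr_sumr mulrC ler_wpM2r ?powR_ge0// sum_geometric_le//.
rewrite powR_gt0//= powRN invf_lt1 ?powR_gt0//.
by have := @gt0_ltr_powR R c c0 1 gamma; rewrite powR1; apply; rewrite ?nnegrE ?(ltW g0).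
Qed.

(** The left side is, up to constants, the residual times the inverse standard deviation at a vertex
    of scale [r], with [m] the finest resolution in use. After expansion, each product with
    [(tau * r) ^ (- a)] falls under one of the two bounds supplied by [budget], except that of the
    minimum, which cancels it. *)
Lemma vertex_factor a b eps tau (r z m Y : R) : 0 < b -> b <= a -> 0 < r -> r <= 1 -> 0 < tau ->
  r^-1 <= z * m -> 1 <= z -> 0 < m -> 0 < eps -> eps <= 1 -> 1 <= Y ->
  m `^ (a - b) * tau `^ (- a) <= Y -> eps * m `^ a * tau `^ (- a) <= Y ->
  (r `^ b + Num.min 1 ((tau * r) `^ a) + eps) * (1 + (tau * r) `^ (- a)) <= (4 + 2 * z `^ a) * Y.
Proof.
move=> b0 ba r0 r1 t0 rz z1 m0 e0 e1 Y1 h1 h2.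
have a0 : 0 < a by exact: lt_le_trans ba.
have z0 : 0 < z by exact: lt_le_trans z1.
have tr0 : 0 < tau * r by rewrite mulr_gt0.
have ri0 : 0 < r^-1 by rewrite invr_gt0.
set mn := Num.min _ _.
have mn0 : 0 <= mn by rewrite le_min ler01 powR_ge0.
have mn1 : mn <= 1 by rewrite ge_min lexx.
have mt : mn * (tau * r) `^ (- a) <= 1.
  apply: (@le_trans _ _ ((tau * r) `^ a * (tau * r) `^ (- a))).
    by rewrite ler_wpM2r ?powR_ge0// ge_min lexx orbT.
  by rewrite powRN mulfV// gt_eqF// powR_gt0.
have rb : r `^ b <= 1.
  by have := @ge0_ler_powR R b (ltW b0) r 1; rewrite powR1; apply; rewrite ?nnegrE ?(ltW r0).
have T : (tau * r) `^ (- a) = r^-1 `^ a * tau `^ (- a).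
  by rewrite powRM ?(ltW t0) ?(ltW r0)// mulrC; congr (_ * _); rewrite -powR_inv1 ?(ltW r0)// -powRrM mulN1r.
have pm c : 0 <= c -> r^-1 `^ c <= z `^ c * m `^ c.
  move=> c0; rewrite -powRM ?(ltW z0) ?(ltW m0)//.
  by apply: ge0_ler_powR; rewrite ?nnegrE ?(ltW ri0) ?mulr_ge0 ?(ltW z0) ?(ltW m0).
have za : z `^ (a - b) <= z `^ a.
  by rewrite ler_powR// gerBl ltW.
have zp : 0 <= z `^ a by exact: powR_ge0.
have k1 : r `^ b * (tau * r) `^ (- a) <= z `^ a * Y.
  have -> : r `^ b * (tau * r) `^ (- a) = r^-1 `^ (a - b) * tau `^ (- a).
    rewrite T mulrA; congr (_ * _); rewrite powRB ?(gt_eqF ri0) ?implybT//.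
    by rewrite mulrC; congr (_ * _); rewrite -powRN -powR_inv1 ?(ltW r0)// -powRrM mulN1r opprK.
  apply: (@le_trans _ _ (z `^ a * (m `^ (a - b) * tau `^ (- a)))); last by rewrite ler_wpM2l.
  rewrite mulrA ler_wpM2r ?powR_ge0//; apply: le_trans (pm _ _) _; first by rewrite subr_ge0.
  by rewrite ler_wpM2r ?powR_ge0.
have k2 : eps * (tau * r) `^ (- a) <= z `^ a * Y.
  rewrite T; apply: (@le_trans _ _ (z `^ a * (eps * m `^ a * tau `^ (- a)))); last by rewrite ler_wpM2l.
  rewrite [leRHS](_ : _ = eps * (z `^ a * m `^ a * tau `^ (- a))); last by ring.
  by rewrite ler_pM2l// ler_wpM2r ?powR_ge0// pm// ltW.
have k3 : mn * (tau * r) `^ (- a) <= Y by exact: le_trans Y1.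
move: k1 k2 k3 zp Y1; set T' := _ `^ (- a) in mt T *; set za' := z `^ a; move=> k1 k2 k3 zp Y1.
have -> : (r `^ b + mn + eps) * (1 + T') = r `^ b + mn + eps + r `^ b * T' + eps * T' + mn * T' by ring.
have -> : (4 + 2 * za') * Y = 4 * Y + za' * Y + za' * Y by ring.
lra.
Qed.

(** With [h = U ^ (d / 2)] the norm of the early values is of order [1 + y * h], and its square is
    of order [1 + y ^+ 2 * U ^+ d]. The 1 is absorbed because the rate is bounded below, by
    [budget]. *)
Lemma early_factor a b eps tau (kp Ce N U V : R) (d : nat) : 0 < b -> b <= a -> 0 < tau ->
  0 < eps -> 0 < kp -> 0 < Ce -> 1 <= U -> eps `^ (- b^-1) = U ->
  let e := a - b + d%:R / 2 in let y := U `^ (a - b) * tau `^ (- a) in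
  0 <= N -> N <= Ce * (1 + tau `^ (- a) + tau `^ (- a) * (kp * eps) `^ (- (e / b))) ->
  1 <= 4 * (V ^+ d + y ^+ 2 * U ^+ d) -> 0 <= V ->
  N ^+ 2 <= 2 * Ce ^+ 2 * (4 + (1 + kp `^ (- (e / b))) ^+ 2) * (V ^+ d + y ^+ 2 * U ^+ d).
Proof.
move=> b0 ba t0 e0 kp0 Ce0 U1 UE e y N0 hN h4 V0.
have U0 : 0 < U by exact: lt_le_trans U1.
set kk := kp `^ _ in hN *; have kk0 : 0 <= kk by exact: powR_ge0.
pose h := U `^ (d%:R / 2).
have hh : h ^+ 2 = U ^+ d.
  by rewrite -powR_mulrn ?powR_ge0// -powRrM divfK// powR_mulrn// ltW.
have h1 : 1 <= h.
  have := @ge0_ler_powR R (d%:R / 2) (divr_ge0 (ler0n _ _) (ler0n _ _)) 1 U.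
  by rewrite powR1; apply; rewrite ?nnegrE ?ler01// ltW.
have yh : U `^ e * tau `^ (- a) = y * h.
  by rewrite /y /h /e powRD ?(gt_eqF U0) ?implybT//; ring.
have eE : (kp * eps) `^ (- (e / b)) = kk * U `^ e.
  by rewrite powRM ?(ltW kp0) ?(ltW e0)// -UE -powRrM; congr (_ * _ `^ _); ring.
have e0' : 0 <= e by rewrite addr_ge0 ?subr_ge0 ?divr_ge0.
have U1e : 1 <= U `^ e.
  by have := @ge0_ler_powR R e e0' 1 U; rewrite powR1; apply; rewrite ?nnegrE ?ler01// ltW.
have hN' : N <= Ce * (1 + (1 + kk) * (y * h)).
  apply: le_trans hN _; rewrite ler_pM2l// -addrA lerD2l eE -yh mulrDl mul1r lerD//.
    by rewrite ler_peMl ?powR_ge0.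
  by rewrite le_eqVlt; apply/orP; left; apply/eqP; ring.
have y0 : 0 <= y by rewrite mulr_ge0 ?powR_ge0.
set w := (1 + kk) * (y * h) in hN'.
have w0 : 0 <= w by rewrite !mulr_ge0 ?addr_ge0 ?powR_ge0.
apply: (@le_trans _ _ ((Ce * (1 + w)) ^+ 2)).
  by rewrite lerXn2r ?nnegrE// mulr_ge0 ?(ltW Ce0)// addr_ge0.
rewrite exprMn -[leRHS]mulrA (mulrC 2) -[leRHS]mulrA ler_pM2l ?exprn_gt0//.
have w2 : w ^+ 2 = (1 + kk) ^+ 2 * (y ^+ 2 * U ^+ d) by rewrite /w -hh; ring.
have s : (1 + w) ^+ 2 <= 2 * (1 + w ^+ 2) by have := sqr_ge0 (1 - w); nra.
apply: le_trans s _; rewrite ler_pM2l// w2 mulrDl lerD// ler_wpM2l ?sqr_ge0//.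
by rewrite lerDr exprn_ge0.
Qed.

End Rates.

(** * Construction of the approximating function *)

Section Assembly.
Variables (R : realType) (d : nat) (a b ga cd cL cN : R) (i0 : nat).
Hypotheses (d0 : (0 < d)%N) (b0 : 0 < b) (ba : b <= a) (ga1 : 1 < ga).
Hypotheses (cd0 : 0 < cd) (cL0 : 0 < cL) (cN0 : 0 < cN).

Let a0 : 0 < a. Proof. exact: lt_le_trans ba. Qed.
Let ga0 : 0 < ga. Proof. exact: lt_trans ga1. Qed.

(* Early vertices take the values of [early_extension]; the other vertices take
   the values of [f0] up to a layer [j] of resolution [m], the larger of the
   two critical resolutions, and the kriging predictions beyond, where [f] is
   then free of cost. *)
Lemma vecchia_approximation : exists2 C : R, 0 < C &
  forall (f0 : 'rV[R]_d -> R) (tau s : R), holder_ball b f0 -> 0 < tau -> 0 < s ->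
  forall (n J : nat) (X : 'I_n -> 'rV[R]_d) (pa : 'I_n -> {set 'I_n}) (lay : 'I_n -> 'I_J.+1),
    injective X -> (forall i, unit_cube (X i)) -> layered X pa lay ga cd ->
    norming X pa lay (strict_floor a) i0 ga cL cN ->
    (forall i, vandermonde (parent_pts X pa i) \in unitmx) ->
    (exists i, (lay i < J)%N) ->
  let theta := interp_const X pa lay in
  forall eps, 0 < eps < 1 ->
  let U := eps `^ (- b^-1) in let V := tau * eps `^ (- a^-1) in
  let y := U `^ (a - b) * tau `^ (- a) in
  exists2 f : 'I_n -> R,
    (forall i, `|f i - f0 (X i)| <= theta * expR (2 * theta) * eps) &
    rkhs_sqnorm a tau s X pa f <= C * s ^- 2 * (V ^+ d + y ^+ 2 * U ^+ d).
Proof.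
(* Indices are shifted by one, so the vertices out of reach of the norming condition are those with
   [i < i0.-1]. *)
set l := strict_floor a; set q := strict_floor b; pose p := i0.-1.
have la : l%:R < a <= l.+1%:R := strict_floorP a0.
have al0 : 0 < a - l%:R by rewrite subr_gt0; case/andP: la.
have ql : (q <= l)%N by exact: strict_floor_le.
have [Cw Cw0 wh] := whitney d0 b0.
have [C [kp [C0 kp0 kb]]] := kriging_bounds d0 la ql ba cd0 cL0 cN0 Cw0.
have [Ce Ce0 early] := early_extension q p d0 a0 b0 ba Cw0.
(* The construction works with accuracy [kappa * eps]: [2 * i0 + 3] such errors accumulate along the
   layers, and one more comes from replacing [f0] by its smoothed version [f1]. *)
pose kappa : R := (2 * i0%:R + 4)^-1.
have kd : 0 < 2 * i0%:R + 4 :> R by rewrite ltr_wpDl ?mulr_ge0.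
have kappa0 : 0 < kappa by rewrite invr_gt0.
have kappa1 : kappa <= 1 by rewrite invf_le1//; have := ler0n R i0; lra.
pose G (c : R) := (1 - ga `^ (- c))^-1.
have G0 c : 0 < c -> 0 <= G c.
  move=> c0; rewrite invr_ge0 subr_ge0 powRN invf_le1 ?powR_gt0//.
  by have := @ge0_ler_powR R c (ltW c0) 1 ga; rewrite powR1; apply; rewrite ?nnegrE ?ler01 ?(ltW ga0) ?(ltW ga1).
(* The resolution is taken [C1] times beyond the critical one: [B1] makes the sum of the Gronwall
   coefficients at most 1, [B2] and [B3] make the two consistency errors small relative to [eps],
   and [kp^-1] places all later layers where kriging is close to interpolation. *)
have [B1 B11 hB1] := powR_decay (mulr_ge0 (ltW C0) (G0 _ al0)) al0 ltr01.
have [B2 B21 hB2] := powR_decay (mulr_ge0 (ltW C0) (G0 _ b0)) b0 kappa0.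
have [B3 B31 hB3] := powR_decay (mulr_ge0 (ltW C0) (G0 _ a0)) a0 kappa0.
pose C1 := B1 + B2 + B3 + kp^-1.
have kpi : 0 < kp^-1 by rewrite invr_gt0.
have [C11 CB1 CB2 CB3 Ckp] : [/\ 1 <= C1, B1 <= C1, B2 <= C1, B3 <= C1 & kp^-1 <= C1].
  by rewrite /C1; split; lra.
have C10 : 0 < C1 by exact: lt_le_trans C11.
(* The first layer [j] of resolution at least [C1 * m] overshoots by at most one factor [ga]. *)
pose z := ga * C1.
have z1 : 1 <= z by rewrite /z mulr_ege1// ltW.
have z0 : 0 < z by exact: lt_le_trans z1.
pose kk := kappa `^ (- ((a - b + d%:R / 2) / b)).
pose K0 := 2 * Ce ^+ 2 * (4 + (1 + kk) ^+ 2).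
pose K1 := C ^+ 3 * (4 + 2 * z `^ a) ^+ 2.
have K00 : 0 <= K0.
  by apply: mulr_ge0; [apply: mulr_ge0 | apply: addr_ge0] => //; exact: sqr_ge0.
have K10 : 0 <= K1 by apply: mulr_ge0; [exact/exprn_ge0/ltW | exact: sqr_ge0].
have zc0 : 0 <= 1 + z / cd by rewrite addr_ge0 ?divr_ge0 ?(ltW z0) ?(ltW cd0).
exists (p%:R * K0 + 4 * (1 + z / cd) ^+ d * K1 + 1).
  rewrite ltr_wpDl// addr_ge0//; first exact: mulr_ge0.
  by apply: mulr_ge0 => //; apply: mulr_ge0 => //; exact: exprn_ge0.
move=> f0 tau s hf t0 s0 n J X pa lay Xinj uX lyr nrm uV layJ theta eps /andP[e0 e1] U V y.
have [pa_lay sep mono] := lyr.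
have pa_lt i k : k \in pa i -> (k < i)%N.
  by move=> /pa_lay; rewrite ltnNge [(k < i)%N]ltnNge; apply: contra => /mono.
have pa_irr i : i \notin pa i by apply/negP => /pa_lt; rewrite ltnn.
have theta1 : 1 <= theta := interp_const_ge1 X pa_lay layJ.
have thE : interp_const X pa lay = theta by [].
clearbody theta.
have gp k : 0 < ga ^- k by rewrite invr_gt0 exprn_gt0.
have g1 k : ga ^- k <= 1 by rewrite invf_le1 ?exprn_gt0// exprn_ege1// ltW.
have design (i : 'I_n) : ~~ (i < p)%N -> local_design l cd cL cN X pa i (ga ^- lay i).
  move=> ip; have i0i : (i0 <= i.+1)%N.
    by move: ip; rewrite -leqNgt /p; case: (i0).
  have [pE [v [h [hr ci cp nA]]]] := nrm i i0i; split => //; last by exists v, h.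
  have ly k : k \in i |: pa i -> (lay k <= lay i)%N.
    by rewrite in_setU1 => /orP[/eqP -> //|/pa_lay/ltnW].
  by move=> k1 k2 /ly h1 /ly h2 k12; apply: sep.
have U0 : 0 < U by exact: powR_gt0.
have V0 : 0 < V by rewrite mulr_gt0// powR_gt0.
have U1 : 1 <= U.
  have bi0 : - b^-1 <= 0 by rewrite oppr_le0 invr_ge0 ltW.
  by have := @ger_powR R eps; move=> h; rewrite -(powRr0 eps) h// e0 ltW.
have eU : eps * U `^ b = 1.
  by rewrite -powRrM mulNr mulVf ?gt_eqF// -{1}(powRr1 (ltW e0)) -powRD ?(gt_eqF e0) ?implybT// subrr powRr0.
have eV : eps * V `^ a = tau `^ a.
  rewrite powRM ?powR_ge0 ?(ltW t0)// -powRrM mulNr mulVf ?gt_eqF// mulrCA.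
  by rewrite -{1}(powRr1 (ltW e0)) -powRD ?(gt_eqF e0) ?implybT// subrr powRr0 mulr1.
have := budget d b0 ba U1 V0 e0 t0 eU eV; set m := Num.max U V; rewrite -/y => -[bd1 bd2 bd3].
have m1 : 1 <= m by rewrite le_max U1.
have m0 : 0 < m by exact: lt_le_trans m1.
have y0 : 0 <= y by rewrite mulr_ge0 ?powR_ge0.
set T := V ^+ d + y ^+ 2 * U ^+ d in bd3 *.
have T4 : 1 <= 4 * T.
  apply: le_trans bd3; rewrite -[leLHS]mulr1 ler_pM ?exprn_ege1//.
  by rewrite lerDl.
have exj := expn_unbounded (C1 * m) ga1; case: (ex_minnP exj) => j jge jmin {exj}.
have jle : ga ^+ j <= z * m.
  case: j jge jmin => [|j] jge jmin; first by rewrite expr0 mulr_ege1.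
  have : ga ^+ j < C1 * m by rewrite ltNge; apply/negP => /jmin; rewrite ltnn.
  by rewrite exprS /z -mulrA ler_pM2l// => /ltW.
pose eps1 := kappa * eps.
have eps10 : 0 < eps1 by rewrite mulr_gt0.
have eps11 : eps1 <= eps by rewrite ler_piMl// ltW.
have [f1 [f1f f1b /= f1t]] := wh f0 hf _ X eps1 uX eps10.
have /choice[P hP] : forall i, exists P, polyw q P /\ taylor_at b Cw f1 P (X i).
  by move=> i; have [P Pq Pt] := f1t (X i) (uX i); exists P.
have cardp : (#|{: {k : 'I_n | (k < p)%N}}| <= p)%N.
  have inj : injective (fun k : {k : 'I_n | (k < p)%N} => Ordinal (valP k)).
    by move=> k1 k2 [/val_inj/val_inj].
  by have := leq_card _ inj; rewrite card_ord.
have [g [N [N0 gf gN NB]]] := early _ (fun k => X (val k)) f1 (fun k => P (val k)) tau eps1 cardp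
  (fun k => uX _) t0 eps10 f1b (fun k => (hP _).1) (fun k => (hP _).2).
pose D : pred 'I_n := fun i => (i < p)%N || (lay i <= j)%N.
have [f [fD fK]] := kriging_continuation a tau X pa_lt D (fun i => oapp g (f1 (X i)) (insub i)).
have fg k : f (val k) = g k by rewrite fD ?valK// /D (valP k).
have fn (i : 'I_n) : ~~ (i < p)%N -> (lay i <= j)%N -> f i = f1 (X i).
  by move=> ip ij; rewrite fD ?insubN// /D ij orbT.
pose e i := f i - f1 (X i).
have eD i : D i -> `|e i| <= eps1.
  rewrite /e; case: (boolP (i < p)%N) => [ip _|ip]; last first.
    by rewrite /D (negbTE ip)/= => ij; rewrite fn// subrr normr0 ltW.
  by have := gf (Sub i ip); rewrite -fg SubK.
have kbi (i : 'I_n) (ip : ~~ (i < p)%N) :=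
  kb n tau s X pa i (ga ^- lay i) t0 s0 Xinj pa_irr uX (gp _) (g1 _) (design i ip).
have cmB u v : (forall k, f k = u k + v k) -> forall i,
    cond_mean a tau X pa i f = cond_mean a tau X pa i u + cond_mean a tau X pa i v.
  by move=> fuv i; rewrite !cond_meanE -big_split; apply: eq_bigr => k _; rewrite fuv mulrDr.
have cme := cmB e (fun k => f1 (X k)) (fun k => esym (subrK _ _)).
have gj k1 k2 : (k1 <= k2)%N -> ga ^- k2 <= ga ^- k1.
  by move=> k12; rewrite lef_pV2 ?posrE ?exprn_gt0// ler_weXn2l// ltW.
exists f => [i|].
  (* This uses that [m] is at least [V]; the power [a] of the right side is [eps] times a small
     constant. *)
  have taugj : tau * ga ^- j <= eps `^ (a^-1) * C1^-1.
    have tE : tau = V * eps `^ (a^-1).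
      by rewrite /V -mulrA -powRD ?(gt_eqF e0) ?implybT// addNr powRr0 mulr1.
    rewrite {1}tE mulrAC mulrC ler_wpM2l ?powR_ge0// ler_pdivrMr ?exprn_gt0//.
    rewrite mulrC ler_pdivlMr// mulrC; apply: le_trans jge.
    by rewrite ler_pM2l// le_max lexx orbT.
  have ea1 : eps `^ (a^-1) <= 1.
    have := @ge0_ler_powR R a^-1 _ eps 1; rewrite powR1; apply; rewrite ?nnegrE ?invr_ge0 ?(ltW a0) ?(ltW e0) ?(ltW e1)//.
  have tauC : tau * ga ^- j <= C1^-1.
    by apply: le_trans taugj _; rewrite ler_piMl ?invr_ge0 ?(ltW C10).
  have invC c : C1^-1 `^ c = C1 `^ (- c).
    by rewrite -powR_inv1 ?(ltW C10)// -powRrM mulN1r.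
  have tg0 : 0 <= tau * ga ^- j by rewrite mulr_ge0 ?(ltW t0) ?(ltW (gp _)).
  have C1i0 : 0 <= C1^-1 by rewrite invr_ge0 ltW.
  have eps10' := ltW eps10.
  (* One factor [theta] comes from interpolation at early vertices, the other from prolongation, and
     [expR theta] from Gronwall with coefficients of sum at most 1. The second [theta] is then
     absorbed into another [expR theta]. *)
  suff he : `|e i| <= theta * (theta * ((2 * i0%:R + 3) * eps1)) * expR theta.
    have -> : f i - f0 (X i) = e i + (f1 (X i) - f0 (X i)) by rewrite /e addrA subrK.
    apply: le_trans (ler_normD _ _) _; apply: le_trans (lerD he (f1f i)) _.
    have tt : 1 <= theta * theta * expR theta.
      by rewrite !mulr_ege1// (le_trans _ (expR_ge1Dx _))// lerDl (le_trans ler01).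
    apply: (@le_trans _ _ (theta * theta * expR theta * ((2 * i0%:R + 4) * eps1))).
      have -> : theta * theta * expR theta * ((2 * i0%:R + 4) * eps1) =
        theta * (theta * ((2 * i0%:R + 3) * eps1)) * expR theta + theta * theta * expR theta * eps1 by ring.
      by rewrite lerD2l ler_peMl.
    have -> : theta * theta * expR theta * ((2 * i0%:R + 4) * eps1) = theta * (theta * expR theta) * eps.
      by rewrite /eps1 /kappa; field; rewrite gt_eqF.
    have -> : expR (2 * theta) = expR theta * expR theta by rewrite -expRD; congr expR; ring.
    rewrite ler_wpM2r ?(ltW e0)// ler_wpM2l ?(le_trans ler01)// ler_wpM2r ?expR_ge0//.
    by apply: le_trans (expR_ge1Dx _); rewrite lerDr.
  have t0' : 0 <= theta := le_trans ler01 theta1.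
  have [ij|ij] := leqP (lay i) j.
    apply: le_trans (eD i _) _; first by rewrite /D ij orbT.
    rewrite [leRHS](_ : _ = theta * theta * expR theta * (2 * i0%:R + 3) * eps1); last by ring.
    have ex1 : 1 <= expR theta by apply: le_trans (expR_ge1Dx _); rewrite lerDl.
    have i3 : 1 <= 2 * i0%:R + 3 :> R by rewrite -[leLHS]add0r lerD ?mulr_ge0// ler1n.
    have X1 := mulr_ege1 (mulr_ege1 (mulr_ege1 theta1 theta1) ex1) i3.
    exact: ler_peMl eps10' X1.
  set mm := (lay i - j)%N; have jmm : (j + mm)%N = lay i by rewrite subnKC// ltnW.
  pose aa (t : nat) : R := C * (tau * ga ^- (j + t.+1)) `^ (a - l%:R).
  (* Early vertices may lie in layers beyond [j], where no kriging estimate holds for them. There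
     the defect is at most [2 * theta * eps1], and since each of them has one layer, this is charged
     at most [i0] times in total. *)
  pose cnt (t : nat) : R := \sum_(k < n | (k < p)%N) (lay k == (j + t.+1)%N :> nat)%:R.
  pose bb (t : nat) : R := 2 * theta * eps1 * cnt t +
    C * ((ga ^- (j + t.+1)) `^ b + (tau * ga ^- (j + t.+1)) `^ a).
  have cnt0 t : 0 <= cnt t by apply: sumr_ge0.
  have P0 t : 0 <= C * ((ga ^- (j + t.+1)) `^ b + (tau * ga ^- (j + t.+1)) `^ a).
    by rewrite mulr_ge0 ?(ltW C0)// addr_ge0 ?powR_ge0.
  have aa0 t : 0 <= aa t by rewrite mulr_ge0 ?powR_ge0 ?(ltW C0).
  have te0 : 0 <= 2 * theta * eps1 by rewrite mulr_ge0// mulr_ge0.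
  have Q0 t : 0 <= 2 * theta * eps1 * cnt t by rewrite mulr_ge0.
  have bb0 t : 0 <= bb t by exact: addr_ge0.
  have scnt : \sum_(t < mm) cnt t <= i0%:R.
    rewrite exchange_big/=; apply: (@le_trans _ _ (\sum_(k < n | (k < p)%N) 1)).
      apply: ler_sum => k _.
      case: (pickP (fun t : 'I_mm => lay k == (j + t.+1)%N :> nat)) => [t1 /eqP E|no].
        rewrite (bigD1 t1)//= E eqxx big1 ?addr0// => t tt1.
        by rewrite eqn_add2l eqSS [(_ == _)](_ : _ = false)// eq_sym; apply/negbTE.
      by rewrite big1// => t _; rewrite no.
    rewrite sumr_const ler_nat; move: cardp; rewrite card_sig => h.
    by apply: leq_trans h _; rewrite leq_pred.
  have saa : \sum_(t < mm) aa t <= 1.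
    rewrite -mulr_sumr; apply: le_trans (ler_wpM2l (ltW C0) (sum_layers_le j mm ga1 al0 (ltW t0))) _.
    apply: le_trans (hB1 C1 CB1); rewrite -/(G _) -mulrA ler_pM2l// ler_wpM2l ?G0//.
    rewrite -invC; apply: ge0_ler_powR; rewrite ?nnegrE//; exact: ltW.
  have sbb : \sum_(t < mm) C * ((ga ^- (j + t.+1)) `^ b + (tau * ga ^- (j + t.+1)) `^ a) <= 2 * eps1.
    rewrite -mulr_sumr big_split/= mulrDr mulr_natl mulr2n; apply: lerD.
      under eq_bigr do rewrite -[ga ^- _]mul1r.
      apply: le_trans (ler_wpM2l (ltW C0) (sum_layers_le j mm ga1 b0 ler01)) _.
      rewrite -/(G _) mul1r; apply: (@le_trans _ _ (C * G b * C1 `^ (- b) * eps)); last first.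
        by rewrite ler_wpM2r ?(ltW e0)// hB2.
      have -> : C * G b * C1 `^ (- b) * eps = C * (G b * (C1 `^ (- b) * U `^ (- b))).
        have -> : U `^ (- b) = eps by rewrite powRN -[LHS]mul1r -eU mulfK// gt_eqF// powR_gt0.
        by ring.
      rewrite ler_pM2l// ler_wpM2l ?G0// -powRM ?(ltW C10) ?(ltW U0)//.
      have CU : 0 < C1 * U by rewrite mulr_gt0.
      rewrite -[_ `^ (- b)](_ : (C1 * U)^-1 `^ b = _); last first.
        by rewrite -powR_inv1 ?(ltW CU)// -powRrM mulN1r.
      apply: ge0_ler_powR; rewrite ?nnegrE ?invr_ge0 ?(ltW b0) ?(ltW CU) ?exprn_ge0 ?(ltW ga0)//.
      rewrite lef_pV2 ?posrE ?exprn_gt0//; apply: le_trans jge.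
      by rewrite ler_pM2l// le_max lexx.
    apply: le_trans (ler_wpM2l (ltW C0) (sum_layers_le j mm ga1 a0 (ltW t0))) _.
    rewrite -/(G _); apply: (@le_trans _ _ (C * G a * C1 `^ (- a) * eps)); last first.
      by rewrite ler_wpM2r ?(ltW e0)// hB3.
    have -> : C * G a * C1 `^ (- a) * eps = C * (G a * (eps `^ (a^-1) * C1^-1) `^ a).
      rewrite powRM ?powR_ge0// invC -powRrM mulVf ?gt_eqF// powRr1 ?(ltW e0)//; ring.
    rewrite ler_pM2l// ler_wpM2l ?G0//.
    apply: ge0_ler_powR; [exact: ltW | exact: tg0 | | exact: taugj].
    by rewrite nnegrE mulr_ge0 ?powR_ge0.
  have step t (k : 'I_n) : (t < mm)%N -> lay k = (j + t.+1)%N :> nat ->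
      `|e k - interp X pa e k| <= bb t + aa t * norm_layers lay (j + t) e.
    move=> tm lk; have [kearly|kp'] := boolP (k < p)%N.
      have c1 : 1 <= cnt t.
        by rewrite /cnt (bigD1 k)//= lk eqxx lerDl sumr_ge0.
      rewrite -[leLHS]addr0 lerD//; last by rewrite mulr_ge0 ?norm_layers_ge0.
      rewrite /bb -[leLHS]addr0 lerD//.
      apply: (@le_trans _ _ (2 * theta * eps1)); last by rewrite ler_peMr.
      rewrite -mulrA mulr_natl mulr2n; apply: le_trans (ler_normB _ _) _; apply: lerD.
        by apply: le_trans (eD k _) _; [rewrite /D kearly | rewrite ler_peMl].
      rewrite -thE; apply: (interp_le X pa_lay layJ); rewrite ?lk ?addnS// => k' kk'; apply: eD.
      by rewrite /D (ltn_trans (pa_lt _ _ kk') kearly).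
    have [_ _ tay krg] := kbi k kp'.
    have fk : f k = cond_mean a tau X pa k f.
      by apply: fK; rewrite /D (negbTE kp')/= -ltnNge lk addnS ltnS leq_addr.
    (* As [f] equals its own kriging prediction at [k], the defect is the discrepancy of kriging and
       interpolation on [e], which feeds Gronwall, minus the kriging error of [f1], which is a
       consistency error. *)
    have eE : e k - interp X pa e k = (cond_mean a tau X pa k e - interp X pa e k) -
        (f1 (X k) - cond_mean a tau X pa k (fun k => f1 (X k))).
      by rewrite {1}/e fk cme; ring.
    have tk : tau * ga ^- lay k <= kp.
      apply: (@le_trans _ _ (tau * ga ^- j)).
        by rewrite ler_pM2l// gj// lk leq_addr.
      by apply: le_trans tauC _; rewrite invf_ple ?posrE.
    have eM k' : k' \in pa k -> `|e k'| <= norm_layers lay (j + t) e.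
      by move=> /pa_lay kk'; apply: norm_layers_ge; rewrite -ltnS -addnS -lk.
    rewrite eE; apply: le_trans (ler_normB _ _) _; rewrite [leRHS]addrC; apply: lerD.
      by rewrite /aa -lk; exact: krg.
    apply: le_trans (tay f1 (P k) f1b (hP k).1 (hP k).2) _.
    rewrite /bb -lk -[leLHS]add0r lerD// ler_pM2l// lerD2l ge_min lexx orbT//.
  have := layer_error pa_lay layJ (_ : (j + mm <= J)%N) (_ : norm_layers lay j e <= eps1) aa0 bb0 step.
  rewrite jmm thE => le; apply: le_trans (norm_layers_ge e (leqnn (lay i))) _.
  apply: le_trans (le _ _) _; first by rewrite -ltnS.
    by apply: norm_layers_le => // k kj; apply: eD; rewrite /D kj orbT.
  have sb : eps1 + \sum_(t < mm) bb t <= theta * ((2 * i0%:R + 3) * eps1).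
    rewrite /bb big_split/= -mulr_sumr.
    apply: (@le_trans _ _ (theta * eps1 + (2 * theta * eps1 * i0%:R + theta * (2 * eps1)))); last first.
      by rewrite le_eqVlt; apply/orP; left; apply/eqP; ring.
    rewrite lerD ?ler_peMl// lerD//; first by rewrite ler_wpM2l.
    by apply: le_trans sbb _; rewrite ler_peMl// mulr_ge0.
  apply: ler_pM => //.
  - by rewrite mulr_ge0// addr_ge0// sumr_ge0.
  - by rewrite ler_wpM2l.
  - by rewrite ler_expR ler_piMr.
have cv0 i : 0 < cond_var a tau s X pa i by exact: cond_var_gt0.
rewrite (rkhs_sqnormE pa_lt cv0).
have s2 : 0 <= s ^- 2 by rewrite invr_ge0 sqr_ge0.
have T0 : 0 <= T.
  by apply: addr_ge0; [exact/exprn_ge0/ltW | apply: mulr_ge0; [exact: sqr_ge0 | exact/exprn_ge0/ltW]].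
have Y1 : 1 <= 1 + y by rewrite lerDl.
have cost i : (f i - cond_mean a tau X pa i f) ^+ 2 / cond_var a tau s X pa i <=
    (i < p)%:R * (K0 * T * s ^- 2) + (lay i <= j)%:R * (K1 * (1 + y) ^+ 2 * s ^- 2).
  have A0 : 0 <= K0 * T * s ^- 2 by rewrite mulr_ge0// mulr_ge0.
  have A1 : 0 <= K1 * (1 + y) ^+ 2 * s ^- 2 by rewrite mulr_ge0// mulr_ge0// sqr_ge0.
  have [ip|ip] := boolP (i < p)%N.
    apply: le_trans (early_cost pa_lt d0 a0 t0 s0 Xinj N0 gN fg ip) _.
    rewrite mul1r -[leLHS]addr0; apply: lerD; last exact: mulr_ge0.
    apply: ler_wpM2r => //; exact: early_factor b0 ba t0 e0 kappa0 Ce0 U1 erefl N0 NB T4 (ltW V0).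
  rewrite mul0r add0r; have [ij|ij] := leqP (lay i) j; last first.
    rewrite {1}fK ?subrr ?expr0n ?mul0r//.
    by rewrite /D (negbTE ip)/= -ltnNge.
  have [cml cvl tay _] := kbi i ip; set r := ga ^- lay i in cvl tay.
  have r0 : 0 < r by exact: gp.
  rewrite mul1r; pose S := r `^ b + Num.min 1 ((tau * r) `^ a) + eps.
  have S0 : 0 <= S by rewrite !addr_ge0 ?powR_ge0 ?(ltW e0)// le_min ler01 powR_ge0.
  have res : `|f i - cond_mean a tau X pa i f| <= C * S.
    rewrite fn// cme opprD addrCA addrC; apply: le_trans (ler_normB _ _) _.
    rewrite /S mulrDr; apply: lerD; first exact: tay f1 (P i) f1b (hP i).1 (hP i).2.
    apply: le_trans (cml e eps1 _) _; last by rewrite ler_pM2l.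
    by move=> k ki; apply: eD; rewrite /D (leq_trans (ltnW (pa_lay _ _ ki)) ij) orbT.
  have vf : S * (1 + (tau * r) `^ (- a)) <= (4 + 2 * z `^ a) * (1 + y).
    apply: (@vertex_factor R a b eps tau r z m (1 + y)) => //; try exact: ltW.
    - exact: g1.
    - rewrite /r invrK; apply: le_trans jle.
      by rewrite ler_weXn2l// ltW.
  apply: (@le_trans _ _ ((C * S) ^+ 2 * (C * s ^- 2 * (1 + (tau * r) `^ (- a)) ^+ 2))).
    apply: ler_pM => //; first exact: sqr_ge0.
      by rewrite invr_ge0 ltW.
    by rewrite -real_normK ?num_real// lerXn2r ?nnegrE// mulr_ge0 ?(ltW C0).
  rewrite [leLHS](_ : _ = C ^+ 3 * (S * (1 + (tau * r) `^ (- a))) ^+ 2 * s ^- 2); last by ring.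
  rewrite ler_wpM2r// /K1 -mulrA -exprMn ler_wpM2l ?exprn_ge0 ?(ltW C0)//.
  rewrite lerXn2r ?nnegrE//; first by rewrite mulr_ge0// addr_ge0 ?powR_ge0.
  by apply: le_trans vf; rewrite mulr_ge0// addr_ge0 ?powR_ge0.
apply: le_trans (ler_sum _ (fun i _ => cost i)) _.
rewrite big_split/= -!mulr_suml.
have c1 : \sum_(i < n) (i < p)%:R <= p%:R :> R.
  rewrite -natr_sum ler_nat -big_mkcond/= sum1_card; move: cardp.
  by rewrite card_sig.
(* The vertices up to layer [j] are separated by [cd * ga ^- j], so packing bounds their number by a
   multiple of [m ^+ d]. *)
have c2 : \sum_(i < n) (lay i <= j)%:R <= (1 + z / cd) ^+ d * m ^+ d.
  rewrite -natr_sum -big_mkcond/= sum1_card.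
  have := @card_separated_le R d n X [set i | (lay i <= j)%N] (cd * ga ^- j).
  rewrite cardsE => h; apply: le_trans (h _ uX _) _; first by rewrite mulr_gt0.
    move=> i k; rewrite !inE => ij kj ik.
    have [ki|ki] := leqP (lay i) (lay k).
      by apply: le_trans (sep (lay k) i k ik ki (leqnn _)); rewrite ler_pM2l// gj.
    by apply: le_trans (sep (lay i) i k ik (leqnn _) (ltnW ki)); rewrite ler_pM2l// gj.
  have h1 : 1 + (cd * ga ^- j)^-1 <= (1 + z / cd) * m.
    rewrite invfM invrK mulrDl mul1r; apply: lerD => //.
    by rewrite mulrAC mulrC ler_wpM2r// invr_ge0 ltW.
  have h0 : 0 <= 1 + (cd * ga ^- j)^-1.
    by rewrite addr_ge0// invr_ge0 mulr_ge0 ?(ltW cd0) ?(ltW (gp _)).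
  by rewrite -exprMn lerXn2r ?nnegrE//; exact: le_trans h1.
apply: (@le_trans _ _ (p%:R * (K0 * T * s ^- 2) +
    (1 + z / cd) ^+ d * m ^+ d * (K1 * (1 + y) ^+ 2 * s ^- 2))).
  apply: lerD; apply: ler_wpM2r => //; first by rewrite mulr_ge0// mulr_ge0.
  by rewrite mulr_ge0// mulr_ge0// sqr_ge0.
rewrite [leLHS](_ : _ = s ^- 2 * (p%:R * K0 * T + (1 + z / cd) ^+ d * K1 * (m ^+ d * (1 + y) ^+ 2))); last by ring.
rewrite [leRHS](_ : _ = s ^- 2 * ((p%:R * K0 + 4 * (1 + z / cd) ^+ d * K1 + 1) * T)); last by ring.
rewrite ler_wpM2l//.
have W0 : 0 <= (1 + z / cd) ^+ d * K1 by rewrite mulr_ge0// exprn_ge0.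
apply: le_trans (lerD (lexx _) (ler_wpM2l W0 bd3)) _.
rewrite [leRHS](_ : _ = p%:R * K0 * T + (1 + z / cd) ^+ d * K1 * (4 * T) + T); last by ring.
by rewrite lerDl.
Qed.

End Assembly.

(** * The infimum over the Vecchia space *)

Theorem lemma8 (R : realType) :
  exists2 c : R, 0 < c &
  forall (d : nat) (alpha beta gamma cd cL cN : R) (i0 : nat),
    (0 < d)%N -> 0 < beta -> beta <= alpha ->
    1 < gamma -> 0 < cd -> 0 < cL -> 0 < cN ->
  exists2 C : R, 0 < C &
  forall (f0 : 'rV[R]_d -> R) (tau s : R),
    holder_ball beta f0 -> 0 < tau -> 0 < s ->
  forall (n J : nat) (X : 'I_n -> 'rV[R]_d) (pa : 'I_n -> {set 'I_n})
      (lay : 'I_n -> 'I_J.+1),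
    injective X -> (forall i, unit_cube (X i)) -> acyclic pa ->
    layered X pa lay gamma cd ->
    norming X pa lay (strict_floor alpha) i0 gamma cL cN ->
    (* the Vandermonde matrices are invertible and the supremum defining
       interp_const is not over the empty set *)
    (forall i, vandermonde (parent_pts X pa i) \in unitmx) ->
    (exists i, (lay i < J)%N) ->
  let theta := interp_const X pa lay in
  let theta' := theta * expR (c * theta) in
  forall eps : R, 0 < eps < 1 ->
    (ereal_inf [set (rkhs_sqnorm alpha tau s X pa f)%:E | f in
       [set f | vecchia_rkhs alpha tau s X pa f /\
                forall i, (`|f i - f0 (X i)| <= theta' * eps)%R]] <=
     (C * (s ^- 2 *
        (tau ^+ d * eps `^ (- (d%:R / alpha)) +
         tau `^ (- (2 * alpha)) *
           eps `^ (- ((2 * (alpha - beta) + d%:R) / beta))) *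
        ln eps^-1 ^+ (alpha \is a Num.nat)))%:E)%E.
Proof.
(* One half of [expR (2 * theta)] is the Gronwall factor, the other absorbs a surplus factor
   [theta]. *)
exists 2 => // d alpha beta ga cd cL cN i0 d0 b0 ba ga1 cd0 cL0 cN0.
have a0 : 0 < alpha by exact: lt_le_trans ba.
have [C C0 H] := vecchia_approximation i0 d0 b0 ba ga1 cd0 cL0 cN0.
have [Cw Cw0 wh] := whitney d0 b0.
exists C => // f0 tau s hf t0 s0 n J X pa lay Xinj uX _ lyr nrm uV layJ theta theta' eps eps01.
have [pa_lay _ mono] := lyr.
have pa_lt i k : k \in pa i -> (k < i)%N.
  by move=> /pa_lay; rewrite ltnNge [(k < i)%N]ltnNge; apply: contra => /mono.
have pa_irr i : i \notin pa i by apply/negP => /pa_lt; rewrite ltnn.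
have cv0 i : 0 < cond_var alpha tau s X pa i by exact: cond_var_gt0.
have /andP[e0 e1] := eps01.
set B := tau ^+ d * _ + _.
have B0 : 0 <= B.
  by rewrite addr_ge0// mulr_ge0 ?powR_ge0// exprn_ge0// ltW.
have s2 : 0 <= s ^- 2 by rewrite invr_ge0 sqr_ge0.
have sB : 0 <= s ^- 2 * B by exact: mulr_ge0.
have th1 : 1 <= theta := interp_const_ge1 X pa_lay layJ.
have hE : theta' = theta * expR (2 * theta) by [].
clearbody theta'.
have inf_le f : (forall i, `|f i - f0 (X i)| <= theta' * eps) ->
    rkhs_sqnorm alpha tau s X pa f <= C * (s ^- 2 * B * ln eps^-1 ^+ (alpha \is a Num.nat)) ->
    (ereal_inf [set (rkhs_sqnorm alpha tau s X pa f)%:E | f in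
       [set f | vecchia_rkhs alpha tau s X pa f /\
                forall i, (`|f i - f0 (X i)| <= theta' * eps)%R]] <=
     (C * (s ^- 2 * B * ln eps^-1 ^+ (alpha \is a Num.nat)))%:E)%E.
  move=> fe fn; apply: (@le_trans _ _ (rkhs_sqnorm alpha tau s X pa f)%:E); last by rewrite lee_fin.
  apply: ereal_inf_lbound; exists f => //; split => //.
  exact: vecchia_rkhsT pa_lt cv0 f.
have ex1 : 1 + 1 <= expR 1 :> R by exact: expR_ge1Dx.
(* When [eps >= expR (- 1)] the logarithmic factor can be close to 0, and the zero function is
   taken: its norm is 0, and the tolerance is at least [expR 2 * expR (- 1)], above the bound 2
   obtained for [f0] at the vertices. *)
have [le|lt] := leP (expR (- 1)) eps.
  apply: (inf_le (fun=> 0)) => [i|]; last first.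
    rewrite (rkhs_sqnormE pa_lt cv0) big1; last first.
      move=> i _; rewrite cond_meanE big1 => [|k _]; last by rewrite mulr0.
      by rewrite subrr expr0n mul0r.
    rewrite mulr_ge0 ?(ltW C0)// mulr_ge0// exprn_ge0// ln_ge0// invf_ge1 ?(ltW e1)//.
  have [f1 [f1f f1b _]] := wh f0 hf _ X 1 uX ltr01.
  rewrite sub0r normrN; apply: (@le_trans _ _ (1 + 1)).
    rewrite -[f0 _](subrK (f1 (X i))); apply: le_trans (ler_normD _ _) _.
    by rewrite lerD ?f1b// distrC.
  apply: le_trans ex1 _; rewrite hE.
  apply: (@le_trans _ _ (1 * expR 2 * expR (- 1))).
    by rewrite mul1r -expRD; rewrite ler_expR; lra.
  apply: ler_pM => //; rewrite ?mul1r ?expR_ge0//.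
  rewrite -[leLHS]mul1r; apply: ler_pM => //; rewrite ?expR_ge0// ler_expR.
  by rewrite ler_peMr.
have [f fe fn] := H f0 tau s hf t0 s0 n J X pa lay Xinj uX lyr nrm uV layJ eps eps01.
apply: (inf_le f) => [i|]; first by rewrite hE; exact: fe.
apply: le_trans fn _.
have -> : (tau * eps `^ (- alpha^-1)) ^+ d +
    (eps `^ (- beta^-1) `^ (alpha - beta) * tau `^ (- alpha)) ^+ 2 * eps `^ (- beta^-1) ^+ d = B.
  have pr2 (u v : R) k : u `^ v ^+ k = u `^ (v * k%:R) by rewrite -powR_mulrn ?powR_ge0// -powRrM.
  rewrite /B !exprMn !pr2 -!powRrM; congr (_ + _); first by congr (_ * _ `^ _); ring.
  rewrite mulrAC -powRD ?(gt_eqF e0) ?implybT// mulrC; congr (_ `^ _ * _ `^ _); first by ring.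
  by field; rewrite gt_eqF.
(* Here [eps < expR (- 1)], so that [ln eps^-1] is at least 1. *)
rewrite -mulrA ler_pM2l// ler_peMr// exprn_ege1//.
rewrite lnV ?posrE// -[leLHS]opprK lerN2 -[leRHS]expRK ler_ln ?posrE ?expR_gt0//.
exact: ltW.
Qed.
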